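(* Let $\Phi=\begin{pmatrix}\Phi_{11}&\Phi_{12}\\ \Phi_{21}&\Phi_{22}\end{pmatrix}$ be a bounded measurable block matrix function on $\mathbb T$, where $\Phi_{11}$ has size $m_1\times n_1$ and $\Phi_{22}$ has size $m_2\times n_2$, and let $d=\min\{m_1,n_1\}$. Suppose that $\|\Gamma_\Phi\|_{\rm e}$ is less than the smallest nonzero superoptimal singular value of the four block problem for $\Phi$. Then there exists a unique superoptimal solution $Q$ of the four block problem for $\Phi$. Moreover, the singular values $$s_j\left(\begin{pmatrix}\Phi_{11}-Q&\Phi_{12}\\ \Phi_{21}&\Phi_{22}\end{pmatrix}(\zeta)\right),\qquad 1\le j\le d-1,$$ are (almost everywhere) constant on $\mathbb T$.
   Context: $\mathbb T$ is the unit circle; $H^2$ is the Hardy space, $H^2_-=L^2\ominus H^2$, and $H^2(\mathbb C^k)$, $H^2_-(\mathbb C^k)$, $L^2(\mathbb C^k)$ are the spaces of $\mathbb C^k$-valued functions on $\mathbb T$. $M_{k,l}$ is the space of $k\times l$ matrices, $L^\infty(M_{k,l})$ and $H^\infty(M_{k,l})$ are the spaces of bounded (resp. bounded analytic) $M_{k,l}$-valued functions, and $\|F\|_\infty=\operatorname{ess\,sup}_{\zeta\in\mathbb T}\|F(\zeta)\|$ with the operator norm. For a matrix or Hilbert space operator $A$, $s_j(A)$ ($j\ge0$) is the distance from $A$ to the set of matrices (operators) of rank at most $j$. $\|T\|_{\rm e}=\inf\{\|T-K\|:K\text{ compact}\}$ is the essential norm. Four block operator: for $m=m_1+m_2$,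 $n=n_1+n_2$ and $\Phi\in L^\infty(M_{m,n})$ in block form, $\Gamma_\Phi:H^2(\mathbb C^{n_1})\oplus L^2(\mathbb C^{n_2})\to H^2_-(\mathbb C^{m_1})\oplus L^2(\mathbb C^{m_2})$ is $\Gamma_\Phi f=\mathbb P^-\Phi f$, where $\mathbb P^-$ is the orthogonal projection of $L^2(\mathbb C^{m_1})\oplus L^2(\mathbb C^{m_2})$ onto $H^2_-(\mathbb C^{m_1})\oplus L^2(\mathbb C^{m_2})$. Superoptimal solutions: for $Q\in H^\infty(M_{m_1,n_1})$ put $\Phi_Q=\begin{pmatrix}\Phi_{11}-Q&\Phi_{12}\\ \Phi_{21}&\Phi_{22}\end{pmatrix}$. Let $\Omega_0$ be the set of $Q\in H^\infty(M_{m_1,n_1})$ minimizing $\|\Phi_Q\|_\infty$ and, inductively, $\Omega_j$ the set of $Q\in\Omega_{j-1}$ minimizing $\operatorname{ess\,sup}_{\zeta}s_j(\Phi_Q(\zeta))$ over $\Omega_{j-1}$. Elements of $\Omega_{d-1}$, $d=\min\{m_1,n_1\}$, are the superoptimal solutions of the four block problem for $\Phi$; the superoptimal singular values are $t_j=\operatorname{ess\,sup}_\zeta s_j(\Phi_Q(\zeta))$ for $Q\in\Omega_j$, $0\le j\le d-1$. The hypothesis means $\|\Gamma_\Phi\|_{\rm e}<t_j$ for every $j\le d-1$ with $t_j\ne0$. *)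

(* Defs.v *)
From HB Require Import structures.
From mathcomp Require Import all_boot all_order all_algebra.
From mathcomp Require Import complex.
From mathcomp Require Import all_classical all_reals all_analysis.
From mathcomp Require Import ess_sup_inf.

Set Implicit Arguments.
Unset Strict Implicit.
Unset Printing Implicit Defensive.

Import Order.TTheory GRing.Theory Num.Theory.
Import numFieldNormedType.Exports.

Local Open Scope classical_set_scope.
Local Open Scope ring_scope.

Definition circle (R : realType) : Type := {z : R[i] | `|z| == 1}.

HB.instance Definition _ (R : realType) := Choice.on (circle R).

Section circle.
Variable R : realType.

Lemma norm_cis (t : R) : `|Complex (cos t) (sin t)| == 1.
Proof. by rewrite normc_def /= cos2Dsin2 sqrtr1. Qed.

Definition cis (t : measurableTypeR R) : circle R :=
  exist (fun z : R[i] => `|z| == 1) _ (norm_cis t).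

HB.instance Definition _ := isPointed.Build (circle R) (cis (0 : R)).

(* [cis] restricted to [0, 2 pi[ is a Borel isomorphism onto the circle, so
   this is the Borel sigma-algebra of the circle. *)
Definition circle_measurable : set (set (circle R)) :=
  image_set_system [set: _] cis measurable.

Lemma circle_measurable0 : circle_measurable set0.
Proof. by rewrite /circle_measurable /image_set_system /= preimage_set0 setI0. Qed.

Lemma circle_measurableC A : circle_measurable A -> circle_measurable (~` A).
Proof.
rewrite /circle_measurable /image_set_system /= !setTI => mA.
by rewrite preimage_setC; exact: measurableC.
Qed.

Lemma circle_measurable_bigcup (F : (set (circle R))^nat) :
  (forall k, circle_measurable (F k)) -> circle_measurable (\bigcup_k F k).
Proof.
rewrite /circle_measurable /image_set_system /= setTI => mF.
rewrite preimage_bigcup; apply: bigcup_measurable => k _.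
by have := mF k; rewrite /= setTI.
Qed.

HB.instance Definition _ :=
  isMeasurable.Build default_measure_display (circle R)
    circle_measurable0 circle_measurableC circle_measurable_bigcup.

Lemma measurable_cis : measurable_fun [set: _] cis.
Proof. by move=> _ A mA; exact: mA. Qed.

HB.instance Definition _ :=
  isMeasurableFun.Build _ _ _ _ cis measurable_cis.

Lemma pi2_gt0 : 0 < pi *+ 2 :> R.
Proof. by rewrite mulrn_wgt0 // pi_gt0. Qed.

Definition arc_measure : probability (circle R) R :=
  distribution (uniform_prob pi2_gt0) cis.

End circle.

Arguments arc_measure {R}.

Section matrix_norms.
Variable R : realType.

Definition vnorm k (x : 'cV[R[i]]_k) : R :=
  Num.sqrt (\sum_(i < k) Normc.normc (x i ord0) ^+ 2).

Definition opnorm k l (A : 'M[R[i]]_(k, l)) : R :=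
  sup [set vnorm (A *m x) | x in [set x | vnorm x <= 1]].

Definition sval_mx (j : nat) k l (A : 'M[R[i]]_(k, l)) : R :=
  inf [set opnorm (A - B) | B in [set B | (\rank B <= j)%N]].

End matrix_norms.

(* Elements of the function spaces below are functions on the circle; the usual
   classes modulo equality almost everywhere are not formed. Analytic functions
   are represented by their boundary values. *)
Section function_spaces.
Variable R : realType.
Local Notation C := R[i].
Local Notation T := (circle R).

Definition cmeasurable (f : T -> C) : Prop :=
  measurable_fun [set: T] (fun z => complex.Re (f z)) /\
  measurable_fun [set: T] (fun z => complex.Im (f z)).

Definition cintegral (f : T -> C) : C :=
  Complex (Rintegral arc_measure [set: T] (fun z => complex.Re (f z)))
          (Rintegral arc_measure [set: T] (fun z => complex.Im (f z))).

Definition fourier (f : T -> C) (n : int) : C :=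
  cintegral (fun z => f z * sval z ^ (- n)).

Definition mx_measurable k l (F : T -> 'M[C]_(k, l)) : Prop :=
  forall i j, cmeasurable (fun z => F z i j).

Definition mx_analytic k l (F : T -> 'M[C]_(k, l)) : Prop :=
  forall i j (n : int), n < 0 -> fourier (fun z => F z i j) n = 0.

Definition Linfnorm k l (F : T -> 'M[C]_(k, l)) : \bar R :=
  ess_sup arc_measure (fun z => (opnorm (F z))%:E).

Definition Linf k l : set (T -> 'M[C]_(k, l)) :=
  [set F | mx_measurable F /\ (Linfnorm F < +oo)%E].

Definition Hinf k l : set (T -> 'M[C]_(k, l)) :=
  [set F | Linf F /\ mx_analytic F].

Definition L2norm k (f : T -> 'cV[C]_k) : \bar R :=
  Lnorm arc_measure 2%:E (fun z => (vnorm (f z))%:E).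

Definition L2 k : set (T -> 'cV[C]_k) :=
  [set f | mx_measurable f /\ (L2norm f < +oo)%E].

Definition L2dot k (f g : T -> 'cV[C]_k) : C :=
  cintegral (fun z => \sum_(i < k) f z i ord0 * conjc (g z i ord0)).

Definition H2 k : set (T -> 'cV[C]_k) := [set f | L2 f /\ mx_analytic f].

Definition H2minus k : set (T -> 'cV[C]_k) :=
  [set f | L2 f /\ forall g, H2 g -> L2dot f g = 0].

Definition dsum k1 k2 (E : set (T -> 'cV[C]_k1)) (F : set (T -> 'cV[C]_k2)) :
    set (T -> 'cV[C]_(k1 + k2)) :=
  [set f | E (fun z => usubmx (f z)) /\ F (fun z => dsubmx (f z))].

(* Orthogonal projection of f onto the closed subspace E of L2 (the default
   value f of [xget] is irrelevant). *)
Definition orthproj k (E : set (T -> 'cV[C]_k)) (f : T -> 'cV[C]_k) :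
    T -> 'cV[C]_k :=
  xget f [set g | E g /\ forall h, E h -> L2dot (f - g) h = 0].

End function_spaces.

Section operators.
Variables (R : realType) (k l : nat).
Local Notation T := (circle R).
Variables (E : set (T -> 'cV[R[i]]_k)) (F : set (T -> 'cV[R[i]]_l)).
Implicit Types A K : (T -> 'cV[R[i]]_k) -> (T -> 'cV[R[i]]_l).

Definition linear_ae A : Prop :=
  (forall f, E f -> F (A f)) /\
  (forall (a : R[i]) f g, E f -> E g ->
    ae_eq arc_measure [set: T] (A (a *: f + g)) (a *: A f + A g)).

Definition op_norm A : \bar R :=
  ereal_sup [set L2norm (A f) | f in [set f | E f /\ (L2norm f <= 1)%E]].

(* The image of the unit ball of E is relatively (sequentially) compact in F.
   Together with linearity this implies that K is bounded and hence that it
   respects equality almost everywhere. *)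
Definition compact_op K : Prop :=
  linear_ae K /\
  forall u : nat -> T -> 'cV[R[i]]_k,
    (forall n, E (u n) /\ (L2norm (u n) <= 1)%E) ->
    exists phi : nat -> nat, exists g : T -> 'cV[R[i]]_l,
      [/\ {homo phi : p q / (p < q)%N}, F g &
          L2norm (K (u (phi n)) - g) @[n --> \oo] --> 0%E].

Definition ess_norm A : \bar R :=
  ereal_inf [set op_norm (fun f => A f - K f) | K in compact_op].

End operators.

Section four_block.
Variables (R : realType) (m1 m2 n1 n2 : nat).
Local Notation C := R[i].
Local Notation T := (circle R).
Variable Phi : T -> 'M[C]_(m1 + m2, n1 + n2).

Definition Gamma_dom : set (T -> 'cV[C]_(n1 + n2)) :=
  dsum (@H2 R n1) (@L2 R n2).

Definition Gamma_cod : set (T -> 'cV[C]_(m1 + m2)) :=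
  dsum (@H2minus R m1) (@L2 R m2).

Definition Gamma (f : T -> 'cV[C]_(n1 + n2)) : T -> 'cV[C]_(m1 + m2) :=
  orthproj Gamma_cod (fun z => Phi z *m f z).

Definition Gamma_ess_norm : \bar R := ess_norm Gamma_dom Gamma_cod Gamma.

Definition PhiQ (Q : T -> 'M[C]_(m1, n1)) : T -> 'M[C]_(m1 + m2, n1 + n2) :=
  fun z => block_mx (ulsubmx (Phi z) - Q z) (ursubmx (Phi z))
                    (dlsubmx (Phi z)) (drsubmx (Phi z)).

Definition ess_sval (j : nat) (Q : T -> 'M[C]_(m1, n1)) : \bar R :=
  ess_sup arc_measure (fun z => (sval_mx j (PhiQ Q z))%:E).

Definition minimizers (S : set (T -> 'M[C]_(m1, n1)))
    (v : (T -> 'M[C]_(m1, n1)) -> \bar R) : set (T -> 'M[C]_(m1, n1)) :=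
  [set Q | S Q /\ forall Q', S Q' -> (v Q <= v Q')%E].

Fixpoint Omega (j : nat) : set (T -> 'M[C]_(m1, n1)) :=
  match j with
  | 0 => minimizers (@Hinf R m1 n1) (fun Q => Linfnorm (PhiQ Q))
  | i.+1 => minimizers (Omega i) (ess_sval i.+1)
  end.

(* Meaningful when 0 < minn m1 n1. *)
Definition superoptimal : set (T -> 'M[C]_(m1, n1)) := Omega (minn m1 n1).-1.

(* t is the superoptimal singular value t_j; it does not depend on the choice
   of Q in Omega j, by minimality. *)
Definition superoptimal_sval (j : nat) (t : \bar R) : Prop :=
  (j < minn m1 n1)%N /\ exists2 Q, Omega j Q & t = ess_sval j Q.

End four_block.

(* Main.v *)
Require Import Defs.
From mathcomp Require Import all_boot all_order all_algebra.
From mathcomp Require Import complex ring lra zify.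
From mathcomp Require Import all_classical all_reals all_analysis.
From mathcomp Require Import measurable_realfun ess_sup_inf.
Set Implicit Arguments.
Unset Strict Implicit.
Unset Printing Implicit Defensive.
Import Order.TTheory GRing.Theory Num.Theory.
Import numFieldNormedType.Exports.
Local Open Scope classical_set_scope.
Local Open Scope ring_scope.

(** Call a bounded hermitian weight W admissible if [||Gamma f||^2 <= (W f, f)] on
the domain of Gamma. A weighted Nehari theorem (one-step extensions of the
Fourier coefficients of Gamma, dominated by the form of W) shows that W is
admissible if and only if [Phi_Q^* Phi_Q <= W] almost everywhere for some Q in
H^infinity.

The set [Omega_j] is described by a weight
[W_j(a) = sum_(i < j) t_i^2 v_i v_i^* + a^2 (1 - sum_(i < j) v_i v_i^* )], where
[v_i] is obtained by pointwise Gram-Schmidt from functions [f_i] in the domain of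
Gamma: [t_j] is the least a such that [W_j(a)] is admissible, and Q is in
[Omega_j] if and only if [Phi_Q^* Phi_Q <= W_j(t_j)]. If [t_j] exceeds the
essential norm, a compactness argument gives a new [f_j] with
[||Gamma f_j||^2 = (W_j(t_j) f_j, f_j)]. Equality forces
[Phi_Q f_j = Gamma f_j] and [Phi_Q^* Phi_Q v_j = t_j^2 v_j] for all Q in
[Omega_j], so the singular values [t_0, ..., t_j] of [Phi_Q] are constant. That
[v_j] vanishes almost nowhere follows from two facts: the last block column of
Phi is bounded by the essential norm, so that the [v_i] are independent exactly
when the analytic parts of the [f_i] are, and the rank of a family in H^2 is
constant almost everywhere.

If some [t_j] is 0, then [Phi_Q] is determined by the [f_i]. Otherwise
[min(m1, n1)] vectors [v_i] with independent upper parts determine Q, or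
[Phi_Q v_i] do so for the adjoint. *)

(** For j >= 1 the singular value s_j is not convex in Q, so the successive minimizations are not
    Nehari problems as they stand. They become so because all competitors at stage j share the
    singular vectors v_i, i < j, and their values t_i, while the rest of Phi_Q is no larger than
    these. Then s_j(Phi_Q) <= a is the pointwise inequality Phi_Q^* Phi_Q <= W_j(a), and
    admissibility turns the search for Q into a test on Gamma alone. The symbol is never factorized
    to split off the singular values already found: the v_i, which are measurable but not analytic,
    enter only through the weight. For a <= t_i the weight is bounded below by a^2, so at every
    stage the comparison with the essential norm takes place in the unweighted norm. Level 0 leaves
    no room above the essential norm. There the inequality makes Phi_Q vanish off the span of the
    v_i, and the process ends at once. *)

Section complex_numbers.
Variable R : realType.
Implicit Types (a b : R[i]) (x : R).
Local Notation Re := (@complex.Re R).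
Local Notation Im := (@complex.Im R).

(** The squared modulus with values in R: estimates become polynomial inequalities in real and
    imaginary parts, without square roots. *)
Definition cn2 a : R := Re a ^+ 2 + Im a ^+ 2.

Lemma ReD a b : Re (a + b) = Re a + Re b. Proof. by case: a; case: b. Qed.
Lemma ImD a b : Im (a + b) = Im a + Im b. Proof. by case: a; case: b. Qed.
Lemma ReN a : Re (- a) = - Re a. Proof. by case: a. Qed.
Lemma ImN a : Im (- a) = - Im a. Proof. by case: a. Qed.
Lemma ReB a b : Re (a - b) = Re a - Re b. Proof. by case: a; case: b. Qed.
Lemma ImB a b : Im (a - b) = Im a - Im b. Proof. by case: a; case: b. Qed.
Lemma ReM a b : Re (a * b) = Re a * Re b - Im a * Im b.
Proof. by case: a; case: b. Qed.
Lemma ImM a b : Im (a * b) = Re a * Im b + Im a * Re b.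
Proof. by case: a; case: b. Qed.
Lemma ReJ a : Re (conjc a) = Re a. Proof. by case: a. Qed.
Lemma ImJ a : Im (conjc a) = - Im a. Proof. by case: a. Qed.
Lemma Re0 : Re 0 = 0. Proof. by []. Qed.
Lemma Im0 : Im 0 = 0. Proof. by []. Qed.
Lemma Re1 : Re 1 = 1. Proof. by []. Qed.
Lemma Im1 : Im 1 = 0. Proof. by []. Qed.
Lemma ReR x : Re x%:C%C = x. Proof. by []. Qed.
Lemma ImR x : Im x%:C%C = 0. Proof. by []. Qed.
Definition ReImE := (ReD, ImD, ReN, ImN, ReM, ImM, ReJ, ImJ, Re0, Im0, Re1, Im1,
  ReR, ImR).

Lemma Re_sum I (r : seq I) (P : pred I) (F : I -> R[i]) :
  Re (\sum_(i <- r | P i) F i) = \sum_(i <- r | P i) Re (F i).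
Proof. by apply: (big_morph _ ReD Re0). Qed.

Lemma Im_sum I (r : seq I) (P : pred I) (F : I -> R[i]) :
  Im (\sum_(i <- r | P i) F i) = \sum_(i <- r | P i) Im (F i).
Proof. by apply: (big_morph _ ImD Im0). Qed.

Lemma complex_ext a b : Re a = Re b -> Im a = Im b -> a = b.
Proof. by case: a => ? ?; case: b => ? ? /= -> ->. Qed.

Lemma conjcD a b : conjc (a + b) = conjc a + conjc b.
Proof. exact: raddfD. Qed.
Lemma conjcB a b : conjc (a - b) = conjc a - conjc b.
Proof. exact: raddfB. Qed.
Lemma conjcM a b : conjc (a * b) = conjc a * conjc b.
Proof. exact: rmorphM. Qed.
Lemma conjc_sum I (r : seq I) (P : pred I) (F : I -> R[i]) :
  conjc (\sum_(i <- r | P i) F i) = \sum_(i <- r | P i) conjc (F i).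
Proof. exact: raddf_sum. Qed.
Lemma conjcR x : conjc (x%:C)%C = x%:C%C.
Proof. by apply: complex_ext; rewrite !ReImE // oppr0. Qed.

Lemma cn2_ge0 a : 0 <= cn2 a. Proof. by rewrite addr_ge0 ?sqr_ge0. Qed.
Lemma cn2M a b : cn2 (a * b) = cn2 a * cn2 b.
Proof. by rewrite /cn2 !ReImE; ring. Qed.
Lemma cn2J a : cn2 (conjc a) = cn2 a.
Proof. by rewrite /cn2 !ReImE; ring. Qed.
Lemma cn2N a : cn2 (- a) = cn2 a.
Proof. by rewrite /cn2 !ReImE; ring. Qed.
Lemma cn2R x : cn2 x%:C%C = x ^+ 2. Proof. by rewrite /cn2 /=; ring. Qed.
Lemma cn2_0 : cn2 0 = 0. Proof. by rewrite /cn2 /=; ring. Qed.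
Lemma cn2_1 : cn2 1 = 1. Proof. by rewrite /cn2 /=; ring. Qed.
Lemma cn2_eq0 a : cn2 a = 0 -> a = 0.
Proof.
rewrite /cn2 => /eqP; rewrite paddr_eq0 ?sqr_ge0 // !sqrf_eq0.
by move=> /andP[/eqP h1 /eqP h2]; apply: complex_ext.
Qed.
Lemma cn2_le0 a : cn2 a <= 0 -> a = 0.
Proof. by move=> h; apply: cn2_eq0; apply/eqP; rewrite eq_le h cn2_ge0. Qed.
Lemma mulcJ a : a * conjc a = (cn2 a)%:C%C.
Proof. by apply: complex_ext; rewrite !ReImE /cn2; ring. Qed.
Lemma mulJc a : conjc a * a = (cn2 a)%:C%C.
Proof. by rewrite mulrC mulcJ. Qed.
Lemma cn2D_le a b : cn2 (a + b) <= 2 * cn2 a + 2 * cn2 b.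
Proof.
rewrite /cn2 !ReImE.
have := sqr_ge0 (Re a - Re b); have := sqr_ge0 (Im a - Im b); nra.
Qed.
Lemma normc2 a : Normc.normc a ^+ 2 = cn2 a.
Proof. by case: a => u v /=; rewrite sqr_sqrtr // addr_ge0 ?sqr_ge0. Qed.
Lemma sqr_Re_le a : Re a ^+ 2 <= cn2 a.
Proof. by rewrite lerDl sqr_ge0. Qed.
Lemma sqr_Im_le a : Im a ^+ 2 <= cn2 a.
Proof. by rewrite lerDr sqr_ge0. Qed.

End complex_numbers.

(** Only e <= 1 has to be tested, so that error terms of higher order in e can be absorbed into C *
    e. *)
Lemma le_eps (R : realType) (x y C : R) : 0 <= C ->
  (forall e, 0 < e -> e <= 1 -> x <= y + C * e) -> x <= y.
Proof.
move=> C0 h; apply/ler_addgt0Pr => e e0.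
have C1 : 0 < C + 1 by lra.
pose d := Num.min 1 (e / (C + 1)).
have d0 : 0 < d by rewrite lt_min ltr01 divr_gt0.
have d1 : d <= 1 by rewrite ge_min lexx.
apply: le_trans (h d d0 d1) _; rewrite lerD2l.
have : d <= e / (C + 1) by rewrite ge_min lexx orbT.
rewrite ler_pdivlMr //; nra.
Qed.

(** Uses |a + b|^2 <= (1 + e)|a|^2 + (1 + 1/e)|b|^2 with |b|^2 <= e^2, so that both losses are of
    order e. *)
Lemma cn2_limit (R : realType) (w c : R[i]) (Q : R) : 0 <= Q ->
  (forall e, 0 < e -> exists z, cn2 (z - c) <= e /\ cn2 (w - z) <= Q + e) ->
  cn2 (w - c) <= Q.
Proof.
move=> Q0 h; apply: (@le_eps _ _ _ (Q + 4)); first lra.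
move=> e e0 e1; have [|z [h1 h2]] := h (e ^+ 2); first exact: exprn_gt0.
have -> : w - c = (w - z) + (z - c) by rewrite addrA subrK.
have key (a b : R[i]) : cn2 (a + b) <= (1 + e) * cn2 a + (1 + e^-1) * cn2 b.
  have e' : e * e^-1 = 1 by rewrite divff // gt_eqF.
  have e'0 : 0 < e^-1 by rewrite invr_gt0.
  have sq (u v : R) : (u + v) ^+ 2 <= (1 + e) * u ^+ 2 + (1 + e^-1) * v ^+ 2.
    rewrite -subr_ge0.
    have -> : (1 + e) * u ^+ 2 + (1 + e^-1) * v ^+ 2 - (u + v) ^+ 2 =
      e * (u - e^-1 * v) ^+ 2 by field; rewrite gt_eqF.
    by rewrite mulr_ge0 ?sqr_ge0 // ltW.
  rewrite /cn2 !ReImE; have := sq (complex.Re a) (complex.Re b).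
  have := sq (complex.Im a) (complex.Im b); lra.
apply: le_trans (key _ _) _.
have k1 : (1 + e) * cn2 (w - z) <= (1 + e) * (Q + e ^+ 2) by rewrite ler_wpM2l //; lra.
have k2 : (1 + e^-1) * cn2 (z - c) <= (1 + e^-1) * e ^+ 2.
  by rewrite ler_wpM2l // addr_ge0 // invr_ge0 ltW.
have -> : Q + (Q + 4) * e = (1 + e) * (Q + e ^+ 2) + (1 + e^-1) * e ^+ 2 +
   e * (3 - 2 * e - e ^+ 2) by field; rewrite gt_eqF.
have : 0 <= e * (3 - 2 * e - e ^+ 2).
  have -> : 3 - 2 * e - e ^+ 2 = (1 - e) * (3 + e) by ring.
  by rewrite !mulr_ge0 //; lra.
lra.
Qed.

Lemma natSinv_lt (R : realType) (e : R) : 0 < e ->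
  exists N, forall n, (N <= n)%N -> n.+1%:R^-1 < e.
Proof.
move=> e0; exists (Num.truncn e^-1) => n hn.
rewrite invf_plt ?posrE //; apply: lt_le_trans (truncnS_gt _) _.
by rewrite ler_nat.
Qed.

Lemma real_cauchy_cvg (R : realType) (u : nat -> R) :
  (forall e, 0 < e -> exists N, forall m n, (N <= m)%N -> (N <= n)%N ->
     `|u m - u n| < e) ->
  exists l, forall e, 0 < e -> exists N, forall n, (N <= n)%N -> `|u n - l| < e.
Proof.
move=> h.
have /cauchy_cvgP/cvg_ex[l hl] : cauchy (u @ \oo).
  apply/cauchy_exP => e e0; have [N hN] := h _ e0.
  by exists (u N), N => // n /= hn; rewrite /ball /=; exact: hN.
exists l => e e0; move/cvgrPdist_lt : hl => /(_ _ e0)[N _ hN].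
by exists N => n hn; rewrite distrC; exact: hN.
Qed.

Lemma complex_cauchy_cvg (R : realType) (u : nat -> R[i]) :
  (forall e, 0 < e -> exists N, forall m n, (N <= m)%N -> (N <= n)%N ->
     cn2 (u m - u n) < e) ->
  exists l, forall e, 0 < e -> exists N, forall n, (N <= n)%N -> cn2 (u n - l) < e.
Proof.
have lt_of_sqr (x e : R) : 0 < e -> x ^+ 2 < e ^+ 2 -> `|x| < e.
  by move=> e0 h; rewrite -(@ltr_pXn2r _ 2) ?nnegrE ?(ltW e0) // real_normK // num_real.
move=> h.
have [|a ha] := @real_cauchy_cvg R (fun n => complex.Re (u n)).
  move=> e e0; have [|N hN] := h (e ^+ 2); first exact: exprn_gt0.
  exists N => m n hm hn; apply: lt_of_sqr => //.
  by rewrite -ReB; apply: le_lt_trans (sqr_Re_le _) _; exact: hN.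
have [|b hb] := @real_cauchy_cvg R (fun n => complex.Im (u n)).
  move=> e e0; have [|N hN] := h (e ^+ 2); first exact: exprn_gt0.
  exists N => m n hm hn; apply: lt_of_sqr => //.
  by rewrite -ImB; apply: le_lt_trans (sqr_Im_le _) _; exact: hN.
exists (Complex a b) => e e0.
(* As d <= 1, a real number of modulus below d has its square below d, hence below e / 2. *)
pose d := Num.min 1 (e / 2).
have d0 : 0 < d by rewrite lt_min ltr01 /=; lra.
have d1 : d <= 1 by rewrite ge_min lexx.
have d2 : d <= e / 2 by rewrite ge_min lexx orbT.
have [N1 h1] := ha _ d0; have [N2 h2] := hb _ d0.
exists (maxn N1 N2) => n; rewrite geq_max => /andP[/h1 k1 /h2 k2].
rewrite /cn2 ReB ImB /=.
have sq (x : R) : `|x| < d -> x ^+ 2 < e / 2.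
  move=> hx; rewrite -real_normK ?num_real //.
  apply: lt_le_trans d2; have := normr_ge0 x; nra.
have := sq _ k1; have := sq _ k2; lra.
Qed.

(** * Hermitian forms *)

Section hermitian_forms.
Variables (R : realType) (V : lmodType R[i]).
Local Notation C := R[i].
Local Notation Re := (@complex.Re R).
Local Notation Im := (@complex.Im R).
Implicit Types (E S : set V) (B : V -> V -> C).

Definition linsub E :=
  E 0 /\ forall (a : C) x y, E x -> E y -> E (a *: x + y).

Section subspace_facts.
Variable E : set V.
Hypothesis sE : linsub E.
Lemma sub0 : E 0. Proof. by case: sE. Qed.
Lemma subL a x y : E x -> E y -> E (a *: x + y). Proof. by case: sE => _; apply. Qed.
Lemma subZ a x : E x -> E (a *: x).
Proof. by move=> Ex; rewrite -[_ *: _]addr0; apply: subL => //; exact: sub0. Qed.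
Lemma subD x y : E x -> E y -> E (x + y).
Proof. by move=> Ex Ey; rewrite -[x]scale1r; apply: subL. Qed.
Lemma subN x : E x -> E (- x).
Proof. by move=> Ex; rewrite -scaleN1r; apply: subZ. Qed.
Lemma subB x y : E x -> E y -> E (x - y).
Proof. by move=> Ex Ey; apply: subD => //; exact: subN. Qed.
Lemma sub_sum I (r : seq I) (P : pred I) (F : I -> V) :
  (forall i, P i -> E (F i)) -> E (\sum_(i <- r | P i) F i).
Proof. by move=> h; elim/big_ind : _ => //; [exact: sub0|exact: subD]. Qed.
End subspace_facts.

(** Semi-inner products on a subspace of functions. Definiteness is not asked: functions are not
    identified almost everywhere, and the form of an admissible weight is degenerate on the vectors
    of interest. *)
Record hform E B : Prop := HForm {
  hform_sub : linsub E ;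
  hformL : forall a x y z, E x -> E y -> E z -> B (a *: x + y) z = a * B x z + B y z ;
  hformJ : forall x y, E x -> E y -> B y x = conjc (B x y) ;
  hform_ge0 : forall x, E x -> 0 <= Re (B x x) }.

Definition qf B x : R := Re (B x x).

Definition qlim B (u : nat -> V) x :=
  forall e : R, 0 < e -> exists N, forall n, (N <= n)%N -> qf B (u n - x) < e.
Definition qcauchy B (u : nat -> V) :=
  forall e : R, 0 < e -> exists N, forall m n, (N <= m)%N -> (N <= n)%N ->
    qf B (u m - u n) < e.
Definition qcomplete E B :=
  forall u, (forall n, E (u n)) -> qcauchy B u -> exists2 x, E x & qlim B u x.
Definition qclosed E B S :=
  forall u x, (forall n, S (u n)) -> E x -> qlim B u x -> S x.

Section facts.
Variables (E : set V) (B : V -> V -> C).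
Hypothesis hB : hform E B.
Let sE := hform_sub hB.
Local Notation q := (qf B).
Let E0 : E 0 := sub0 sE.
#[local] Hint Resolve E0 : core.

Lemma hformD x y z : E x -> E y -> E z -> B (x + y) z = B x z + B y z.
Proof. by move=> Ex Ey Ez; rewrite -{1}[x]scale1r (hformL hB) // mul1r. Qed.
Lemma hform0 z : E z -> B 0 z = 0.
Proof.
move=> Ez; have := hformD (sub0 sE) (sub0 sE) Ez; rewrite addr0.
by rewrite -[X in X = _]addr0 => /addrI.
Qed.
Lemma hformZ a x z : E x -> E z -> B (a *: x) z = a * B x z.
Proof.
by move=> Ex Ez; rewrite -[a *: x]addr0 (hformL hB) // hform0 // addr0.
Qed.
Lemma hformN x z : E x -> E z -> B (- x) z = - B x z.
Proof. by move=> Ex Ez; rewrite -scaleN1r hformZ // mulN1r. Qed.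
Lemma hformB x y z : E x -> E y -> E z -> B (x - y) z = B x z - B y z.
Proof. by move=> Ex Ey Ez; rewrite hformD ?hformN //; exact: subN. Qed.
Lemma hformDr x y z : E x -> E y -> E z -> B z (x + y) = B z x + B z y.
Proof.
move=> Ex Ey Ez; rewrite (hformJ hB) ?hformD ?conjcD //; last exact: subD.
by rewrite -!(hformJ hB).
Qed.
Lemma hformNr x z : E x -> E z -> B z (- x) = - B z x.
Proof.
move=> Ex Ez; rewrite (hformJ hB) ?hformN ?raddfN //=; last exact: subN.
by rewrite -(hformJ hB).
Qed.
Lemma hformBr x y z : E x -> E y -> E z -> B z (x - y) = B z x - B z y.
Proof. by move=> Ex Ey Ez; rewrite hformDr ?hformNr //; exact: subN. Qed.
Lemma hformZr a x z : E x -> E z -> B z (a *: x) = conjc a * B z x.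
Proof.
move=> Ex Ez; rewrite (hformJ hB) ?hformZ ?conjcM //; last exact: subZ.
by rewrite -(hformJ hB).
Qed.
Lemma hform0r z : E z -> B z 0 = 0.
Proof. by move=> Ez; rewrite (hformJ hB) ?hform0 ?conjc0. Qed.
Lemma hform_suml I (r : seq I) (P : pred I) (F : I -> V) z :
  (forall i, P i -> E (F i)) -> E z ->
  B (\sum_(i <- r | P i) F i) z = \sum_(i <- r | P i) B (F i) z.
Proof.
move=> h Ez.
have [] : E (\sum_(i <- r | P i) F i) /\
   B (\sum_(i <- r | P i) F i) z = \sum_(i <- r | P i) B (F i) z; last by [].
elim/big_ind2 : _ => //.
- by rewrite hform0.
- move=> x1 x2 y1 y2 [h1 h2] [h3 h4]; split; first exact: subD.
  by rewrite hformD // h2 h4.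
- by move=> i Pi; split => //; exact: h.
Qed.
Lemma Im_hform x : E x -> Im (B x x) = 0.
Proof.
move=> Ex; have /(congr1 Im) := hformJ hB Ex Ex; rewrite ImJ; lra.
Qed.
Lemma hformxx x : E x -> B x x = (q x)%:C%C.
Proof. by move=> Ex; apply: complex_ext; rewrite // Im_hform. Qed.
Lemma qf_ge0 x : E x -> 0 <= q x. Proof. exact: hform_ge0. Qed.
Lemma qfZ a x : E x -> q (a *: x) = cn2 a * q x.
Proof.
move=> Ex; rewrite /qf hformZ ?hformZr //; last exact: subZ.
by rewrite mulrA mulcJ ReM /= mul0r subr0.
Qed.
Lemma qf0 : q 0 = 0. Proof. by rewrite /qf hform0. Qed.
Lemma qfN x : E x -> q (- x) = q x.
Proof. by move=> Ex; rewrite -scaleN1r qfZ // cn2N cn2_1 mul1r. Qed.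
Lemma qfD x y : E x -> E y -> q (x + y) = q x + 2 * Re (B x y) + q y.
Proof.
move=> Ex Ey; rewrite /qf hformD ?hformDr //; last exact: subD.
by rewrite (hformJ hB Ex Ey) !ReImE; ring.
Qed.
Lemma qfB x y : E x -> E y -> q (x - y) = q x - 2 * Re (B x y) + q y.
Proof.
by move=> Ex Ey; rewrite qfD ?qfN ?hformNr ?ReN //; [ring|exact: subN].
Qed.
Lemma qfBC x y : E x -> E y -> q (x - y) = q (y - x).
Proof. by move=> Ex Ey; rewrite -opprB qfN //; exact: subB. Qed.
Lemma parallelogram x y : E x -> E y ->
  q (x + y) + q (x - y) = 2 * q x + 2 * q y.
Proof. by move=> Ex Ey; rewrite qfD // qfB //; ring. Qed.

(** First-order condition at an approximate minimum. With N = |B(x, y)|^2, the test c = - s B(x, y)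
    gives 2 s N <= eps + s^2 N q(y); the best s is 1 / q(y), and if q(y) = 0 a large s forces N = 0.
    The Cauchy-Schwarz inequality is the case eps = q(x). *)
Lemma almost_orthogonal x y (eps : R) : E x -> E y -> 0 <= eps ->
  (forall c, q x - eps <= q (x + c *: y)) -> cn2 (B x y) <= eps * q y.
Proof.
move=> Ex Ey e0 h; set N := cn2 (B x y).
have N0 : 0 <= N by exact: cn2_ge0.
have y0 := qf_ge0 Ey.
have key (s : R) : 2 * s * N <= eps + s ^+ 2 * N * q y.
  have := h (- (s%:C%C * B x y)).
  rewrite qfD ?qfZ ?hformZr //; last exact: subZ.
  have -> : Re (conjc (- (s%:C%C * B x y)) * B x y) = - s * N.
    by rewrite /N /cn2 !ReImE; ring.
  rewrite cn2N cn2M cn2R -/N.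
  nra.
have [qy0|qyn0] := eqVneq (q y) 0.
  rewrite qy0 mulr0.
  have [//|Npos] := lerP N 0; exfalso.
  have := key ((eps + 1) / (2 * N)); rewrite qy0 mulr0 addr0.
  have -> : 2 * ((eps + 1) / (2 * N)) * N = eps + 1 by field; rewrite gt_eqF.
  lra.
have qpos : 0 < q y by rewrite lt_neqAle eq_sym qyn0.
have := key (q y)^-1.
rewrite -(ler_pM2r qpos).
have -> : 2 * (q y)^-1 * N * q y = 2 * N by field.
have -> : (eps + (q y)^-1 ^+ 2 * N * q y) * q y = eps * q y + N by field.
lra.
Qed.

Lemma cauchy_schwarz x y : E x -> E y -> cn2 (B x y) <= q x * q y.
Proof.
move=> Ex Ey; apply: almost_orthogonal => //; first exact: qf_ge0.
by move=> c; rewrite subrr qf_ge0 //; apply: subD => //; exact: subZ.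
Qed.

Lemma hform_radical x y : E x -> E y -> q x = 0 -> B x y = 0.
Proof.
move=> Ex Ey qx; apply: cn2_le0; have := cauchy_schwarz Ex Ey.
by rewrite qx mul0r.
Qed.

Lemma qfD_le x y : E x -> E y -> q (x + y) <= 2 * q x + 2 * q y.
Proof.
move=> Ex Ey; rewrite -parallelogram // lerDl qf_ge0 //; exact: subB.
Qed.

Lemma qfB_le x y : E x -> E y -> q (x - y) <= 2 * q x + 2 * q y.
Proof. by move=> Ex Ey; rewrite -(qfN Ey) qfD_le //; exact: subN. Qed.

Lemma qf_eq0D x y : E x -> E y -> q x = 0 -> q (x + y) = q y.
Proof. by move=> Ex Ey h; rewrite qfD // hform_radical // h Re0; ring. Qed.

Lemma qlim_form u x y (c : C) : (forall n, E (u n)) -> E x -> E y -> qlim B u x ->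
  (forall e, 0 < e -> exists N, forall n, (N <= n)%N -> cn2 (B (u n) y - c) <= e) ->
  B x y = c.
Proof.
move=> Eu Ex Ey hl hc; apply/eqP; rewrite -subr_eq0; apply/eqP; apply: cn2_le0.
apply: (@le_eps _ _ _ (2 * q y + 2)); first by have := qf_ge0 Ey; lra.
move=> e e0 _; have [N1 h1] := hl _ e0; have [N2 h2] := hc _ e0.
pose n := maxn N1 N2; rewrite add0r.
have -> : B x y - c = - (B (u n - x) y) + (B (u n) y - c).
  by rewrite hformB // opprB addrA subrK.
apply: le_trans (cn2D_le _ _) _; rewrite cn2N.
have := cauchy_schwarz (subB sE (Eu n) Ex) Ey.
have := h1 n (leq_maxl _ _); have := h2 n (leq_maxr _ _).
by have := qf_ge0 Ey; nra.
Qed.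

Lemma qlim_qf u x : (forall n, E (u n)) -> E x -> qlim B u x ->
  forall e : R, 0 < e -> exists N, forall n, (N <= n)%N -> `|q (u n) - q x| < e.
Proof.
move=> Eu Ex hl e e0.
pose K := q x + 1; have qx0 := qf_ge0 Ex.
(* The two bounds make q(d) and the cross term 2 Re B(x, d) each smaller than e / 2. *)
have t0 : 0 < Num.min (e / 2) (e ^+ 2 / (16 * K)).
  by rewrite lt_min; apply/andP; split; [lra|apply: divr_gt0; [nra|rewrite /K; lra]].
have [N h] := hl _ t0; exists N => n /h; rewrite lt_min => /andP[h1 h2].
set d := u n - x in h1 h2.
have Ed : E d by exact: subB.
have -> : u n = x + d by rewrite /d addrC subrK.
rewrite qfD //.
have -> : q x + 2 * Re (B x d) + q d - q x = 2 * Re (B x d) + q d by ring.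
have cs := le_trans (sqr_Re_le _) (cauchy_schwarz Ex Ed).
have d0 := qf_ge0 Ed.
have : `|Re (B x d)| < e / 4.
  rewrite -(@ltr_pXn2r _ 2) // ?nnegrE //; last lra.
  rewrite -normrX ger0_norm ?sqr_ge0 //; apply: le_lt_trans cs _.
  apply: le_lt_trans (_ : K * q d < _); first by rewrite /K; nra.
  rewrite mulrC -ltr_pdivlMr; last by rewrite /K; lra.
  apply: lt_le_trans h2 _; rewrite le_eqVlt; apply/orP; left; apply/eqP; field.
  by rewrite /K gt_eqF //; lra.
move=> hh; apply: le_lt_trans (ler_normD _ _) _.
by rewrite normrM (ger0_norm d0) ger0_norm //; lra.
Qed.

(** Parallelogram law: the midpoint of [x + u m] and [x + u n] is again in x + S, so its seminorm is
    at least d. *)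
Lemma near_minimizers_cauchy (S : set V) x (d : R) (u : nat -> V) :
  linsub S -> S `<=` E -> E x -> (forall n, S (u n)) ->
  (forall s, S s -> d <= q (x + s)) ->
  (forall n, q (x + u n) <= d + n.+1%:R^-1) -> qcauchy B u.
Proof.
move=> sS SE Ex Su hd hu e e0.
have Eu n := SE _ (Su n).
have [|N /(_ N (leqnn N)) hN] := @natSinv_lt R (e / 4); first lra.
exists N => m n hm hn.
have hsmall k : (N <= k)%N -> q (x + u k) <= d + N.+1%:R^-1.
  move=> hk; apply: le_trans (hu k) _; rewrite lerD2l lef_pV2 ?posrE //.
  by rewrite ler_nat.
have -> : u m - u n = (x + u m) - (x + u n) by rewrite opprD addrACA subrr add0r.
have hp := parallelogram (subD sE Ex (Eu m)) (subD sE Ex (Eu n)).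
have hmid := hd _ (subZ sS (2^-1)%:C%C (subD sS (Su m) (Su n))).
have h4 : q (x + u m + (x + u n)) = 4 * q (x + (2^-1)%:C%C *: (u m + u n)).
  have -> : x + u m + (x + u n) = 2%:R%:C%C *: (x + (2^-1)%:C%C *: (u m + u n)).
    rewrite scalerDr scalerA -[_ * _]rmorphM /= divff // scale1r.
    by rewrite addrACA -[x + x]mulr2n rmorph_nat scaler_nat.
  rewrite qfZ ?cn2R; last by apply: (subD sE) => //; apply: (subZ sE); exact: subD.
  by ring.
have := hsmall _ hm; have := hsmall _ hn; move: hN; move: (N.+1%:R^-1) => k; lra.
Qed.

Lemma minimizing_sequence (S : set V) x : linsub S -> S `<=` E -> E x ->
  exists d : R, exists u : nat -> V, [/\ forall n, S (u n),
    forall s, S s -> d <= q (x + s) & forall n, q (x + u n) <= d + n.+1%:R^-1].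
Proof.
move=> sS SE Ex.
pose A := [set q (x + s) | s in S].
have hA : has_inf A.
  split; first by exists (q (x + 0)); exists 0 => //; exact: sub0.
  by exists 0 => _ [s Ss <-]; apply: qf_ge0; apply: subD => //; exact: SE.
have hn n : exists s, S s /\ q (x + s) <= inf A + n.+1%:R^-1.
  have n0 : 0 < n.+1%:R^-1 :> R by rewrite invr_gt0.
  have [_ [s Ss <-] hs] := inf_adherent n0 hA.
  by exists s; split=> //; exact: ltW.
have [u hu] := choice hn; exists (inf A), u; split => //.
- by move=> n; have [] := hu n.
- by move=> s Ss; apply: ge_inf; [exact: (proj2 hA)|exists s].
- by move=> n; have [] := hu n.
Qed.

Lemma minimizers_almost_orthogonal (S : set V) x (d : R) (u : nat -> V) :
  linsub S -> S `<=` E -> E x -> (forall n, S (u n)) ->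
  (forall s, S s -> d <= q (x + s)) ->
  (forall n, q (x + u n) <= d + n.+1%:R^-1) ->
  forall n s, S s -> cn2 (B (x + u n) s) <= n.+1%:R^-1 * q s.
Proof.
move=> sS SE Ex Su hd hu n s Ss.
apply: almost_orthogonal.
- by apply: (subD sE) => //; exact: SE.
- exact: SE.
- by rewrite invr_ge0.
move=> c; rewrite -addrA.
apply: le_trans (hd _ (subD sS (Su n) (subZ sS c Ss))).
by rewrite lerBlDr.
Qed.

Lemma projection (S : set V) x : qcomplete E B -> linsub S -> S `<=` E ->
  qclosed E B S -> E x -> exists2 s, S s & forall t, S t -> B (x - s) t = 0.
Proof.
move=> cE sS SE cS Ex.
have [d [u [Su hd hu]]] := minimizing_sequence sS SE Ex.
have Eu n := SE _ (Su n).
have [s Es hs] := cE u Eu (near_minimizers_cauchy sS SE Ex Su hd hu).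
have Ss : S s by exact: cS hs.
(* The minimization runs over x + S, whence the sign. *)
exists (- s); first exact: subN.
move=> t St; rewrite opprK.
apply: (@qlim_form (fun n => x + u n)) => //.
- by move=> n; exact: subD.
- exact: subD.
- exact: SE.
- move=> e e0; have [N hN] := hs e e0; exists N => n /hN.
  by rewrite opprD addrACA subrr add0r.
- move=> e e0.
  have t0 := qf_ge0 (SE _ St).
  have et0 : 0 < e / (q t + 1) by apply: divr_gt0 => //; lra.
  have [N hN] := natSinv_lt et0.
  exists N => n hn; rewrite subr0.
  apply: le_trans (minimizers_almost_orthogonal sS SE Ex Su hd hu n St) _.
  have := hN n hn; rewrite /= ltr_pdivlMr; last lra.
  have : 0 <= n.+1%:R^-1 :> R by rewrite invr_ge0.
  by move: (n.+1%:R^-1) => k; nra.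
Qed.

(* One-step Hahn-Banach extension for a Hilbert seminorm: the value [c] is the
   limit of [- l] along a sequence minimizing the seminorm on [x + S]. *)
Lemma extension_step (S : set V) x (l : V -> C) :
  linsub S -> S `<=` E -> E x ->
  (forall a f g, S f -> S g -> l (a *: f + g) = a * l f + l g) ->
  (forall f, S f -> cn2 (l f) <= q f) ->
  exists c, forall f, S f -> cn2 (l f + c) <= q (f + x).
Proof.
move=> sS SE Ex lL lq.
have [d [u [Su hd hu]]] := minimizing_sequence sS SE Ex.
have Eu n := SE _ (Su n).
have uC := near_minimizers_cauchy sS SE Ex Su hd hu.
have lB f g : S f -> S g -> l (f - g) = l f - l g.
  by move=> Sf Sg; rewrite addrC -scaleN1r lL // mulN1r addrC.
have [|c hc] := @complex_cauchy_cvg R (fun n => l (u n)).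
  move=> e e0; have [N hN] := uC _ e0; exists N => m n hm hn.
  by rewrite -lB //; apply: le_lt_trans (lq _ (subB sS (Su m) (Su n))) (hN _ _ hm hn).
exists (- c) => f Sf.
have Ef := SE _ Sf.
have fx0 := qf_ge0 (subD sE Ef Ex).
set Q := q (f + x).
have d0 : 0 <= d.
  rewrite leNgt; apply/negP => dn.
  have [N /(_ N (leqnn N)) hN] := @natSinv_lt R (- d) ltac:(lra).
  have := qf_ge0 (subD sE Ex (Eu N)); have := hu N.
  by move: hN; move: (N.+1%:R^-1) => k; lra.
(* In f + x = (x + u n) + (f - u n) the cross term is of order e by almost orthogonality, and q (x +
   u n) >= d >= 0 may be dropped; hence q (f - u n) exceeds Q by at most a multiple of e. *)
have step n e : 0 < e -> e <= 1 -> n.+1%:R^-1 < e ^+ 2 ->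
    cn2 (l f - l (u n)) <= Q + (2 * Q + 2 * d + 3) * e.
  move=> e0 e1; rewrite -lB // => ke; apply: le_trans (lq _ (subB sS Sf (Su n))) _.
  have Ed := subB sE Ef (Eu n); have Ey := subD sE Ex (Eu n).
  have hyn := minimizers_almost_orthogonal sS SE Ex Su hd hu n (subB sS Sf (Su n)).
  have un := hu n; have dn := hd _ (Su n).
  have k0 : 0 <= n.+1%:R^-1 :> R by rewrite invr_ge0.
  move: (n.+1%:R^-1) hyn un k0 ke => k hyn un k0 ke.
  have hQ : Q = q (x + u n) + 2 * Re (B (x + u n) (f - u n)) + q (f - u n).
    by rewrite -qfD //; congr q; rewrite addrC addrACA subrr addr0 addrC.
  have DQ : q (f - u n) <= 2 * Q + 2 * q (x + u n).
    rewrite /Q; have -> : f - u n = (f + x) - (x + u n).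
      by rewrite opprD addrA addrK.
    apply: qfB_le => //; exact: subD.
  have D0 : 0 <= q (f - u n) by exact: qf_ge0.
  have r2 := le_trans (sqr_Re_le _) hyn.
  move: (q (f - u n)) (Re (B (x + u n) (f - u n))) DQ D0 r2 hQ => D r DQ D0 r2 hQ.
  have kk : k <= 1 by nra.
  have kD : k * D <= e ^+ 2 * D by rewrite ler_wpM2r // ltW.
  have ra : r ^+ 2 <= e ^+ 2 * (2 * Q + 2 * d + 2).
    apply: le_trans r2 _; apply: le_trans kD _; rewrite ler_wpM2l ?sqr_ge0 //; lra.
  have M0 : 0 <= 2 * Q + 2 * d + 2 by lra.
  have ee : 0 < e ^+ 2 by exact: exprn_gt0.
  have : - (2 * r) <= e + e * (2 * Q + 2 * d + 2).
    rewrite -(ler_pM2l e0).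
    have -> : e * (e + e * (2 * Q + 2 * d + 2)) = e ^+ 2 + e ^+ 2 * (2 * Q + 2 * d + 2).
      by ring.
    have := sqr_ge0 (e + r); lra.
  lra.
apply: cn2_limit => // e e0.
have K0 : 0 < 2 * Q + 2 * d + 3 by rewrite /Q; lra.
pose e' := Num.min 1 (e / (2 * Q + 2 * d + 3)).
have e'0 : 0 < e' by rewrite lt_min ltr01 divr_gt0.
have e'1 : e' <= 1 by rewrite ge_min lexx.
have e'2 : (2 * Q + 2 * d + 3) * e' <= e.
  by rewrite mulrC -ler_pdivlMr // ge_min lexx orbT.
have [N1 h1] := hc _ e0.
have [N2 h2] := natSinv_lt (exprn_gt0 2 e'0).
exists (l (u (maxn N1 N2))); split; first by apply: ltW; apply: h1; exact: leq_maxl.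
apply: le_trans (step _ _ e'0 e'1 (h2 _ (leq_maxr _ _))) _; lra.
Qed.

Definition lin (l : V -> C) := forall a f g, E f -> E g -> l (a *: f + g) = a * l f + l g.

Lemma linD l f g : lin l -> E f -> E g -> l (f + g) = l f + l g.
Proof. by move=> ll Ef Eg; rewrite -[f]scale1r ll // mul1r scale1r. Qed.

Lemma lin0 l : lin l -> l 0 = 0.
Proof.
move=> ll; have := linD ll E0 E0; rewrite addr0.
by rewrite -[X in X = _]addr0 => /addrI.
Qed.

Lemma linZ l a f : lin l -> E f -> l (a *: f) = a * l f.
Proof. by move=> ll Ef; rewrite -[a *: f]addr0 ll // lin0 // addr0. Qed.

Lemma linB l f g : lin l -> E f -> E g -> l (f - g) = l f - l g.
Proof. by move=> ll Ef Eg; rewrite addrC -scaleN1r ll // mulN1r addrC. Qed.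

Lemma lin_sum (I : eqType) (r : seq I) (c : I -> C) (phi : I -> V -> C) :
  (forall i, i \in r -> lin (phi i)) -> lin (fun f => \sum_(i <- r) c i * phi i f).
Proof.
move=> h a f g Ef Eg; rewrite mulr_sumr -big_split /=.
by rewrite !big_seq; apply: eq_bigr => i ir; rewrite h //; ring.
Qed.

(** The constraints phi_i f = 0 are released one at a time. The biorthogonal vector x_i spans the
    direction gained by releasing phi_i, and [extension_step] supplies the value there. *)
Lemma extension_finite (l : V -> C) r (phi : nat -> V -> C) (x : nat -> V) :
  lin l -> (forall i, (i < r)%N -> lin (phi i)) -> (forall i, (i < r)%N -> E (x i)) ->
  (forall i j, (i < r)%N -> (j < r)%N -> phi i (x j) = (i == j)%:R) ->
  (forall f, E f -> (forall i, (i < r)%N -> phi i f = 0) -> cn2 (l f) <= q f) ->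
  exists c : nat -> C, forall f, E f -> cn2 (l f + \sum_(i < r) c i * phi i f) <= q f.
Proof.
move=> ll lphi Ex phix hl.
suff [c hc] : exists c : nat -> C, forall f, E f ->
    (forall i, (r <= i < r)%N -> phi i f = 0) ->
    cn2 (l f + \sum_(i < r) c i * phi i f) <= q f.
  exists c => f Ef; apply: hc => // i /andP[h1 h2].
  by move: (leq_trans h2 h1); rewrite ltnn.
suff H s : (s <= r)%N -> exists c : nat -> C, forall f, E f ->
    (forall i, (s <= i < r)%N -> phi i f = 0) ->
    cn2 (l f + \sum_(i < s) c i * phi i f) <= q f by exact: H.
elim: s => [_|s IH sr].
  by exists (fun=> 0) => f Ef h; rewrite big_ord0 addr0; apply: hl.
have [c hc] := IH (ltnW sr).
pose S := [set f | E f /\ forall i, (s <= i < r)%N -> phi i f = 0].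
have lphi' i : (i < r)%N -> lin (phi i) by exact: lphi.
have sS : linsub S.
  split; first by split=> // i /andP[_ ir]; rewrite lin0 //; exact: lphi'.
  move=> a f g [Ef hf] [Eg hg]; split; first exact: subL.
  by move=> i ir; case/andP: (ir) => _ ir'; rewrite lphi' // hf // hg // mulr0 addr0.
have SE : S `<=` E by move=> f [].
pose l' f := l f + \sum_(i < s) c i * phi i f.
have ll' : lin l'.
  move=> a f g Ef Eg; rewrite /l' ll // (@lin_sum _ _ (c \o val) (phi \o val)) //=.
    by ring.
  by move=> i _; apply: lphi; exact: ltn_trans (ltn_ord i) sr.
have [d hd] := @extension_step S (x s) l' sS SE (Ex _ sr)
  (fun a f g Sf Sg => ll' a f g (SE _ Sf) (SE _ Sg)) (fun f Sf => hc f Sf.1 Sf.2).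
(* The earlier phi_i vanish at x_s, so this coefficient gives the extended functional the value d at
   x_s. *)
exists (fun i => if i == s then d - l (x s) else c i) => f Ef hf.
rewrite big_ord_recr /= eqxx.
have -> : \sum_(i < s) (if val i == s then d - l (x s) else c i) * phi i f =
    \sum_(i < s) c i * phi i f.
  by apply: eq_bigr => i _ /=; rewrite ltn_eqF.
have xs0 : \sum_(i < s) c i * phi i (x s) = 0.
  rewrite big1 // => i _; rewrite phix ?(ltn_trans (ltn_ord i)) //.
  by rewrite (ltn_eqF (ltn_ord i)) mulr0.
set a := phi s f.
pose g := f - a *: x s.
have Ea : E (a *: x s) by apply: (subZ sE); exact: Ex.
have Sg : S g.
  split; first exact: subB.
  move=> i /andP[si ir]; rewrite /g linB ?linZ ?phix //; try exact: lphi'; try exact: Ex.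
  move: si; rewrite leq_eqVlt => /orP[/eqP <-|si].
    by rewrite eqxx mulr1 subrr.
  by rewrite (gtn_eqF si) mulr0 subr0 hf // si.
have fE : f = g + a *: x s by rewrite /g subrK.
have -> : l f + (\sum_(i < s) c i * phi i f + (d - l (x s)) * a) = l' g + a * d.
  have -> : l' g = l' f - a * l (x s).
    by rewrite /g linB ?linZ //; [rewrite {2}/l' xs0 addr0|exact: Ex].
  by rewrite /l'; ring.
have [a0|an0] := eqVneq a 0.
  rewrite a0 mul0r addr0; move: fE; rewrite a0 scale0r addr0 => ->.
  by apply: hc; [exact: Sg.1|exact: Sg.2].
have -> : l' g + a * d = a * (l' (a^-1 *: g) + d).
  rewrite linZ //; last exact: Sg.1.
  by rewrite mulrDr mulrA divff // mul1r.
have -> : f = a *: (a^-1 *: g + x s).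
  by rewrite scalerDr scalerA divff // scale1r.
rewrite cn2M qfZ; last by apply: (subD sE); [apply: (subZ sE); exact: Sg.1|exact: Ex].
by rewrite ler_wpM2l ?cn2_ge0 //; apply: hd; apply: subZ.
Qed.

(** By Pythagoras q (s m - s n) = q (s m) - q (s n) for m <= n, so the projections s_n are Cauchy;
    their limit lies in every S_n and therefore has seminorm 0. *)
Lemma decreasing_projections (S : nat -> set V) x (s : nat -> V) :
  qcomplete E B -> (forall n, linsub (S n)) -> (forall n, S n `<=` E) ->
  (forall n, qclosed E B (S n)) -> (forall n, S n.+1 `<=` S n) ->
  (forall y, E y -> (forall n, S n y) -> q y = 0) ->
  E x -> (forall n, S n (s n)) -> (forall n t, S n t -> B (x - s n) t = 0) ->
  forall e : R, 0 < e -> exists N, forall n, (N <= n)%N -> q (s n) < e.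
Proof.
move=> cE sS SE cS dS iS Ex Ss hs.
have Es n := SE _ _ (Ss n).
have SM m n : (m <= n)%N -> S n `<=` S m.
  move=> mn; rewrite -(subnK mn); elim: (n - m)%N => // k IH y /dS; exact: IH.
have key m n : (m <= n)%N -> q (s m - s n) = q (s m) - q (s n).
  move=> mn; rewrite qfB //.
  have h1 : B (s m) (s n) = B (x) (s n).
    have := hs m _ (SM _ _ mn _ (Ss n)); rewrite hformB // => /eqP.
    by rewrite subr_eq0 eq_sym => /eqP.
  have h2 : B x (s n) = (q (s n))%:C%C.
    have := hs n _ (Ss n); rewrite hformB // => /eqP.
    by rewrite subr_eq0 => /eqP ->; exact: hformxx.
  by rewrite h1 h2 ReR; ring.
have dq m n : (m <= n)%N -> q (s n) <= q (s m).
  by move=> mn; rewrite -subr_ge0 -key // qf_ge0 //; exact: subB.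
pose A := [set q (s n) | n in setT].
have hA : has_inf A.
  split; first by exists (q (s 0)); exists 0%N.
  by exists 0 => _ [n _ <-]; exact: qf_ge0.
have lA n : inf A <= q (s n) by apply: ge_inf; [exact: (proj2 hA)|exists n].
have near e : 0 < e -> exists N, forall n, (N <= n)%N -> q (s n) < inf A + e.
  move=> e0; have [_ [N _ <-] hN] := inf_adherent e0 hA.
  by exists N => n Nn; apply: le_lt_trans hN; exact: dq.
have sC : qcauchy B s.
  move=> e e0; have [N hN] := near _ e0; exists N => m n hm hn.
  wlog mn : m n hm hn / (m <= n)%N.
    move=> H; case: (leqP m n) => [|/ltnW] nm; first exact: H.
    by rewrite qfBC //; exact: H.
  rewrite key //; have := hN _ hm; have := lA n; lra.
have [y Ey hy] := cE s Es sC.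
have y0 : q y = 0.
  apply: iS => // n; apply: (cS n (fun k => s (n + k)%N)) => //.
    by move=> k; apply: SM (Ss _); exact: leq_addr.
  move=> e e0; have [N hN] := hy _ e0; exists N => k Nk; apply: hN.
  by apply: leq_trans Nk _; exact: leq_addl.
move=> e e0; have [N hN] := hy _ e0; exists N => n /hN.
rewrite qfB // (hformJ hB Ey (Es n)) (hform_radical Ey) // y0 conjc0 /=.
lra.
Qed.
End facts.
End hermitian_forms.

Lemma mxrank_sum_le (F : fieldType) m n k (A : 'I_k -> 'M[F]_(m, n)) :
  (forall i, \rank (A i) <= 1)%N -> (\rank (\sum_(i < k) A i)%R <= k)%N.
Proof.
elim: k A => [|k IH] A hA; first by rewrite big_ord0 mxrank0.
rewrite big_ord_recr /=; apply: leq_trans (mxrank_add _ _) _.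
by rewrite -[leqRHS]addn1 leq_add // IH.
Qed.

(** * Gram-Schmidt and singular values *)

Section pointwise.
Variable R : realType.
Local Notation C := R[i].

Definition hdot n (x y : 'cV[C]_n) : C := \sum_(i < n) x i ord0 * conjc (y i ord0).
Definition vn2 n (x : 'cV[C]_n) : R := \sum_(i < n) cn2 (x i ord0).

Lemma hdot_hform n : hform [set: 'cV[C]_n] (@hdot n).
Proof.
split => //.
- move=> a x y z _ _ _; rewrite /hdot mulr_sumr -big_split /=.
  by apply: eq_bigr => i _; rewrite !mxE; ring.
- move=> x y _ _; rewrite /hdot conjc_sum; apply: eq_bigr => i _.
  by rewrite conjcM conjcK mulrC.
- move=> x _; rewrite Re_sum sumr_ge0 // => i _; rewrite mulcJ; exact: cn2_ge0.
Qed.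

Section dim.
Variable n : nat.
Implicit Types (x y z : 'cV[C]_n) (a : C).
Let H := hdot_hform n.

Lemma qf_hdot x : qf (@hdot n) x = vn2 x.
Proof. by rewrite /qf Re_sum; apply: eq_bigr => i _; rewrite mulcJ. Qed.
Lemma hdotxx x : hdot x x = (vn2 x)%:C%C.
Proof. by rewrite (hformxx H) // qf_hdot. Qed.
Lemma vn2_ge0 x : 0 <= vn2 x. Proof. by rewrite sumr_ge0 // => i _; exact: cn2_ge0. Qed.
Lemma vn2_0 : vn2 (0 : 'cV[C]_n) = 0.
Proof. by rewrite -qf_hdot (qf0 H). Qed.
Lemma vn2_eq0 x : vn2 x = 0 -> x = 0.
Proof.
move=> /eqP; rewrite psumr_eq0 => [|i _]; last exact: cn2_ge0.
move=> /allP h; apply/matrixP => i j; rewrite ord1 mxE.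
by apply: cn2_eq0; apply/eqP/(implyP (h i (mem_index_enum i))).
Qed.
Lemma vn2_gt0 x : x != 0 -> 0 < vn2 x.
Proof.
by move=> x0; rewrite lt_neqAle vn2_ge0 andbT; apply: contra_neq x0 => /esym/vn2_eq0.
Qed.
Lemma vn2Z a x : vn2 (a *: x) = cn2 a * vn2 x.
Proof. by rewrite -!qf_hdot (qfZ H). Qed.
Lemma vn2N x : vn2 (- x) = vn2 x. Proof. by rewrite -!qf_hdot (qfN H). Qed.
Lemma vn2D_le x y : vn2 (x + y) <= 2 * vn2 x + 2 * vn2 y.
Proof. by rewrite -!qf_hdot (qfD_le H). Qed.
Lemma vn2D x y : vn2 (x + y) = vn2 x + 2 * complex.Re (hdot x y) + vn2 y.
Proof. by rewrite -!qf_hdot (qfD H). Qed.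
Lemma vn2D_orth x y : hdot x y = 0 -> vn2 (x + y) = vn2 x + vn2 y.
Proof. by rewrite vn2D => ->; rewrite /=; ring. Qed.
Lemma hdotD x y z : hdot (x + y) z = hdot x z + hdot y z. Proof. exact: (hformD H). Qed.
Lemma hdotB x y z : hdot (x - y) z = hdot x z - hdot y z. Proof. exact: (hformB H). Qed.
Lemma hdotZ a x z : hdot (a *: x) z = a * hdot x z. Proof. exact: (hformZ H). Qed.
Lemma hdotDr x y z : hdot z (x + y) = hdot z x + hdot z y. Proof. exact: (hformDr H). Qed.
Lemma hdotZr a x z : hdot z (a *: x) = conjc a * hdot z x. Proof. exact: (hformZr H). Qed.
Lemma hdot0 z : hdot (0 : 'cV[C]_n) z = 0. Proof. exact: (hform0 H). Qed.
Lemma hdot0r z : hdot z (0 : 'cV[C]_n) = 0. Proof. exact: (hform0r H). Qed.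
Lemma hdotC x y : hdot y x = conjc (hdot x y). Proof. exact: (hformJ H). Qed.
Lemma hdot_suml I (r : seq I) (P : pred I) (F : I -> 'cV[C]_n) z :
  hdot (\sum_(i <- r | P i) F i) z = \sum_(i <- r | P i) hdot (F i) z.
Proof. by rewrite (hform_suml H). Qed.
Lemma hdot_sumr I (r : seq I) (P : pred I) (F : I -> 'cV[C]_n) z :
  hdot z (\sum_(i <- r | P i) F i) = \sum_(i <- r | P i) hdot z (F i).
Proof. by rewrite hdotC hdot_suml conjc_sum; apply: eq_bigr => i _; rewrite -hdotC. Qed.
Lemma hdot_cs x y : cn2 (hdot x y) <= vn2 x * vn2 y.
Proof. by rewrite -!qf_hdot (cauchy_schwarz H). Qed.
Lemma vnormE x : vnorm x = Num.sqrt (vn2 x).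
Proof. by rewrite /vnorm; congr Num.sqrt; apply: eq_bigr => i _; rewrite normc2. Qed.
Lemma sqr_vnorm x : vnorm x ^+ 2 = vn2 x.
Proof. by rewrite vnormE sqr_sqrtr // vn2_ge0. Qed.
Lemma vnorm_ge0 x : 0 <= vnorm x. Proof. by rewrite vnormE sqrtr_ge0. Qed.

Lemma vnorm_le (k : R) x : 0 <= k -> (vnorm x <= k) = (vn2 x <= k ^+ 2).
Proof.
by move=> k0; rewrite -sqr_vnorm ler_pXn2r // nnegrE vnorm_ge0.
Qed.

(** Families are indexed by all naturals and cut off at k, so that they can be prolonged one vector
    at a time. *)
Definition spanp (e : nat -> 'cV[C]_n) k x := exists c : nat -> C, x = \sum_(i < k) c i *: e i.

Lemma spanp_sub e k : linsub (spanp e k).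
Proof.
split; first by exists (fun=> 0); rewrite big1 // => i _; rewrite scale0r.
move=> a x y [c ->] [d ->]; exists (fun i => a * c i + d i).
rewrite scaler_sumr -big_split /=; apply: eq_bigr => i _.
by rewrite scalerDl scalerA.
Qed.

Lemma spanp_mem e k i : (i < k)%N -> spanp e k (e i).
Proof.
move=> ik; exists (fun j => (j == i)%:R).
rewrite (bigD1 (Ordinal ik)) //= eqxx scale1r big1 ?addr0 // => j ji.
by rewrite -val_eqE /= in ji; rewrite (negbTE ji) scale0r.
Qed.

Lemma spanp_trans e e' k k' x : (forall i, (i < k)%N -> spanp e' k' (e i)) ->
  spanp e k x -> spanp e' k' x.
Proof.
move=> h [c ->]; apply: (sub_sum (spanp_sub _ _)) => i _.
by apply: (subZ (spanp_sub _ _)); exact: h.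
Qed.

Lemma spanp_widen e k k' x : (k <= k')%N -> spanp e k x -> spanp e k' x.
Proof.
by move=> kk'; apply: spanp_trans => i ik; apply: spanp_mem; exact: leq_trans kk'.
Qed.

(* Orthonormal up to zero vectors. *)
Definition porth (e : nat -> 'cV[C]_n) k := forall i j, (i < k)%N -> (j < k)%N ->
  hdot (e i) (e j) = ((i == j) && (e i != 0))%:R.

Definition proj (e : nat -> 'cV[C]_n) k x := \sum_(i < k) hdot x (e i) *: e i.

Section porth.
Variables (e : nat -> 'cV[C]_n) (k : nat).
Hypothesis he : porth e k.

Lemma porth_vn2 i : (i < k)%N -> vn2 (e i) = (e i != 0)%:R.
Proof. 
move=> ik; rewrite -qf_hdot /qf he // eqxx /=.
by case: (e i != 0).
Qed.

Lemma hdot_sum_porth (c : nat -> C) i : (i < k)%N ->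
  hdot (\sum_(j < k) c j *: e j) (e i) = c i * (e i != 0)%:R.
Proof.
move=> ik; rewrite hdot_suml (bigD1 (Ordinal ik)) //= hdotZ he // eqxx /=.
rewrite big1 ?addr0 // => j ji; rewrite hdotZ he //.
by rewrite -val_eqE /= in ji; rewrite (negbTE ji) mulr0.
Qed.

Lemma hdot_porth_nz x i : (i < k)%N -> hdot x (e i) * (e i != 0)%:R = hdot x (e i).
Proof. by case: eqVneq => [->|]; rewrite ?mulr1 // hdot0r mul0r. Qed.

Lemma hdot_proj x i : (i < k)%N -> hdot (proj e k x) (e i) = hdot x (e i).
Proof. by move=> ik; rewrite (hdot_sum_porth (fun j => hdot x (e j))) // hdot_porth_nz. Qed.

Lemma hdot_res x i : (i < k)%N -> hdot (x - proj e k x) (e i) = 0.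
Proof. by move=> ik; rewrite hdotB hdot_proj // subrr. Qed.

Lemma hdot_res_span x y : spanp e k y -> hdot (x - proj e k x) y = 0.
Proof.
by move=> [c ->]; rewrite hdot_sumr big1 // => i _; rewrite hdotZr hdot_res // mulr0.
Qed.

Lemma proj_span x : spanp e k (proj e k x).
Proof. by exists (fun i => hdot x (e i)). Qed.

Lemma span_proj x : spanp e k x -> proj e k x = x.
Proof.
move=> [c ->]; rewrite /proj; apply: eq_bigr => i _; rewrite hdot_sum_porth //.
by case: eqVneq => [->|]; rewrite ?scaler0 // mulr1.
Qed.

Lemma vn2_proj x : vn2 (proj e k x) = \sum_(i < k) cn2 (hdot x (e i)).
Proof.
apply: complexI; rewrite -hdotxx {2}/proj hdot_sumr rmorph_sum /=.
by apply: eq_bigr => i _; rewrite hdotZr hdot_proj // mulJc.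
Qed.

Lemma vn2_split x : vn2 x = vn2 (proj e k x) + vn2 (x - proj e k x).
Proof.
have {1}-> : x = proj e k x + (x - proj e k x) by rewrite addrC subrK.
have h : hdot (proj e k x) (x - proj e k x) = 0.
  by rewrite hdotC hdot_res_span ?conjc0 //; exact: proj_span.
by rewrite (vn2D_orth h).
Qed.

Lemma vn2_res x : vn2 (x - proj e k x) = vn2 x - \sum_(i < k) cn2 (hdot x (e i)).
Proof. by rewrite (vn2_split x) vn2_proj addrAC subrr add0r. Qed.

Lemma bessel x : \sum_(i < k) cn2 (hdot x (e i)) <= vn2 x.
Proof. by rewrite -subr_ge0 -vn2_res vn2_ge0. Qed.

Lemma vn2_span x : spanp e k x -> vn2 x = \sum_(i < k) cn2 (hdot x (e i)).
Proof. by move=> /span_proj hx; rewrite -vn2_proj hx. Qed.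
End porth.

(** Both sides equal the double sum of |<e_i, u_j>|^2. Since the vectors have norm 0 or 1, this is
    the invariance of dimension. *)
Lemma porth_trace e u k r : porth e k -> porth u r ->
  (forall i, (i < k)%N -> spanp u r (e i)) ->
  (forall i, (i < r)%N -> spanp e k (u i)) ->
  \sum_(i < k) vn2 (e i) = \sum_(i < r) vn2 (u i).
Proof.
move=> he hu h1 h2.
rewrite (eq_bigr _ (fun (i : 'I_k) _ => vn2_span hu (h1 i (ltn_ord i)))).
rewrite [RHS](eq_bigr _ (fun (i : 'I_r) _ => vn2_span he (h2 i (ltn_ord i)))).
rewrite exchange_big /=; apply: eq_bigr => i _; apply: eq_bigr => j _.
by rewrite hdotC cn2J.
Qed.

Definition vnormalize x : 'cV[C]_n := ((Num.sqrt (vn2 x))^-1)%:C%C *: x.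

Lemma vnormalizeK x : (Num.sqrt (vn2 x))%:C%C *: vnormalize x = x.
Proof.
have [->|x0] := eqVneq x 0; first by rewrite /vnormalize !scaler0.
rewrite scalerA -[_ * _]rmorphM /= divff ?scale1r //.
by rewrite gt_eqF // sqrtr_gt0 vn2_gt0.
Qed.

Lemma vn2_vnormalize x : vn2 (vnormalize x) = (x != 0)%:R.
Proof.
have [->|x0] := eqVneq x 0; first by rewrite /vnormalize scaler0 vn2_0.
rewrite vn2Z cn2R exprVn sqr_sqrtr ?vn2_ge0 // mulVf // gt_eqF //.
exact: vn2_gt0.
Qed.

Lemma vnormalize_eq0 x : (vnormalize x == 0) = (x == 0).
Proof.
apply/eqP/eqP => [h|->]; last by rewrite /vnormalize scaler0.
by rewrite -(vnormalizeK x) h scaler0.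
Qed.

Fixpoint gs_seq (f : nat -> 'cV[C]_n) k : seq 'cV[C]_n :=
  if k is k'.+1 then
    let s := gs_seq f k' in
    rcons s (vnormalize (f k' - \sum_(v <- s) hdot (f k') v *: v))
  else [::].

(* Gram-Schmidt; a vector depending on the previous ones yields 0. *)
Definition gs f i := locked (nth 0 (gs_seq f i.+1) i).

Lemma size_gs_seq f k : size (gs_seq f k) = k.
Proof. by elim: k => //= k IH; rewrite size_rcons IH. Qed.

Lemma nth_gs_seq f k i : (i < k)%N -> nth 0 (gs_seq f k) i = gs f i.
Proof.
elim: k => // k IH; rewrite ltnS leq_eqVlt => /orP[/eqP ->|ik]; first by rewrite /gs -lock.
by rewrite /= nth_rcons size_gs_seq ik IH.
Qed.

Lemma gsE f i : gs f i = vnormalize (f i - proj (gs f) i (f i)).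
Proof.
rewrite {1}/gs -lock /= nth_rcons size_gs_seq ltnn eqxx; congr (vnormalize (_ - _)).
rewrite (big_nth 0) size_gs_seq big_mkord; apply: eq_bigr => j _.
by rewrite nth_gs_seq.
Qed.

Lemma gs_porth f k : porth (gs f) k.
Proof.
elim: k => [//|k IH] i j.
have key l : (l < k)%N -> hdot (gs f k) (gs f l) = 0.
  by move=> lk; rewrite [gs f k]gsE hdotZ hdot_res ?mulr0.
rewrite !ltnS (leq_eqVlt i) (leq_eqVlt j) => /orP[/eqP ->|ik] /orP[/eqP ->|jk].
- rewrite eqxx hdotxx [in LHS]gsE vn2_vnormalize gsE vnormalize_eq0.
  by case: (_ != 0).
- by rewrite key // gtn_eqF.
- by rewrite hdotC key // conjc0 ltn_eqF.
- exact: IH.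
Qed.

Lemma spanp_gs f k i : (i < k)%N -> spanp (gs f) k (f i).
Proof.
move=> ik; apply: (@spanp_widen _ i.+1) => //.
rewrite -(subrK (proj (gs f) i (f i)) (f i)); apply: (subD (spanp_sub _ _)).
  rewrite -(vnormalizeK (_ - _)) -gsE; apply: (subZ (spanp_sub _ _)).
  exact: spanp_mem.
by apply: (@spanp_widen _ i) => //; exact: proj_span.
Qed.

Lemma gs_spanp f k i : (i < k)%N -> spanp f k (gs f i).
Proof.
elim: k i => // k IH i; rewrite ltnS leq_eqVlt => /orP[/eqP ->|ik]; last first.
  by apply: (@spanp_widen _ k) => //; exact: IH.
rewrite gsE; apply: (subZ (spanp_sub _ _)); apply: (subB (spanp_sub _ _)).
  exact: spanp_mem.
apply: (@spanp_widen _ k) => //; apply: (@spanp_trans (gs f) f k); last exact: proj_span.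
exact: IH.
Qed.

Lemma gs_eq0 f i : gs f i = 0 <-> spanp f i (f i).
Proof.
split=> [/eqP|h].
  rewrite gsE vnormalize_eq0 subr_eq0 => /eqP ->.
  by apply: (@spanp_trans (gs f) f i); [move=> j; exact: gs_spanp|exact: proj_span].
apply/eqP; rewrite gsE vnormalize_eq0 span_proj ?subrr //; first exact: gs_porth.
by apply: spanp_trans h => j; exact: spanp_gs.
Qed.

Lemma eq_gs f g k : (forall i, (i <= k)%N -> f i = g i) -> gs f k = gs g k.
Proof.
elim/ltn_ind: k => k IH h; rewrite (gsE f) (gsE g) -(h k (leqnn k)).
apply: (congr1 (fun y => vnormalize (f k - y))).
apply: eq_bigr => i _; rewrite (IH i) // => j ji; apply: h.
exact: leq_trans ji (ltnW _).
Qed.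

End dim.

Definition adj m n (A : 'M[C]_(m, n)) : 'M[C]_(n, m) := \matrix_(i, j) conjc (A j i).

Lemma hdot_adj m n (A : 'M[C]_(m, n)) x y : hdot (A *m x) y = hdot x (adj A *m y).
Proof.
rewrite /hdot; under eq_bigr do rewrite mxE mulr_suml.
rewrite exchange_big /=; apply: eq_bigr => j _; rewrite mxE conjc_sum mulr_sumr.
by apply: eq_bigr => i _; rewrite mxE conjcM conjcK; ring.
Qed.

Lemma adjK m n (A : 'M[C]_(m, n)) : adj (adj A) = A.
Proof. by apply/matrixP => i j; rewrite !mxE conjcK. Qed.

Section opnorm.
Variables (m n : nat).
Implicit Types (A B : 'M[C]_(m, n)) (x : 'cV[C]_n).

Lemma vn2_mulmx_le A x :
  vn2 (A *m x) <= (\sum_(i < m) \sum_(j < n) cn2 (A i j)) * vn2 x.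
Proof.
rewrite /vn2 mulr_suml; apply: ler_sum => i _; rewrite -/(vn2 x).
pose r : 'cV[C]_n := \col_j conjc (A i j).
have -> : (A *m x) i ord0 = hdot x r.
  by rewrite mxE /hdot; apply: eq_bigr => j _; rewrite mxE conjcK mulrC.
have := hdot_cs x r; rewrite mulrC; congr (_ <= _ * _).
by apply: eq_bigr => j _; rewrite mxE cn2J.
Qed.

Lemma opnorm_has_sup A :
  has_sup [set vnorm (A *m x) | x in [set x | vnorm x <= 1]].
Proof.
split; first by exists (vnorm (A *m 0)); exists 0 => //=; rewrite vnormE vn2_0 sqrtr0.
exists (Num.sqrt (\sum_(i < m) \sum_(j < n) cn2 (A i j))) => _ [x /= hx <-].
rewrite [leLHS]vnormE ler_wsqrtr //; apply: le_trans (vn2_mulmx_le _ _) _.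
move: hx; rewrite vnorm_le // expr1n => hx.
rewrite ler_piMr // sumr_ge0 // => i _; rewrite sumr_ge0 // => j _; exact: cn2_ge0.
Qed.

Lemma opnorm_ge0 A : 0 <= opnorm A.
Proof.
apply: (@le_trans _ _ (vnorm (A *m 0))); first exact: vnorm_ge0.
apply: ub_le_sup; first exact: (proj2 (opnorm_has_sup A)).
by exists 0 => //=; rewrite vnormE vn2_0 sqrtr0.
Qed.

Lemma opnormP A x : vn2 (A *m x) <= opnorm A ^+ 2 * vn2 x.
Proof.
have [->|x0] := eqVneq x 0; first by rewrite mulmx0 !vn2_0 mulr0.
rewrite -{1}(vnormalizeK x) -scalemxAr vn2Z cn2R sqr_sqrtr ?vn2_ge0 // mulrC.
rewrite ler_wpM2r ?vn2_ge0 // -vnorm_le ?opnorm_ge0 //.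
apply: ub_le_sup; first exact: (proj2 (opnorm_has_sup A)).
by exists (vnormalize x) => //=; rewrite vnorm_le // expr1n vn2_vnormalize x0.
Qed.

Lemma opnorm_le A a : 0 <= a ->
  opnorm A <= a <-> forall x, vn2 (A *m x) <= a ^+ 2 * vn2 x.
Proof.
move=> a0; split=> [h x|h].
  apply: le_trans (opnormP _ _) _; rewrite ler_wpM2r ?vn2_ge0 //.
  by rewrite ler_pXn2r // nnegrE opnorm_ge0.
apply: ge_sup; first exact: (proj1 (opnorm_has_sup A)).
move=> _ [x /= hx <-]; rewrite vnorm_le //; apply: le_trans (h x) _.
by move: hx; rewrite vnorm_le // expr1n => hx; rewrite ler_piMr // sqr_ge0.
Qed.

Lemma sval_has_inf j A :
  has_inf [set opnorm (A - B) | B in [set B : 'M[C]_(m, n) | (\rank B <= j)%N]].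
Proof.
split; first by exists (opnorm (A - 0)); exists 0 => //=; rewrite mxrank0.
by exists 0 => _ [B _ <-]; exact: opnorm_ge0.
Qed.

Lemma sval_ge0 j A : 0 <= sval_mx j A.
Proof.
apply: lb_le_inf; first exact: (proj1 (sval_has_inf j A)).
by move=> _ [B _ <-]; exact: opnorm_ge0.
Qed.

Lemma sval_mx0 A : sval_mx 0 A = opnorm A.
Proof.
rewrite /sval_mx.
have -> : [set opnorm (A - B) | B in [set B : 'M[C]_(m, n) | (\rank B <= 0)%N]] =
    [set opnorm A].
  apply/seteqP; split=> [y [B /=]|y /= ->].
    by rewrite leqn0 mxrank_eq0 => /eqP -> <-; rewrite subr0.
  by exists 0; [rewrite /= mxrank0|rewrite subr0].
exact: inf1.
Qed.

(** If P is the projection onto the span of e, then A P has rank at most j and A - A P is A composed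
    with the projection onto the orthogonal complement. *)
Lemma sval_le j A e a : 0 <= a -> porth e j ->
  (forall x, (forall i, (i < j)%N -> hdot x (e i) = 0) ->
     vn2 (A *m x) <= a ^+ 2 * vn2 x) -> sval_mx j A <= a.
Proof.
move=> a0 he h.
pose P : 'M[C]_n := \sum_(i < j) e i *m adj (e i).
have hP x : P *m x = proj e j x.
  rewrite /P mulmx_suml; apply: eq_bigr => i _; rewrite -mulmxA.
  have -> : adj (e i) *m x = (hdot x (e i))%:M.
    apply/matrixP => k l; rewrite !ord1 !mxE eqxx mulr1n; apply: eq_bigr => s _.
    by rewrite mxE mulrC.
  by rewrite mul_mx_scalar.
have rP : (\rank (A *m P) <= j)%N.
  apply: leq_trans (mxrankM_maxr _ _) _.
  by apply: mxrank_sum_le => i; exact: mulmx_max_rank.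
apply: le_trans (_ : opnorm (A - A *m P) <= a).
  apply: ge_inf; first exact: (proj2 (sval_has_inf j A)).
  by exists (A *m P).
apply/opnorm_le => // x; rewrite mulmxBl -mulmxA hP -mulmxBr.
apply: le_trans (h _ _) _; first by move=> i ij; exact: hdot_res.
by rewrite ler_wpM2l ?sqr_ge0 // (vn2_split he x) lerDr vn2_ge0.
Qed.

(** A matrix of rank at most j kills some nonzero vector of the (j+1)-dimensional span of w. *)
Lemma sval_ge j A (w : nat -> 'cV[C]_n) b : 0 <= b ->
  (forall c : nat -> C, \sum_(i < j.+1) c i *: w i = 0 :> 'cV[C]_n -> forall i, (i <= j)%N -> c i = 0) ->
  (forall x, spanp w j.+1 x -> b ^+ 2 * vn2 x <= vn2 (A *m x)) -> b <= sval_mx j A.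
Proof.
move=> b0 hw h; apply: lb_le_inf; first exact: (proj1 (sval_has_inf j A)).
move=> _ [B /= rB <-].
pose W : 'M[C]_(n, j.+1) := \matrix_(k, i) w i k ord0.
have hW (c : 'cV[C]_j.+1) : W *m c = \sum_(i < j.+1) c i ord0 *: w i.
  apply/matrixP => k l; rewrite ord1 summxE !mxE; apply: eq_bigr => i _.
  by rewrite !mxE mulrC.
have : kermx ((B *m W)^T) != 0.
  rewrite -mxrank_eq0 mxrank_ker mxrank_tr subn_eq0 -ltnNge ltnS.
  exact: leq_trans (mxrankM_maxl _ _) rB.
move=> /rowV0Pn[r /sub_kermxP hr r0].
have hc : B *m (W *m r^T) = 0.
  by rewrite mulmxA -[B *m W]trmxK -trmx_mul hr trmx0.
set u := W *m r^T in hc.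
have u0 : u != 0.
  apply: contra_neq r0; rewrite /u hW => hu.
  have hu' : \sum_(i < j.+1) (fun i => r ord0 (inord i)) (val i) *: w i = 0.
    by rewrite -[RHS]hu; apply: eq_bigr => i _; rewrite /= inord_val mxE.
  apply/matrixP => k l; rewrite ord1 mxE -(inord_val l).
  exact: (hw (fun i => r ord0 (inord i)) hu' l (ltn_ord l)).
have su : spanp w j.+1 u.
  exists (fun i => r ord0 (inord i)).
  by rewrite /u hW; apply: eq_bigr => i _; rewrite inord_val mxE.
have := opnormP (A - B) u; rewrite mulmxBl hc subr0 => h2.
have := le_trans (h u su) h2; rewrite ler_pM2r ?vn2_gt0 //.
by rewrite ler_pXn2r // nnegrE opnorm_ge0.
Qed.

Section singular_vectors.
Variables (A : 'M[C]_(m, n)) (e : nat -> 'cV[C]_n) (t : nat -> R) (r : nat).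
Hypothesis he : porth e r.
Hypothesis e0 : forall i, (i < r)%N -> e i != 0.
Hypothesis t0 : forall i, (i < r)%N -> 0 <= t i.
Hypothesis ht : forall i, (i < r)%N -> adj A *m (A *m e i) = (t i ^+ 2)%:C%C *: e i.

Lemma vn2_mul_span x : spanp e r x ->
  vn2 (A *m x) = \sum_(i < r) t i ^+ 2 * cn2 (hdot x (e i)).
Proof.
move=> sx; apply: complexI; rewrite -hdotxx hdot_adj.
rewrite -{2}(span_proj he sx) /proj !mulmx_sumr hdot_sumr rmorph_sum /=.
apply: eq_bigr => i _; rewrite -!scalemxAr ht // scalerA hdotZr conjcM conjcR.
by apply: complex_ext; rewrite !ReImE /cn2; ring.
Qed.

Lemma vn2_mul_split x :
  vn2 (A *m x) = \sum_(i < r) t i ^+ 2 * cn2 (hdot x (e i))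
    + vn2 (A *m (x - proj e r x)).
Proof.
have {1}-> : x = proj e r x + (x - proj e r x) by rewrite addrC subrK.
rewrite mulmxDr vn2D_orth.
  rewrite vn2_mul_span; last exact: proj_span.
  by congr (_ + _); apply: eq_bigr => i _; rewrite hdot_proj.
rewrite hdotC hdot_adj /proj !mulmx_sumr hdot_sumr big1 ?conjc0 // => i _.
by rewrite -!scalemxAr ht // scalerA hdotZr hdot_res // mulr0.
Qed.

(** The bound M says that on the complement of the known singular vectors A does not exceed the
    known singular values; s_r is then the norm of A on that complement. *)
Lemma sval_leP a M : 0 <= a -> (forall i, (i < r)%N -> M <= t i) -> 0 <= M ->
  (forall x, (forall i, (i < r)%N -> hdot x (e i) = 0) -> vn2 (A *m x) <= M ^+ 2 * vn2 x) ->
  sval_mx r A <= a <->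
  forall x, (forall i, (i < r)%N -> hdot x (e i) = 0) -> vn2 (A *m x) <= a ^+ 2 * vn2 x.
Proof.
move=> a0 Mt M0 hM; split=> [h x hx|h]; last exact: sval_le h.
have [->|x0] := eqVneq x 0; first by rewrite mulmx0 !vn2_0 mulr0.
have xp := vn2_gt0 x0.
pose b := Num.sqrt (vn2 (A *m x) / vn2 x).
have b2 : b ^+ 2 = vn2 (A *m x) / vn2 x by rewrite sqr_sqrtr // divr_ge0 // vn2_ge0.
have b0 : 0 <= b by exact: sqrtr_ge0.
have bM : b ^+ 2 <= M ^+ 2 by rewrite b2 ler_pdivrMr // hM.
have prx : proj e r x = 0 by rewrite /proj big1 // => i _; rewrite hx // scale0r.
(* As b <= M <= t_i, A expands by at least b on the whole span of the e_i and x, which has dimension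
   r + 1. *)
suff : b <= sval_mx r A.
  move=> hb; rewrite -ler_pdivrMr // -b2 ler_pXn2r ?nnegrE //; exact: le_trans h.
pose w i := if i == r then x else e i.
have sumw (c : nat -> C) : \sum_(i < r.+1) c i *: w i = \sum_(i < r) c i *: e i + c r *: x.
  rewrite big_ord_recr /= {2}/w eqxx; congr (_ + _).
  by apply: eq_bigr => i _; rewrite /w ltn_eqF.
have dotw (c : nat -> C) i : (i < r)%N ->
    hdot (\sum_(i < r.+1) c i *: w i) (e i) = c i.
  move=> ir; rewrite sumw hdotD hdot_sum_porth // e0 // mulr1 hdotZ hx // mulr0.
  by rewrite addr0.
apply: (@sval_ge _ _ w) => //.
  move=> c hc i; rewrite leq_eqVlt => /orP[/eqP ->|ir]; last by rewrite -(dotw c) // hc hdot0.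
  have := hc; rewrite sumw big1 ?add0r => [/eqP|j _]; last by rewrite -(dotw c) // hc hdot0 scale0r.
  by rewrite scaler_eq0 (negbTE x0) orbF => /eqP.
move=> y [c hy]; have yE : y = \sum_(i < r) c i *: e i + c r *: x by rewrite hy sumw.
have py : proj e r y = \sum_(i < r) c i *: e i.
  by apply: eq_bigr => i _; rewrite hy dotw.
have ry : y - proj e r y = c r *: x by rewrite py {1}yE addrAC subrr add0r.
rewrite vn2_mul_split (vn2_split he y) vn2_proj // ry -scalemxAr !vn2Z mulrDr mulr_sumr.
apply: lerD.
  apply: ler_sum => i _; rewrite ler_wpM2r ?cn2_ge0 //; apply: le_trans bM _.
  by rewrite ler_pXn2r ?nnegrE ?t0 // Mt.
by rewrite b2 mulrCA ler_wpM2l ?cn2_ge0 // divfK // gt_eqF.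
Qed.

(** The upper bound comes from the complement of e_0, ..., e_(j-1), the lower bound from the span of
    e_0, ..., e_j. *)
Lemma sval_eq j M : (j < r)%N ->
  (forall i k, (i <= k)%N -> (k < r)%N -> t k <= t i) -> M <= t j -> 0 <= M ->
  (forall x, (forall i, (i < r)%N -> hdot x (e i) = 0) -> vn2 (A *m x) <= M ^+ 2 * vn2 x) ->
  sval_mx j A = t j.
Proof.
move=> jr tmono Mt M0 hM; have tj0 := t0 jr.
have sub k : (k <= r)%N -> porth e k.
  by move=> kr i l ik lk; apply: he; [exact: leq_trans kr|exact: leq_trans kr].
apply/eqP; rewrite eq_le; apply/andP; split.
  apply: (@sval_le _ _ e) => //; first exact: sub (ltnW jr).
  move=> x hx; rewrite vn2_mul_split (vn2_split he x) mulrDr vn2_proj // mulr_sumr.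
  apply: lerD.
    apply: ler_sum => i _; case: (ltnP i j) => ij; first by rewrite hx // cn2_0 !mulr0.
    by rewrite ler_wpM2r ?cn2_ge0 // ler_pXn2r ?nnegrE ?t0 // tmono.
  apply: le_trans (hM _ _) _; first by move=> i ir; exact: hdot_res.
  by rewrite ler_wpM2r ?vn2_ge0 // ler_pXn2r ?nnegrE.
apply: (@sval_ge _ _ e) => //.
  move=> c hc i ij; have ir : (i < r)%N by exact: leq_ltn_trans ij jr.
  have := hdot_sum_porth (sub _ jr) c ij; rewrite hc hdot0 e0 // mulr1 => /esym.
  exact.
move=> x sx; rewrite (vn2_mul_span (spanp_widen jr sx)) (vn2_span (sub _ jr) sx).
rewrite mulr_sumr [leRHS](bigID (fun i : 'I_r => (i < j.+1)%N)) /=.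
rewrite (big_ord_widen r (fun i => t j ^+ 2 * cn2 (hdot x (e i)))) //.
rewrite -[leLHS]addr0; apply: lerD.
  apply: ler_sum => i; rewrite ltnS => ij.
  by rewrite ler_wpM2r ?cn2_ge0 // ler_pXn2r ?nnegrE ?t0 // tmono.
by apply: sumr_ge0 => i _; rewrite mulr_ge0 ?sqr_ge0 ?cn2_ge0.
Qed.
End singular_vectors.
End opnorm.
End pointwise.

(** * Integration on the circle *)

Section real_integrals.
Variable R : realType.
Local Notation T := (circle R).
Local Notation mu := (@arc_measure R).
Implicit Types f g : T -> R.

Definition rI f := mu.-integrable [set: T] (EFin \o f).
Definition rint f : R := Rintegral mu [set: T] f.
Local Notation mfun f := (measurable_fun [set: T] f).

Lemma rI_meas f : rI f -> mfun f.
Proof. by move=> /measurable_int /measurable_EFinP. Qed.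

Lemma rI_dom_ae f g : mfun f -> rI g ->
  (\forall z \ae mu, `|f z| <= g z) -> rI f.
Proof.
move=> mf ig h; have mg := rI_meas ig; apply/integrableP; split.
  exact/measurable_EFinP.
case/integrableP : ig => _; apply: le_lt_trans.
apply: ae_ge0_le_integral => //=.
- by do 2 apply: measurableT_comp => //.
- by do 2 apply: measurableT_comp => //.
- by apply: filterS h => z hz _; rewrite lee_fin (le_trans hz) // ler_norm.
Qed.

Lemma rI_dom f g : mfun f -> rI g -> (forall z, `|f z| <= g z) -> rI f.
Proof. by move=> mf ig h; apply: rI_dom_ae ig _ => //; exact: aeW. Qed.

Lemma rI_cst (k : R) : rI (fun=> k).
Proof. exact: finite_measure_integrable_cst. Qed.

Lemma rID f g : rI f -> rI g -> rI (fun z => f z + g z).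
Proof. by move=> hf hg; exact: (integrableD measurableT hf hg). Qed.
Lemma rIZ (k : R) f : rI f -> rI (fun z => k * f z).
Proof. by move=> hf; exact: (integrableZl measurableT k hf). Qed.
Lemma rIN f : rI f -> rI (fun z => - f z).
Proof. by move=> /(rIZ (-1)); under eq_fun do rewrite mulN1r. Qed.
Lemma rIB f g : rI f -> rI g -> rI (fun z => f z - g z).
Proof. by move=> hf hg; apply: rID => //; exact: rIN. Qed.
Lemma rI_sum I (r : seq I) (P : pred I) (F : I -> T -> R) :
  (forall i, P i -> rI (F i)) -> rI (fun z => \sum_(i <- r | P i) F i z).
Proof.
move=> h; elim: r => [|i r IH].
  by under eq_fun do rewrite big_nil; exact: rI_cst.
under eq_fun do rewrite big_cons; case: (boolP (P i)) => // Pi; apply: rID => //; exact: h.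
Qed.

Lemma rint_ext f g : f =1 g -> rint f = rint g.
Proof. by move=> h; apply: eq_Rintegral => z _; exact: h. Qed.
Lemma rintD f g : rI f -> rI g -> rint (fun z => f z + g z) = rint f + rint g.
Proof. by move=> hf hg; exact: RintegralD. Qed.
Lemma rintZ k f : rI f -> rint (fun z => k * f z) = k * rint f.
Proof. by move=> hf; exact: RintegralZl. Qed.
Lemma rintN f : rI f -> rint (fun z => - f z) = - rint f.
Proof.
move=> hf; rewrite -mulN1r -rintZ //; apply: rint_ext => z; by rewrite mulN1r.
Qed.
Lemma rintB f g : rI f -> rI g -> rint (fun z => f z - g z) = rint f - rint g.
Proof. by move=> hf hg; exact: RintegralB. Qed.
Lemma rint0 : rint (fun=> 0) = 0.
Proof. by rewrite /rint Rintegral_cst // mul0r. Qed.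
Lemma rint_cst k : rint (fun=> k) = k.
Proof. rewrite /rint Rintegral_cst //; transitivity (k * fine 1%E); last by rewrite mulr1.
by congr (k * fine _); exact: probability_setT. Qed.
Lemma rint_sum I (r : seq I) (P : pred I) (F : I -> T -> R) :
  (forall i, P i -> rI (F i)) ->
  rint (fun z => \sum_(i <- r | P i) F i z) = \sum_(i <- r | P i) rint (F i).
Proof.
move=> h; elim: r => [|i r IH].
  by rewrite big_nil -[RHS]rint0; apply: rint_ext => z; rewrite big_nil.
rewrite big_cons; case: ifP => Pi; last first.
  by rewrite -IH; apply: rint_ext => z; rewrite big_cons Pi.
rewrite -IH -rintD; [|exact: h|exact: rI_sum].
by apply: rint_ext => z; rewrite big_cons Pi.
Qed.

Lemma rint_ae f g : rI f -> rI g -> (\forall z \ae mu, f z = g z) -> rint f = rint g.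
Proof.
move=> hf hg h; rewrite /rint /Rintegral; congr fine; apply: ae_eq_integral => //.
- by apply/measurable_EFinP; exact: rI_meas.
- by apply/measurable_EFinP; exact: rI_meas.
- by apply: filterS h => z /= ->.
Qed.

Lemma rintE f : rI f -> (\int[mu]_z (f z)%:E)%E = (rint f)%:E.
Proof. by move=> hf; rewrite /rint /Rintegral fineK //; exact: integrable_fin_num. Qed.

Lemma rint_ge0 f : rI f -> (\forall z \ae mu, 0 <= f z) -> 0 <= rint f.
Proof.
move=> hf h; rewrite (@rint_ae f (fun z => `|f z|)) //.
- exact: Rintegral_ge0.
- exact: integrable_norm.
- by apply: filterS h => z hz; rewrite ger0_norm.
Qed.

Lemma rint_le f g : rI f -> rI g -> (\forall z \ae mu, f z <= g z) -> rint f <= rint g.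
Proof.
move=> hf hg h; rewrite -subr_ge0 -rintB // rint_ge0 //; first exact: rIB.
by apply: filterS h => z; rewrite subr_ge0.
Qed.

Lemma rint_eq0 f : rI f -> (\forall z \ae mu, 0 <= f z) -> rint f = 0 ->
  \forall z \ae mu, f z = 0.
Proof.
move=> hf h f0.
have mf := rI_meas hf.
have : (\int[mu]_(z in [set: T]) `|(EFin \o f) z|)%E = 0%E.
  rewrite /=; transitivity (rint (fun z => `|f z|))%:E.
    by rewrite -rintE //; exact: integrable_norm.
  congr EFin; rewrite -f0; apply: rint_ae => //; first exact: integrable_norm.
  by apply: filterS h => z hz; rewrite ger0_norm.
move/ae_eq_integral_abs => /(_ measurableT); have mf' : measurable_fun [set: T] (EFin \o f).
  exact/measurable_EFinP.
by move=> /(_ mf'); apply: filterS => z /(_ Logic.I) [].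
Qed.

Lemma ae_ex (P : T -> Prop) : (\forall z \ae mu, P z) -> exists z, P z.
Proof.
move=> [A [mA A0 hA]]; apply: contrapT => h.
have : A = [set: T].
  by apply/seteqP; split=> // z _; apply: hA => Pz; apply: h; exists z.
move=> AT; move: A0; rewrite AT probability_setT => /eqP; by rewrite onee_eq0.
Qed.

Lemma ae_all (P : nat -> T -> Prop) :
  (forall n, \forall z \ae mu, P n z) -> \forall z \ae mu, forall n, P n z.
Proof. by move=> h; apply/ae_foralln. Qed.

Lemma ae_all_fin (I : finType) (P : I -> T -> Prop) :
  (forall i, \forall z \ae mu, P i z) -> \forall z \ae mu, forall i, P i z.
Proof. by move=> h; apply: filter_forall. Qed.

Lemma ae_all_count (I : countType) (P : I -> T -> Prop) :
  (forall i, \forall z \ae mu, P i z) -> \forall z \ae mu, forall i, P i z.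
Proof.
move=> h; have : \forall z \ae mu, forall n, if unpickle n is Some i then P i z else True.
  by apply: ae_all => n; case: unpickle => [i|]; [exact: h|exact: aeW].
by apply: filterS => z hz i; have := hz (pickle i); rewrite pickleK.
Qed.

(** Provides a measurable function, defined everywhere, for a limit that exists only almost
    everywhere. *)
Lemma measurable_fun_fine_limn_esup (u : nat -> T -> R) : (forall n, mfun (u n)) ->
  mfun (fun z => fine (limn_esup (fun n => (u n z)%:E))).
Proof.
move=> mu_; apply: (@measurableT_comp _ _ _ _ _ _ (@fine R)) => //.
apply: measurable_fun_limn_esup => n.
exact/measurable_EFinP.
Qed.

Lemma fatou_rint (u : nat -> T -> R) f (e : R) :
  (forall n, mfun (u n)) -> mfun f -> (forall n z, 0 <= u n z) -> (forall z, 0 <= f z) ->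
  (forall n, rI (u n)) -> (forall n, rint (u n) <= e) ->
  (\forall z \ae mu, (fun n => u n z) @ \oo --> f z) -> rI f /\ rint f <= e.
Proof.
move=> mu_ mf u0 f0 iu ue uf.
have key : (\int[mu]_z (f z)%:E <= e%:E)%E.
  apply: le_trans (_ : _ <= \int[mu]_z (limn_einf (fun n => (u n z)%:E)))%E _.
    have hE n : measurable_fun [set: T] (fun z => (u n z)%:E) by exact/measurable_EFinP.
    apply: ae_ge0_le_integral => //=.
    - by move=> z _; rewrite lee_fin.
    - exact/measurable_EFinP.
    - move=> z _; rewrite limn_einf_lim; apply: lime_ge; first exact: is_cvg_einfs.
      by apply: nearW => k; apply: le_ereal_inf_tmp => _ [l _ <-]; rewrite lee_fin.
    - rewrite (_ : (fun z => _) =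
        (fun z => - limn_esup (-%E \o (fun n => (u n z)%:E)))%E); last first.
        by apply/funext => z; rewrite limn_esupN oppeK.
      apply: measurableT_comp => //; apply: measurable_fun_limn_esup => n.
      exact: measurableT_comp.
    - apply: filterS uf => z hz _.
      have : (fun n => (u n z)%:E) @ \oo --> (f z)%:E by apply/fine_cvgP; split;
        [exact: nearW|exact: hz].
      by move=> /cvg_limn_einf_sup[-> _].
  apply: le_trans (fatou _ _ _ _) _ => //.
  - by move=> n; exact/measurable_EFinP.
  - by move=> n z _; rewrite lee_fin.
  rewrite limn_einf_lim; apply: lime_le; first exact: is_cvg_einfs.
  apply: nearW => n; apply: le_trans (_ : _ <= \int[mu]_z (u n z)%:E)%E _.
    by apply: ereal_inf_lbound; exists n => //=.
  by rewrite rintE // lee_fin.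
have If : rI f.
  apply/integrableP; split; first exact/measurable_EFinP.
  under eq_integral do rewrite /= ger0_norm //.
  by apply: le_lt_trans key _; rewrite ltry.
by split => //; rewrite -lee_fin -rintE.
Qed.

(** The series of the 4^n d_n^2 has finite integral, since 4^n 8^-n = 2^-n is summable. Where the
    sum S is finite, 4^n d_n^2 <= S for all n. *)
Lemma fast_cauchy_ae (d : nat -> T -> R) : (forall n, mfun (d n)) ->
  (forall n, rI (fun z => d n z ^+ 2)) ->
  (forall n, rint (fun z => d n z ^+ 2) <= (8^-1) ^+ n) ->
  \forall z \ae mu, exists S : R, 0 <= S /\ forall n, `|d n z| <= S * (2^-1) ^+ n.
Proof.
move=> md id hd.
pose w n z : \bar R := (4 ^+ n * d n z ^+ 2)%:E.
have w0 n z : (0 <= w n z)%E by rewrite lee_fin mulr_ge0 ?sqr_ge0 // exprn_ge0.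
have mw n : measurable_fun [set: T] (w n).
  by apply/measurable_EFinP; apply: measurable_funM => //; apply: measurable_funX.
pose S z : \bar R := (\sum_(0 <= n <oo) w n z)%E.
have mS : measurable_fun [set: T] S by apply: ge0_emeasurable_sum.
have S0 z : (0 <= S z)%E by apply: nneseries_ge0.
have IS : (\int[mu]_z S z < +oo)%E.
  rewrite integral_nneseries //.
  apply: le_lt_trans (_ : _ <= \sum_(0 <= n <oo) ((2^-1) ^+ n)%:E)%E _.
    apply: lee_nneseries => n _; first by move=> _; exact: integral_ge0.
    rewrite rintE; last exact: rIZ.
    rewrite rintZ // lee_fin.
    apply: le_trans (_ : 4 ^+ n * (8^-1) ^+ n <= _); first by rewrite ler_wpM2l // exprn_ge0.
    rewrite -exprMn; have -> : 4 * 8^-1 = 2^-1 :> R by lra.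
    by [].
  have : (fun n => (series (geometric 1 (2^-1)) n : R)) @ \oo --> (1 * (1 - 2^-1)^-1 : R).
    by apply: cvg_geometric_series; rewrite ger0_norm //; lra.
  move=> hcv; rewrite -[X in (X < _)%E](_ : (1 * (1 - 2^-1)^-1)%:E = _) ?ltry //.
  apply/esym/cvg_lim => //; apply/fine_cvgP; split.
    by apply: nearW => n; rewrite sumEFin.
  apply: cvg_trans hcv; apply: near_eq_cvg; apply: nearW => n /=.
  by rewrite sumEFin /=; apply: eq_bigr => k _; rewrite /geometric /= mul1r.
have : \forall z \ae mu, [set: T] z -> S z \is a fin_num.
  apply: integrable_ae => //; apply/integrableP; split => //.
  by under eq_integral do rewrite gee0_abs //.
apply: filterS => z /(_ Logic.I) Sfin.
exists (Num.sqrt (fine (S z))); split; first exact: sqrtr_ge0.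
move=> n.
have h : 4 ^+ n * d n z ^+ 2 <= fine (S z).
  rewrite -lee_fin fineK //.
  apply: le_trans (_ : (\sum_(0 <= k < n.+1) w k z <= _)%E).
    by rewrite big_nat_recr //= leeDr // sume_ge0.
  exact: nneseries_lim_ge.
rewrite -sqrtr_sqr.
have -> : d n z ^+ 2 = (4 ^+ n * d n z ^+ 2) * ((2^-1) ^+ n) ^+ 2.
  rewrite -exprM mulnC exprM mulrAC -exprMn.
  have -> : 4 * 2^-1 ^+ 2 = 1 :> R by rewrite expr2; lra.
  by rewrite expr1n mul1r.
rewrite sqrtrM; last by rewrite mulr_ge0 ?sqr_ge0 // exprn_ge0.
rewrite sqrtr_sqr ger0_norm; last by rewrite exprn_ge0.
by rewrite ler_wpM2r ?exprn_ge0 // ler_wsqrtr.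
Qed.

Lemma geometric_cauchy_cvg (u : nat -> R) (S : R) : 0 <= S ->
  (forall n, `|u n.+1 - u n| <= S * (2^-1) ^+ n) -> cvg (u @ \oo).
Proof.
move=> S0 h.
have step n p : `|u (n + p)%N - u n| <= S * 2 * (2^-1) ^+ n * (1 - (2^-1) ^+ p).
  elim: p => [|p IH]; first by rewrite addn0 subrr normr0 expr0 subrr mulr0.
  have -> : u (n + p.+1)%N - u n = (u (n + p).+1 - u (n + p)%N) + (u (n + p)%N - u n).
    by rewrite addnS addrA subrK.
  apply: le_trans (ler_normD _ _) _; apply: le_trans (lerD (h _) IH) _.
  rewrite exprD exprS; move: (2^-1 ^+ n) (2^-1 ^+ p) => a b.
  rewrite le_eqVlt; apply/orP; left; apply/eqP; lra.
have p0 n : 0 <= (2^-1 : R) ^+ n by rewrite exprn_ge0.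
have p1 n : (2^-1 : R) ^+ n <= n.+1%:R^-1.
  elim: n => [|n IH]; first by rewrite expr0 invr1.
  rewrite exprS; apply: le_trans (ler_wpM2l _ IH) _; first by [].
  rewrite -invfM lef_pV2 ?posrE ?mulr_gt0 // -natrM ler_nat; lia.
have [|l hl] := @real_cauchy_cvg R u.
  move=> e e0.
  have e8 : 0 < e / (4 * S + 1) by apply: divr_gt0 => //; lra.
  have [N hN] := natSinv_lt e8; exists N.
  have hs n : (N <= n)%N -> `|u n - u N| < e / 2.
    move=> hn; rewrite -(subnKC hn); apply: le_lt_trans (step _ _) _.
    have := hN N (leqnn N); rewrite ltr_pdivlMr; last lra.
    have := p1 N; have := p0 N; have := p0 (n - N)%N.
    move: (2^-1 ^+ N) (2^-1 ^+ (n - N)) (N.+1%:R^-1) => a b c b0 a0 ac ce.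
    have : S * 2 * a * b >= 0 by rewrite !mulr_ge0.
    have : S * a <= S * c by rewrite ler_wpM2l.
    lra.
  move=> m n hm hn.
  have -> : u m - u n = (u m - u N) - (u n - u N) by rewrite opprB addrA subrK.
  apply: le_lt_trans (ler_normB _ _) _; have := hs _ hm; have := hs _ hn; lra.
apply/cvg_ex; exists l; apply/cvgrPdist_lt => e e0.
by have [N hN] := hl e e0; exists N => // n /= hn; rewrite distrC; exact: hN.
Qed.

(** A subsequence with rapidly decreasing increments converges almost everywhere; Fatou's lemma
    applied along it turns the Cauchy condition into convergence of the whole sequence. *)
Lemma real_L2_complete (u : nat -> T -> R) : (forall n, mfun (u n)) ->
  (forall n, rI (fun z => u n z ^+ 2)) ->
  (forall e, 0 < e -> exists N, forall m n, (N <= m)%N -> (N <= n)%N ->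
     rint (fun z => (u m z - u n z) ^+ 2) < e) ->
  exists g, [/\ mfun g, rI (fun z => g z ^+ 2) &
  forall e, 0 < e -> exists N, forall n, (N <= n)%N -> rint (fun z => (u n z - g z) ^+ 2) <= e].
Proof.
move=> mu_ iu uC.
have sqB f g : mfun f -> mfun g -> rI (fun z => f z ^+ 2) -> rI (fun z => g z ^+ 2) ->
    rI (fun z => (f z - g z) ^+ 2).
  move=> mf mg hf hg.
  apply: (@rI_dom _ (fun z => 2 * f z ^+ 2 + 2 * g z ^+ 2)).
  - by apply: measurable_funX; exact: measurable_funB.
  - by apply: rID; exact: rIZ.
  - by move=> z; rewrite ger0_norm ?sqr_ge0 //; have := sqr_ge0 (f z + g z); nra.
have hch k : exists N, forall m n, (N <= m)%N -> (N <= n)%N ->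
   rint (fun z => (u m z - u n z) ^+ 2) < (8^-1) ^+ k.
  by apply: uC; rewrite exprn_gt0.
have [ph hph] := choice hch.
pose phi := fix phi k := if k is k'.+1 then maxn (ph k) (phi k').+1 else ph 0%N.
have phi_ge k : (ph k <= phi k)%N by case: k => //= k; exact: leq_maxl.
have phi_mono k : (phi k < phi k.+1)%N by exact: leq_maxr.
have phi_id k : (k <= phi k)%N by elim: k => // k IH; exact: leq_ltn_trans IH (phi_mono k).
have fast : \forall z \ae mu, exists S : R, 0 <= S /\
    forall n, `|u (phi n.+1) z - u (phi n) z| <= S * (2^-1) ^+ n.
  apply: (@fast_cauchy_ae (fun n z => u (phi n.+1) z - u (phi n) z)).
  - by move=> n; exact: measurable_funB.
  - by move=> n; exact: sqB.
  - move=> n; apply: ltW; apply: hph; last exact: phi_ge.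
    exact: leq_trans (phi_ge n) (ltnW (phi_mono n)).
pose g z := fine (limn_esup (fun n => (u (phi n) z)%:E)).
have mg : mfun g by apply: (@measurable_fun_fine_limn_esup (fun n => u (phi n))).
have ug : \forall z \ae mu, (fun n => u (phi n) z) @ \oo --> g z.
  apply: filterS fast => z [S [S0 hS]].
  have /cvg_ex[l hl] := @geometric_cauchy_cvg (fun n => u (phi n) z) S S0 hS.
  have : (fun n => (u (phi n) z)%:E) @ \oo --> l%:E.
    by apply/fine_cvgP; split; [exact: nearW|exact: hl].
  by move=> /cvg_limn_einf_sup[_ h]; rewrite /g h.
have key e : 0 < e -> exists N, forall m, (N <= m)%N ->
    rI (fun z => (u m z - g z) ^+ 2) /\ rint (fun z => (u m z - g z) ^+ 2) <= e.
  move=> e0; have [N hN] := uC e e0; exists N => m hm.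
  apply: (@fatou_rint (fun n z => (u m z - u (phi (n + N)%N) z) ^+ 2)).
  - by move=> n; apply: measurable_funX; exact: measurable_funB.
  - by apply: measurable_funX; exact: measurable_funB.
  - by move=> n z; exact: sqr_ge0.
  - by move=> z; exact: sqr_ge0.
  - by move=> n; exact: sqB.
  - move=> n; apply: ltW; apply: hN => //.
    by apply: leq_trans (phi_id _); exact: leq_addl.
  - apply: filterS ug => z hz.
    have hc : (fun n => u m z - u (phi (n + N)%N) z) @ \oo --> u m z - g z.
      apply: cvgB; first exact: cvg_cst.
      by rewrite (cvg_shiftn N (fun n => u (phi n) z)).
    by under eq_fun do rewrite expr2; rewrite expr2; exact: (cvgM hc hc).
have [N0 /(_ N0 (leqnn _)) [i0 _]] := key 1 ltr01.
exists g; split => //.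
  have -> : (fun z => g z ^+ 2) = (fun z => (u N0 z - (u N0 z - g z)) ^+ 2).
    by apply/funext => z; congr (_ ^+ 2); ring.
  by apply: sqB => //; exact: measurable_funB.
by move=> e e0; have [N hN] := key e e0; exists N => n hn; have [] := hN n hn.
Qed.
End real_integrals.

(** * Complex, matrix and vector valued functions; the space L^2 *)

Section vector_functions.
Variable R : realType.
Local Notation C := R[i].
Local Notation T := (circle R).
Local Notation mu := (@arc_measure R).
Local Notation Re := (@complex.Re R).
Local Notation Im := (@complex.Im R).
Local Notation mfun f := (measurable_fun [set: T] f).
Section scalars.
Implicit Types f g : T -> C.

Lemma cm_cst (c : C) : cmeasurable (fun _ : T => c).
Proof. by split; exact: measurable_cst. Qed.
Lemma cmD f g : cmeasurable f -> cmeasurable g -> cmeasurable (fun z => f z + g z).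
Proof.
move=> [h1 h2] [h3 h4]; split.
  by under eq_fun do rewrite ReD; exact: measurable_funD.
by under eq_fun do rewrite ImD; exact: measurable_funD.
Qed.
Lemma cmN f : cmeasurable f -> cmeasurable (fun z => - f z).
Proof.
move=> [h1 h2]; split.
  by under eq_fun do rewrite ReN; exact: measurable_funN.
by under eq_fun do rewrite ImN; exact: measurable_funN.
Qed.
Lemma cmB f g : cmeasurable f -> cmeasurable g -> cmeasurable (fun z => f z - g z).
Proof. by move=> hf hg; apply: cmD => //; exact: cmN. Qed.
Lemma cmM f g : cmeasurable f -> cmeasurable g -> cmeasurable (fun z => f z * g z).
Proof.
move=> [h1 h2] [h3 h4]; split.
  by under eq_fun do rewrite ReM; apply: measurable_funB; exact: measurable_funM.
by under eq_fun do rewrite ImM; apply: measurable_funD; exact: measurable_funM.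
Qed.
Lemma cmJ f : cmeasurable f -> cmeasurable (fun z => conjc (f z)).
Proof.
move=> [h1 h2]; split.
  by under eq_fun do rewrite ReJ.
by under eq_fun do rewrite ImJ; exact: measurable_funN.
Qed.
Lemma cmR (f : T -> R) : mfun f -> cmeasurable (fun z => (f z)%:C%C).
Proof. by move=> h; split => //=; exact: measurable_cst. Qed.
Lemma cm_sum I (r : seq I) (P : pred I) (F : I -> T -> C) :
  (forall i, P i -> cmeasurable (F i)) -> cmeasurable (fun z => \sum_(i <- r | P i) F i z).
Proof.
move=> h; elim: r => [|i r IH].
  by under eq_fun do rewrite big_nil; exact: cm_cst.
under eq_fun do rewrite big_cons; case: (boolP (P i)) => // Pi; apply: cmD => //; exact: h.
Qed.
Lemma m_cn2 f : cmeasurable f -> mfun (fun z => cn2 (f z)).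
Proof. by move=> [h1 h2]; apply: measurable_funD; exact: measurable_funX. Qed.

Definition cI f := rI (fun z => Re (f z)) /\ rI (fun z => Im (f z)).

Lemma cI_meas f : cI f -> cmeasurable f.
Proof. by move=> [h1 h2]; split; exact: rI_meas. Qed.

Lemma sqr_le_abs (x y : R) : 0 <= y -> x ^+ 2 <= y ^+ 2 -> `|x| <= y.
Proof. by move=> y0; rewrite -(real_normK (num_real x)) ler_pXn2r // nnegrE. Qed.

Lemma cI_dom_ae f (g : T -> R) : cmeasurable f -> rI g ->
  (\forall z \ae mu, 0 <= g z /\ cn2 (f z) <= g z ^+ 2) -> cI f.
Proof.
move=> [h1 h2] ig h; split; apply: rI_dom_ae ig _ => //; apply: filterS h => z [g0 hz].
  by apply: sqr_le_abs => //; apply: le_trans hz; exact: sqr_Re_le.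
by apply: sqr_le_abs => //; apply: le_trans hz; exact: sqr_Im_le.
Qed.

Lemma cI_dom f (g : T -> R) : cmeasurable f -> rI g ->
  (forall z, 0 <= g z /\ cn2 (f z) <= g z ^+ 2) -> cI f.
Proof. by move=> hf hg h; apply: cI_dom_ae hg _ => //; exact: aeW. Qed.

Lemma cID f g : cI f -> cI g -> cI (fun z => f z + g z).
Proof.
move=> [h1 h2] [h3 h4]; split.
  by under eq_fun do rewrite ReD; exact: rID.
by under eq_fun do rewrite ImD; exact: rID.
Qed.
Lemma cIZ (c : C) f : cI f -> cI (fun z => c * f z).
Proof.
move=> [h1 h2]; split.
  by under eq_fun do rewrite ReM; apply: rIB; exact: rIZ.
by under eq_fun do rewrite ImM; apply: rID; exact: rIZ.
Qed.
Lemma cIJ f : cI f -> cI (fun z => conjc (f z)).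
Proof.
move=> [h1 h2]; split; first by under eq_fun do rewrite ReJ.
by under eq_fun do rewrite ImJ; exact: rIN.
Qed.
Lemma cintE f : cintegral f = Complex (rint (fun z => Re (f z))) (rint (fun z => Im (f z))).
Proof. by []. Qed.
Lemma cintD f g : cI f -> cI g ->
  cintegral (fun z => f z + g z) = cintegral f + cintegral g.
Proof.
move=> [h1 h2] [h3 h4]; apply: complex_ext; rewrite !ReImE /= -rintD //.
  by apply: rint_ext => z; rewrite ReD.
by apply: rint_ext => z; rewrite ImD.
Qed.
Lemma cintZ (c : C) f : cI f -> cintegral (fun z => c * f z) = c * cintegral f.
Proof.
move=> [h1 h2]; apply: complex_ext; rewrite !ReImE /= -!rintZ //.
  rewrite -rintB; [|exact: rIZ|exact: rIZ].
  by apply: rint_ext => z; rewrite ReM.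
rewrite -rintD; [|exact: rIZ|exact: rIZ].
by apply: rint_ext => z; rewrite ImM.
Qed.
Lemma cintJ f : cI f -> cintegral (fun z => conjc (f z)) = conjc (cintegral f).
Proof.
move=> [h1 h2]; apply: complex_ext; rewrite !ReImE /=.
  by apply: rint_ext => z; rewrite ReJ.
by rewrite -rintN //; apply: rint_ext => z; rewrite ImJ.
Qed.
Lemma cint_ext f g : f =1 g -> cintegral f = cintegral g.
Proof. by move=> /funext ->. Qed.
Lemma cint_ae f g : cI f -> cI g -> (\forall z \ae mu, f z = g z) ->
  cintegral f = cintegral g.
Proof.
move=> [h1 h2] [h3 h4] h; rewrite !cintE; congr Complex.
  by apply: rint_ae => //; apply: filterS h => z ->.
by apply: rint_ae => //; apply: filterS h => z ->.
Qed.
Lemma cint_sum I (r : seq I) (P : pred I) (F : I -> T -> C) :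
  (forall i, P i -> cI (F i)) ->
  cintegral (fun z => \sum_(i <- r | P i) F i z) = \sum_(i <- r | P i) cintegral (F i).
Proof.
move=> h; apply: complex_ext; rewrite ?Re_sum ?Im_sum /= -rint_sum.
- by apply: rint_ext => z; rewrite Re_sum.
- by move=> i /h[].
- by apply: rint_ext => z; rewrite Im_sum.
- by move=> i /h[].
Qed.

End scalars.

Section matrices.
Variables m n : nat.
Implicit Types (F G : T -> 'M[C]_(m, n)).
Lemma mm_cst (A : 'M[C]_(m, n)) : mx_measurable (fun _ : T => A).
Proof. by move=> i j; exact: cm_cst. Qed.
Lemma mmD F G : mx_measurable F -> mx_measurable G -> mx_measurable (fun z => F z + G z).
Proof. by move=> hF hG i j; under eq_fun do rewrite mxE; exact: cmD. Qed.
Lemma mmN F : mx_measurable F -> mx_measurable (fun z => - F z).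
Proof. by move=> hF i j; under eq_fun do rewrite mxE; exact: cmN. Qed.
Lemma mmB F G : mx_measurable F -> mx_measurable G -> mx_measurable (fun z => F z - G z).
Proof. by move=> hF hG; apply: mmD => //; exact: mmN. Qed.
Lemma mmZ (c : T -> C) F : cmeasurable c -> mx_measurable F ->
  mx_measurable (fun z => c z *: F z).
Proof. by move=> hc hF i j; under eq_fun do rewrite mxE; exact: cmM. Qed.
Lemma mm_sum I (r : seq I) (P : pred I) (F : I -> T -> 'M[C]_(m, n)) :
  (forall i, P i -> mx_measurable (F i)) ->
  mx_measurable (fun z => \sum_(i <- r | P i) F i z).
Proof.
move=> h i j; under eq_fun do rewrite summxE; apply: cm_sum => k Pk; exact: h.
Qed.
Lemma mm_adj F : mx_measurable F -> mx_measurable (fun z => adj (F z)).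
Proof. by move=> hF i j; under eq_fun do rewrite mxE; apply: cmJ; exact: hF. Qed.
End matrices.

Lemma mm_mulmx m n p (F : T -> 'M[C]_(m, n)) (G : T -> 'M[C]_(n, p)) :
  mx_measurable F -> mx_measurable G -> mx_measurable (fun z => F z *m G z).
Proof.
move=> hF hG i j; under eq_fun do rewrite mxE; apply: cm_sum => k _; exact: cmM.
Qed.

Section vectors.
Variable k : nat.
Implicit Types (f g : T -> 'cV[C]_k).

Lemma cm_hdot f g : mx_measurable f -> mx_measurable g ->
  cmeasurable (fun z => hdot (f z) (g z)).
Proof. by move=> hf hg; apply: cm_sum => i _; apply: cmM => //; exact: cmJ. Qed.

Lemma m_vn2 f : mx_measurable f -> mfun (fun z => vn2 (f z)).
Proof.
move=> hf; rewrite /vn2; apply: measurable_sum => i; exact: m_cn2.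
Qed.

Lemma Lnorm2E f : mx_measurable f ->
  L2norm f = ((\int[mu]_z (vn2 (f z))%:E) `^ 2^-1)%E.
Proof.
move=> hf; rewrite /L2norm unlock; congr (_ `^ _)%E; apply: eq_integral => z _ /=.
rewrite ger0_norm ?vnorm_ge0 // powR_mulrn ?vnorm_ge0 // ?sqr_vnorm //.
Qed.

Lemma L2P f : L2 f <-> mx_measurable f /\ rI (fun z => vn2 (f z)).
Proof.
have E g : mx_measurable g -> rI (fun z => vn2 (g z)) <->
    (\int[mu]_z (vn2 (g z))%:E < +oo)%E.
  move=> hg; split=> [h|h]; first by rewrite rintE // ltry.
  apply/integrableP; split; first by apply/measurable_EFinP; exact: m_vn2.
  by under eq_integral do rewrite /= ger0_norm ?vn2_ge0 //.
split=> -[mf hf]; split=> //; last first.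
  by rewrite Lnorm2E // poweR_lty //; apply/(E _ mf).
apply/(E _ mf).
have h : (0%R <= \int[mu]_z (vn2 (f z))%:E)%E.
  by apply: integral_ge0 => z _; rewrite lee_fin vn2_ge0.
move: hf; rewrite Lnorm2E //.
move: h; case: (\int[mu]_z (vn2 (f z))%:E)%E => [r|//|//] _; first by move=> _; rewrite ltry.
by rewrite poweRE invr_eq0 pnatr_eq0 /=.
Qed.

Lemma L2_meas f : L2 f -> mx_measurable f. Proof. by case. Qed.
Lemma L2_rI f : L2 f -> rI (fun z => vn2 (f z)). Proof. by move=> /L2P[]. Qed.

Lemma L2normE f : L2 f -> L2norm f = (Num.sqrt (rint (fun z => vn2 (f z))))%:E.
Proof.
move=> /L2P[mf hf]; rewrite Lnorm2E // rintE // poweR_EFin powR12_sqrt //.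
by apply: rint_ge0 => //; apply: aeW => z; exact: vn2_ge0.
Qed.

Lemma L2_sub : linsub (@L2 R k).
Proof.
split.
  apply/L2P; split; first exact: mm_cst.
  by under eq_fun do rewrite vn2_0; exact: rI_cst.
move=> a f g /L2P[mf hf] /L2P[mg hg]; apply/L2P.
have mh : mx_measurable (a *: f + g : T -> 'cV[C]_k).
  by apply: mmD => //; apply: mmZ => //; exact: cm_cst.
split => //.
apply: (@rI_dom _ _ (fun z => 2 * (cn2 a * vn2 (f z)) + 2 * vn2 (g z))).
- exact: m_vn2.
- by apply: rID; apply: rIZ => //; exact: rIZ.
- move=> z; rewrite ger0_norm ?vn2_ge0 // -vn2Z; exact: vn2D_le.
Qed.

Lemma hdot_bound (x y : 'cV[C]_k) : cn2 (hdot x y) <= (vn2 x + vn2 y) ^+ 2.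
Proof.
apply: le_trans (hdot_cs _ _) _; have := vn2_ge0 x; have := vn2_ge0 y; nra.
Qed.

Lemma cI_hdot f g : L2 f -> L2 g -> cI (fun z => hdot (f z) (g z)).
Proof.
move=> /L2P[mf hf] /L2P[mg hg].
apply: (@cI_dom _ (fun z => vn2 (f z) + vn2 (g z))).
- exact: cm_hdot.
- exact: rID.
- by move=> z; rewrite hdot_bound addr_ge0 ?vn2_ge0.
Qed.

Lemma L2dotE f g : L2dot f g = cintegral (fun z => hdot (f z) (g z)).
Proof. by []. Qed.

Lemma L2_hform : hform (@L2 R k) (@L2dot R k).
Proof.
split; first exact: L2_sub.
- move=> a f g h Lf Lg Lh; rewrite !L2dotE.
  rewrite (@cint_ext _ (fun z => a * hdot (f z) (h z) + hdot (g z) (h z))); last first.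
    by move=> z; rewrite -hdotZ -hdotD.
  rewrite cintD ?cintZ //; try exact: cI_hdot.
  by apply: cIZ; exact: cI_hdot.
- move=> f g Lf Lg; rewrite !L2dotE -cintJ; last exact: cI_hdot.
  by apply: cint_ext => z; rewrite hdotC.
- move=> f Lf /=; apply: rint_ge0; first by have [] := cI_hdot Lf Lf.
  by apply: aeW => z; rewrite -/(hdot _ _) hdotxx vn2_ge0.
Qed.

Lemma qfL2 f : qf (@L2dot R k) f = rint (fun z => vn2 (f z)).
Proof. by apply: rint_ext => z; rewrite -/(hdot _ _) hdotxx. Qed.

Lemma L2norm_qf f : L2 f -> L2norm f = (Num.sqrt (qf (@L2dot R k) f))%:E.
Proof. by move=> Lf; rewrite L2normE // qfL2. Qed.

Lemma L2dot_ae f f' g g' : L2 f -> L2 f' -> L2 g -> L2 g' ->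
  (\forall z \ae mu, f z = f' z) -> (\forall z \ae mu, g z = g' z) ->
  L2dot f g = L2dot f' g'.
Proof.
move=> ? ? ? ? h1 h2; apply: cint_ae; try exact: cI_hdot.
by move: h1 h2; apply: filterS2 => z -> ->.
Qed.

Lemma qf_eq0_ae f : L2 f -> qf (@L2dot R k) f = 0 <-> \forall z \ae mu, f z = 0.
Proof.
move=> Lf; split=> [|h].
  rewrite qfL2 => /(rint_eq0 (L2_rI Lf)) h.
  have : \forall z \ae mu, vn2 (f z) = 0 by apply: h; apply: aeW => z; exact: vn2_ge0.
  by apply: filterS => z; exact: vn2_eq0.
rewrite qfL2 -[RHS](@rint0 R); apply: rint_ae; first exact: L2_rI.
  exact: rI_cst.
by apply: filterS h => z ->; rewrite vn2_0.
Qed.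

Lemma L2_ae_of_qf f g : L2 f -> L2 g -> qf (@L2dot R k) (f - g) = 0 ->
  \forall z \ae mu, f z = g z.
Proof.
move=> Lf Lg /qf_eq0_ae h; have := h (subB L2_sub Lf Lg).
by apply: filterS => z /eqP; rewrite subr_eq0 => /eqP.
Qed.

Lemma L2P_comp f : L2 f <-> mx_measurable f /\
  forall i, rI (fun z => Re (f z i ord0) ^+ 2) /\ rI (fun z => Im (f z i ord0) ^+ 2).
Proof.
split=> [/L2P[mf hf]|[mf hf]].
  split => // i; have [m1 m2] := mf i ord0.
  have le z : cn2 (f z i ord0) <= vn2 (f z).
    by rewrite /vn2 (bigD1 i) //= lerDl sumr_ge0 // => j _; exact: cn2_ge0.
  split; apply: (rI_dom _ hf); try exact: measurable_funX.
    by move=> z; rewrite ger0_norm ?sqr_ge0 //; exact: le_trans (sqr_Re_le _) (le z).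
  by move=> z; rewrite ger0_norm ?sqr_ge0 //; exact: le_trans (sqr_Im_le _) (le z).
apply/L2P; split => //; apply: rI_sum => i _; have [h1 h2] := hf i; exact: rID.
Qed.

Lemma L2_complete : qcomplete (@L2 R k) (@L2dot R k).
Proof.
move=> u Lu uC.
have hd m n i : rint (fun z => (Re (u m z i ord0) - Re (u n z i ord0)) ^+ 2) <=
    qf (@L2dot R k) (u m - u n) /\
    rint (fun z => (Im (u m z i ord0) - Im (u n z i ord0)) ^+ 2) <=
    qf (@L2dot R k) (u m - u n).
  have Ld := subB L2_sub (Lu m) (Lu n).
  have /L2P_comp[md /(_ i)[d1 d2]] := Ld.
  have le z : cn2 ((u m - u n) z i ord0) <= vn2 ((u m - u n) z).
    by rewrite /vn2 (bigD1 i) //= lerDl sumr_ge0 // => j _; exact: cn2_ge0.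
  have E z : Re ((u m - u n) z i ord0) = Re (u m z i ord0) - Re (u n z i ord0).
    by rewrite /= !mxE ReB.
  have E' z : Im ((u m - u n) z i ord0) = Im (u m z i ord0) - Im (u n z i ord0).
    by rewrite /= !mxE ImB.
  rewrite qfL2; split.
    rewrite (_ : (fun z => _) = fun z => Re ((u m - u n) z i ord0) ^+ 2); last first.
      by apply/funext => z; rewrite E.
    apply: rint_le => //; first exact: L2_rI.
    by apply: aeW => z; exact: le_trans (sqr_Re_le _) (le z).
  rewrite (_ : (fun z => _) = fun z => Im ((u m - u n) z i ord0) ^+ 2); last first.
    by apply/funext => z; rewrite E'.
  apply: rint_le => //; first exact: L2_rI.
  by apply: aeW => z; exact: le_trans (sqr_Im_le _) (le z).
have compl i : exists g : (T -> R) * (T -> R),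
   [/\ mfun g.1, mfun g.2, rI (fun z => g.1 z ^+ 2), rI (fun z => g.2 z ^+ 2) &
   forall e, 0 < e -> exists N, forall n, (N <= n)%N ->
     rint (fun z => (Re (u n z i ord0) - g.1 z) ^+ 2) <= e /\
     rint (fun z => (Im (u n z i ord0) - g.2 z) ^+ 2) <= e].
  have hc n := (L2P_comp (u n)).1 (Lu n).
  have [|||g1 [mg1 ig1 hg1]] := @real_L2_complete R (fun n z => Re (u n z i ord0)).
  - by move=> n; have [/(_ i ord0)[]] := hc n.
  - by move=> n; have [_ /(_ i)[]] := hc n.
  - move=> e e0; have [N hN] := uC _ e0; exists N => m n hm hn.
    by apply: le_lt_trans (hd m n i).1 (hN _ _ hm hn).
  have [|||g2 [mg2 ig2 hg2]] := @real_L2_complete R (fun n z => Im (u n z i ord0)).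
  - by move=> n; have [/(_ i ord0)[]] := hc n.
  - by move=> n; have [_ /(_ i)[]] := hc n.
  - move=> e e0; have [N hN] := uC _ e0; exists N => m n hm hn.
    by apply: le_lt_trans (hd m n i).2 (hN _ _ hm hn).
  exists (g1, g2); split => // e e0.
  have [N1 h1] := hg1 _ e0; have [N2 h2] := hg2 _ e0.
  by exists (maxn N1 N2) => n; rewrite geq_max => /andP[/h1 ? /h2 ?].
have [g hg] := choice compl.
pose G : T -> 'cV[C]_k := fun z => \col_i Complex ((g i).1 z) ((g i).2 z).
have LG : L2 G.
  apply/L2P_comp; split.
    move=> i j; have [m1 m2 _ _ _] := hg i.
    by split; under eq_fun do rewrite mxE /=.
  by move=> i; have [_ _ i1 i2 _] := hg i; split; under eq_fun do rewrite mxE /=.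
exists G => // e e0.
(* There are 2k terms of size at most e'; k + 1 in place of k makes the final inequality strict and
   covers k = 0. *)
pose e' := e / (2 * k.+1)%:R.
have e'0 : 0 < e' by rewrite divr_gt0.
have /choice[N hN] : forall i, exists N, forall n, (N <= n)%N ->
     rint (fun z => (Re (u n z i ord0) - (g i).1 z) ^+ 2) <= e' /\
     rint (fun z => (Im (u n z i ord0) - (g i).2 z) ^+ 2) <= e'.
  by move=> i; have [_ _ _ _ /(_ _ e'0)] := hg i.
exists (\max_i N i) => n hn.
have Ld := subB L2_sub (Lu n) LG.
have /L2P_comp[_ hd2] := Ld.
rewrite qfL2 /vn2 rint_sum; last by move=> i _; have [? ?] := hd2 i; exact: rID.
apply: le_lt_trans (_ : \sum_(i < k) (e' + e') < e).
  apply: ler_sum => i _; have [i1 i2] := hd2 i; rewrite rintD //.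
  have [|h1 h2] := hN i n; first by apply: leq_trans hn; exact: leq_bigmax.
  apply: lerD.
    by rewrite (_ : (fun z => _) = fun z => (Re (u n z i ord0) - (g i).1 z) ^+ 2) //;
      apply/funext => z; rewrite /= !mxE ReB.
  by rewrite (_ : (fun z => _) = fun z => (Im (u n z i ord0) - (g i).2 z) ^+ 2) //;
      apply/funext => z; rewrite /= !mxE ImB.
rewrite sumr_const card_ord -mulr2n -mulrnA -mulr_natr /e' mulrAC ltr_pdivrMr //.
rewrite ltr_pM2l // ltr_nat; lia.
Qed.
End vectors.
End vector_functions.

(** * Polynomials approximating a step function *)

Section step_polynomials.
Variable R : realType.

Lemma bernoulli_ineq (d : R) n : -1 <= d -> 1 + n%:R * d <= (1 + d) ^+ n.
Proof.
move=> d0; elim: n => [|n IH]; first by rewrite mul0r addr0 expr0.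
rewrite exprS -natr1; apply: le_trans (_ : (1 + d) * (1 + n%:R * d) <= _).
  by have : 0 <= n%:R * d ^+ 2 by [rewrite mulr_ge0 ?sqr_ge0|]; lra.
by rewrite ler_wpM2l //; lra.
Qed.

(** Write q = s^2: Bernoulli's inequality bounds n s^n by 1 / (1 - s), and a factor s^n is left to
    tend to 0. *)
Lemma cvg_natr_geometric (q : R) : 0 <= q < 1 -> (fun n => n%:R * q ^+ n) @ \oo --> (0 : R).
Proof.
move=> /andP[q0 q1].
pose s := Num.sqrt q.
have s0 : 0 <= s by exact: sqrtr_ge0.
have sq : s ^+ 2 = q by rewrite sqr_sqrtr.
have s1 : s < 1 by rewrite -(ltr_pXn2r (ltn0Sn 1)) ?nnegrE // sq expr1n.
have bnd n : n%:R * s ^+ n <= (1 - s)^-1.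
  have h := @bernoulli_ineq (s^-1 - 1) n.
  have [s00|sn0] := eqVneq s 0.
    rewrite s00 subr0 invr1; case: n {h} => [|n]; first by rewrite mul0r.
    by rewrite expr0n mulr0.
  have sp : 0 < s by rewrite lt_neqAle eq_sym sn0.
  have sn : 0 < s ^+ n by rewrite exprn_gt0.
  have si : 1 < s^-1 by rewrite invf_gt1.
  rewrite -ler_pdivlMr // -[_^-1 / _]mulrC.
  have := h ltac:(lra); rewrite addrCA subrr addr0 exprVn => h1.
  have d0 : 0 < 1 - s by lra.
  rewrite ler_pdivlMr //.
  have : n%:R * (s^-1 - 1) <= (s ^+ n)^-1 by lra.
  apply: le_trans; rewrite ler_wpM2l //.
  have -> : s^-1 - 1 = (1 - s) * s^-1 by rewrite mulrBl divff // mul1r.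
  by rewrite ler_peMr ?ltW.
have hs : (fun n => (1 - s)^-1 * s ^+ n) @ \oo --> (0 : R).
  rewrite -[X in _ --> X](mulr0 (1 - s)^-1); apply: cvgM; first exact: cvg_cst.
  have := @cvg_geometric R 1 s; rewrite ger0_norm // => /(_ s1).
  by rewrite (_ : geometric 1 s = GRing.exp s) //; apply/funext => n; rewrite /geometric /= mul1r.
apply: (squeeze_cvgr _ (cvg_cst 0) hs); apply: nearW => n.
rewrite mulr_ge0 ?exprn_ge0 //= -sq -exprM mulnC exprM expr2 mulrA.
by rewrite ler_wpM2r ?exprn_ge0.
Qed.

(** Let N = n 2^n and y = x^n, so N y = n (2x)^n. Bernoulli gives (1 - y)^N >= 1 - N y, which tends
    to 1 if x < 1/2, and (1 - y)^N <= 1 / (1 + y)^N <= 1 / (1 + N y), which is at most 1 / (n + 1)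
    if x >= 1/2. The factor n settles the case x = 1/2. *)
Lemma step_polynomials_cvg (x : R) : 0 <= x <= 1 ->
  (fun n => (1 - x ^+ n) ^+ (n * 2 ^ n)) @ \oo --> ((x < 2^-1)%R%:R : R).
Proof.
move=> /andP[x0 x1].
have y0 n : 0 <= x ^+ n by rewrite exprn_ge0.
have y1 n : x ^+ n <= 1 by rewrite exprn_ile1.
case: ltrP => hx.
  have h2x : 0 <= 2 * x < 1 by apply/andP; split; lra.
  have hc : (fun n => 1 - n%:R * (2 * x) ^+ n) @ \oo --> (1 - 0 : R).
    by apply: cvgB; [exact: cvg_cst|exact: cvg_natr_geometric].
  rewrite subr0 in hc; apply: (@squeeze_cvgr _ _ _ _ (fun n => 1 - n%:R * (2 * x) ^+ n) (cst 1)) => //=; last exact: cvg_cst.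
  apply: nearW => n.
  apply/andP; split; last by rewrite exprn_ile1 // ?subr_ge0 //; have := y0 n; lra.
  have := @bernoulli_ineq (- x ^+ n) (n * 2 ^ n) ltac:(have := y1 n; lra).
  apply: le_trans; rewrite natrM natrX exprMn; lra.
have hc : (fun n => n.+1%:R^-1) @ \oo --> (0 : R) by exact: cvg_harmonic.
apply: (squeeze_cvgr _ (cvg_cst 0) hc); apply: nearW => n.
apply/andP; split; first by rewrite exprn_ge0 // subr_ge0.
have y0n := y0 n; have y1n := y1 n.
have h1 : 1 + (n * 2 ^ n)%:R * x ^+ n <= (1 + x ^+ n) ^+ (n * 2 ^ n).
  by apply: bernoulli_ineq; lra.
have h2 : n.+1%:R <= 1 + (n * 2 ^ n)%:R * x ^+ n.
  rewrite -natr1 addrC lerD2l natrM natrX -mulrA -exprMn ler_peMr // exprn_ege1 //.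
  lra.
have h3 : (1 - x ^+ n) ^+ (n * 2 ^ n) * (1 + x ^+ n) ^+ (n * 2 ^ n) <= 1.
  rewrite -exprMn exprn_ile1 //; first by rewrite mulr_ge0 //; lra.
  nra.
have h4 : 0 <= (1 - x ^+ n) ^+ (n * 2 ^ n) by rewrite exprn_ge0 // subr_ge0.
rewrite -[leRHS]mul1r ler_pdivlMr //; apply: le_trans h3.
by rewrite ler_wpM2l //; exact: le_trans h2 h1.
Qed.
End step_polynomials.

(** * Uniqueness of Fourier coefficients *)

Section circle_functions.
Variable R : realType.
Local Notation C := R[i].
Local Notation T := (circle R).
Local Notation mu := (@arc_measure R).
Local Notation Re := (@complex.Re R).
Local Notation Im := (@complex.Im R).
Local Notation mfun f := (measurable_fun [set: T] f).

Definition zpow (n : int) (z : T) : C := sval z ^ n.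

Lemma cn2_circle (z : T) : cn2 (sval z) = 1.
Proof.
case: z => z /= /eqP hz.
apply: complexI; rewrite /cn2 add_Re2_Im2 hz expr1n //.
Qed.

Lemma circle_neq0 (z : T) : sval z != 0.
Proof. by apply/eqP => h; have := cn2_circle z; rewrite h cn2_0 => /eqP; rewrite eq_sym oner_eq0. Qed.

Lemma conjc_circle (z : T) : conjc (sval z) = (sval z)^-1.
Proof.
apply: (mulfI (circle_neq0 z)); rewrite mulfV ?circle_neq0 // mulcJ cn2_circle //.
Qed.

Lemma zpowD m n z : zpow (m + n) z = zpow m z * zpow n z.
Proof. by rewrite /zpow exprzDr // unitfE circle_neq0. Qed.
Lemma zpow0 z : zpow 0 z = 1. Proof. by []. Qed.
Lemma zpow1 z : zpow 1 z = sval z. Proof. by rewrite /zpow expr1z. Qed.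
Lemma zpowN n z : zpow (- n) z = (zpow n z)^-1.
Proof. by rewrite /zpow -invr_expz. Qed.

Lemma conjc_zpow n z : conjc (zpow n z) = zpow (- n) z.
Proof.
have h (k : nat) : conjc (zpow k z) = (zpow k z)^-1.
  by rewrite /zpow -exprnP rmorphXn /= conjc_circle exprVn.
rewrite zpowN; case: n => n; first exact: h.
by rewrite NegzE zpowN conjc_inv h.
Qed.

Lemma cn2_zpow n z : cn2 (zpow n z) = 1.
Proof. by apply: complexI; rewrite -mulcJ conjc_zpow -zpowD subrr. Qed.

Lemma circle_mfun (f : T -> R) : measurable_fun [set: R] (f \o @cis R) -> mfun f.
Proof.
move=> h _ A mA; rewrite setTI.
have := h measurableT A mA; rewrite setTI => hA.
by rewrite /measurable /= /circle_measurable /image_set_system /= setTI.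
Qed.

Lemma cm_circle : cmeasurable (fun z : T => sval z).
Proof.
split; apply: circle_mfun.
  apply: (eq_measurable_fun (@cos R)) => //.
  by apply: continuous_measurable_fun; exact: continuous_cos.
apply: (eq_measurable_fun (@sin R)) => //.
by apply: continuous_measurable_fun; exact: continuous_sin.
Qed.

Lemma cmX (f : T -> C) n : cmeasurable f -> cmeasurable (fun z => f z ^+ n).
Proof.
move=> hf; elim: n => [|n IH]; first exact: cm_cst.
by under eq_fun do rewrite exprS; exact: cmM.
Qed.

Lemma cm_zpow n : cmeasurable (zpow n).
Proof.
case: n => n; first by apply: cmX; exact: cm_circle.
rewrite (_ : zpow _ = fun z => conjc (sval z ^+ n.+1)).
  by apply: cmJ; apply: cmX; exact: cm_circle.
by apply/funext => z; rewrite NegzE -conjc_zpow.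
Qed.

Lemma rint_dct (u : nat -> T -> R) (f g : T -> R) :
  (forall n, mfun (u n)) -> rI g -> (forall n z, `|u n z| <= g z) ->
  (forall z, (fun n => u n z) @ \oo --> f z) ->
  rI f /\ (fun n => rint (u n)) @ \oo --> rint f.
Proof.
move=> mu_ ig h uf.
have uE : forall z : T, (fun n => (u n z)%:E) @ \oo --> (f z)%:E.
  by move=> z; apply/fine_cvgP; split; [exact: nearW|exact: uf].
have mE n : measurable_fun [set: T] (EFin \o u n) by exact/measurable_EFinP.
have mfE : measurable_fun [set: T] (EFin \o f).
  by apply: emeasurable_fun_cvg => [n|z _]; [exact: mE|exact: uE].
have [||if_ _ hh] := @dominated_convergence _ T R mu [set: T] measurableT
  (fun n z => (u n z)%:E) (EFin \o f) (EFin \o g) mE mfE _ ig _.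
- by apply: aeW => z _; exact: uE.
- by apply: aeW => z n _; rewrite /= lee_fin; exact: h.
split => //.
have iu n : rI (u n) by apply: rI_dom ig (h n).
have : (fun n => (rint (u n))%:E) @ \oo --> (rint f)%:E.
  rewrite -rintE //; apply: cvg_trans hh; apply: near_eq_cvg; apply: nearW => n.
  by rewrite /= rintE.
by move=> /fine_cvgP[].
Qed.

Local Notation I2pi := (`[0%R, pi *+ 2]%classic : set (measurableTypeR R)).
Local Notation leb := (lebesgue_measure : {measure set (measurableTypeR R) -> \bar R}).

Lemma ge0_integral_arc (f : T -> \bar R) : measurable_fun [set: T] f ->
  (forall z, 0 <= f z)%E ->
  (\int[mu]_z f z = ((pi *+ 2)^-1)%:E * \int[leb]_(x in I2pi) f (cis x))%E.
Proof.
move=> mf f0; rewrite ge0_integral_distribution //.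
rewrite integral_uniform //; first by rewrite subr0.
  exact: measurableT_comp.
by move=> x; exact: f0.
Qed.

Lemma rI_arc (f : T -> R) : rI f -> leb.-integrable I2pi (EFin \o (f \o @cis R)).
Proof.
move=> hf; have mf := rI_meas hf.
have mfc : measurable_fun [set: R] (f \o @cis R) by exact: measurableT_comp.
apply/integrableP; split.
  by apply/measurable_EFinP; exact: measurable_funTS.
case/integrableP : hf => _.
rewrite ge0_integral_arc //; last by do 2 apply: measurableT_comp => //.
have p0 : (0 < (pi *+ 2)^-1 :> R) by rewrite invr_gt0 pi2_gt0.
rewrite /=; case: (\int[_]_(x in _) _)%E => [r|h|//]; first by move=> _; rewrite ltry.
by move: h; rewrite gt0_muley // lte_fin.
Qed.

Lemma rint_arc (f : T -> R) : rI f ->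
  rint f = (pi *+ 2)^-1 * (\int[leb]_(x in I2pi) f (cis x)).
Proof.
move=> hf; have mf := rI_meas hf.
have hl := rI_arc hf.
have mfE : measurable_fun [set: T] (EFin \o f) by exact/measurable_EFinP.
have E1 : (\int[leb]_(x in I2pi) (EFin \o f)^\+ (cis x) =
    \int[leb]_(x in I2pi) (EFin \o (f \o @cis R))^\+ x)%E.
  by apply: eq_integral => x _; rewrite !funeposE.
have E2 : (\int[leb]_(x in I2pi) (EFin \o f)^\- (cis x) =
    \int[leb]_(x in I2pi) (EFin \o (f \o @cis R))^\- x)%E.
  by apply: eq_integral => x _; rewrite !funenegE.
rewrite /rint /Rintegral integralE (ge0_integral_arc (measurable_funepos mfE)) //.
rewrite (ge0_integral_arc (measurable_funeneg mfE)) // -muleBr //; last first.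
  apply: fin_num_adde_defr.
  rewrite ge0_fin_numE. 
  have mI : measurable I2pi by exact: measurable_itv.
  by rewrite E1; exact: (integral_funepos_lt_pinfty mI hl).
  exact: integral_ge0.
rewrite E1 E2.
by rewrite -[X in (_ * X)%E]integralE fineM //; exact: integrable_fin_num.
Qed.

(** Laurent polynomials with a single denominator. On the circle |p| = |a|, which later replaces
    trigonometric tests by polynomial ones. *)
Definition trigpoly (p : T -> C) :=
  exists (a : {poly C}) (N : nat), forall z, p z = zpow (- N%:Z) z * a.[sval z].

Lemma trigpoly_cst (c : C) : trigpoly (fun=> c).
Proof. by exists c%:P, 0%N => z; rewrite hornerC oppr0 zpow0 mul1r. Qed.

Lemma trigpolyM p q : trigpoly p -> trigpoly q -> trigpoly (fun z => p z * q z).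
Proof.
move=> [a [N ha]] [b [M hb]]; exists (a * b), (N + M)%N => z.
by rewrite ha hb hornerM PoszD opprD zpowD; ring.
Qed.

Lemma trigpolyD p q : trigpoly p -> trigpoly q -> trigpoly (fun z => p z + q z).
Proof.
move=> [a [N ha]] [b [M hb]]; exists (a * 'X^M + b * 'X^N), (N + M)%N => z.
rewrite ha hb hornerD !hornerM !hornerXn PoszD opprD zpowD.
have h (k : nat) : zpow (- k%:Z) z * sval z ^+ k = 1.
  by rewrite -[_ ^+ _]/(zpow k z) -zpowD addNr zpow0.
have hN := h N; have hM := h M.
rewrite mulrDr.
have -> : zpow (- N%:Z) z * zpow (- M%:Z) z * (a.[sval z] * sval z ^+ M) =
  zpow (- N%:Z) z * a.[sval z] * (zpow (- M%:Z) z * sval z ^+ M) by ring.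
have -> : zpow (- N%:Z) z * zpow (- M%:Z) z * (b.[sval z] * sval z ^+ N) =
  zpow (- M%:Z) z * b.[sval z] * (zpow (- N%:Z) z * sval z ^+ N) by ring.
by rewrite hN hM !mulr1.
Qed.

Lemma trigpolyN p : trigpoly p -> trigpoly (fun z => - p z).
Proof.
move=> /(trigpolyM (trigpoly_cst (-1))); rewrite (_ : (fun z => _) = fun z => - p z) //.
by apply/funext => z; rewrite mulN1r.
Qed.

Lemma trigpolyX p n : trigpoly p -> trigpoly (fun z => p z ^+ n).
Proof.
move=> hp; elim: n => [|n IH]; first exact: trigpoly_cst.
by rewrite (_ : (fun z => _) = fun z => p z * p z ^+ n); [exact: trigpolyM|
  apply/funext => z; rewrite exprS].
Qed.

Lemma trigpoly_zpow n : trigpoly (zpow n).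
Proof.
case: n => n.
  by exists 'X^n, 0%N => z; rewrite hornerXn oppr0 zpow0 mul1r.
by exists 1, n.+1 => z; rewrite hornerC mulr1 NegzE.
Qed.

Lemma cm_horner (a : {poly C}) : cmeasurable (fun z : T => a.[sval z]).
Proof.
rewrite (_ : (fun z => _) = fun z => \sum_(i < size a) a`_i * sval z ^+ i); last first.
  by apply/funext => z; rewrite horner_coef.
apply: cm_sum => i _; apply: cmM; first exact: cm_cst.
by apply: cmX; exact: cm_circle.
Qed.

Lemma cm_trigpoly p : trigpoly p -> cmeasurable p.
Proof.
move=> [a [N ha]]; rewrite (_ : p = fun z => zpow (- N%:Z) z * a.[sval z]); last exact/funext.
by apply: cmM; [exact: cm_zpow|exact: cm_horner].
Qed.

Definition fourier_null (h : T -> C) := forall n, cintegral (fun z => h z * zpow n z) = 0.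

Lemma cI_zpow (h : T -> C) n : cI h -> cI (fun z => h z * zpow n z).
Proof.
move=> hh; have [h1 h2] := hh.
apply: (@cI_dom _ _ (fun z => `|Re (h z)| + `|Im (h z)|)).
- by apply: cmM; [exact: cI_meas|exact: cm_zpow].
- by apply: rID; exact: integrable_norm.
- move=> z; split; first by rewrite addr_ge0.
  rewrite cn2M cn2_zpow mulr1 /cn2 -(real_normK (num_real (Re _))).
  rewrite -(real_normK (num_real (Im _))).
  by have := normr_ge0 (Re (h z)); have := normr_ge0 (Im (h z)); nra.
Qed.

Lemma cint0 : cintegral (fun _ : T => 0 : C) = 0.
Proof. by rewrite cintE /= rint0. Qed.

Lemma fourier_null_trigpoly (h : T -> C) p : cI h -> fourier_null h -> trigpoly p ->
  cintegral (fun z => h z * p z) = 0.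
Proof.
move=> ih hn [a [N ha]].
rewrite (@cint_ext _ _ (fun z => \sum_(i < size a) a`_i * (h z * zpow (i%:Z - N%:Z) z))); last first.
  move=> z; rewrite ha horner_coef !mulr_sumr; apply: eq_bigr => i _.
  by rewrite -[_ ^+ _]/(zpow i z) zpowD; ring.
rewrite cint_sum; last by move=> i _; apply: cIZ; exact: cI_zpow.
by rewrite big1 // => i _; rewrite cintZ ?hn ?mulr0 //; exact: cI_zpow.
Qed.

(* The indicator of the arc [a < Re (al z)] is a bounded limit of the
   trigonometric polynomials [(1 - x ^ n) ^ (n 2 ^ n)], [x] affine in [Re (al z)]. *)
Lemma fourier_null_arc (h : T -> R) (al : C) (a : R) : rI h ->
  fourier_null (fun z => (h z)%:C%C) -> cn2 al = 1 ->
  rI (fun z => h z * (a < Re (al * sval z))%R%:R) /\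
  rint (fun z => h z * (a < Re (al * sval z))%R%:R) = 0.
Proof.
move=> ih hn al1.
(* Scaled so that x has values in [0, 1] and is below 1/2 exactly where Re (al z) > a. *)
pose x (z : T) : R := 2^-1 + (a - Re (al * sval z)) / (2 * (`|a| + 1)).
have a0 := normr_ge0 a.
have den0 : 0 < 2 * (`|a| + 1) by lra.
have r1 (z : T) : `|Re (al * sval z)| <= 1.
  by apply: sqr_le_abs => //; apply: le_trans (sqr_Re_le _) _; rewrite cn2M al1 cn2_circle expr1n mulr1.
have xb z : 0 <= x z <= 1.
  have : `|a - Re (al * sval z)| <= `|a| + 1.
    by apply: le_trans (ler_normB _ _) _; rewrite lerD2l.
  rewrite ler_norml => /andP[h1 h2].
  have k1 : - 2^-1 <= (a - Re (al * sval z)) / (2 * (`|a| + 1)) by rewrite ler_pdivlMr //; lra.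
  have k2 : (a - Re (al * sval z)) / (2 * (`|a| + 1)) <= 2^-1 by rewrite ler_pdivrMr //; lra.
  by rewrite /x; apply/andP; split; lra.
have xE z : (x z < 2^-1) = (a < Re (al * sval z)).
  by rewrite /x -[X in _ < X]addr0 ltrD2l pmulr_llt0 ?invr_gt0 // subr_lt0.
have mx : mfun x.
  apply: measurable_funD; first exact: measurable_cst.
  apply: measurable_funM; last exact: measurable_cst.
  apply: measurable_funB; first exact: measurable_cst.
  by have [] : cmeasurable (fun z : T => al * sval z)
    by apply: cmM; [exact: cm_cst|exact: cm_circle].
have tx : trigpoly (fun z => (x z)%:C%C).
  rewrite (_ : (fun z => _) = fun z => (2^-1 + a / (2 * (`|a| + 1)))%:C%C +
     (- (2 * (`|a| + 1))^-1 / 2)%:C%C * (al * zpow 1 z + conjc al * zpow (-1) z)).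
    apply: trigpolyD; first exact: trigpoly_cst.
    apply: trigpolyM; first exact: trigpoly_cst.
    by apply: trigpolyD; apply: trigpolyM; try exact: trigpoly_cst; exact: trigpoly_zpow.
  apply/funext => z; rewrite -conjc_zpow zpow1 -conjcM /x.
  case: (al * sval z) => u v; apply: complex_ext => /=; field; rewrite gt_eqF //; lra.
pose P n z : R := (1 - x z ^+ n) ^+ (n * 2 ^ n).
have P01 n z : 0 <= P n z <= 1.
  have /andP[x0 x1] := xb z.
  have y1 : x z ^+ n <= 1 by rewrite exprn_ile1.
  have y0 : 0 <= x z ^+ n by rewrite exprn_ge0.
  by rewrite exprn_ge0 ?subr_ge0 //= exprn_ile1 ?subr_ge0 //; lra.
have mP n : mfun (P n).
  apply: measurable_funX; apply: measurable_funB; first exact: measurable_cst.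
  exact: measurable_funX.
have mh := rI_meas ih.
have tP n : trigpoly (fun z => (P n z)%:C%C).
  rewrite (_ : (fun z => _) = fun z => (1 + - (x z)%:C%C ^+ n) ^+ (n * 2 ^ n)); last first.
    by apply/funext => z; rewrite /P rmorphXn /= rmorphB /= rmorphXn.
  apply: trigpolyX; apply: trigpolyD; first exact: trigpoly_cst.
  by apply: trigpolyN; exact: trigpolyX.
have cIh : cI (fun z => (h z)%:C%C) by split => //=; exact: rI_cst.
have int0 n : rint (fun z => h z * P n z) = 0.
  have /(congr1 Re) := fourier_null_trigpoly cIh hn (tP n).
  rewrite cintE /= => <-; apply: rint_ext => z; ring.
have [||||hI hc] := @rint_dct (fun n z => h z * P n z)
   (fun z => h z * (a < Re (al * sval z))%R%:R) (fun z => `|h z|).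
- by move=> n; exact: measurable_funM.
- exact: integrable_norm.
- move=> n z; have /andP[p0 p1] := P01 n z.
  by rewrite normrM (ger0_norm p0) ler_piMr.
- move=> z; apply: cvgM; first exact: cvg_cst.
  by rewrite -xE; apply: step_polynomials_cvg; exact: xb.
have : (fun n => rint (fun z => h z * P n z)) = (fun=> 0) by apply/funext.
move=> E; rewrite E in hc.
by split => //; exact: (cvg_unique (@Rhausdorff R) hc (cvg_cst 0)).
Qed.

(** Rotation by -s/2 centres the arc of angles between 0 and s at the point 1; the cases bring t -
    s/2 into [0, pi], where the cosine decreases. *)
Lemma arc_interval (s t : R) : 0 <= s <= pi *+ 2 -> 0 <= t <= pi *+ 2 ->
  (cos (s / 2) < Re (sval (cis (- (s / 2))) * sval (cis t))) = (0 < t < s).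
Proof.
move=> /andP[s0 s1] /andP[t0 t1].
have p0 := pi_gt0 R.
have -> : Re (sval (cis (- (s / 2))) * sval (cis t)) = cos (t - s / 2).
  by rewrite /= cosN sinN cosB; ring.
rewrite -mulr_natr in s1 t1.
have hs : s / 2 \in `[0, pi] by rewrite in_itv /=; apply/andP; split; lra.
have lt_abs (u : R) : u \in `[0, pi] -> (cos (s / 2) < cos u) = (u < s / 2).
  by move=> hu; rewrite ltr_cos.
have [h1|h1] := lerP (t - s / 2) 0.
  rewrite -[cos (t - s / 2)]cosN lt_abs; last by rewrite in_itv /=; apply/andP; split; lra.
  apply/idP/andP => [h|[h h']]; last by lra.
  by split; lra.
have [h2|h2] := lerP (t - s / 2) pi.
  rewrite lt_abs; last by rewrite in_itv /=; apply/andP; split; lra.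
  apply/idP/andP => [h|[h h']]; last by lra.
  by split; lra.
have -> : cos (t - s / 2) = cos (pi *+ 2 - (t - s / 2)).
  by rewrite -[LHS]cosN -[LHS]cosD2pi; congr cos; ring.
rewrite lt_abs; last by rewrite in_itv /= -mulr_natr; apply/andP; split; lra.
rewrite -mulr_natr; apply/idP/andP => [h|[h h']]; first by split; lra.
lra.
Qed.

(** Arcs starting at angle 0 give all values of the indefinite integral of h, which is therefore 0;
    by Lebesgue differentiation h vanishes almost everywhere. *)
Lemma fourier_null_real (h : T -> R) : rI h -> fourier_null (fun z => (h z)%:C%C) ->
  \forall z \ae mu, h z = 0.
Proof.
move=> ih hn.
have pi20 := pi2_gt0 R.
pose J : set (measurableTypeR R) := `]0%R, pi *+ 2[%classic.
have mJ : measurable J by exact: measurable_itv.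
have mI : measurable I2pi by exact: measurable_itv.
(* Extended by 0 to the whole line, so that integrals from minus infinity can be differentiated. *)
pose G : R -> R := (h \o @cis R) \_ J.
have iJ : leb.-integrable J (EFin \o (h \o @cis R)).
  apply: (@integrableS _ _ _ _ I2pi) => //; last exact: rI_arc.
  by move=> x /=; rewrite !in_itv /= => /andP[/ltW -> /ltW ->].
have iG : leb.-integrable [set: R] (EFin \o G).
  rewrite (_ : EFin \o G = (EFin \o (h \o @cis R)) \_ J); last by rewrite restrict_EFin.
  exact: (integrable_mkcond _ mJ).1.
have hint s : \int[leb]_(x in `]-oo, s]) G x = 0.
  rewrite -Rintegral_itv_bndo_bndc; last exact: (integrableS measurableT).
  (* Clamping s to [0, 2 pi] does not change the integral of G and makes [arc_interval]
     applicable. *)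
  pose s' := Num.min (Num.max s 0) (pi *+ 2).
  have s'0 : 0 <= s' <= pi *+ 2.
    by rewrite /s' ge_min lexx orbT le_min le_max lexx orbT (ltW pi20).
  have [hI E] := fourier_null_arc (cos (s' / 2)) ih hn (cn2_circle (cis (- (s' / 2)))).
  rewrite rint_arc // in E.
  have -> : \int[leb]_(x in `]-oo, s[) G x = \int[leb]_(x in I2pi) (h (cis x) *
      (cos (s' / 2) < Re (sval (cis (- (s' / 2))) * sval (cis x)))%R%:R).
    rewrite Rintegral_mkcond [RHS]Rintegral_mkcond; apply: eq_Rintegral => x _.
    rewrite !patchE; case: ifPn => xs; case: ifPn => xI.
    - rewrite arc_interval //; last by move: xI; rewrite inE /= in_itv.
      rewrite /G patchE; move: xs; rewrite inE /= in_itv /= => xs.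
      case: ifPn => xJ.
        move: xJ; rewrite inE /J /= in_itv /= => /andP[x0 x2].
        by rewrite x0 /s' lt_min lt_max xs x2 mulr1.
      case: andP => [[h1 h2]|]; last by rewrite mulr0.
      exfalso; move/negP: xJ; apply; rewrite inE /J /= in_itv /= h1 /=.
      by apply: lt_le_trans h2 _; case/andP: s'0.
    - rewrite /G patchE ifN //; apply: contra xI; rewrite !inE /J /= !in_itv /=.
      by move=> /andP[/ltW -> /ltW ->].
    - rewrite arc_interval //; last by move: xI; rewrite inE /= in_itv.
      have [h1|] := boolP (0 < x < s'); last by rewrite mulr0.
      exfalso; move: h1; rewrite /s' lt_min lt_max => /andP[x0 /andP[/orP[xs'|xs'] _]].
        by move/negP: xs; apply; rewrite inE /= in_itv.
      by move: (lt_trans x0 xs'); rewrite ltxx.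
    - by [].
  by move/eqP: E; rewrite mulf_eq0 invr_eq0 (gt_eqF pi20) /= => /eqP.
have : \forall x \ae leb, G x = 0.
  have := @FTC1Ny R G _ _.
  move=> /(_ _ _)/=.
  have h1 : forall y, leb.-integrable `]-oo, y] (EFin \o G).
    by move=> y; apply: (integrableS measurableT).
  have h2 : locally_integrable [set: R] G := integrable_locally mJ iJ.
  move=> /(_ h1 h2); apply: filterS; first exact: (ae_filter_ringOfSetsType leb).
  move=> x [_ <-].
  have -> : (fun x0 => \int[leb]_(t in [set` `]-oo, x0]]) G t) = cst 0.
    by apply/funext => y; exact: hint.
  by rewrite derive1_cst.
have pt (a : R) : \forall x \ae leb, x <> a.
  exists [set a]; split => //; first exact: lebesgue_measure_set1.
  by move=> x /=; apply: contra_notP.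
move=> G0.
have h0 : rint (fun z => `|h z|) = 0.
  rewrite rint_arc; last exact: integrable_norm.
  rewrite /Rintegral (_ : (\int[leb]_(x in I2pi) (`|h (cis x)|)%:E = 0)%E) ?mulr0 //.
  rewrite -[RHS](@integral0 _ _ _ leb I2pi); apply: ae_eq_integral => //.
    by case/integrableP : (rI_arc (integrable_norm ih)).
  have := G0; have := pt 0; have := pt (pi *+ 2).
  apply: filterS3; first exact: (ae_filter_ringOfSetsType leb).
  move=> x h1 h2; rewrite /G patchE; case: ifPn => [_ /= -> _|xJ _ xI].
    by rewrite normr0.
  exfalso; move/negP: xJ; apply; rewrite inE /J /= in_itv /=.
  move: xI; rewrite /= in_itv /= => /andP[x0 x1].
  by rewrite !lt_neqAle x0 x1 !andbT eq_sym; apply/andP; split; exact/eqP.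
have := rint_eq0 (integrable_norm ih) (aeW _ (fun z => normr_ge0 (h z))) h0.
by apply: filterS => z /eqP; rewrite normr_eq0 => /eqP.
Qed.

(** The conjugate of h has vanishing coefficients as well, hence so do the real and the imaginary
    part. *)
Lemma fourier_null_eq0 (h : T -> C) : cI h -> fourier_null h -> \forall z \ae mu, h z = 0.
Proof.
move=> ih hn; have [i1 i2] := ih.
have hJ n : cintegral (fun z => conjc (h z) * zpow n z) = 0.
  rewrite (@cint_ext _ _ (fun z => conjc (h z * zpow (- n) z))).
    by rewrite cintJ ?hn ?conjc0 //; exact: cI_zpow.
  by move=> z; rewrite conjcM conjc_zpow opprK.
have ihJ := cIJ ih.
have key (c d : C) : cI (fun z => (c * h z + d * conjc (h z))) /\
    fourier_null (fun z => (c * h z + d * conjc (h z))).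
  split; first by apply: cID; exact: cIZ.
  move=> n; rewrite (@cint_ext _ _ (fun z => c * (h z * zpow n z) +
    d * (conjc (h z) * zpow n z))); last by move=> z; ring.
  rewrite cintD ?cintZ ?hn ?hJ ?mulr0 ?addr0 //; try exact: cI_zpow.
    by apply: cIZ; exact: cI_zpow.
  by apply: cIZ; exact: cI_zpow.
have r1 : \forall z \ae mu, Re (h z) = 0.
  apply: fourier_null_real => // n; rewrite -((key (2^-1)%:C%C (2^-1)%:C%C).2 n).
  congr cintegral; apply/funext => z; congr (_ * _).
  by apply: complex_ext; case: (h z) => u v /=; field.
have r2 : \forall z \ae mu, Im (h z) = 0.
  apply: fourier_null_real => // n; rewrite -((key (Complex 0 (- 2^-1)) (Complex 0 (2^-1))).2 n).
  congr cintegral; apply/funext => z; congr (_ * _).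
  by apply: complex_ext; case: (h z) => u v /=; field.
by move: r1 r2; apply: filterS2 => z ? ?; apply: complex_ext.
Qed.
End circle_functions.

(** * Hardy spaces *)

Section annihilators.
Variables (R : realType) (V : lmodType R[i]) (E : set V) (B : V -> V -> R[i]).
Hypothesis hB : hform E B.
Let sE := hform_sub hB.

(** The Hardy spaces and the domain and codomain of Gamma all have this form, so linearity and
    closedness are proved once. *)
Definition annih (A : set V) : set V := [set x | E x /\ forall a, A a -> B x a = 0].

Lemma annih_sub A : A `<=` E -> linsub (annih A).
Proof.
move=> AE; split; first by split; [exact: sub0|move=> a /AE Ea; exact: (hform0 hB)].
move=> c x y [Ex hx] [Ey hy]; split; first exact: subL.
by move=> a Aa; rewrite (hformL hB) ?hx ?hy ?mulr0 ?addr0 //; exact: AE.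
Qed.

Lemma annihE A : annih A `<=` E. Proof. by move=> x []. Qed.

Lemma annih_closed A : A `<=` E -> qclosed E B (annih A).
Proof.
move=> AE u x hu Ex ux; split => // a Aa.
apply: (qlim_form hB (u := u)) => //; first by move=> n; exact: (hu n).1.
  exact: AE.
move=> e e0; exists 0%N => n _; rewrite (hu n).2 // subrr cn2_0; exact: ltW.
Qed.

(** S need not be closed: a minimizing sequence still converges in E, to some y with x + y
    orthogonal to S, so that x + y has seminorm 0. *)
Lemma dense_of_orthogonal (S : set V) : qcomplete E B -> linsub S -> S `<=` E ->
  (forall y, E y -> (forall s, S s -> B y s = 0) -> qf B y = 0) ->
  forall x e, E x -> 0 < e -> exists2 s, S s & qf B (x - s) < e.
Proof.
move=> cE sS SE hS x e Ex e0.
have [d [u [Su hd hu]]] := minimizing_sequence hB sS SE Ex.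
have Eu n := SE _ (Su n).
have uC := near_minimizers_cauchy hB sS SE Ex Su hd hu.
have [y Ey uy] := cE u Eu uC.
have q0 : qf B (x + y) = 0.
  apply: hS => [|s Ss]; first exact: (subD sE).
  apply: (qlim_form hB (u := fun n => x + u n)) => //.
  - by move=> n; exact: (subD sE).
  - exact: (subD sE).
  - exact: SE.
  - move=> e' e'0; have [N hN] := uy e' e'0; exists N => n /hN.
    by rewrite opprD addrACA subrr add0r.
  - move=> e' e'0.
    have t0 := qf_ge0 hB (SE _ Ss).
    have et0 : 0 < e' / (qf B s + 1) by apply: divr_gt0 => //; lra.
    have [N hN] := natSinv_lt et0.
    exists N => n hn; rewrite subr0.
    apply: le_trans (minimizers_almost_orthogonal hB sS SE Ex Su hd hu n Ss) _.
    have := hN n hn; rewrite /= ltr_pdivlMr; last lra.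
    have : 0 <= n.+1%:R^-1 :> R by rewrite invr_ge0.
    by move: (n.+1%:R^-1) => k; nra.
have [N /(_ N (leqnn N)) hN] := uy e e0.
exists (- u N); first exact: subN.
rewrite opprK; have -> : x + u N = (x + y) + (u N - y) by rewrite addrACA addrN addr0.
rewrite (qf_eq0D hB) //; first exact: (subD sE).
exact: (subB sE).
Qed.
End annihilators.

(** * Multiplication operators, the shift and block decompositions *)

Section multipliers.
Variable R : realType.
Local Notation C := R[i].
Local Notation T := (circle R).
Local Notation mu := (@arc_measure R).

Lemma LinfP m n (F : T -> 'M[C]_(m, n)) : Linf F <-> mx_measurable F /\
  exists2 M : R, 0 <= M & \forall z \ae mu, forall x, vn2 (F z *m x) <= M ^+ 2 * vn2 x.
Proof.
split=> -[mF h]; split => //.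
  have h1 := ess_sup_ge mu (fun z => (opnorm (F z))%:E).
  have : exists M : R, (Linfnorm F <= M%:E)%E.
    move: h; rewrite /Linfnorm; case: (ess_sup _ _) => [r|//|] _; first by exists r.
    by exists 0; rewrite leNye.
  move=> [M hM].
  exists (Num.max M 0); first by rewrite le_max lexx orbT.
  apply: filterS h1 => z hz x; have := le_trans hz hM; rewrite lee_fin => hz'.
  apply: (opnorm_le _ _).1; first by rewrite le_max lexx orbT.
  by rewrite le_max hz'.
case: h => M M0 h.
apply: (@le_lt_trans _ _ M%:E); last by rewrite ltry.
by apply/ess_supP; apply: filterS h => z hz; rewrite lee_fin; exact: (opnorm_le _ M0).2.
Qed.

Lemma L2_mulmx m n (F : T -> 'M[C]_(m, n)) f : Linf F -> L2 f -> L2 (fun z => F z *m f z).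
Proof.
move=> /LinfP[mF [M M0 hM]] /L2P[mf hf]; apply/L2P.
have mFf : mx_measurable (fun z => F z *m f z) by exact: mm_mulmx.
split => //; apply: (@rI_dom_ae _ _ (fun z => M ^+ 2 * vn2 (f z))).
- exact: m_vn2.
- exact: rIZ.
- by apply: filterS hM => z hz; rewrite ger0_norm ?vn2_ge0.
Qed.

Lemma L2_mulc n (c : T -> C) (M : R) (f : T -> 'cV[C]_n) : cmeasurable c ->
  (\forall z \ae mu, cn2 (c z) <= M) -> L2 f -> L2 (fun z => c z *: f z).
Proof.
move=> mc hM /L2P[mf hf]; apply/L2P.
have mcf : mx_measurable (fun z => c z *: f z) by exact: mmZ.
split => //; apply: (@rI_dom_ae _ _ (fun z => M * vn2 (f z))).
- exact: m_vn2.
- exact: rIZ.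
- by apply: filterS hM => z hz; rewrite ger0_norm ?vn2_ge0 // vn2Z ler_wpM2r ?vn2_ge0.
Qed.

(** Pointwise, |A^* y|^4 = |<A A^* y, y>|^2 <= M^2 |A^* y|^2 |y|^2. *)
Lemma Linf_adj m n (F : T -> 'M[C]_(m, n)) : Linf F -> Linf (fun z => adj (F z)).
Proof.
move=> /LinfP[mF [M M0 hM]]; apply/LinfP; split; first exact: mm_adj.
exists M => //; apply: filterS hM => z hz y.
have h : vn2 (adj (F z) *m y) ^+ 2 <= (M ^+ 2 * vn2 y) * vn2 (adj (F z) *m y).
  have e1 : hdot (F z *m (adj (F z) *m y)) y = (vn2 (adj (F z) *m y))%:C%C.
    by rewrite hdot_adj hdotxx.
  have := hdot_cs (F z *m (adj (F z) *m y)) y; rewrite e1 cn2R => h1.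
  apply: le_trans h1 _; rewrite mulrAC ler_wpM2r ?vn2_ge0 //; exact: hz.
have [v0|v0] := eqVneq (vn2 (adj (F z) *m y)) 0.
  by rewrite v0 mulr_ge0 ?sqr_ge0 ?vn2_ge0.
have vp : 0 < vn2 (adj (F z) *m y) by rewrite lt_neqAle eq_sym v0 vn2_ge0.
by move: h; rewrite expr2 ler_pM2r.
Qed.

Lemma L2dot_adj m n (F : T -> 'M[C]_(m, n)) f g :
  L2dot (fun z => F z *m f z) g = L2dot f (fun z => adj (F z) *m g z).
Proof. by apply: cint_ext => z; exact: hdot_adj. Qed.

Definition shift k (n : int) (f : T -> 'cV[C]_k) : T -> 'cV[C]_k :=
  fun z => zpow n z *: f z.

Section shift.
Variable k : nat.
Implicit Types f g : T -> 'cV[C]_k.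
Local Notation dot := (@L2dot R k).

Lemma L2_shift n f : L2 f -> L2 (shift n f).
Proof.
apply: (@L2_mulc _ _ 1); first exact: cm_zpow.
by apply: aeW => z; rewrite cn2_zpow.
Qed.

Lemma shiftD m n f : shift m (shift n f) = shift (m + n) f.
Proof. by apply/funext => z; rewrite /shift scalerA -zpowD. Qed.

Lemma shift0 f : shift 0 f = f.
Proof. by apply/funext => z; rewrite /shift zpow0 scale1r. Qed.

Lemma shiftK n f : shift (- n) (shift n f) = f.
Proof. by rewrite shiftD addNr shift0. Qed.

Lemma shiftNK n f : shift n (shift (- n) f) = f.
Proof. by rewrite shiftD addrN shift0. Qed.

Lemma shift_lin n (a : C) f g : shift n (a *: f + g) = a *: shift n f + shift n g.
Proof.
apply/funext => z; rewrite /shift.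
by change (zpow n z *: (a *: f z + g z) = a *: (zpow n z *: f z) + zpow n z *: g z);
  rewrite scalerDr !scalerA mulrC.
Qed.

Lemma shiftB n f g : shift n (f - g) = shift n f - shift n g.
Proof. by apply/funext => z; rewrite /shift /= scalerBr. Qed.

Lemma L2dot_shift n f g : dot (shift n f) g = dot f (shift (- n) g).
Proof.
apply: cint_ext => z; rewrite -/(hdot _ _) -/(hdot _ _) /shift hdotZ hdotZr conjc_zpow.
by rewrite opprK.
Qed.

Lemma L2dot_shift2 n f g : dot (shift n f) (shift n g) = dot f g.
Proof. by rewrite L2dot_shift shiftK. Qed.

Lemma qf_shift n f : qf dot (shift n f) = qf dot f.
Proof. by rewrite /qf L2dot_shift2. Qed.

Definition zvec (n : int) (i : 'I_k) : T -> 'cV[C]_k := fun z => zpow n z *: delta_mx i ord0.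

Lemma zvecE n i : zvec n i = shift n (fun=> delta_mx i ord0). Proof. by []. Qed.

Lemma L2_cst (x : 'cV[C]_k) : L2 (fun _ : T => x).
Proof. by apply/L2P; split; [exact: mm_cst|exact: rI_cst]. Qed.

Lemma L2_zvec n i : L2 (zvec n i).
Proof. by apply: L2_shift; exact: L2_cst. Qed.

Lemma hdot_delta (x : 'cV[C]_k) i : hdot x (delta_mx i ord0) = x i ord0.
Proof.
rewrite /hdot (bigD1 i) //= big1 => [|j ji]; first by rewrite mxE !eqxx conjc1 mulr1 addr0.
by rewrite mxE (negbTE ji) conjc0 mulr0.
Qed.

Lemma fourierE f n i : fourier (fun z => f z i ord0) n = dot f (zvec n i).
Proof.
apply: cint_ext => z; rewrite -/(hdot _ _) /zvec hdotZr hdot_delta conjc_zpow.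
by rewrite mulrC.
Qed.

Lemma cI_comp f i : L2 f -> cI (fun z => f z i ord0).
Proof.
move=> Lf; rewrite (_ : (fun z => _) = fun z => hdot (f z) (delta_mx i ord0)).
  by apply: cI_hdot => //; exact: L2_cst.
by apply/funext => z; rewrite hdot_delta.
Qed.

Lemma L2_fourier_eq0 f : L2 f -> (forall n i, dot f (zvec n i) = 0) -> qf dot f = 0.
Proof.
move=> Lf h; apply/(qf_eq0_ae Lf).
have : \forall z \ae mu, forall i, f z i ord0 = 0.
  apply: ae_all_fin => i; apply: fourier_null_eq0; first exact: cI_comp.
  by move=> n; rewrite -[RHS](h (- n) i) -fourierE /fourier opprK.
by apply: filterS => z hz; apply/matrixP => i j; rewrite ord1 hz mxE.
Qed.

Lemma H2E : @H2 R k = annih (@L2 R k) dot [set f | exists n i, n < 0 /\ f = zvec n i].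
Proof.
apply/seteqP; split=> f [Lf hf]; split => //.
  by move=> _ [n [i [n0 ->]]]; rewrite -fourierE; exact: hf.
move=> i j n n0; rewrite ord1 fourierE; apply: hf; by exists n, i.
Qed.

Let zvecL2 : [set f | exists n i, n < 0 /\ f = zvec n i] `<=` @L2 R k.
Proof. by move=> _ [n [i [_ ->]]]; exact: L2_zvec. Qed.

Lemma H2P f : H2 f <-> L2 f /\ forall n i, n < 0 -> dot f (zvec n i) = 0.
Proof.
rewrite H2E; split=> -[Lf h]; split => //.
  by move=> n i n0; apply: h; exists n, i.
by move=> _ [n [i [n0 ->]]]; exact: h.
Qed.

Lemma H2_L2 : @H2 R k `<=` @L2 R k. Proof. by move=> f []. Qed.

Lemma H2_sub : linsub (@H2 R k).
Proof. by rewrite H2E; exact: (annih_sub (L2_hform R k) zvecL2). Qed.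

Lemma H2_closed : qclosed (@L2 R k) dot (@H2 R k).
Proof. by rewrite H2E; exact: (annih_closed (L2_hform R k) zvecL2). Qed.

Lemma H2_shift (n : nat) f : H2 f -> H2 (shift n f).
Proof.
move=> /H2P[Lf hf]; apply/H2P; split; first exact: L2_shift.
move=> l i l0; rewrite L2dot_shift zvecE shiftD -zvecE hf //; lia.
Qed.

Lemma H2minus_sub : linsub (@H2minus R k).
Proof. exact: (annih_sub (L2_hform R k) H2_L2). Qed.

Lemma zvec_H2minus n i : n < 0 -> H2minus (zvec n i).
Proof.
move=> n0; split; first exact: L2_zvec.
move=> g /H2P[Lg hg]; rewrite (hformJ (L2_hform R k) Lg) ?hg ?conjc0 //.
exact: L2_zvec.
Qed.

Lemma H2_of_orth f : L2 f -> (forall g, H2minus g -> dot f g = 0) -> H2 f.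
Proof.
by move=> Lf h; apply/H2P; split => // n i n0; apply: h; exact: zvec_H2minus.
Qed.

Lemma H2minus_shift (n : nat) f : H2minus f -> H2minus (shift (- n%:Z) f).
Proof.
move=> [Lf hf]; split; first exact: L2_shift.
by move=> g Hg; rewrite L2dot_shift opprK hf //; exact: H2_shift.
Qed.

(** The existence of a projection rules out the default value in [orthproj]. *)
Lemma orthproj_spec (E : set (T -> 'cV[C]_k)) f : linsub E -> E `<=` @L2 R k ->
  qclosed (@L2 R k) dot E -> L2 f ->
  E (orthproj E f) /\ forall h, E h -> dot (f - orthproj E f) h = 0.
Proof.
move=> sE EL cE Lf; rewrite /orthproj.
case: xgetP => [g _ //|h].
have [s Es hs] := projection (L2_hform R k) (L2_complete (k := k)) sE EL cE Lf.
by case: (h s).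
Qed.

End shift.

Section dsum.
Variables m1 m2 : nat.
Implicit Types (f g : T -> 'cV[C]_(m1 + m2)).
Local Notation dot := (@L2dot R _).

Definition top f : T -> 'cV[C]_m1 := fun z => usubmx (f z).
Definition bot f : T -> 'cV[C]_m2 := fun z => dsubmx (f z).
Definition inl_fun (h : T -> 'cV[C]_m1) : T -> 'cV[C]_(m1 + m2) := fun z => col_mx (h z) 0.
Definition inr_fun (h : T -> 'cV[C]_m2) : T -> 'cV[C]_(m1 + m2) := fun z => col_mx 0 (h z).

Lemma hdot_col (x y : 'cV[C]_(m1 + m2)) :
  hdot x y = hdot (usubmx x) (usubmx y) + hdot (dsubmx x) (dsubmx y).
Proof.
rewrite /hdot big_split_ord /=; congr (_ + _); apply: eq_bigr => i _; by rewrite !mxE.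
Qed.

Lemma vn2_col (x : 'cV[C]_(m1 + m2)) : vn2 x = vn2 (usubmx x) + vn2 (dsubmx x).
Proof.
rewrite /vn2 big_split_ord /=; congr (_ + _); apply: eq_bigr => i _; by rewrite !mxE.
Qed.

Lemma mm_top f : mx_measurable f -> mx_measurable (top f).
Proof.
move=> hf i j; rewrite (_ : (fun z => _) = fun z => f z (lshift m2 i) j) //.
by apply/funext => z; rewrite mxE.
Qed.
Lemma mm_bot f : mx_measurable f -> mx_measurable (bot f).
Proof.
move=> hf i j; rewrite (_ : (fun z => _) = fun z => f z (rshift m1 i) j) //.
by apply/funext => z; rewrite mxE.
Qed.
Lemma mm_col (h1 : T -> 'cV[C]_m1) (h2 : T -> 'cV[C]_m2) :
  mx_measurable h1 -> mx_measurable h2 -> mx_measurable (fun z => col_mx (h1 z) (h2 z)).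
Proof.
move=> H1 H2 i j; case: (fintype.splitP i) => k ik.
  by have -> : i = lshift m2 k by [exact: val_inj]; under eq_fun do rewrite col_mxEu.
by have -> : i = rshift m1 k by [exact: val_inj]; under eq_fun do rewrite col_mxEd.
Qed.

Lemma L2_col f : L2 f <-> L2 (top f) /\ L2 (bot f).
Proof.
have E (g : T -> 'cV[C]_(m1 + m2)) z : g z = col_mx (top g z) (bot g z).
  by rewrite /top /bot vsubmxK.
split=> [/L2P[mf hf]|[/L2P[m1f h1f] /L2P[m2f h2f]]].
  split; apply/L2P.
    split; first exact: mm_top.
    apply: (rI_dom _ hf); first by apply: m_vn2; exact: mm_top.
    by move=> z; rewrite ger0_norm ?vn2_ge0 // vn2_col lerDl vn2_ge0.
  split; first exact: mm_bot.
  apply: (rI_dom _ hf); first by apply: m_vn2; exact: mm_bot.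
  by move=> z; rewrite ger0_norm ?vn2_ge0 // vn2_col lerDr vn2_ge0.
apply/L2P; split.
  by rewrite (_ : f = fun z => col_mx (top f z) (bot f z)); [exact: mm_col|exact/funext].
by under eq_fun do rewrite vn2_col; exact: rID.
Qed.

Lemma L2dot_col f g : L2 f -> L2 g -> dot f g = dot (top f) (top g) + dot (bot f) (bot g).
Proof.
move=> /L2_col[tf bf] /L2_col[tg bg]; rewrite !L2dotE -cintD; try exact: cI_hdot.
by apply: cint_ext => z; exact: hdot_col.
Qed.

Lemma top_inl h : top (inl_fun h) = h.
Proof. by apply/funext => z; rewrite /top col_mxKu. Qed.
Lemma bot_inl h : bot (inl_fun h) = 0.
Proof. by apply/funext => z; rewrite /bot col_mxKd. Qed.
Lemma top_inr h : top (inr_fun h) = 0.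
Proof. by apply/funext => z; rewrite /top col_mxKu. Qed.
Lemma bot_inr h : bot (inr_fun h) = h.
Proof. by apply/funext => z; rewrite /bot col_mxKd. Qed.

Lemma L2_inl h : L2 h -> L2 (inl_fun h).
Proof.
by move=> Lh; apply/L2_col; rewrite top_inl bot_inl; split => //; exact: sub0 (L2_sub R _).
Qed.
Lemma L2_inr h : L2 h -> L2 (inr_fun h).
Proof.
by move=> Lh; apply/L2_col; rewrite top_inr bot_inr; split => //; exact: sub0 (L2_sub R _).
Qed.

Lemma dot_inl f h : L2 f -> L2 h -> dot f (inl_fun h) = dot (top f) h.
Proof.
move=> Lf Lh; rewrite L2dot_col //; last exact: L2_inl.
rewrite top_inl bot_inl (hform0r (L2_hform R _)) ?addr0 //.
by have /L2_col[] := Lf.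
Qed.
Lemma dot_inr f h : L2 f -> L2 h -> dot f (inr_fun h) = dot (bot f) h.
Proof.
move=> Lf Lh; rewrite L2dot_col //; last exact: L2_inr.
rewrite top_inr bot_inr (hform0r (L2_hform R _)) ?add0r //.
by have /L2_col[] := Lf.
Qed.

Lemma dsum_annih (A : set (T -> 'cV[C]_m1)) : A `<=` @L2 R m1 ->
  dsum (annih (@L2 R m1) (@L2dot R m1) A) (@L2 R m2) =
  annih (@L2 R (m1 + m2)) (@L2dot R (m1 + m2)) [set inl_fun h | h in A].
Proof.
move=> AL; apply/seteqP; split=> f.
  move=> [[tf hf] bf]; split; first by apply/L2_col.
  by move=> _ [h Ah <-]; rewrite dot_inl ?hf //; [apply/L2_col|exact: AL].
move=> [Lf hf]; have /L2_col[tf bf] := Lf; split => //; split => // h Ah.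
by rewrite -dot_inl ?hf //; [exists h|exact: AL].
Qed.

Definition neg_zvec : set (T -> 'cV[C]_m1) := [set f | exists n i, n < 0 /\ f = zvec n i].

Lemma neg_zvec_L2 : neg_zvec `<=` @L2 R m1.
Proof. by move=> _ [n [i [_ ->]]]; exact: L2_zvec. Qed.

Lemma inl_L2 (A : set (T -> 'cV[C]_m1)) : A `<=` @L2 R m1 ->
  [set inl_fun h | h in A] `<=` @L2 R (m1 + m2).
Proof. by move=> AL _ [h Ah <-]; apply: L2_inl; exact: AL. Qed.

Lemma Gamma_domE : @Gamma_dom R m1 m2 =
  annih (@L2 R (m1 + m2)) (@L2dot R (m1 + m2)) [set inl_fun h | h in neg_zvec].
Proof. by rewrite -dsum_annih; [rewrite -H2E|exact: neg_zvec_L2]. Qed.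

Lemma Gamma_codE : @Gamma_cod R m1 m2 =
  annih (@L2 R (m1 + m2)) (@L2dot R (m1 + m2)) [set inl_fun h | h in @H2 R m1].
Proof. by rewrite -dsum_annih //; exact: H2_L2. Qed.

Lemma dom_sub : linsub (@Gamma_dom R m1 m2).
Proof. by rewrite Gamma_domE; exact: (annih_sub (L2_hform R _) (inl_L2 neg_zvec_L2)). Qed.
Lemma dom_L2 : @Gamma_dom R m1 m2 `<=` @L2 R _.
Proof. by rewrite Gamma_domE => f []. Qed.
Lemma dom_closed : qclosed (@L2 R _) (@L2dot R _) (@Gamma_dom R m1 m2).
Proof. by rewrite Gamma_domE; exact: (annih_closed (L2_hform R _) (inl_L2 neg_zvec_L2)). Qed.
Lemma cod_sub : linsub (@Gamma_cod R m1 m2).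
Proof. by rewrite Gamma_codE; exact: (annih_sub (L2_hform R _) (inl_L2 (@H2_L2 _))). Qed.
Lemma cod_L2 : @Gamma_cod R m1 m2 `<=` @L2 R _.
Proof. by rewrite Gamma_codE => f []. Qed.
Lemma cod_closed : qclosed (@L2 R _) (@L2dot R _) (@Gamma_cod R m1 m2).
Proof. by rewrite Gamma_codE; exact: (annih_closed (L2_hform R _) (inl_L2 (@H2_L2 _))). Qed.

Lemma top_shift n f : top (shift n f) = shift n (top f).
Proof. by apply/funext => z; rewrite /top /shift linearZ. Qed.
Lemma bot_shift n f : bot (shift n f) = shift n (bot f).
Proof. by apply/funext => z; rewrite /bot /shift linearZ. Qed.

Lemma dom_shift (n : nat) f : Gamma_dom f -> Gamma_dom (shift n f).
Proof.
move=> [h1 h2]; split; first by rewrite -/(top _) top_shift; exact: H2_shift.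
by rewrite -/(bot _) bot_shift; exact: L2_shift.
Qed.

Lemma cod_shift (n : nat) f : Gamma_cod f -> Gamma_cod (shift (- n%:Z) f).
Proof.
move=> [h1 h2]; split; first by rewrite -/(top _) top_shift; exact: H2minus_shift.
by rewrite -/(bot _) bot_shift; exact: L2_shift.
Qed.

Lemma cod_inr h : L2 h -> Gamma_cod (inr_fun h).
Proof.
move=> Lh; split; first by rewrite -/(top _) top_inr; exact: sub0 (@H2minus_sub _).
by rewrite -/(bot _) bot_inr.
Qed.

Lemma dom_inr h : L2 h -> Gamma_dom (inr_fun h).
Proof.
move=> Lh; split; first by rewrite -/(top _) top_inr; exact: sub0 (@H2_sub _).
by rewrite -/(bot _) bot_inr.
Qed.

Lemma cod_inl h : H2minus h -> Gamma_cod (inl_fun h).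
Proof.
move=> Hh; split; first by rewrite -/(top _) top_inl.
by rewrite -/(bot _) bot_inl; exact: sub0 (L2_sub R _).
Qed.

Lemma dom_inl h : H2 h -> Gamma_dom (inl_fun h).
Proof.
move=> Hh; split; first by rewrite -/(top _) top_inl.
by rewrite -/(bot _) bot_inl; exact: sub0 (L2_sub R _).
Qed.

(** Describes what Gamma discards from Phi f: an analytic upper part and nothing below. *)
Lemma orth_cod f : L2 f -> (forall h, Gamma_cod h -> dot f h = 0) ->
  H2 (top f) /\ \forall z \ae mu, bot f z = 0.
Proof.
move=> Lf hf; have /L2_col[Lt Lb] := Lf; split.
  apply: H2_of_orth => // g Hg; rewrite -dot_inl //; last exact: Hg.1.
  by apply: hf; exact: cod_inl.
by apply/(qf_eq0_ae Lb); rewrite /qf -dot_inr // hf //; exact: cod_inr.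
Qed.
End dsum.
End multipliers.

(** * Fourier series of vector functions *)

Section fourier_series.
Variable R : realType.
Local Notation C := R[i].
Local Notation T := (circle R).
Local Notation mu := (@arc_measure R).
Local Notation Re := (@complex.Re R).
Local Notation Im := (@complex.Im R).

Lemma de_moivre (n : nat) (t : R) :
  zpow n (cis t) = Complex (cos (n%:R * t)) (sin (n%:R * t)).
Proof.
elim: n => [|n IH]; first by rewrite zpow0 mul0r cos0 sin0.
rewrite -addn1 PoszD zpowD IH zpow1 natrD mulrDl mul1r cosD sinD.
by apply: complex_ext; rewrite /= ; ring.
Qed.

Lemma sin_natr_pi2 (n : nat) : sin (n%:R * (pi *+ 2)) = 0 :> R /\ cos (n%:R * (pi *+ 2)) = 1 :> R.
Proof.
elim: n => [|n [IHs IHc]]; first by rewrite mul0r sin0 cos0.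
by rewrite -natr1 mulrDl mul1r sinD2pi cosD2pi.
Qed.

Lemma cI_zpow1 n : cI (zpow n : T -> C).
Proof.
rewrite (_ : zpow n = fun z => 1 * zpow n z); last by apply/funext => z; rewrite mul1r.
by apply: cI_zpow; split; exact: rI_cst.
Qed.

Lemma ftc2_of_is_derive (F f : R -> R) (a b : R) : a < b -> continuous f ->
  (forall x : R, is_derive x (1 : R) F (f x)) ->
  \int[lebesgue_measure]_(x in `[a, b]) f x = F b - F a.
Proof.
move=> ab cf dF; rewrite /Rintegral (@continuous_FTC2 _ _ F) //=.
- exact: continuous_subspaceT.
- have cF : continuous F.
    by move=> x; apply: differentiable_continuous; apply/derivable1_diffP; have [] := dF x.
  split.
  + by move=> x _; have [] := dF x.
  + by apply: cvg_at_right_filter; exact: cF.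
  + by apply: cvg_at_left_filter; exact: cF.
- by move=> x _; rewrite derive1E; have [_ ->] := dF x.
Qed.

Lemma cint_zpow (n : int) : cintegral (zpow n : T -> C) = (n == 0)%:R.
Proof.
have pi20 := pi2_gt0 R.
have nat_case (k : nat) : (0 < k)%N -> cintegral (zpow k : T -> C) = 0.
  move=> k0; have kn0 : k%:R != 0 :> R by rewrite pnatr_eq0 -lt0n.
  have [i1 i2] := cI_zpow1 k.
  have [s2 c2] := sin_natr_pi2 k.
  have der1 (x : R) : is_derive x 1 (fun t : R => k%:R^-1 * sin (k%:R * t)) (cos (k%:R * x)).
    by apply: is_derive_eq; rewrite /GRing.scale /= mulr1 mulrCA mulVf // mulr1.
  have der2 (x : R) : is_derive x 1 (fun t : R => - k%:R^-1 * cos (k%:R * t)) (sin (k%:R * x)).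
    apply: is_derive_eq; rewrite /GRing.scale /= mulr1 !mulNr mulrN opprK.
    by rewrite mulrCA mulVf // mulr1.
  have cont1 : continuous (fun t : R => cos (k%:R * t)).
    by move=> x; apply: continuous_comp; [exact: mulrl_continuous|exact: continuous_cos].
  have cont2 : continuous (fun t : R => sin (k%:R * t)).
    by move=> x; apply: continuous_comp; [exact: mulrl_continuous|exact: continuous_sin].
  have hre : \int[lebesgue_measure]_(x in `[0, pi *+ 2]) Re (zpow k (cis x)) = 0.
    have -> : (fun x => Re (zpow k (cis x))) = (fun x : R => cos (k%:R * x)).
      by apply/funext => t; rewrite de_moivre.
    by rewrite (ftc2_of_is_derive pi20 cont1 der1) /= s2 !mulr0 sin0 mulr0 subrr.
  have him : \int[lebesgue_measure]_(x in `[0, pi *+ 2]) Im (zpow k (cis x)) = 0.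
    have -> : (fun x => Im (zpow k (cis x))) = (fun x : R => sin (k%:R * x)).
      by apply/funext => t; rewrite de_moivre.
    by rewrite (ftc2_of_is_derive pi20 cont2 der2) /= c2 mulr0 cos0 subrr.
  by rewrite cintE !rint_arc // hre him mulr0.
case: n => [[|k]|k].
- rewrite (@cint_ext _ _ (fun=> 1)) //; rewrite cintE /= rint_cst rint_cst.
  by [].
- by rewrite nat_case.
- rewrite (@cint_ext _ _ (fun z => conjc (zpow k.+1 z))).
    by rewrite cintJ; [rewrite nat_case // conjc0|exact: cI_zpow1].
  by move=> z; rewrite conjc_zpow NegzE.
Qed.

Section vectors.
Variable k : nat.
Implicit Types f g : T -> 'cV[C]_k.
Local Notation dot := (@L2dot R k).
Let hL := L2_hform R k.

Lemma zvec_dot n m (i j : 'I_k) : dot (zvec n i) (zvec m j) = ((n == m) && (i == j))%:R.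
Proof.
rewrite L2dotE (@cint_ext _ _ (fun z => (i == j)%:R * zpow (n - m) z)); last first.
  move=> z; rewrite /zvec hdotZ hdotZr hdot_delta mxE eqxx andbT conjc_zpow zpowD eq_sym.
  by ring.
rewrite cintZ ?cint_zpow; last exact: cI_zpow1.
by rewrite subr_eq0; case: eqP => _; case: eqP => _; rewrite /= ?mulr1 ?mulr0 // mul0r.
Qed.

Lemma cst_zvec (x : 'cV[C]_k) : (fun=> x) = \sum_(i < k) x i ord0 *: zvec 0 i :> (T -> 'cV[C]_k).
Proof.
apply/funext => z; rewrite fct_sumE; apply/matrixP => a b; rewrite ord1 summxE.
transitivity (\sum_(j < k) (x j ord0 *: delta_mx j ord0 : 'cV[C]_k) a ord0).
  rewrite (bigD1 a) //= big1 => [|j ja]; first by rewrite !mxE !eqxx mulr1 addr0.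
  by rewrite !mxE eq_sym (negbTE ja) mulr0.
apply: eq_bigr => j _.
change ((x j ord0 *: delta_mx j ord0 : 'cV[C]_k) a ord0 =
  (x j ord0 *: (zpow 0 z *: delta_mx j ord0) : 'cV[C]_k) a ord0).
by rewrite zpow0 scale1r.
Qed.

Lemma H2_zvec (n : nat) (i : 'I_k) : H2 (zvec n i : T -> 'cV[C]_k).
Proof.
by apply/H2P; split=> [|m j m0]; [exact: L2_zvec|rewrite zvec_dot; case: eqP => // e; lia].
Qed.

(* H2 is the closed span of the [zvec n i], [n >= 0]. *)
Lemma H2minus_of_fourier f : L2 f -> (forall (n : nat) i, dot f (zvec n i) = 0) -> H2minus f.
Proof.
move=> Lf hf; split => // g Hg.
pose P : set (T -> 'cV[C]_k) := [set h | exists (n : nat) i, h = zvec n i].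
have PL : P `<=` @L2 R k by move=> _ [n [i ->]]; exact: L2_zvec.
pose A := annih (@L2 R k) dot P.
have AL : A `<=` @L2 R k by exact: annihE.
(* The double annihilator serves as the closed span of P. For g in H^2, the difference between g and
   its projection on M has no Fourier coefficients left. *)
pose M := annih (@L2 R k) dot A.
have sM : linsub M by exact: (annih_sub hL AL).
have cM : qclosed (@L2 R k) dot M by exact: (annih_closed hL AL).
have [m Mm hm] := projection hL (@L2_complete R k) sM (@annihE _ _ _ _ _) cM Hg.1.
have Af : A f by split => // _ [n [i ->]].
have PM h : P h -> M h.
  move=> Ph; split; first exact: PL.
  by move=> a [La ha]; rewrite (hformJ hL La) ?ha ?conjc0 //; exact: PL.
have neg n i : n < 0 -> A (zvec n i).
  move=> n0; split; first exact: L2_zvec.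
  by move=> _ [l [j ->]]; rewrite zvec_dot; case: eqP => // e; lia.
have Hm : H2 m.
  by apply/H2P; split=> [|n i n0]; [exact: Mm.1|apply: Mm.2; exact: neg].
have Hw : H2 (g - m) by exact: (subB (@H2_sub R k)).
have w0 : qf dot (g - m) = 0.
  apply: L2_fourier_eq0; first exact: Hw.1.
  move=> n i; case: n => n; first by apply: hm; apply: PM; exists n, i.
  by have /H2P[_ ->] := Hw.
have -> : g = m + (g - m) by rewrite addrC subrK.
have -> : dot f (m + (g - m)) = dot f m + dot f (g - m).
  exact (hformDr hL Mm.1 Hw.1 Lf).
rewrite (hformJ hL (H2_L2 Hw) Lf) (hform_radical hL (H2_L2 Hw) Lf w0) conjc0 addr0.
by rewrite (hformJ hL Mm.1 Lf) (Mm.2 _ Af) conjc0.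
Qed.

Lemma H2_H2minus f g : H2 f -> H2minus g -> dot f g = 0.
Proof. by move=> Hf [Lg hg]; rewrite (hformJ hL Lg Hf.1) hg // conjc0. Qed.

(** The squared distance of two partial sums is a difference of partial sums of a bounded series
    with nonnegative terms. *)
Lemma riesz_fischer (c : nat -> 'I_k -> C) (M : R) :
  (forall K, \sum_(n < K) \sum_(i < k) cn2 (c n i) <= M) ->
  exists S, [/\ H2 S, forall (n : nat) i, dot S (zvec n i) = c n i & qf dot S <= M].
Proof.
move=> hM.
pose u K : T -> 'cV[C]_k := \sum_(n < K) \sum_(i < k) c n i *: zvec n i.
have Hu K : H2 (u K).
  apply: (sub_sum (@H2_sub R k)) => n _; apply: (sub_sum (@H2_sub R k)) => i _.
  by apply: (subZ (@H2_sub R k)); exact: H2_zvec.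
have Lu K := (Hu K).1.
have uz K (n : nat) i : dot (u K) (zvec n i) = (n < K)%N%:R * c n i.
  have Lin (m : nat) : L2 (\sum_(j < k) c m j *: zvec m j).
    by apply: (sub_sum (L2_sub R k)) => j _; apply: (subZ (L2_sub R k)); exact: L2_zvec.
  rewrite /u (hform_suml hL) => [|m _|]; [|exact: Lin|exact: L2_zvec].
  have inner (m : nat) : dot (\sum_(j < k) c m j *: zvec m j) (zvec n i) = (m == n)%:R * c n i.
    rewrite (hform_suml hL) => [|j _|]; [|by apply: (subZ (L2_sub R k)); exact: L2_zvec|exact: L2_zvec].
    transitivity (\sum_(j < k) c m j * ((m == n) && (j == i))%:R).
      apply: eq_bigr => j _; rewrite (hformZ hL); [|exact: L2_zvec|exact: L2_zvec].
      by rewrite zvec_dot.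
    rewrite (bigD1 i) //= eqxx andbT big1 => [|j ji].
      by case: (m =P n) => [->|mn]; rewrite ?addr0 ?mulr1 ?mul1r ?mulr0 ?mul0r.
    by rewrite (negbTE ji) andbF mulr0.
  under eq_bigr do rewrite inner.
  case: ltnP => nK; last first.
    by rewrite big1 ?mul0r // => m _; rewrite ltn_eqF ?mul0r //; exact: leq_trans (ltn_ord m) nK.
  rewrite (bigD1 (Ordinal nK)) //= eqxx big1 ?addr0 // => m mn.
  by rewrite -val_eqE /= in mn; rewrite (negbTE mn) mul0r.
have uu K L : (K <= L)%N -> qf dot (u L - u K) =
    \sum_(n < L) \sum_(i < k) cn2 (c n i) - \sum_(n < K) \sum_(i < k) cn2 (c n i).
  move=> KL.
  have dotu J f : L2 f -> Re (dot f (u J)) = \sum_(n < J) \sum_(i < k) Re (conjc (c n i) * dot f (zvec n i)).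
    move=> Lf; rewrite (hformJ hL (Lu J) Lf) ReJ /u (hform_suml hL) //; last first.
      move=> m _; apply: (sub_sum (L2_sub R k)) => j _.
      by apply: (subZ (L2_sub R k)); exact: L2_zvec.
    rewrite Re_sum; apply: eq_bigr => n _; rewrite (hform_suml hL) //; last first.
      by move=> j _; apply: (subZ (L2_sub R k)); exact: L2_zvec.
    rewrite Re_sum; apply: eq_bigr => i _; rewrite (hformZ hL) //; last exact: L2_zvec.
    by rewrite (hformJ hL Lf (L2_zvec R n i)) !ReImE; ring.
  have qu J : qf dot (u J) = \sum_(n < J) \sum_(i < k) cn2 (c n i).
    rewrite /qf dotu //; apply: eq_bigr => n _; apply: eq_bigr => i _.
    by rewrite uz ltn_ord mul1r mulJc.
  have cross : Re (dot (u L) (u K)) = qf dot (u K).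
    rewrite dotu // qu; apply: eq_bigr => n _; apply: eq_bigr => i _.
    by rewrite uz (leq_trans (ltn_ord n) KL) mul1r mulJc.
  by rewrite (qfB hL) // cross !qu; ring.
pose s K := \sum_(n < K) \sum_(i < k) cn2 (c n i).
have s0 n : 0 <= \sum_(i < k) cn2 (c n i) by apply: sumr_ge0 => i _; exact: cn2_ge0.
have smono K L : (K <= L)%N -> s K <= s L.
  move=> KL; rewrite -subr_ge0 -uu // (qf_ge0 hL) //; exact: (subB (L2_sub R k)).
have hs : has_sup [set s K | K in setT].
  by split; [exists (s 0%N); exists 0%N|exists M => _ [K _ <-]; exact: hM].
have uC : qcauchy dot u.
  move=> e e0; have [_ [N _ <-] hN] := sup_adherent e0 hs.
  exists N => p q hp hq.
  wlog pq : p q hp hq / (q <= p)%N.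
    move=> H; case: (leqP q p) => [|/ltnW] h; first exact: H.
    by rewrite (qfBC hL) //; exact: H.
  rewrite uu // -/(s p) -/(s q).
  have : s p <= sup [set s K | K in setT] by apply: ub_le_sup; [exact: (proj2 hs)|exists p].
  have := smono _ _ hq; lra.
have [S LS uS] := @L2_complete R k u Lu uC.
have HS : H2 S by exact: (H2_closed Hu LS uS).
exists S; split => //.
  move=> n i; apply: (qlim_form hL Lu LS (L2_zvec R n i) uS) => e e0.
  by exists n.+1 => K nK; rewrite uz nK mul1r subrr cn2_0 ltW.
have qM K : qf dot (u K) <= M.
  have u0 : u 0%N = 0 by rewrite /u big_ord0.
  have := uu 0%N K (leq0n K); rewrite u0 subr0 big_ord0 subr0 => ->.
  exact: hM.
apply/ler_addgt0Pr => e e0; have [N /(_ N (leqnn N)) hN] := qlim_qf hL Lu LS uS e0.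
by move: hN (qM N); rewrite ltr_norml => /andP[h1 h2]; lra.
Qed.
End vectors.
End fourier_series.

(** * Positivity tested on polynomials *)

Section test_functions.
Variable R : realType.
Local Notation C := R[i].
Local Notation T := (circle R).
Local Notation mu := (@arc_measure R).
Local Notation Re := (@complex.Re R).
Local Notation Im := (@complex.Im R).
Local Notation mfun f := (measurable_fun [set: T] f).

Lemma poly_bounded (a : {poly C}) : exists M : R, 0 <= M /\ forall z : T, cn2 a.[sval z] <= M.
Proof.
elim/poly_ind: a => [|a c [M [M0 hM]]]; first by exists 0; split => // z; rewrite horner0 cn2_0.
exists (2 * M + 2 * cn2 c); split; first by rewrite addr_ge0 ?mulr_ge0 ?cn2_ge0.
move=> z; rewrite hornerMXaddC; apply: le_trans (cn2D_le _ _) _.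
by rewrite cn2M cn2_circle mulr1 lerD2r ler_pM2l.
Qed.

Lemma rI_mul_poly (h : T -> R) (a : {poly C}) : rI h -> rI (fun z => h z * cn2 a.[sval z]).
Proof.
move=> hI; have [M [M0 hM]] := poly_bounded a.
apply: (@rI_dom _ _ (fun z => M * `|h z|)).
- by apply: measurable_funM; [exact: rI_meas|apply: m_cn2; exact: cm_horner].
- by apply: rIZ; rewrite /rI; apply: (integrable_norm hI).
- by move=> z; rewrite normrM mulrC ler_wpM2r // ger0_norm ?cn2_ge0.
Qed.

(* The functions [cn2 a] are dense enough among nonnegative test functions: with
   [w^2 = 1 + |h|], the multiples [w a z^-N] are dense in L2, hence approximate
   [w 1_(h > 0)]. *)
Lemma le0_of_polynomial_tests (h : T -> R) : rI h ->
  (forall a : {poly C}, rint (fun z => h z * cn2 a.[sval z]) <= 0) ->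
  \forall z \ae mu, h z <= 0.
Proof.
move=> hI hh; have mh := rI_meas hI.
pose w z := Num.sqrt (1 + `|h z|).
have w1 z : 0 < 1 + `|h z| by apply: ltr_wpDr.
have w2 z : w z ^+ 2 = 1 + `|h z| by rewrite sqr_sqrtr // ltW.
have wp z : 0 < w z by rewrite sqrtr_gt0.
have nhI : rI (fun z => `|h z|) by exact: (integrable_norm hI).
have w2I : rI (fun z => w z ^+ 2).
  by rewrite (_ : (fun z => _) = fun z => 1 + `|h z|); [apply: rID => //; exact: rI_cst|exact/funext].
have mw : mfun w.
  rewrite /w; apply: (measurableT_comp (continuous_measurable_fun (@sqrt_continuous R))).
  by apply: measurable_funD => //; exact: measurableT_comp.
have cmw : cmeasurable (fun z => (w z)%:C%C) by exact: cmR.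
pose dot := @L2dot R 1; have hL := L2_hform R 1.
pose S : set (T -> 'cV[C]_1) :=
  [set f | exists2 p, trigpoly p & forall z, f z = ((w z)%:C%C * p z)%:M].
have sclE (c d : C) : (c%:M : 'cV[C]_1) ord0 ord0 = c by rewrite mxE eqxx.
have vn2M (c : C) : vn2 (c%:M : 'cV[C]_1) = cn2 c by rewrite /vn2 big_ord1 mxE eqxx.
have mmM (c : T -> C) : cmeasurable c -> mx_measurable (fun z => (c z)%:M : 'cV[C]_1).
  move=> mc i j; rewrite !ord1 (_ : (fun z => _) = c) //.
  by apply/funext => z; rewrite mxE.
have SL : S `<=` @L2 R 1.
  move=> f [p pt hf]; apply/L2P; split.
    rewrite (_ : f = fun z => ((w z)%:C%C * p z)%:M); last exact/funext.
    by apply: mmM; apply: cmM => //; exact: cm_trigpoly.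
  have [a [N hp]] := pt.
  rewrite (_ : (fun z => _) = fun z => w z ^+ 2 * cn2 a.[sval z]).
    exact: rI_mul_poly.
  by apply/funext => z; rewrite hf vn2M cn2M cn2R hp cn2M cn2_zpow mul1r.
have sS : linsub S.
  split; first by exists (fun=> 0); [exact: trigpoly_cst|move=> z; rewrite mulr0 raddf0].
  move=> c f g [p pt hf] [r rt hg]; exists (fun z => c * p z + r z).
    by apply: trigpolyD => //; apply: trigpolyM => //; exact: trigpoly_cst.
  move=> z; change (c *: f z + g z = ((w z)%:C%C * (c * p z + r z))%:M).
  by rewrite hf hg scale_scalar_mx -raddfD /=; congr (_ %:M); ring.
pose x : T -> 'cV[C]_1 := fun z => ((w z)%:C%C * (0 < h z)%R%:R)%:M.
have mpos : mfun (fun z => (0 < h z)%R%:R : R).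
  rewrite (_ : (fun z => _) = \1_[set z | 0 < h z]); last first.
    by apply/funext => z; rewrite indicE mem_setE.
  apply: measurable_indic; rewrite (_ : [set z | _] = [set: T] `&` h @^-1` `]0, +oo[).
    by apply: mh => //; exact: measurable_itv.
  by apply/seteqP; split=> z /=; rewrite in_itv /= andbT; [|case].
have cpos : cmeasurable (fun z => (0 < h z)%R%:R).
  rewrite (_ : (fun z => _) = fun z => ((0 < h z)%R%:R : R)%:C%C); first exact: cmR.
  by apply/funext => z; case: (0 < h z).
have Lx : L2 x.
  apply/L2P; split; first by apply: mmM; exact: cmM.
  apply: (rI_dom _ w2I); first by apply: m_vn2; apply: mmM; exact: cmM.
  move=> z; rewrite ger0_norm ?vn2_ge0 // vn2M cn2M cn2R ler_piMr ?sqr_ge0 //.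
  by case: (0 < h z); rewrite ?cn2_1 ?cn2_0.
have dense : forall y, L2 y -> (forall s, S s -> dot y s = 0) -> qf dot y = 0.
  move=> y Ly hy; apply/(qf_eq0_ae Ly).
  have Lw : L2 (fun z => (w z)%:C%C%:M : 'cV[C]_1).
    apply: SL; exists (fun=> 1); first exact: trigpoly_cst.
    by move=> z; rewrite mulr1.
  have yw : cI (fun z => y z ord0 ord0 * (w z)%:C%C).
    rewrite (_ : (fun z => _) = fun z => hdot (y z) ((w z)%:C%C%:M)); first exact: cI_hdot.
    by apply/funext => z; rewrite /hdot big_ord1 mxE eqxx mulr1n conjcR.
  have := fourier_null_eq0 yw.
  have F0 : fourier_null (fun z => y z ord0 ord0 * (w z)%:C%C).
    move=> n; rewrite -[RHS](hy (fun z => ((w z)%:C%C * zpow (- n) z)%:M)); last first.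
      by exists (zpow (- n)) => //; exact: trigpoly_zpow.
    apply: cint_ext => z; rewrite big_ord1 mxE eqxx mulr1n conjcM conjcR conjc_zpow opprK.
    by rewrite mulrA.
  move=> /(_ F0); apply: filterS => z /eqP; rewrite mulf_eq0 => /orP[/eqP y0|/eqP[w0]].
    by apply/matrixP => i j; rewrite !ord1 y0 mxE.
  by have := wp z; rewrite w0 ltxx.
pose hp z := h z * (0 < h z)%R%:R.
have hpI : rI hp.
  apply: (rI_dom _ nhI); first exact: measurable_funM.
  by move=> z; rewrite /hp; case: ltrP => _; rewrite ?mulr1 ?mulr0 ?normr0.
have hp0 z : 0 <= hp z by rewrite /hp; case: ltrP => h0; rewrite ?mulr1 ?mulr0 // ltW.
suff hp00 : rint hp = 0.
  have := rint_eq0 hpI (aeW _ hp0) hp00; apply: filterS => z.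
  by rewrite /hp; case: ltrP => // h0; rewrite mulr1 => e; rewrite e ltxx in h0.
apply/eqP; rewrite eq_le rint_ge0 ?andbT //; last exact: aeW.
apply: (@le_eps _ _ _ 2) => // e e0 _; rewrite add0r.
have [s [p [a [N pE]] hs] xs] := dense_of_orthogonal hL (@L2_complete R 1) sS SL dense Lx e0.
have Ls : L2 s by apply: SL; exists p => //; exists a, N.
have xsI : rI (fun z => vn2 (x z - s z)) by exact: (L2_rI (subB (L2_sub R 1) Lx Ls)).
have haI := rI_mul_poly a hI.
(* Pointwise, h^+ <= 2 h |p|^2 + 2 |x - s|^2: where h > 0 this is 1 <= 2 |p|^2 + 2 |1 - p|^2, and
   where h <= 0 the weight w^2 = 1 + |h| compensates the negative term. *)
apply: (@le_trans _ _ (2 * rint (fun z => h z * cn2 a.[sval z]) + 2 * rint (fun z => vn2 (x z - s z)))).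
  rewrite -!rintZ // -rintD; [|exact: rIZ|exact: rIZ].
  apply: rint_le => //; first by apply: rID; exact: rIZ.
  apply: aeW => z; rewrite /hp hs /x -raddfB /= vn2M -mulrBr cn2M cn2R w2.
  have -> : cn2 a.[sval z] = cn2 (p z) by rewrite pE cn2M cn2_zpow mul1r.
  case: ltrP => h0.
    have := cn2D_le (1 - p z) (p z); rewrite subrK cn2_1 mulr1 gtr0_norm //.
    have := cn2_ge0 (1 - p z); move: (cn2 (1 - p z)) (cn2 (p z)) => u v u0 h1; nra.
  rewrite mulr0 sub0r cn2N ler0_norm //.
  by have := cn2_ge0 (p z); move: (cn2 (p z)) => u u0; nra.
have := hh a; move: xs; rewrite qfL2 => /ltW; rewrite -/dot.
by move: (rint _) => u; move: (rint _) => v; lra.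
Qed.

Lemma rational_vector_dense n (v : 'cV[C]_n) (e : R) : 0 < e ->
  exists r : {ffun 'I_n -> rat * rat},
    vn2 ((\col_i Complex (ratr (r i).1) (ratr (r i).2)) - v) <= e ^+ 2.
Proof.
move=> e0; pose d := e / (2 * n%:R + 1).
have n1 : 0 < 2 * n%:R + 1 :> R by apply: ltr_wpDl => //; rewrite mulr_ge0.
have d0 : 0 < d by apply: divr_gt0.
have approx (x : R) : exists q : rat, `|ratr q - x| < d.
  have [|q] := @rat_in_itvoo R (x - d) (x + d); first by lra.
  by rewrite in_itv /= => /andP[h1 h2]; exists q; rewrite ltr_norml; lra.
have /choice[f hf] : forall x : R, exists q : rat, `|ratr q - x| < d by [].
exists [ffun i => (f (Re (v i ord0)), f (Im (v i ord0)))].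
apply: (@le_trans _ _ (\sum_(i < n) 2 * d ^+ 2)).
  apply: ler_sum => i _; rewrite !mxE ffunE /= /cn2 ReB ImB /=.
  have := hf (Re (v i ord0)); have := hf (Im (v i ord0)).
  move=> h1 h2; have sq (y : R) : `|y| < d -> y ^+ 2 <= d ^+ 2.
    by move=> h; rewrite -(real_normK (num_real y)) lerXn2r ?nnegrE ?normr_ge0 // ltW.
  by have := sq _ h1; have := sq _ h2; lra.
rewrite sumr_const card_ord -[leLHS]mulr_natl /d expr_div_n.
have n0 : 0 <= n%:R :> R by [].
rewrite mulrCA !mulrA ler_pdivrMr ?exprn_gt0 //.
rewrite -mulrA -expr2 mulrC ler_wpM2l ?sqr_ge0 //.
by move: n0; move: (n%:R : R) => N N0; nra.
Qed.

(** The exceptional null set depends on v. Countably many rational vectors share one null set, and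
    at a fixed z the quadratic form is continuous in v. *)
Lemma ae_psd n (K : T -> 'M[C]_n) :
  (forall v : 'cV[C]_n, \forall z \ae mu, 0 <= Re (hdot (K z *m v) v)) ->
  \forall z \ae mu, forall v : 'cV[C]_n, 0 <= Re (hdot (K z *m v) v).
Proof.
move=> hK; pose rv (r : {ffun 'I_n -> rat * rat}) : 'cV[C]_n :=
  \col_i Complex (ratr (r i).1) (ratr (r i).2).
have := ae_all_count (fun r => hK (rv r)); apply: filterS => z hz v.
pose M := \sum_(i < n) \sum_(j < n) cn2 (K z i j).
have M0 : 0 <= M by apply: sumr_ge0 => i _; apply: sumr_ge0 => j _; exact: cn2_ge0.
have Re_cs (x y : 'cV[C]_n) : Re (hdot x y) <= vnorm x * vnorm y.
  rewrite (le_trans (ler_norm _)) // sqr_le_abs ?mulr_ge0 ?vnorm_ge0 //.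
  by rewrite exprMn !sqr_vnorm; apply: le_trans (sqr_Re_le _) (hdot_cs _ _).
pose c := vnorm (K z *m v) + Num.sqrt M * vnorm v + Num.sqrt M.
have c0 : 0 <= c by rewrite !addr_ge0 ?mulr_ge0 ?vnorm_ge0 ?sqrtr_ge0.
apply: (@le_eps _ _ _ c) => // e e0 e1.
have [r hr] := rational_vector_dense v e0.
have := hz r; rewrite -/(rv r) in hr *.
have -> : rv r = v + (rv r - v) by rewrite addrC subrK.
move: hr; move: (rv r - v) => d hd.
have dn : vnorm d <= e by rewrite vnorm_le // ltW.
have Kd : vnorm (K z *m d) <= Num.sqrt M * e.
  rewrite vnorm_le ?mulr_ge0 ?sqrtr_ge0 ?(ltW e0) // exprMn sqr_sqrtr //.
  by apply: le_trans (vn2_mulmx_le _ _) _; rewrite ler_wpM2l.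
rewrite mulmxDr hdotD !hdotDr !ReD => h; apply: (le_trans h).
have h1 := Re_cs (K z *m v) d; have h2 := Re_cs (K z *m d) v; have h3 := Re_cs (K z *m d) d.
have v0 := vnorm_ge0 v; have kv0 := vnorm_ge0 (K z *m v); have sM := sqrtr_ge0 M.
have d0 := vnorm_ge0 d.
have g1 : vnorm (K z *m v) * vnorm d <= vnorm (K z *m v) * e by rewrite ler_wpM2l.
have g2 : vnorm (K z *m d) * vnorm v <= Num.sqrt M * e * vnorm v by rewrite ler_wpM2r.
have g3 : vnorm (K z *m d) * vnorm d <= Num.sqrt M * e * 1.
  by apply: ler_pM => //; [exact: vnorm_ge0|exact: le_trans dn e1].
rewrite /c mulrDl mulrDl; move: g1 g2 g3 h1 h2 h3.
have -> : Num.sqrt M * vnorm v * e = Num.sqrt M * e * vnorm v by ring.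
by rewrite mulr1 => *; lra.
Qed.
End test_functions.

Local Notation "F '\*m' f" := (fun z => F z *m f z) (at level 40, left associativity).

(** * Multiplication by bounded analytic functions *)

Section analytic_multipliers.
Variable R : realType.
Local Notation C := R[i].
Local Notation T := (circle R).
Local Notation mu := (@arc_measure R).
Local Notation Re := (@complex.Re R).

Lemma L2dot_mx_zvec m n (F : T -> 'M[C]_(m, n)) (k l : int) i j :
  L2dot (F \*m zvec l j) (zvec k i) = fourier (fun z => F z i j) (k - l).
Proof.
apply: cint_ext => z; rewrite -/(hdot _ _) /zvec hdotZr hdot_delta -scalemxAr mxE conjc_zpow.
have -> : (F z *m (delta_mx j ord0 : 'cV[C]_n)) i ord0 = F z i j.
  rewrite mxE (bigD1 j) //= mxE !eqxx mulr1 big1 ?addr0 // => a aj.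
  by rewrite mxE (negbTE aj) mulr0.
by rewrite -/(zpow _ z) opprB addrC zpowD; ring.
Qed.

(** By duality it suffices that Q^* maps z^k e_i, k < 0, into H^2_-; tested on exponentials, this
    involves only the coefficients of Q of negative index. *)
Lemma H2_mulmx m n (Q : T -> 'M[C]_(m, n)) h : Hinf Q -> H2 h -> H2 (Q \*m h).
Proof.
move=> [LQ aQ] Hh; apply/H2P; split; first by apply: L2_mulmx => //; exact: Hh.1.
move=> k i k0; rewrite L2dot_adj; apply: H2_H2minus => //.
have Lw : L2 ((fun z => adj (Q z)) \*m zvec k i) by apply: L2_mulmx; [exact: Linf_adj|exact: L2_zvec].
apply: H2minus_of_fourier => // l j.
rewrite L2dot_adj (hformJ (L2_hform R _)); last exact: L2_zvec.
- under eq_fun do rewrite adjK.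
  by rewrite L2dot_mx_zvec aQ ?conjc0 //; lia.
- by under eq_fun do rewrite adjK; apply: L2_mulmx => //; exact: L2_zvec.
Qed.

Lemma mulmx_shift m n (F : T -> 'M[C]_(m, n)) k f : F \*m shift k f = shift k (F \*m f).
Proof. by apply/funext => z; rewrite /shift scalemxAr. Qed.

Lemma mulmx_lin m n (F : T -> 'M[C]_(m, n)) (a : C) (f g : T -> 'cV[C]_n) :
  F \*m (a *: f + g) = a *: (F \*m f) + (F \*m g).
Proof.
apply/funext => z; change (F z *m (a *: f z + g z) = a *: (F z *m f z) + F z *m g z).
by rewrite mulmxDr scalemxAr.
Qed.

Lemma mulmxfB m n (F : T -> 'M[C]_(m, n)) (f g : T -> 'cV[C]_n) :
  F \*m (f - g) = (F \*m f) - (F \*m g).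
Proof. by apply/funext => z; rewrite mulmxBr. Qed.

End analytic_multipliers.

Arguments inl_fun {R m1 m2} h.
Arguments inr_fun {R m1 m2} h.

(** * The four block operator *)

Section gamma.
Variable R : realType.
Local Notation C := R[i].
Local Notation T := (circle R).
Local Notation mu := (@arc_measure R).
Local Notation Re := (@complex.Re R).
Variables (m1 m2 n1 n2 : nat).
Implicit Types (Q : T -> 'M[C]_(m1, n1)).
Local Notation dom := (@Gamma_dom R n1 n2).
Local Notation cod := (@Gamma_cod R m1 m2).
Let hD := L2_hform R (n1 + n2).
Let hC := L2_hform R (m1 + m2).
Local Notation dotD := (@L2dot R (n1 + n2)).
Local Notation dotC := (@L2dot R (m1 + m2)).

(* Sealed, since unification would otherwise unfold the projection. *)
Definition gam (Phi : T -> 'M[C]_(m1 + m2, n1 + n2)) := locked (Gamma Phi).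

Lemma L2dot_shift_zvec k l (f : T -> 'cV[C]_k) n i :
  L2dot (shift l f) (zvec n i) = L2dot f (zvec (n - l) i).
Proof. by rewrite L2dot_shift zvecE shiftD -zvecE addrC. Qed.

Section fixed_symbol.
Variable Phi : T -> 'M[C]_(m1 + m2, n1 + n2).
Hypothesis hPhi : Linf Phi.
Local Notation G := (gam Phi).
Implicit Types f g : T -> 'cV[C]_(n1 + n2).

Lemma Gamma_spec f : L2 f -> cod (G f) /\ forall h, cod h -> dotC ((Phi \*m f) - G f) h = 0.
Proof.
move=> Lf; rewrite /gam -lock; apply: orthproj_spec; [exact: cod_sub|exact: cod_L2|exact: cod_closed|].
exact: L2_mulmx.
Qed.

Lemma Gamma_in_cod f : L2 f -> cod (G f). Proof. by move=> /Gamma_spec[]. Qed.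

Lemma L2_Gamma f : L2 f -> L2 (G f). Proof. by move=> /Gamma_in_cod /cod_L2. Qed.

Lemma L2_PhiB f : L2 f -> L2 ((Phi \*m f) - G f).
Proof. by move=> Lf; apply: (subB (L2_sub R _)); [exact: L2_mulmx|exact: L2_Gamma]. Qed.

Lemma Gamma_residual f : L2 f ->
  H2 (top ((Phi \*m f) - G f)) /\ \forall z \ae mu, bot ((Phi \*m f) - G f) z = 0.
Proof. by move=> Lf; apply: orth_cod; [exact: L2_PhiB|exact: (Gamma_spec Lf).2]. Qed.

(** Gamma is known only up to null sets, so identities such as linearity and the shift formula are
    derived through this characterization. *)
Lemma Gamma_unique f (g : T -> 'cV[C]_(m1 + m2)) : L2 f -> cod g ->
  (forall h, cod h -> dotC ((Phi \*m f) - g) h = 0) -> \forall z \ae mu, G f z = g z.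
Proof.
move=> Lf cg hg; have [cG hG] := Gamma_spec Lf.
have LG := cod_L2 cG; have Lg := cod_L2 cg.
have LP : L2 (Phi \*m f) by exact: L2_mulmx.
apply: L2_ae_of_qf => //.
have cd : cod (G f - g) by exact: (subB (@cod_sub R m1 m2)).
have Ld := cod_L2 cd.
have e1 := hG _ cd; have e2 := hg _ cd.
rewrite (hformB hC LP LG Ld) in e1; rewrite (hformB hC LP Lg Ld) in e2.
rewrite /qf (hformB hC LG Lg Ld); apply/eqP.
by rewrite (_ : _ - _ = 0) //; rewrite -[RHS](subrr 0) -{1}e2 -{1}e1; ring.
Qed.

Lemma Gamma_lin (a : C) f g : L2 f -> L2 g ->
  \forall z \ae mu, G (a *: f + g) z = (a *: G f + G g) z.
Proof.
move=> Lf Lg; have [cf hf] := Gamma_spec Lf; have [cg hg] := Gamma_spec Lg.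
apply: Gamma_unique; [exact: (subL (L2_sub R _))|exact: (subL (@cod_sub R m1 m2))|].
move=> h ch; rewrite mulmx_lin.
have -> : a *: (Phi \*m f) + (Phi \*m g) - (a *: G f + G g) =
    a *: ((Phi \*m f) - G f) + ((Phi \*m g) - G g).
  by rewrite scalerBr opprD addrACA.
have Lh := cod_L2 ch; rewrite (hformL hC a (L2_PhiB Lf) (L2_PhiB Lg) Lh).
by rewrite (hf _ ch) (hg _ ch) mulr0 addr0.
Qed.

Lemma Gamma_dot_lin h : L2 h -> lin (@L2 R _) (fun f => dotC (G f) h).
Proof.
move=> Lh a f g Lf Lg; rewrite -(hformL hC) //; try exact: L2_Gamma.
have ae := Gamma_lin a Lf Lg.
have L1 := L2_Gamma (subL (L2_sub R _) a Lf Lg).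
have L2' := subL (L2_sub R _) a (L2_Gamma Lf) (L2_Gamma Lg).
exact (L2dot_ae L1 L2' Lh Lh ae (aeW mu (fun z => erefl (h z)))).
Qed.

Lemma dot_GammaJ f g : L2 f -> L2 g -> dotC (G g) (G f) = conjc (dotC (G f) (G g)).
Proof. by move=> Lf Lg; apply: (hformJ hC); exact: L2_Gamma. Qed.

Lemma Gamma_hform : hform (@L2 R _) (fun f g => dotC (G f) (G g)).
Proof.
split; first exact: L2_sub.
- by move=> a x y z Lx Ly Lz; apply: Gamma_dot_lin => //; exact: L2_Gamma.
- by move=> x y Lx Ly; exact: dot_GammaJ.
- by move=> x Lx; apply: (hform_ge0 hC); exact: L2_Gamma.
Qed.

Lemma GammaB f g : L2 f -> L2 g -> \forall z \ae mu, G (f - g) z = (G f - G g) z.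
Proof.
move=> Lf Lg; have := Gamma_lin (-1) Lg Lf; rewrite !scaleN1r.
by rewrite [- g + f]addrC [- G g + G f]addrC.
Qed.

Lemma qf_Gamma_split f : L2 f ->
  qf dotC (Phi \*m f) = qf dotC (G f) + qf dotC ((Phi \*m f) - G f).
Proof.
move=> Lf; have [cf hf] := Gamma_spec Lf.
have LG := L2_Gamma Lf; have Lr := L2_PhiB Lf; have h0 := hf _ cf.
have e : Phi \*m f = (Phi \*m f) - G f + G f by rewrite subrK.
rewrite [in LHS]e; move: Lr h0; move: ((Phi \*m f) - G f) => r Lr h0.
by rewrite (qfD hC) // h0 /= mulr0 addr0 addrC.
Qed.

Lemma qf_Gamma_le f : L2 f -> qf dotC (G f) <= qf dotC (Phi \*m f).
Proof. by move=> Lf; rewrite (qf_Gamma_split Lf) lerDl (qf_ge0 hC (L2_PhiB Lf)). Qed.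

(* The coefficients lost when [G f] is multiplied by z. *)
Definition gcoef f (i : 'I_m1) : C := dotC (G f) (inl_fun (zvec (-1) i)).

Lemma gcoefE f i : L2 f -> gcoef f i = L2dot (top (G f)) (zvec (-1) i).
Proof. by move=> Lf; rewrite /gcoef dot_inl //; [exact: L2_Gamma|exact: L2_zvec]. Qed.

Let xs : 'I_m1 -> T -> 'cV[C]_(m1 + m2) := fun i => inl_fun (zvec 0 i).

Let Lxs i : L2 (xs i). Proof. by apply: L2_inl; exact: L2_zvec. Qed.

Let Lsum f : L2 (\sum_i gcoef f i *: xs i).
Proof. by apply: (sub_sum (L2_sub R _)) => i _; apply: (subZ (L2_sub R _)). Qed.

(** Multiplication by z moves the coefficients of index -1 of the upper part to index 0, that is,
    out of H^2_-; they are subtracted. *)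
Lemma Gamma_shift f : L2 f ->
  \forall z \ae mu, G (shift 1 f) z = (shift 1 (G f) - \sum_i gcoef f i *: xs i) z.
Proof.
move=> Lf; have [cf hf] := Gamma_spec Lf; have LG := L2_Gamma Lf.
have [Ht _] := cf.
have Lg : L2 (shift 1 (G f) - \sum_i gcoef f i *: xs i).
  by apply: (subB (L2_sub R _)) => //; exact: L2_shift.
have dotx h : L2 h -> dotC (\sum_i gcoef f i *: xs i) h = \sum_i gcoef f i * dotC (xs i) h.
  move=> Lh; rewrite (hform_suml hC) => // [|i _]; last by apply: (subZ (L2_sub R _)).
  by apply: eq_bigr => i _; rewrite (hformZ hC).
apply: Gamma_unique; first exact: L2_shift.
  split; last by have /L2_col[] := Lg.
  apply: H2minus_of_fourier; first by have /L2_col[] := Lg.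
  move=> n i; rewrite -/(top _) -dot_inl //; last exact: L2_zvec.
  have Lz := L2_inl m2 (L2_zvec R n i).
  rewrite (hformB hC) //; last exact: L2_shift.
  rewrite (dotx _ Lz).
  rewrite dot_inl; [|exact: L2_shift|exact: L2_zvec].
  rewrite top_shift L2dot_shift_zvec.
  have xz j : dotC (xs j) (inl_fun (zvec n i)) = ((0 == n%:Z) && (j == i))%:R.
    rewrite dot_inl; [|exact: Lxs|exact: L2_zvec].
    by rewrite /xs top_inl zvec_dot.
  have -> : \sum_j gcoef f j * dotC (xs j) (inl_fun (zvec n i)) =
      (0 == n%:Z)%:R * gcoef f i.
    rewrite (bigD1 i isT) big1 => [|j /negbTE ji].
      by rewrite xz eqxx andbT Monoid.mulm1 mulrC.
    by rewrite xz ji andbF mulr0.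
  case: (n) => [|k]; first by rewrite eqxx mul1r -(gcoefE i Lf) subrr.
  rewrite mul0r subr0 (_ : k.+1%:Z - 1 = k); last by lia.
  by apply: Ht.2; exact: H2_zvec.
move=> h ch; rewrite mulmx_shift.
have -> : shift 1 (Phi \*m f) - (shift 1 (G f) - \sum_i gcoef f i *: xs i) =
    shift 1 ((Phi \*m f) - G f) + \sum_i gcoef f i *: xs i.
  by rewrite shiftB opprB addrCA addrC.
have Lh := cod_L2 ch.
rewrite (hformD hC) //; last by apply: L2_shift; exact: L2_PhiB.
rewrite L2dot_shift (hf _ (cod_shift 1 ch)) add0r (dotx _ Lh).
rewrite big1 // => i _; rewrite (hformJ hC Lh (Lxs i)) dot_inl //; last exact: L2_zvec.
have [Hh _] := ch.
by rewrite Hh.2 ?conjc0 ?mulr0 //; exact: (H2_zvec R 0 i).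
Qed.

Lemma qf_Gamma_shift f : L2 f ->
  qf dotC (G (shift 1 f)) = qf dotC (G f) - \sum_i cn2 (gcoef f i).
Proof.
move=> Lf; have LG := L2_Gamma Lf.
have Lsf : L2 (shift 1 f) by exact: L2_shift.
have Lr : L2 (shift 1 (G f) - \sum_i gcoef f i *: xs i).
  by apply: (subB (L2_sub R _)) => //; exact: L2_shift.
have -> : qf dotC (G (shift 1 f)) = qf dotC (shift 1 (G f) - \sum_i gcoef f i *: xs i).
  rewrite /qf; congr Re; have ae := Gamma_shift Lf.
  by apply: (L2dot_ae _ _ _ _ ae ae) => //; exact: L2_Gamma.
rewrite (qfB hC) ?qf_shift //; last exact: L2_shift.
have dxx h : L2 h -> dotC h (\sum_i gcoef f i *: xs i) = \sum_i conjc (gcoef f i) * dotC h (xs i).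
  move=> Lh; rewrite (hformJ hC) // (hform_suml hC) => // [|i _]; last by apply: (subZ (L2_sub R _)).
  rewrite conjc_sum; apply: eq_bigr => i _; rewrite (hformZ hC) // conjcM.
  by rewrite -(hformJ hC).
have e1 : Re (dotC (shift 1 (G f)) (\sum_i gcoef f i *: xs i)) = \sum_i cn2 (gcoef f i).
  rewrite dxx; last exact: L2_shift.
  rewrite Re_sum; apply: eq_bigr => i _.
  rewrite L2dot_shift.
  have -> : shift (- 1) (xs i) = inl_fun (zvec (-1) i).
    apply/funext => z; rewrite /shift /xs /inl_fun /zvec zpow0 scale1r.
    by rewrite scale_col_mx scaler0.
  by rewrite mulJc.
have e2 : qf dotC (\sum_i gcoef f i *: xs i) = \sum_i cn2 (gcoef f i).
  rewrite /qf dxx // Re_sum; apply: eq_bigr => i _.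
  rewrite (hform_suml hC) => // [|j _]; last by apply: (subZ (L2_sub R _)).
  rewrite (bigD1 i isT) big1 => [|j /negbTE ji].
    rewrite (hformZ hC) // dot_inl; [|exact: Lxs|exact: L2_zvec].
    by rewrite /xs top_inl zvec_dot !eqxx mulr1 Monoid.mulm1 mulJc.
  rewrite (hformZ hC) // dot_inl; [|exact: Lxs|exact: L2_zvec].
  by rewrite /xs top_inl zvec_dot ji andbF mulr0.
by rewrite e1 e2; ring.
Qed.

Definition wform (W : T -> 'M[C]_(n1 + n2)) f g : C := dotD (W \*m f) g - dotC (G f) (G g).

Definition admissible (W : T -> 'M[C]_(n1 + n2)) :=
  [/\ Linf W, forall z, adj (W z) = W z & forall f, dom f -> 0 <= qf (wform W) f].

Lemma wform_hform W : admissible W -> hform dom (wform W).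
Proof.
move=> [LW aW pW]; have sD := @dom_L2 R n1 n2; split; first exact: dom_sub.
- move=> a x y z /sD Lx /sD Ly /sD Lz.
  rewrite /wform mulmx_lin (hformL hD) //; try exact: L2_mulmx.
  rewrite (Gamma_dot_lin (L2_Gamma Lz) a Lx Ly).
  move: (dotD _ _) (dotD _ _) (dotC _ _) (dotC _ _) => b1 b2 b3 b4; ring.
- move=> x y /sD Lx /sD Ly; rewrite /wform conjcB -dot_GammaJ //; congr (_ - _).
  rewrite -(hformJ hD) //; last exact: L2_mulmx.
  by rewrite L2dot_adj; congr L2dot; apply/funext => z; rewrite aW.
- by move=> x Dx; exact: pW.
Qed.

(** The term (W f, f) does not change because |z| = 1, so the form gains exactly what ||Gamma f||^2
    loses. *)
Lemma wform_shift W f : L2 f -> Linf W ->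
  qf (wform W) (shift 1 f) = qf (wform W) f + \sum_i cn2 (gcoef f i).
Proof.
move=> Lf LW.
have e : qf (wform W) (shift 1 f) = Re (dotD (W \*m shift 1 f) (shift 1 f)) - qf dotC (G (shift 1 f)).
  by rewrite /qf /wform ReB.
rewrite e qf_Gamma_shift // mulmx_shift L2dot_shift2 /qf /wform ReB; ring.
Qed.

End fixed_symbol.
End gamma.

(** * The weighted Nehari theorem *)

Section nehari.
Variable R : realType.
Local Notation C := R[i].
Local Notation T := (circle R).
Local Notation mu := (@arc_measure R).
Local Notation Re := (@complex.Re R).
Variables (m1 m2 n1 n2 : nat).
Local Notation dom := (@Gamma_dom R n1 n2).
Local Notation cod := (@Gamma_cod R m1 m2).
Let hD := L2_hform R (n1 + n2).
Let hC := L2_hform R (m1 + m2).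
Local Notation dotD := (@L2dot R (n1 + n2)).
Local Notation dotC := (@L2dot R (m1 + m2)).
Local Notation fD := (T -> 'cV[C]_(n1 + n2)).

(** The constants of the upper block, continued by 0 to all naturals to match the indexing in
    [extension_finite]. *)
Definition const_vec (i : nat) : fD :=
  oapp (fun i : 'I_n1 => inl_fun (zvec 0 i)) 0 (insub i).

Lemma const_vecE (i : 'I_n1) : const_vec i = inl_fun (zvec 0 i).
Proof. by rewrite /const_vec valK. Qed.

Lemma dom_const_vec i : dom (const_vec i).
Proof.
rewrite /const_vec; case: insubP => [k _ _|_]; last exact: (sub0 (@dom_sub R n1 n2)).
by apply: dom_inl; exact: (H2_zvec R 0).
Qed.

Lemma dot_const_vec (f : fD) (i : 'I_n1) : L2 f -> dotD f (const_vec i) = L2dot (top f) (zvec 0 i).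
Proof. by move=> Lf; rewrite const_vecE dot_inl //; exact: L2_zvec. Qed.

(** Left inverse of multiplication by z on the domain of Gamma. Only the constant terms of the upper
    block have to be removed, since the lower block may be divided by z freely. *)
Definition backshift (f : fD) : fD :=
  shift (- 1) (f - \sum_(i < n1) dotD f (const_vec i) *: const_vec i).

Lemma dot_const_vec_lin i : lin dom (fun f => dotD f (const_vec i)).
Proof. by move=> a f g /dom_L2 Lf /dom_L2 Lg; apply: (hformL hD) => //; exact: dom_L2 (dom_const_vec i). Qed.

Lemma dot_const_vec_id i j : (i < n1)%N -> (j < n1)%N ->
  dotD (const_vec j) (const_vec i) = (i == j)%:R.
Proof.
move=> i1 j1; pose I := Ordinal i1; pose J := Ordinal j1.
change (dotD (const_vec J) (const_vec I) = (val I == val J)%:R).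
rewrite dot_const_vec; last exact: dom_L2 (dom_const_vec _).
by rewrite const_vecE top_inl zvec_dot eqxx /= eq_sym.
Qed.

Lemma dot_const_vec_shift (f : fD) i : dom f -> dotD (shift 1 f) (const_vec i) = 0.
Proof.
move=> Df; have Lf := dom_L2 Df; have Ls : L2 (shift 1 f) by exact: L2_shift.
rewrite /const_vec; case: insubP => [k _ _|_] /=; last by rewrite (hform0r hD).
rewrite dot_inl //; last exact: L2_zvec.
by rewrite top_shift L2dot_shift_zvec; have [/H2P[_ h] _] := Df; exact: h.
Qed.

Let Dsum f : dom (\sum_(i < n1) dotD f (const_vec i) *: const_vec i).
Proof.
by apply: (sub_sum (@dom_sub R n1 n2)) => i _; apply: (subZ (@dom_sub R n1 n2)); exact: dom_const_vec.
Qed.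

Lemma dom_backshift f : dom f -> dom (backshift f).
Proof.
move=> Df; have Lf := dom_L2 Df.
have Dr : dom (f - \sum_(i < n1) dotD f (const_vec i) *: const_vec i).
  exact: (subB (@dom_sub R n1 n2)).
have Lr := dom_L2 Dr.
have Ls : L2 (backshift f) by exact: L2_shift.
split; last by have /L2_col[] := Ls.
apply/H2P; split; first by have /L2_col[] := Ls.
move=> n i n0; rewrite -/(top _) top_shift L2dot_shift_zvec.
have [/H2P[_ hr] _] := Dr.
have [n1'|n1'] := ltP (n - - 1) 0; first exact: hr.
have -> : n - - 1 = 0 by lia.
rewrite -dot_const_vec // (hformB hD Lf (dom_L2 (Dsum f)) (dom_L2 (dom_const_vec i))).
rewrite (hform_suml hD) => [|j _|]; last 2 first.
- by apply: dom_L2; apply: (subZ (@dom_sub R n1 n2)); exact: dom_const_vec.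
- exact: dom_L2 (dom_const_vec i).
rewrite (bigD1 i isT) big1 => [|j /negbTE ji].
  rewrite (hformZ hD) ?dot_const_vec_id ?eqxx ?Monoid.mulm1 ?mulr1 ?subrr //.
    exact: dom_L2 (dom_const_vec i).
  exact: dom_L2 (dom_const_vec i).
rewrite (hformZ hD) ?dot_const_vec_id ?ji ?mulr0 //; last 2 first.
- exact: dom_L2 (dom_const_vec j).
- exact: dom_L2 (dom_const_vec i).
by rewrite val_eqE eq_sym ji mulr0.
Qed.

Lemma backshift_lin (a : C) f g : dom f -> dom g ->
  backshift (a *: f + g) = a *: backshift f + backshift g.
Proof.
move=> Df Dg; rewrite /backshift -shift_lin; congr shift.
rewrite scalerBr addrACA -opprD; congr (_ + - _).
rewrite scaler_sumr -big_split; apply: eq_bigr => i _.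
by rewrite (dot_const_vec_lin i a Df Dg) scalerDl scalerA.
Qed.

Lemma backshiftK f : dom f -> backshift (shift 1 f) = f.
Proof.
move=> Df; rewrite /backshift big1 ?subr0 ?shiftK // => i _.
by rewrite dot_const_vec_shift // scale0r.
Qed.

Lemma shift_backshift f : (forall i, (i < n1)%N -> dotD f (const_vec i) = 0) ->
  shift 1 (backshift f) = f.
Proof.
move=> h; rewrite /backshift big1 ?subr0 ?shiftNK // => i _.
by rewrite h // scale0r.
Qed.

Section symbol.
Variable Phi : T -> 'M[C]_(m1 + m2, n1 + n2).
Hypothesis hPhi : Linf Phi.
Hypothesis m1_gt0 : (0 < m1)%N.
Variable W : T -> 'M[C]_(n1 + n2).
Hypothesis hW : admissible Phi W.
Local Notation G := (gam Phi).
Let hB := wform_hform hPhi hW.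
Let LW : Linf W := let: And3 h _ _ := hW in h.

(** Read la, m1 entries per frequency, as the Fourier coefficients from index -1 upwards of the
    upper part of an operator T extending Gamma. The first m1 are prescribed by Gamma and N further
    ones have been chosen; [pe_shift] says that T intertwines multiplication by z on these
    coefficients. *)
Record partial_extension N (la : nat -> fD -> C) : Prop := PartialExtension {
  pe_lin : forall s, (s < m1 + N)%N -> lin dom (la s) ;
  pe_shift : forall s, (s < N)%N -> forall f, dom f -> la (m1 + s)%N (shift 1 f) = la s f ;
  pe_gcoef : forall (i : 'I_m1) f, la i f = gcoef Phi f i ;
  pe_bound : forall f, dom f -> \sum_(s < N) cn2 (la (m1 + s)%N f) <= qf (wform Phi W) f }.

Lemma partial_extension0 :
  partial_extension 0 (fun s f => oapp (gcoef Phi f) 0 (insub s)).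
Proof.
split => //.
- move=> s; rewrite addn0 => sm a f g /dom_L2 Lf /dom_L2 Lg.
  rewrite insubT /= /gcoef; apply: Gamma_dot_lin => //.
  by apply: L2_inl; exact: L2_zvec.
- by move=> i f; rewrite valK.
- by move=> f Df; rewrite big_ord0; have [_ _] := hW; apply.
Qed.

(* The bound needed for the next functional is the bound already available for
   the previous ones, because multiplication by z costs exactly the coefficients
   [gcoef] in the norm of [G f]. *)
Lemma partial_extensionS N la : partial_extension N la ->
  exists l, partial_extension N.+1 (fun s => if s == (m1 + N)%N then l else la s).
Proof.
move=> [hlin hshift hg hbd].
(* The part of the form not yet used up by the N chosen coefficients. *)
pose BN f g : C := wform Phi W f g - \sum_(s < N) la (m1 + s)%N f * conjc (la (m1 + s)%N g).
have qBN f : qf BN f = qf (wform Phi W) f - \sum_(s < N) cn2 (la (m1 + s)%N f).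
  rewrite /qf /BN ReB Re_sum; congr (_ - _); apply: eq_bigr => s _.
  by rewrite mulcJ.
have hBN : hform dom BN.
  split; first exact: dom_sub.
  - move=> a x y z Dx Dy Dz; rewrite /BN (hformL hB) //.
    have -> : \sum_(s < N) la (m1 + s)%N (a *: x + y) * conjc (la (m1 + s)%N z) =
        a * (\sum_(s < N) la (m1 + s)%N x * conjc (la (m1 + s)%N z)) +
        \sum_(s < N) la (m1 + s)%N y * conjc (la (m1 + s)%N z).
      rewrite mulr_sumr -big_split; apply: eq_bigr => s _ /=.
      by rewrite (hlin _ _ a x y) ?ltn_add2l // mulrDl mulrA.
    move: (wform _ _ _ _) (wform _ _ _ _) (\sum_(s < N) _) (\sum_(s < N) _) => b1 b2 b3 b4.
    by ring.
  - move=> x y Dx Dy; rewrite /BN [RHS]conjcB conjc_sum (hformJ hB Dx Dy).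
    have -> // : \sum_(s < N) la (m1 + s)%N y * conjc (la (m1 + s)%N x) =
        \sum_(s < N) conjc (la (m1 + s)%N x * conjc (la (m1 + s)%N y)).
    by apply: eq_bigr => s _; rewrite conjcM conjcK mulrC.
  - by move=> x Dx; rewrite -/(qf BN x) qBN subr_ge0; exact: hbd.
have lN : lin dom (fun f => la N (backshift f)).
  move=> a f g Df Dg; rewrite backshift_lin //.
  by apply: (hlin N); [lia|exact: dom_backshift|exact: dom_backshift].
have key f : dom f -> (forall i, (i < n1)%N -> dotD f (const_vec i) = 0) ->
    cn2 (la N (backshift f)) <= qf BN f.
  move=> Df /shift_backshift; have Dg := dom_backshift Df.
  move: (backshift f) Dg => g Dg <-; have Lg := dom_L2 Dg.
  rewrite qBN wform_shift //.
  under [X in _ <= _ - X]eq_bigr => s _ do rewrite hshift //.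
  (* Since m1 > 0, the N + 1 functionals on the left are among the m1 + N on the right. *)
  have : \sum_(s < N.+1) cn2 (la s g) <=
      \sum_(i < m1) cn2 (gcoef Phi g i) + \sum_(s < N) cn2 (la (m1 + s)%N g).
    have -> : \sum_(i < m1) cn2 (gcoef Phi g i) = \sum_(i < m1) cn2 (la i g).
      by apply: eq_bigr => i _; rewrite hg.
    apply: (@le_trans _ _ (\sum_(s < m1 + N) cn2 (la s g))); last by rewrite big_split_ord.
    rewrite -(big_mkord xpredT (fun s => cn2 (la s g))).
    rewrite -(big_mkord xpredT (fun s => cn2 (la s g))).
    rewrite [leRHS](@big_cat_nat _ _ _ N.+1) //=; last by lia.
    by rewrite lerDl sumr_ge0 // => s _; exact: cn2_ge0.
  rewrite big_ord_recr /=; have := hbd g Dg; lra.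
have [c hc] := extension_finite hBN lN (fun i _ => dot_const_vec_lin i)
  (fun i _ => dom_const_vec i) (fun i j hi hj => dot_const_vec_id hi hj) key.
pose l f := la N (backshift f) + \sum_(i < n1) c i * dotD f (const_vec i).
exists l; split.
- move=> s; rewrite addnS ltnS leq_eqVlt; case: eqP => [-> _|_ /= sN]; last exact: hlin.
  move=> a f g Df Dg.
  have e : \sum_(i < n1) c i * dotD (a *: f + g) (const_vec i) =
      a * (\sum_(i < n1) c i * dotD f (const_vec i)) + \sum_(i < n1) c i * dotD g (const_vec i).
    rewrite mulr_sumr -big_split; apply: eq_bigr => i _.
    by rewrite (dot_const_vec_lin i a Df Dg) mulrDr mulrCA.
  by rewrite [LHS](f_equal2 +%R (lN a f g Df Dg) e) mulrDr addrACA.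
- move=> s; rewrite ltnS leq_eqVlt; case: eqP => [-> _|_ /= sN] f Df.
    rewrite eqxx ltn_eqF; last by lia.
    rewrite /l backshiftK // big1 ?addr0 // => i _.
    by rewrite dot_const_vec_shift // mulr0.
  rewrite !ltn_eqF; [|by lia|by lia]; exact: hshift.
- by move=> i f; rewrite ltn_eqF //; have := ltn_ord i; lia.
- move=> f Df; rewrite big_ord_recr /= eqxx.
  have := hc f Df; rewrite qBN -/(l f).
  have -> : \sum_(s < N) cn2 ((if (m1 + s == m1 + N)%N then l else la (m1 + s)%N) f) =
      \sum_(s < N) cn2 (la (m1 + s)%N f).
    by apply: eq_bigr => s _; rewrite ltn_eqF // ltn_add2l.
  lra.
Qed.

Lemma shift_functionals : exists la : nat -> fD -> C, [/\ forall s, lin dom (la s),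
  forall s f, dom f -> la (m1 + s)%N (shift 1 f) = la s f,
  forall (i : 'I_m1) f, la i f = gcoef Phi f i &
  forall N f, dom f -> \sum_(s < N) cn2 (la (m1 + s)%N f) <= qf (wform Phi W) f].
Proof.
have /choice[F hF] : forall p : nat * (nat -> fD -> C), exists l, partial_extension p.1 p.2 ->
    partial_extension p.1.+1 (fun s => if s == (m1 + p.1)%N then l else p.2 s).
  move=> [N la] /=; have [/partial_extensionS[l hl]|h] := pselect (partial_extension N la).
    by exists l.
  by exists (la 0%N).
pose fix L N := if N is N'.+1 then
  (fun s => if s == (m1 + N')%N then F (N', L N') else L N' s)
  else (fun s f => oapp (gcoef Phi f) 0 (insub s)).
have HL N : partial_extension N (L N).
  by elim: N => [|N IH]; [exact: partial_extension0|exact: (hF (N, L N))].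
have stab s N k : (s < m1 + N)%N -> L (N + k)%N s = L N s.
  move=> sN; elim: k => [|k IH]; first by rewrite addn0.
  by rewrite addnS /= ltn_eqF ?IH //; lia.
(* Entry s is fixed as soon as s < m1 + N, in particular from stage s + 1 on, so the diagonal
   collects the final values. *)
pose la s := L s.+1 s.
have laE s N : (s < m1 + N)%N -> L N s = la s.
  move=> sN; rewrite /la; have [h|/ltnW h] := leqP N s.+1.
    by rewrite -(subnKC h) stab.
  by rewrite -(subnKC h) stab //; lia.
exists la; split.
- by move=> s; apply: (pe_lin (HL s.+1)); lia.
- move=> s f Df; rewrite -(@laE (m1 + s)%N s.+1) ?ltn_add2l // (pe_shift (HL s.+1)) //.
- by move=> i f; rewrite -(@laE i 0%N) ?addn0 // (pe_gcoef (HL 0%N)).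
- move=> N f Df; have := pe_bound (HL N) Df.
  by under eq_bigr => s _ do rewrite laE ?ltn_add2l //.
Qed.
End symbol.
End nehari.

(** * From the extended coefficients to the symbol Q *)

Section nehari.
Variable R : realType.
Local Notation C := R[i].
Local Notation T := (circle R).
Local Notation mu := (@arc_measure R).
Local Notation Re := (@complex.Re R).

Lemma Linf_of_bound m n (F : T -> 'M[C]_(m, n)) (K : R) : mx_measurable F -> 0 <= K ->
  (\forall z \ae mu, forall x, vn2 (F z *m x) <= K * vn2 x) -> Linf F.
Proof.
move=> mF K0 h; apply/LinfP; split => //; exists (Num.sqrt K); first exact: sqrtr_ge0.
by rewrite sqr_sqrtr.
Qed.

Lemma Re_hdot_le n (x y : 'cV[C]_n) : Re (hdot x y) <= vn2 x + vn2 y.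
Proof.
apply: (le_trans (ler_norm _)); apply: sqr_le_abs; first by rewrite addr_ge0 ?vn2_ge0.
exact: le_trans (sqr_Re_le _) (hdot_bound _ _).
Qed.

Lemma Re_hdot_Linf n (W : T -> 'M[C]_n) : Linf W ->
  exists2 K : R, 0 <= K & \forall z \ae mu, forall x, Re (hdot (W z *m x) x) <= K * vn2 x.
Proof.
move=> /LinfP[_ [M M0 hM]]; exists (M ^+ 2 + 1); first by rewrite addr_ge0 ?sqr_ge0.
apply: filterS hM => z hz x; apply: le_trans (Re_hdot_le _ _) _.
by rewrite mulrDl mul1r lerD2r.
Qed.

Lemma hdot_gram m n (A : 'M[C]_(m, n)) x : hdot (adj A *m A *m x) x = hdot (A *m x) (A *m x).
Proof. by rewrite -mulmxA hdot_adj adjK. Qed.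

Lemma mulmx_delta m n (A : 'M[C]_(m, n)) i j :
  (A *m (delta_mx j ord0 : 'cV[C]_n)) i ord0 = A i j.
Proof.
rewrite mxE (bigD1 j) //= mxE !eqxx mulr1 big1 ?addr0 // => a aj.
by rewrite mxE (negbTE aj) mulr0.
Qed.

Section symbol.
Variables (m1 m2 n1 n2 : nat).
Variable Phi : T -> 'M[C]_(m1 + m2, n1 + n2).
Hypothesis hPhi : Linf Phi.
Local Notation dom := (@Gamma_dom R n1 n2).
Local Notation cod := (@Gamma_cod R m1 m2).
Let hD := L2_hform R (n1 + n2).
Let hC := L2_hform R (m1 + m2).
Let hT := L2_hform R m1.
Local Notation dotD := (@L2dot R (n1 + n2)).
Local Notation dotC := (@L2dot R (m1 + m2)).
Local Notation fD := (T -> 'cV[C]_(n1 + n2)).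
Local Notation G := (gam Phi).
Local Notation cvec := (@const_vec R n1 n2).

Lemma PhiQE (Q : T -> 'M[C]_(m1, n1)) z :
  PhiQ Phi Q z = Phi z - block_mx (Q z) 0 0 0.
Proof.
by rewrite /PhiQ -[in RHS](submxK (Phi z)) opp_block_mx add_block_mx !oppr0 !addr0.
Qed.

Lemma PhiQ_mulE (Q : T -> 'M[C]_(m1, n1)) z (x : 'cV[C]_(n1 + n2)) :
  PhiQ Phi Q z *m x = Phi z *m x - col_mx (Q z *m usubmx x) 0.
Proof.
rewrite PhiQE mulmxBl; congr (_ - _).
by rewrite -{1}[x]vsubmxK mul_block_col !mul0mx !addr0.
Qed.

Lemma PhiQ_mul (Q : T -> 'M[C]_(m1, n1)) (f : fD) :
  PhiQ Phi Q \*m f = (Phi \*m f) - inl_fun (Q \*m top f).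
Proof. by apply/funext => z; rewrite PhiQ_mulE. Qed.

Lemma PhiQ_Linf (Q : T -> 'M[C]_(m1, n1)) : Linf Q -> Linf (PhiQ Phi Q).
Proof.
move=> /LinfP[mQ [M M0 hM]]; have /LinfP[mP [N N0 hN]] := hPhi.
apply: (@Linf_of_bound _ _ _ (2 * N ^+ 2 + 2 * M ^+ 2)).
- move=> i j; rewrite (_ : (fun z => _) =
    (fun z => Phi z i j - (if fintype.split i is inl i' then
       if fintype.split j is inl j' then Q z i' j' else 0 else 0))).
    apply: cmB => //; case: (fintype.split i) => i'; last exact: cm_cst.
    by case: (fintype.split j) => j'; [exact: mQ|exact: cm_cst].
  apply/funext => z; rewrite /PhiQ -[in RHS](submxK (Phi z)) !mxE.
  by case: (fintype.split i) => i'; rewrite !mxE; case: (fintype.split j) => j'; rewrite ?mxE ?subr0.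
- by rewrite addr_ge0 ?mulr_ge0 ?sqr_ge0.
- apply: filterS2 hM hN => z hz hz' x; rewrite PhiQ_mulE.
  apply: le_trans (vn2D_le _ _) _; rewrite vn2N [leRHS]mulrDl -(mulrA 2 (N ^+ 2)) -(mulrA 2 (M ^+ 2)) lerD ?ler_pM2l //.
  rewrite vn2_col col_mxKu col_mxKd vn2_0 addr0; apply: le_trans (hz _) _.
  by rewrite ler_wpM2l ?sqr_ge0 // vn2_col lerDl vn2_ge0.
Qed.

Section admissible.
Hypothesis m1_gt0 : (0 < m1)%N.
Variable W : T -> 'M[C]_(n1 + n2).
Hypothesis hW : admissible Phi W.
Let LW : Linf W := let: And3 h _ _ := hW in h.

(* [Tm] extends [Gamma], is bounded by the weight and commutes with the shift up
   to the symbol: [delta f], the Fourier coefficients of the upper part of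
   [Tm f - Phi f], are those of [- Q f1] for a bounded analytic Q. *)
Lemma weighted_nehari : exists2 Q, Hinf Q &
  \forall z \ae mu, forall x, vn2 (PhiQ Phi Q z *m x) <= Re (hdot (W z *m x) x).
Proof.
have [la [hlin hshift hg hbd]] := shift_functionals hPhi m1_gt0 hW.
have sums K f : \sum_(n < K) \sum_(i < m1) cn2 (la (m1 + (n * m1 + i))%N f) =
    \sum_(s < K * m1) cn2 (la (m1 + s)%N f).
  elim: K => [|K IH]; first by rewrite !big_ord0.
  by rewrite big_ord_recr /= IH mulSnr big_split_ord.
have /choice[S hS] : forall f : fD, exists S : T -> 'cV[C]_m1, dom f -> [/\ H2 S,
    forall (n : nat) i, L2dot S (zvec n i) = la (m1 + (n * m1 + i))%N f &
    qf (@L2dot R m1) S <= qf (wform Phi W) f].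
  move=> f; have [Df|] := pselect (dom f); last by exists 0.
  have [|S hS] := @riesz_fischer R m1 (fun n i => la (m1 + (n * m1 + i))%N f) (qf (wform Phi W) f).
    by move=> K; rewrite sums; exact: hbd.
  by exists S.
have [Tm TmE] : exists Tm : fD -> T -> 'cV[C]_(m1 + m2), forall f, Tm f = G f + inl_fun (S f).
  by exists (fun f => G f + inl_fun (S f)).
have topT f : top (Tm f) = top (G f) + S f.
  by apply/funext => z; rewrite /top TmE -[RHS]/(usubmx (G f z) + S f z) linearD /= col_mxKu.
have HS f : dom f -> H2 (S f) by move=> /hS[].
have LS f : dom f -> L2 (S f) by move=> /HS[].
have LG f : dom f -> L2 (G f) by move=> /dom_L2 Lf; exact: L2_Gamma.
have LT f : dom f -> L2 (Tm f).
  by move=> Df; rewrite TmE; apply: (subD (L2_sub R _)); [exact: LG|apply: L2_inl; exact: LS].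
have LtG f : dom f -> L2 (top (G f)) by move=> /LG /L2_col[].
have LPhi f : dom f -> L2 (Phi \*m f) by move=> /dom_L2 Lf; exact: L2_mulmx.
have LtP f : dom f -> L2 (top (Phi \*m f)) by move=> /LPhi /L2_col[].
have Hm f : dom f -> H2minus (top (G f)).
  by move=> /dom_L2 Lf; have [] := Gamma_in_cod hPhi Lf.
have dT (n : nat) i f : dom f -> L2dot (top (Tm f)) (zvec n i) = la (m1 + (n * m1 + i))%N f.
  move=> Df; rewrite topT (hformD hT (LtG f Df) (LS f Df) (L2_zvec R _ i)).
  rewrite (Hm f Df).2 ?add0r; last exact: (H2_zvec R n).
  by have [_ -> _] := hS f Df.
have dT1 i f : dom f -> L2dot (top (Tm f)) (zvec (-1) i) = la i f.
  move=> Df; rewrite topT (hformD hT (LtG f Df) (LS f Df) (L2_zvec R _ i)).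
  have /H2P[_ h] := HS f Df; rewrite h // addr0 hg gcoefE //; exact: dom_L2.
have [dl dl0] : exists dl : int -> 'I_m1 -> fD -> C,
    forall n i f, dl n i f = L2dot (top (Tm f) - top (Phi \*m f)) (zvec n i).
  by exists (fun n i f => L2dot (top (Tm f) - top (Phi \*m f)) (zvec n i)).
have dlE n i f : dom f -> dl n i f = L2dot (top (Tm f)) (zvec n i) - L2dot (top (Phi \*m f)) (zvec n i).
  move=> Df; rewrite dl0 (hformB hT) //; [by have /L2_col[] := LT f Df|exact: LtP|exact: L2_zvec].
have topB (f g : T -> 'cV[C]_(m1 + m2)) : top (f - g) = top f - top g.
  by apply/funext => z; rewrite /top linearB.
have dl_neg n i f : n < 0 -> dom f -> dl n i f = 0.
  move=> n0 Df; have [Hr _] := Gamma_residual hPhi (dom_L2 Df).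
  have : H2 (S f - top ((Phi \*m f) - G f)) by apply: (subB (@H2_sub R m1)) => //; exact: HS.
  have -> : S f - top ((Phi \*m f) - G f) = top (Tm f) - top (Phi \*m f).
    by rewrite topB topT opprB addrA [S f + _]addrC.
  by rewrite dl0 => /H2P[_]; apply.
have Ds f : dom f -> dom (shift 1 f) by move=> Df; exact: (dom_shift 1 Df).
have dl_shift n i f : dom f -> dl n i (shift 1 f) = dl (n - 1) i f.
  move=> Df; have [n0|n0] := ltP n 0.
    by rewrite !dl_neg //; [lia|exact: Ds].
  case: n n0 => // n _; rewrite (dlE _ _ _ (Ds _ Df)) (dlE _ _ _ Df).
  rewrite mulmx_shift top_shift L2dot_shift_zvec dT ?hshift //; last exact: Ds.
  congr (_ - _); case: n => [|n]; first by rewrite mul0n add0n -dT1.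
  rewrite (_ : n.+1%:Z - 1 = n); last by lia.
  by rewrite dT // mulSn addnA.
have dl_shiftn n i (k : nat) f : dom f -> dl n i (shift k f) = dl (n - k%:Z) i f.
  move=> Df; elim: k n => [|k IH] n; first by rewrite shift0 subr0.
  have -> : shift k.+1 f = shift 1 (shift k f) by rewrite shiftD; congr shift; lia.
  rewrite dl_shift; last exact: dom_shift.
  by rewrite IH; congr dl; lia.
have dl_lin n i : lin dom (dl n i).
  move=> a f g Df Dg; have Dh : dom (a *: f + g) by exact: (subL (@dom_sub R n1 n2)).
  have [n0|n0] := ltP n 0; first by rewrite !dl_neg // mulr0 addr0.
  case: n n0 => // n _; rewrite (dlE _ _ _ Dh) (dlE _ _ _ Df) (dlE _ _ _ Dg).
  rewrite (dT _ _ _ Dh) (dT _ _ _ Df) (dT _ _ _ Dg) (hlin _ _ _ _ Df Dg).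
  have -> : L2dot (top (Phi \*m (a *: f + g))) (zvec n i) =
      a * L2dot (top (Phi \*m f)) (zvec n i) + L2dot (top (Phi \*m g)) (zvec n i).
    rewrite -(hformL hT a (LtP f Df) (LtP g Dg) (L2_zvec R n i)).
    congr L2dot; rewrite mulmx_lin; apply/funext => z; rewrite /top.
    by rewrite -[RHS]/(a *: usubmx (Phi z *m f z) + usubmx (Phi z *m g z)) linearP.
  by move: (la _ f) (la _ g) (L2dot _ _) (L2dot _ _) => b1 b2 b3 b4; ring.
(* A function of the lower block is z^k times another one for every k; this moves the coefficient to
   a negative index, where delta vanishes. *)
have dl_inr n i y : L2 y -> dl n i (inr_fun y) = 0.
  move=> Ly; pose k := `|n|%N.+1.
  have Dy : dom (inr_fun (shift (- k%:Z) y)) by apply: dom_inr; exact: L2_shift.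
  have -> : inr_fun y = shift k (inr_fun (shift (- k%:Z) y)) :> fD.
    apply/funext => z; rewrite /shift /inr_fun scale_col_mx scaler0 scalerA -zpowD.
    by rewrite addrN zpow0 scale1r.
  by rewrite dl_shiftn // dl_neg //; rewrite /k; lia.
(* As delta commutes with multiplication by z, its values on constants determine Q. *)
have [Q QE] : exists Q : T -> 'M[C]_(m1, n1), forall z i j,
    Q z i j = (top (Phi \*m cvec j) - top (Tm (cvec j))) z i ord0.
  exists (fun z => \matrix_(i, j) (top (Phi \*m cvec j) - top (Tm (cvec j))) z i ord0).
  by move=> z i j; rewrite mxE.
have Dx j : dom (cvec j) by exact: dom_const_vec.
have LQj j : L2 (top (Phi \*m cvec j) - top (Tm (cvec j))).
  by apply: (subB (L2_sub R _)); [exact: LtP|have /L2_col[] := LT _ (Dx j)].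
have Qcol (j : 'I_n1) : Q \*m top (cvec j) = top (Phi \*m cvec j) - top (Tm (cvec j)).
  apply/funext => z.
  have -> : top (cvec j) z = delta_mx j ord0 by rewrite const_vecE top_inl /zvec zpow0 scale1r.
  by apply/matrixP => i k; rewrite (ord1 k) mulmx_delta QE.
(* Q is not yet known to be bounded, so square integrability of Q f1 is part of the condition. A
   contains the vector polynomials, which suffice as test functions. *)
pose A f := [/\ dom f, L2 (Q \*m top f) & forall n i, dl n i f = - L2dot (Q \*m top f) (zvec n i)].
have topL (a : C) (f g : fD) : top (a *: f + g) = a *: top f + top g.
  apply/funext => z; rewrite /top -[RHS]/(a *: usubmx (f z) + usubmx (g z)).
  exact: linearP.
have sA : linsub A.
  have sub := @dom_sub R n1 n2; split.
    have -> : (0 : fD) = inr_fun 0 by apply/funext => z; rewrite /inr_fun col_mx0.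
    have e : Q \*m top (inr_fun 0 : fD) = 0.
      by apply/funext => z; rewrite top_inr mulmx0.
    have L0 : L2 (0 : T -> 'cV[C]_n2) by exact: (sub0 (L2_sub R _)).
    split; [exact: dom_inr|rewrite e; exact: (sub0 (L2_sub R _))|].
    by move=> n i; rewrite dl_inr // e (hform0 hT) ?oppr0 //; exact: L2_zvec.
  move=> a f g [Df LQf df] [Dg LQg dg].
  have e : Q \*m top (a *: f + g) = a *: (Q \*m top f) + (Q \*m top g).
    by rewrite topL mulmx_lin.
  split; [exact: subL|rewrite e; exact: (subL (L2_sub R _))|].
  move=> n i; rewrite e (hformL hT a LQf LQg (L2_zvec R n i)) dl_lin // df dg.
  by rewrite mulrN opprD.
have A_shift f : A f -> A (shift 1 f).
  move=> [Df LQf df]; have e : Q \*m top (shift 1 f) = shift 1 (Q \*m top f).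
    by rewrite top_shift mulmx_shift.
  split; [exact: Ds|rewrite e; exact: L2_shift|].
  by move=> n i; rewrite e L2dot_shift_zvec (dl_shift _ _ _ Df) df.
have A_x (j : 'I_n1) : A (cvec j).
  split => //; first by rewrite Qcol.
  by move=> n i; rewrite Qcol -(hformN hT (LQj j) (L2_zvec R n i)) opprB dl0.
have A_inr y : L2 y -> A (inr_fun y).
  move=> Ly; have e : Q \*m top (inr_fun y : fD) = 0.
    by apply/funext => z; rewrite top_inr mulmx0.
  split; [exact: dom_inr|rewrite e; exact: (sub0 (L2_sub R _))|].
  by move=> n i; rewrite dl_inr // e (hform0 hT) ?oppr0 //; exact: L2_zvec.
have A_cst (v : 'cV[C]_(n1 + n2)) : A (fun=> v).
  have -> : (fun=> v) = \sum_(j < n1) v (lshift n2 j) ord0 *: cvec j + inr_fun (fun=> dsubmx v) :> fD.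
    apply/funext => z.
    rewrite -[RHS]/((\sum_(j < n1) v (lshift n2 j) ord0 *: cvec j) z + col_mx 0 (dsubmx v)).
    rewrite fct_sumE -[LHS]vsubmxK -[X in X + _]vsubmxK add_col_mx addr0 linear_sum.
    rewrite [X in col_mx _ (X + _)]linear_sum [X in col_mx _ (X + _)]big1 ?add0r => [|j _].
      congr col_mx; have := congr1 (fun f : T -> 'cV[C]_n1 => f z) (cst_zvec (usubmx v)).
      rewrite fct_sumE => ->; apply: eq_bigr => j _; rewrite mxE const_vecE.
      change (v (lshift n2 j) ord0 *: zvec 0 j z =
        usubmx (v (lshift n2 j) ord0 *: (col_mx (zvec 0 j z) 0 : 'cV[C]_(n1 + n2)))).
      by rewrite scale_col_mx col_mxKu.
    rewrite const_vecE.
    change (dsubmx (v (lshift n2 j) ord0 *: (col_mx (zvec 0 j z) 0 : 'cV[C]_(n1 + n2))) = 0).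
    by rewrite scale_col_mx col_mxKd scaler0.
  apply: (subD sA); last by apply: A_inr; exact: L2_cst.
  by apply: (sub_sum sA) => j _; apply: (subZ sA).
have A_poly (a : {poly C}) (v : 'cV[C]_(n1 + n2)) : A (fun z => a.[sval z] *: v).
  elim/poly_ind: a => [|a c IH].
    have -> : (fun z : T => (0 : {poly C}).[sval z] *: v) = (fun=> 0).
      by apply/funext => z; rewrite horner0 scale0r.
    exact: A_cst.
  have -> : (fun z : T => (a * 'X + c%:P).[sval z] *: v) =
      shift 1 (fun z => a.[sval z] *: v) + (fun=> c *: v).
    apply/funext => z; rewrite hornerMXaddC scalerDl mulrC -scalerA.
    by rewrite -[RHS]/(zpow 1 z *: (a.[sval z] *: v) + c *: v) zpow1.
  by apply: (subD sA); [exact: A_shift|exact: A_cst].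
(* On A the function Phi_Q f is T f, and ||T f||^2 = ||Gamma f||^2 + ||S f||^2 is bounded by (W f,
   f). *)
have key f : A f -> L2 (PhiQ Phi Q \*m f) /\
    qf dotC (PhiQ Phi Q \*m f) <= Re (dotD (W \*m f) f).
  move=> [Df LQf df]; have Lf := dom_L2 Df.
  have LPQ : L2 (PhiQ Phi Q \*m f).
    by rewrite PhiQ_mul; apply: (subB (L2_sub R _)); [exact: LPhi|exact: L2_inl].
  split => //.
  have Lt : L2 (top (Tm f) - top (Phi \*m f)).
    by apply: (subB (L2_sub R _)); [have /L2_col[] := LT f Df|exact: LtP].
  have t0 : qf (@L2dot R m1) (top (Tm f) - top (Phi \*m f) + (Q \*m top f)) = 0.
    apply: L2_fourier_eq0; first exact: (subD (L2_sub R _)).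
    move=> n i; rewrite (hformD hT Lt LQf (L2_zvec R n i)).
    by rewrite -dl0 df addNr.
  have /(qf_eq0_ae (subD (L2_sub R _) Lt LQf)) ae1 := t0.
  have [_ ae2] := Gamma_residual hPhi Lf.
  have ae : \forall z \ae mu, (PhiQ Phi Q \*m f) z = Tm f z.
    apply: filterS2 ae1 ae2 => z.
    rewrite -[X in X = 0]/(usubmx (Tm f z) - usubmx (Phi z *m f z) + Q z *m usubmx (f z)) => h1.
    rewrite -[X in X = 0]/(dsubmx (Phi z *m f z - G f z)) => h2.
    rewrite PhiQ_mulE -[LHS]vsubmxK -[RHS]vsubmxK; congr col_mx.
      rewrite linearB /= col_mxKu; apply/eqP; rewrite -subr_eq0 -oppr_eq0; apply/eqP.
      by rewrite -[RHS]h1 opprB opprB addrA addrAC.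
    rewrite linearB /= col_mxKd subr0 TmE -[in RHS]/(G f z + col_mx (S f z) 0) linearD /= col_mxKd addr0.
    by move: h2; rewrite linearB => /eqP; rewrite subr_eq0 => /eqP.
  have -> : qf dotC (PhiQ Phi Q \*m f) = qf dotC (Tm f).
    by rewrite /qf; congr Re; apply: (L2dot_ae _ _ _ _ ae ae) => //; exact: LT.
  rewrite TmE.
  have LSi := L2_inl m2 (LS f Df).
  rewrite (qfD hC (LG f Df) LSi) dot_inl; [|exact: LG|exact: LS].
  rewrite (hformJ hT (LS f Df) (LtG f Df)) (hformJ hT (LtG f Df) (LS f Df)) conjcK.
  rewrite (Hm f Df).2; last exact: HS.
  have -> : qf dotC (inl_fun (S f)) = qf (@L2dot R m1) (S f).
    by rewrite /qf dot_inl ?top_inl //; exact: LS.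
  have [_ _ hb] := hS f Df.
  have e : qf (wform Phi W) f = Re (dotD (W \*m f) f) - qf dotC (G f) by rewrite /qf /wform ReB.
  move: hb; rewrite e Re0 mulr0 addr0.
  by move: (qf _ _) (qf _ _) (Re _) => b1 b2 b3; lra.
have LQv (v : 'cV[C]_(n1 + n2)) : L2 (PhiQ Phi Q \*m (fun=> v)) by have [] := key _ (A_cst v).
have LWv (v : 'cV[C]_(n1 + n2)) : L2 (W \*m (fun=> v)) by apply: L2_mulmx => //; exact: L2_cst.
have rIW (v : 'cV[C]_(n1 + n2)) : rI (fun z => Re (hdot (W z *m v) v)).
  by have [] := cI_hdot (LWv v) (L2_cst v).
(* The integrated bound for a(z) v, with a an arbitrary polynomial, is localized to a pointwise
   bound. *)
have pt (v : 'cV[C]_(n1 + n2)) : \forall z \ae mu,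
    vn2 (PhiQ Phi Q z *m v) - Re (hdot (W z *m v) v) <= 0.
  have rQ : rI (fun z => vn2 (PhiQ Phi Q z *m v)) by exact: (L2_rI (LQv v)).
  apply: le0_of_polynomial_tests; first exact: rIB.
  move=> a; have [LPQ] := key _ (A_poly a v).
  rewrite qfL2 L2dotE cintE /= => h.
  rewrite (@rint_ext _ _ (fun z => vn2 (PhiQ Phi Q z *m v) * cn2 a.[sval z] -
    Re (hdot (W z *m v) v) * cn2 a.[sval z])); last by move=> z; rewrite mulrBl.
  rewrite rintB ?subr_le0; [|exact: rI_mul_poly|exact: rI_mul_poly].
  apply: le_trans (le_trans h _); rewrite le_eqVlt; apply/orP; left; apply/eqP; apply: rint_ext => z.
    by rewrite -scalemxAr vn2Z mulrC.
  by rewrite -scalemxAr hdotZ hdotZr mulrA mulcJ !ReImE mul0r subr0 mulrC.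
have psd := @ae_psd R (n1 + n2) (fun z => W z - adj (PhiQ Phi Q z) *m PhiQ Phi Q z).
have main : \forall z \ae mu, forall x, vn2 (PhiQ Phi Q z *m x) <= Re (hdot (W z *m x) x).
  have E (z : T) v : Re (hdot ((W z - adj (PhiQ Phi Q z) *m PhiQ Phi Q z) *m v) v) =
      Re (hdot (W z *m v) v) - vn2 (PhiQ Phi Q z *m v).
    by rewrite mulmxBl hdotB ReB hdot_gram hdotxx.
  have {}psd := psd (fun v => _); apply: filterS (psd _) => [z hz x|v].
    by have := hz x; rewrite E subr_ge0.
  by apply: filterS (pt v) => z; rewrite E -oppr_ge0 opprB.
exists Q => //; split; last first.
  move=> i j n n0.
  have -> : (fun z => Q z i j) = (fun z => (top (Phi \*m cvec j) - top (Tm (cvec j))) z i ord0).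
    by apply/funext => z; rewrite QE.
  have LTj : L2 (top (Tm (cvec j)) - top (Phi \*m cvec j)).
    by have := subN (L2_sub R _) (LQj j); rewrite opprB.
  rewrite fourierE -opprB (hformN hT LTj (L2_zvec R n i)) -dl0.
  by rewrite dl_neg // oppr0.
(* Boundedness of Q comes last: (Q y, 0) = Phi (y, 0) - Phi_Q (y, 0), and both terms are now
   controlled. *)
have [K K0 hK] := Re_hdot_Linf LW; have /LinfP[mP [N N0 hN]] := hPhi.
apply: (@Linf_of_bound _ _ _ (2 * N ^+ 2 + 2 * K)).
- move=> i j; rewrite (_ : (fun z => _) =
     (fun z => (top (Phi \*m cvec j) - top (Tm (cvec j))) z i ord0)).
    exact: (L2_meas (LQj j)).
  by apply/funext => z; rewrite QE.
- by rewrite addr_ge0 ?mulr_ge0 ?sqr_ge0.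
- apply: filterS3 main hK hN => z h1 h2 h3 y.
  have E : PhiQ Phi Q z *m col_mx y 0 = Phi z *m col_mx y 0 - col_mx (Q z *m y) 0.
    by rewrite PhiQ_mulE col_mxKu.
  have E2 : col_mx (Q z *m y) 0 = Phi z *m col_mx y 0 - PhiQ Phi Q z *m col_mx y 0.
    by rewrite E opprB addrC subrK.
  have -> : vn2 (Q z *m y) = vn2 (col_mx (Q z *m y) 0 : 'cV[C]_(m1 + m2)).
    by rewrite vn2_col col_mxKu col_mxKd vn2_0 addr0.
  have y2 : vn2 (col_mx y 0 : 'cV[C]_(n1 + n2)) = vn2 y.
    by rewrite vn2_col col_mxKu col_mxKd vn2_0 addr0.
  rewrite E2; apply: le_trans (vn2D_le _ _) _; rewrite vn2N [leRHS]mulrDl -(mulrA 2 (N ^+ 2)) -(mulrA 2 K) -y2.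
  by rewrite lerD // ler_pM2l //; exact: le_trans (h1 _) (h2 _).
Qed.
End admissible.
End symbol.
End nehari.

(** The inequality q(s x - y) >= 0 divided by s bounds the cross term. *)
Lemma qfD_weighted (R : realType) (V : lmodType R[i]) (E : set V) B (x y : V) (s : R) :
  hform E B -> E x -> E y -> 0 < s -> qf B (x + y) <= (1 + s) * qf B x + (1 + s^-1) * qf B y.
Proof.
move=> hB Ex Ey s0.
have := qf_ge0 hB (subB (hform_sub hB) (subZ (hform_sub hB) s%:C%C Ex) Ey).
rewrite (qfB hB) //; last exact: (subZ (hform_sub hB)).
rewrite (qfZ hB) // cn2R (hformZ hB) // ReM ReR ImR mul0r subr0 (qfD hB) //.
move: (qf B x) (qf B y) (complex.Re _) => a b c h.
have s1 : s^-1 * s = 1 by rewrite mulVf ?gt_eqF.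
have v0 : 0 < s^-1 by rewrite invr_gt0.
have : 0 <= s^-1 * (s ^+ 2 * a - 2 * (s * c) + b) by rewrite mulr_ge0 // ltW.
have -> : s^-1 * (s ^+ 2 * a - 2 * (s * c) + b) = s^-1 * s * s * a - 2 * (s^-1 * s) * c + s^-1 * b by ring.
rewrite s1 !mul1r mulr1 => h1; lra.
Qed.

(** The choice of s ensures (1 + s) a <= (a + b) / 2, so that half of the gap b - a remains to
    control d. The letters d, g, kd stand for squared norms of a difference and of its images under
    Gamma and a compact K; kp, kq for squared distances to the limit of the images under K. *)
Lemma gap_arith (R : realType) (a b : R) : 0 <= a -> a < b ->
  exists2 s : R, 0 < s & forall e, 0 < e -> exists2 ke : R, 0 < ke &
  exists2 ee : R, 0 < ee & forall d g kd kp kq : R, 0 <= d ->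
    b * d <= g + ee -> g <= (1 + s) * (a * d) + (1 + s^-1) * kd ->
    kd <= 2 * kp + 2 * kq -> kp < ke -> kq < ke -> d < e.
Proof.
move=> a0 ab; pose s := (b - a) / (2 * a + 1).
have den : 0 < 2 * a + 1 by lra.
have s0 : 0 < s by apply: divr_gt0 => //; lra.
have sal : s * a <= (b - a) / 2.
  by rewrite /s mulrAC ler_pdivrMr //; nra.
have H : 0 < 1 + s^-1 by have : 0 < s^-1 by [rewrite invr_gt0]; lra.
exists s => // e e0.
move: (1 + s^-1) H => r r0; move: s s0 sal => s s0 sal.
have gae : 0 < (b - a) * e by apply: mulr_gt0 => //; lra.
exists ((b - a) * e / (16 * r)); first by apply: divr_gt0 => //; lra.
exists ((b - a) * e / 8); first by apply: divr_gt0.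
move=> d g kd kp kq d0 h1 h2 h3 h4 h5.
have h6 : r * kd <= (b - a) * e / 4.
  have -> : (b - a) * e / 4 = r * (4 * ((b - a) * e / (16 * r))).
    by field; rewrite gt_eqF.
  by rewrite ler_pM2l //; lra.
have h7 : s * a * d <= (b - a) / 2 * d by rewrite ler_wpM2r.
have : (b - a) / 2 * d < (b - a) / 2 * e by nra.
by rewrite ltr_pM2l //; lra.
Qed.

(** * Frequency bands and weak convergence of shifts *)

Section frequencies.
Variable R : realType.
Local Notation C := R[i].
Local Notation T := (circle R).
Variable k : nat.
Local Notation dot := (@L2dot R k).
Let hL := L2_hform R k.

Section decreasing.
Variable P : nat -> int -> Prop.
Hypothesis decP : forall N n, P N.+1 n -> P N n.
Hypothesis capP : forall n, exists N, ~ P N n.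

Definition band N : set (T -> 'cV[C]_k) :=
  annih (@L2 R k) dot [set f | exists n i, ~ P N n /\ f = zvec n i].

Let bandL N : [set f | exists n i, ~ P N n /\ f = zvec n i] `<=` @L2 R k.
Proof. by move=> _ [n [i [_ ->]]]; exact: L2_zvec. Qed.

Lemma bandP N f : band N f <-> L2 f /\ forall n i, ~ P N n -> dot f (zvec n i) = 0.
Proof.
split=> -[Lf hf]; split => //; first by move=> n i nP; apply: hf; exists n, i.
by move=> _ [n [i [nP ->]]]; exact: hf.
Qed.

Lemma band_projections_vanish g (s : nat -> T -> 'cV[C]_k) : L2 g -> (forall N, band N (s N)) ->
  (forall N t, band N t -> dot (g - s N) t = 0) ->
  forall e : R, 0 < e -> exists N, forall n, (N <= n)%N -> qf dot (s n) < e.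
Proof.
move=> Lg hs ho; apply: (decreasing_projections hL (S := band) (x := g)); last 3 first.
- exact Lg.
- exact hs.
- exact ho.
- exact: L2_complete.
- by move=> N; exact: (annih_sub hL (bandL (N := N))).
- by move=> N f [].
- by move=> N; exact: (annih_closed hL (bandL (N := N))).
- move=> N f /bandP[Lf hf]; apply/bandP; split => // n i nP; apply: hf => h.
  by apply: nP; exact: decP.
- move=> y Ly hy; apply: L2_fourier_eq0 => // n i; have [N nP] := capP n.
  by have /bandP[_] := hy N; apply.
Qed.

(** A coefficient with index in P n is also a coefficient of the projection of g onto band n, and
    these projections tend to 0 in norm. *)
Lemma riemann_lebesgue g (e : R) : L2 g -> 0 < e ->
  exists N, forall n l (i : 'I_k), (N <= n)%N -> P n l -> cn2 (dot g (zvec l i)) <= e.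
Proof.
move=> Lg e0.
have /choice[s hs] : forall N, exists s, band N s /\ forall t, band N t -> dot (g - s) t = 0.
  move=> N; have [s Ss hs] := projection hL (L2_complete (k := k))
    (annih_sub hL (bandL (N := N))) (@annihE _ _ _ _ _) (annih_closed hL (bandL (N := N))) Lg.
  by exists s.
have [N hN] := band_projections_vanish Lg (fun N => (hs N).1) (fun N => (hs N).2) e0.
exists N => n l i Nn Pl; have [Sn on] := hs n.
have /bandP[Ls _] := Sn.
have bz : band n (zvec l i).
  apply/bandP; split; first exact: L2_zvec.
  by move=> l' i' nP; rewrite zvec_dot; case: eqP => // ll; case: nP; rewrite -ll.
have := on _ bz; rewrite (hformB hL Lg Ls (L2_zvec R l i)) => /eqP; rewrite subr_eq0 => /eqP ->.
apply: le_trans (cauchy_schwarz hL Ls (L2_zvec R l i)) _.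
have -> : qf dot (zvec l i) = 1 by rewrite /qf zvec_dot !eqxx.
by rewrite mulr1 ltW // hN.
Qed.
End decreasing.

(* Multiplication by z^n tends weakly to 0 along any sequence [n] leaving all
   the [P N], so a Cauchy sequence of shifts of g forces g = 0. *)
Lemma cauchy_shifts_eq0 (P : nat -> int -> Prop) (v : nat -> int) g :
  (forall N n, P N.+1 n -> P N n) -> (forall n, exists N, ~ P N n) ->
  (forall l N, exists M, forall n, (M <= n)%N -> exists2 N', (N <= N')%N & P N' (l - v n)) ->
  L2 g -> qcauchy dot (fun n => shift (v n) g) -> qf dot g = 0.
Proof.
move=> decP capP hv Lg hc; have Ls n : L2 (shift (v n) g) by exact: L2_shift.
have [x Lx hx] := @L2_complete R k _ Ls hc.
have x0 : qf dot x = 0.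
  apply: L2_fourier_eq0 => // n i.
  apply: (qlim_form hL Ls Lx (L2_zvec R n i) hx) => e e0.
  have [N hN] := riemann_lebesgue decP capP Lg e0.
  have [M hM] := hv n N; exists M => p Mp; have [N' NN' hP] := hM p Mp.
  by rewrite subr0 L2dot_shift_zvec; exact: hN NN' hP.
apply/eqP; rewrite eq_le (qf_ge0 hL) // andbT; apply/ler_addgt0Pr => e e0.
have [N /(_ N (leqnn N))] := qlim_qf hL Ls Lx hx e0.
by rewrite qf_shift x0 subr0 add0r => h; apply: ltW; exact: le_lt_trans (ler_norm _) h.
Qed.
End frequencies.

(** * Essential norm *)

Section essential_norm.
Variable R : realType.
Local Notation C := R[i].
Local Notation T := (circle R).
Local Notation mu := (@arc_measure R).
Local Notation Re := (@complex.Re R).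
Variables (m1 m2 n1 n2 : nat).
Variable Phi : T -> 'M[C]_(m1 + m2, n1 + n2).
Hypothesis hPhi : Linf Phi.
Local Notation dom := (@Gamma_dom R n1 n2).
Local Notation cod := (@Gamma_cod R m1 m2).
Let hD := L2_hform R (n1 + n2).
Let hC := L2_hform R (m1 + m2).
Local Notation dotD := (@L2dot R (n1 + n2)).
Local Notation dotC := (@L2dot R (m1 + m2)).
Local Notation fD := (T -> 'cV[C]_(n1 + n2)).
Local Notation G := (gam Phi).

Record compact_approx (K : fD -> T -> 'cV[C]_(m1 + m2)) (al : R) : Prop := CompactApprox {
  ca_compact : compact_op dom cod K ;
  ca_ge0 : 0 <= al ;
  ca_le : forall f, dom f -> qf dotC (G f - K f) <= al ^+ 2 * qf dotD f }.

Lemma compact_lin K (a : C) f g : compact_op dom cod K -> dom f -> dom g ->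
  \forall z \ae mu, K (a *: f + g) z = (a *: K f + K g) z.
Proof.
move=> [[_ h] _] Df Dg; have := h a f g Df Dg; rewrite /ae_eq.
by apply: filterS => z; apply.
Qed.

Lemma compact_cod K f : compact_op dom cod K -> dom f -> L2 (K f).
Proof. by move=> [[h _] _] Df; apply: cod_L2; exact: h. Qed.

(** Rewrites the supremum over the unit ball as a quadratic inequality for all f, the form in which
    the gap is used. *)
Lemma ess_norm_approx (t : \bar R) : (Gamma_ess_norm Phi < t)%E ->
  exists K, exists2 al, compact_approx K al & (al%:E < t)%E.
Proof.
rewrite /Gamma_ess_norm /ess_norm => /ereal_inf_lt[_ [K cK <-]] ht.
set A := fun f : fD => Gamma Phi f - K f; have hA : A = fun f => G f - K f.
  by apply/funext => f; rewrite /A /gam -lock.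
have sD := @dom_sub R n1 n2.
have LA f : dom f -> L2 (A f).
  move=> Df; rewrite hA; apply: (subB (L2_sub R _)); [|exact: compact_cod].
  by apply: L2_Gamma => //; exact: dom_L2.
have Lfin f : dom f -> L2norm (A f) = (Num.sqrt (qf dotC (A f)))%:E.
  by move=> /LA; exact: L2norm_qf.
have D0 : dom 0 by exact: sub0.
have N0 : (L2norm (0%R : fD) <= 1)%E.
  by rewrite L2norm_qf ?(qf0 hD) ?sqrtr0 ?lee_fin //; exact: dom_L2.
have ub f : dom f -> (L2norm f <= 1)%E -> (L2norm (A f) <= op_norm dom A)%E.
  by move=> Df Nf; apply: ereal_sup_ubound; exists f.
have ge0 : (0 <= op_norm dom A)%E.
  by apply: le_trans (ub _ D0 N0); rewrite Lfin // lee_fin sqrtr_ge0.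
have [al al0 hal] : exists2 al : R, 0 <= al & op_norm dom A = al%:E.
  move: ge0 ht; case: (op_norm dom A) => [r|//|//]; first by rewrite lee_fin => r0 _; exists r.
  by move=> _; case: t.
exists K, al; last by rewrite -hal.
split => // f Df; have Lf := dom_L2 Df.
have linA a g h : dom g -> dom h -> \forall z \ae mu, A (a *: g + h) z = (a *: A g + A h) z.
  move=> Dg Dh; have := compact_lin a cK Dg Dh.
  have := Gamma_lin hPhi a (dom_L2 Dg) (dom_L2 Dh); rewrite hA; apply: filterS2 => z.
  rewrite -[X in _ = X]/(a *: G g z + G h z) => g1.
  rewrite -[X in _ = X]/(a *: K g z + K h z) => g2.
  rewrite -[LHS]/(G (a *: g + h) z - K (a *: g + h) z) g1 g2.
  rewrite -[RHS]/(a *: (G g z - K g z) + (G h z - K h z)).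
  by rewrite scalerBr opprD addrACA.
have ball (c : R) : c ^+ 2 * qf dotD f <= 1 -> c ^+ 2 * qf dotC (A f) <= al ^+ 2.
  move=> hc; have Dc : dom (c%:C%C *: f) by exact: subZ.
  have : (L2norm (A (c%:C%C *: f)) <= al%:E)%E.
    rewrite -hal; apply: ub => //; rewrite L2norm_qf ?lee_fin; last exact: dom_L2.
    by rewrite -[leRHS]sqrtr1 ler_sqrt // (qfZ hD) // cn2R.
  rewrite Lfin // lee_fin => h.
  have q0 := qf_ge0 hC (LA _ Dc).
  have : qf dotC (A (c%:C%C *: f)) <= al ^+ 2.
    by rewrite -[leLHS]sqr_sqrtr // lerXn2r // nnegrE ?sqrtr_ge0.
  suff -> : qf dotC (A (c%:C%C *: f)) = c ^+ 2 * qf dotC (A f) by [].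
  (* The operator is additive and homogeneous only almost everywhere; that A 0 vanishes almost
     everywhere has to be extracted first. *)
  have e0 := linA 1 _ _ D0 D0; have e1 := linA c%:C%C _ _ Df D0.
  have ae : \forall z \ae mu, A (c%:C%C *: f) z = (c%:C%C *: A f) z.
    rewrite scale1r addr0 in e0; rewrite addr0 in e1; apply: filterS2 e0 e1 => z.
    rewrite -[X in _ = X]/(1 *: A 0 z + A 0 z) scale1r => /eqP.
    rewrite -subr_eq0 opprD addrA subrr sub0r oppr_eq0 => /eqP g0.
    by rewrite -[X in _ = X]/(c%:C%C *: A f z + A 0 z) g0 addr0.
  rewrite -cn2R -(qfZ hC _ (LA f Df)) /qf; congr Re.
  have Lc : L2 (c%:C%C *: A f) by apply: (subZ (L2_sub R _)); exact: LA.
  by have LAc := LA _ Dc; exact: (L2dot_ae LAc Lc LAc Lc ae ae).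
(* The norm of f may be 0, so f is divided by the square root of ||f||^2 + e. *)
apply: (@le_eps _ _ _ (al ^+ 2)); first exact: sqr_ge0.
move=> e e0 _; rewrite -mulrDr.
have p0 : 0 < qf dotD f + e by rewrite ltr_wpDl // (qf_ge0 hD).
have c2 : (Num.sqrt (qf dotD f + e))^-1 ^+ 2 = (qf dotD f + e)^-1.
  by rewrite exprVn sqr_sqrtr // ltW.
have := ball (Num.sqrt (qf dotD f + e))^-1; rewrite c2 => h.
have h1 : (qf dotD f + e)^-1 * qf dotD f <= 1.
  by rewrite mulrC ler_pdivrMr // mul1r lerDl ltW.
have -> : G f - K f = A f by rewrite hA.
by have := h h1; rewrite mulrC ler_pdivrMr.
Qed.

Section gap.
Variables (K : fD -> T -> 'cV[C]_(m1 + m2)) (al be : R).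
Hypothesis hK : compact_approx K al.
Hypothesis al_be : al < be.

(** Along a subsequence the images under K converge. Gamma - K has norm at most al < be, so a lower
    bound by be for Gamma on the differences u m - u n, up to small errors, forces these differences
    to 0. *)
Lemma gap_unit_ball (u : nat -> fD) : (forall n, dom (u n)) -> (forall n, qf dotD (u n) <= 1) ->
  (forall e, 0 < e -> exists N, forall m n, (N <= m)%N -> (N <= n)%N ->
    be ^+ 2 * qf dotD (u m - u n) <= qf dotC (G (u m - u n)) + e) ->
  exists phi : nat -> nat, {homo phi : p q / (p < q)%N} /\ qcauchy dotD (u \o phi).
Proof.
move=> Du u1 hu; have [cK al0 hal] := hK; have sD := @dom_sub R n1 n2.
have ball n : dom (u n) /\ (L2norm (u n) <= 1)%E.
  split => //; rewrite L2norm_qf ?lee_fin; last exact: dom_L2.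
  by rewrite -[leRHS]sqrtr1 ler_sqrt.
have [phi [g [phi_mono cg hg]]] := (proj2 cK) u ball.
have LK n : L2 (K (u n)) by exact: compact_cod.
have Lg := cod_L2 cg.
exists phi; split => //.
have phi_ge n : (n <= phi n)%N.
  by elim: n => // n IH; exact: leq_ltn_trans IH (phi_mono _ _ (ltnSn n)).
have Kcvg e : 0 < e -> exists N, forall n, (N <= n)%N -> qf dotC (K (u (phi n)) - g) < e.
  move=> e0; have LB n : L2 (K (u (phi n)) - g) by exact: (subB (L2_sub R _)).
  have se : 0 < Num.sqrt e by rewrite sqrtr_gt0.
  have hg' : (fun n => Num.sqrt (qf dotC (K (u (phi n)) - g))) @ \oo --> (0 : R).
    rewrite (_ : (fun n => _) = fine \o (fun n => L2norm (K (u (phi n)) - g))).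
      exact: (fine_cvg hg).
    by apply/funext => n; rewrite /= (L2norm_qf (LB n)).
  move/cvgrPdist_lt : hg' => /(_ _ se)[N _ hN].
  exists N => n Nn; have := hN n Nn; rewrite /= sub0r normrN.
  by rewrite ger0_norm ?sqrtr_ge0 // ltr_sqrt.
have be0 : 0 < be by exact: le_lt_trans al0 al_be.
have ab2 : al ^+ 2 < be ^+ 2 by rewrite ltrXn2r // nnegrE // ltW.
have [s s0 arith] := gap_arith (sqr_ge0 al) ab2.
have s1 : 0 <= 1 + s by rewrite addr_ge0 // ltW.
move=> e e0; have [ke ke0 [ee ee0 {}arith]] := arith e e0.
have [N1 hN1] := Kcvg _ ke0; have [N2 hN2] := hu _ ee0.
exists (maxn N1 N2) => p q; rewrite !geq_max => /andP[p1 p2] /andP[q1 q2] /=.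
have Dd : dom (u (phi p) - u (phi q)) by exact: subB.
have Ld := dom_L2 Dd.
have h1 := hN2 _ _ (leq_trans p2 (phi_ge p)) (leq_trans q2 (phi_ge q)).
have LKd : L2 (K (u (phi p) - u (phi q))) by exact: compact_cod.
have LGd : L2 (G (u (phi p) - u (phi q))) by exact: L2_Gamma.
have LGK : L2 (G (u (phi p) - u (phi q)) - K (u (phi p) - u (phi q))).
  exact: (subB (L2_sub R _)).
have h2 : qf dotC (G (u (phi p) - u (phi q))) <=
    (1 + s) * (al ^+ 2 * qf dotD (u (phi p) - u (phi q))) +
    (1 + s^-1) * qf dotC (K (u (phi p) - u (phi q))).
  rewrite -{1}(subrK (K (u (phi p) - u (phi q))) (G (u (phi p) - u (phi q)))).
  apply: le_trans (qfD_weighted hC LGK LKd s0) _.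
  by rewrite lerD2r ler_wpM2l //; exact: hal.
have h3 : qf dotC (K (u (phi p) - u (phi q))) <= 2 * qf dotC (K (u (phi p)) - g) + 2 * qf dotC (K (u (phi q)) - g).
  have LA : L2 (K (u (phi p)) - g) by exact: (subB (L2_sub R _)).
  have LB : L2 (K (u (phi q)) - g) by exact: (subB (L2_sub R _)).
  have ae := compact_lin (-1) cK (Du (phi q)) (Du (phi p)).
  have -> : qf dotC (K (u (phi p) - u (phi q))) = qf dotC ((K (u (phi p)) - g) - (K (u (phi q)) - g)).
    rewrite addrC -scaleN1r in LKd *; rewrite /qf; congr Re.
    have ae' : \forall z \ae mu, K (-1 *: u (phi q) + u (phi p)) z =
        ((K (u (phi p)) - g) - (K (u (phi q)) - g)) z.
      apply: filterS ae => z ->.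
      rewrite -[LHS]/(-1 *: K (u (phi q)) z + K (u (phi p)) z).
      rewrite -[RHS]/((K (u (phi p)) z - g z) - (K (u (phi q)) z - g z)).
      by rewrite opprB addrA subrK scaleN1r addrC.
    have LAB : L2 ((K (u (phi p)) - g) - (K (u (phi q)) - g)) by exact: (subB (L2_sub R _)).
    exact: (L2dot_ae LKd LAB LKd LAB ae' ae').
  exact: (qfB_le hC).
exact: (arith _ _ _ _ _ (qf_ge0 hD Ld) h1 h2 h3 (hN1 _ p1) (hN1 _ q1)).
Qed.

Lemma gap (u : nat -> fD) (M : R) : (forall n, dom (u n)) -> (forall n, qf dotD (u n) <= M) ->
  (forall e, 0 < e -> exists N, forall m n, (N <= m)%N -> (N <= n)%N ->
    be ^+ 2 * qf dotD (u m - u n) <= qf dotC (G (u m - u n)) + e) ->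
  exists phi : nat -> nat, {homo phi : p q / (p < q)%N} /\ qcauchy dotD (u \o phi).
Proof.
move=> Du uM hu; have Lu n := dom_L2 (Du n).
have M0 : 0 <= M by apply: le_trans (uM 0%N); exact: (qf_ge0 hD).
have M1 : 0 < M + 1 by lra.
pose c := (Num.sqrt (M + 1))^-1.
have c0 : 0 < c by rewrite invr_gt0 sqrtr_gt0.
have c2 : c ^+ 2 = (M + 1)^-1 by rewrite exprVn sqr_sqrtr // ltW.
have c20 : 0 < c ^+ 2 by rewrite exprn_gt0.
have Ld m n : L2 (u m - u n) by exact: (subB (L2_sub R _)).
have qd m n : qf dotD (c%:C%C *: u m - c%:C%C *: u n) = c ^+ 2 * qf dotD (u m - u n).
  by rewrite -scalerBr (qfZ hD) // cn2R.
have qG m n : qf dotC (G (c%:C%C *: u m - c%:C%C *: u n)) = c ^+ 2 * qf dotC (G (u m - u n)).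
  by rewrite -scalerBr -cn2R; exact: (qfZ (Gamma_hform hPhi)).
have [n|n|e e0|phi [phim hphi]] := @gap_unit_ball (fun n => c%:C%C *: u n).
- exact: (subZ (@dom_sub R n1 n2)).
- rewrite (qfZ hD) // cn2R c2 mulrC ler_pdivrMr // mul1r; have := uM n; lra.
- have [N hN] := hu _ (divr_gt0 e0 c20); exists N => m n hm hn.
  rewrite qd qG mulrCA; have := hN m n hm hn; rewrite -(ler_pM2l c20) mulrDr.
  by rewrite [c ^+ 2 * (e / _)]mulrCA divff ?mulr1 // gt_eqF.
exists phi; split => // e e0.
have [N hN] := hphi _ (mulr_gt0 c20 e0); exists N => p q hp hq.
by have := hN p q hp hq; rewrite /= qd ltr_pM2l.
Qed.
End gap.
End essential_norm.

(** * Test functions carried by the set where a bound fails *)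

Section restriction.
Variable R : realType.
Local Notation C := R[i].
Local Notation T := (circle R).
Local Notation mu := (@arc_measure R).
Local Notation Re := (@complex.Re R).
Variables (m n : nat) (F : T -> 'M[C]_(m, n)) (b : R) (y : 'cV[C]_n).
Hypothesis hF : Linf F.

Definition exceed (z : T) : C := (b ^+ 2 * vn2 y < vn2 (F z *m y))%R%:R.

Lemma L2_mul_cst : L2 (F \*m (fun=> y)).
Proof. by apply: L2_mulmx => //; exact: L2_cst. Qed.

Lemma cm_exceed : cmeasurable exceed.
Proof.
rewrite (_ : exceed = fun z => ((b ^+ 2 * vn2 y < vn2 (F z *m y))%R%:R : R)%:C%C); last first.
  by apply/funext => z; rewrite /exceed; case: (_ < _).
apply: cmR; rewrite (_ : (fun z => _) = \1_[set z | b ^+ 2 * vn2 y < vn2 (F z *m y)]); last first.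
  by apply/funext => z; rewrite indicE mem_setE.
have mF := m_vn2 (L2_meas L2_mul_cst).
apply: measurable_indic.
rewrite (_ : [set z | _] = [set: T] `&` (fun z => vn2 (F z *m y)) @^-1` `]b ^+ 2 * vn2 y, +oo[).
  by apply: mF => //; exact: measurable_itv.
by apply/seteqP; split=> z /=; rewrite in_itv /= andbT; [|case].
Qed.

Lemma cn2_exceed z : cn2 (exceed z) <= 1.
Proof. by rewrite /exceed; case: (_ < _); rewrite ?cn2_1 ?cn2_0. Qed.

Lemma L2_exceed k (f : T -> 'cV[C]_k) : L2 f -> L2 (fun z => exceed z *: f z).
Proof. by apply: (@L2_mulc _ _ _ 1); [exact: cm_exceed|exact: aeW cn2_exceed]. Qed.

Definition restr : T -> 'cV[C]_n := fun z => exceed z *: y.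

Lemma L2_restr : L2 restr.
Proof. by apply: L2_exceed; exact: L2_cst. Qed.

(** Where the bound fails F y is nonzero, so either alternative makes that set null. The first
    serves the block column of Phi, the second the block row. *)
Lemma le_of_restr0 : qf (@L2dot R n) restr = 0 \/ qf (@L2dot R m) (F \*m restr) = 0 ->
  \forall z \ae mu, vn2 (F z *m y) <= b ^+ 2 * vn2 y.
Proof.
move=> h; have hz : \forall z \ae mu, F z *m restr z = 0.
  case: h => [/(qf_eq0_ae L2_restr)|/(qf_eq0_ae (L2_mulmx hF L2_restr))//].
  by apply: filterS => z ->; rewrite mulmx0.
apply: filterS hz => z; rewrite /restr /exceed; case: ltP => // hb.
rewrite scale1r => e; move: hb; rewrite e vn2_0 ltNge.
by rewrite mulr_ge0 ?sqr_ge0 ?vn2_ge0.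
Qed.

Lemma restr_dominates (c : T -> C) : L2 (fun z => c z *: restr z) ->
  b ^+ 2 * qf (@L2dot R n) (fun z => c z *: restr z) <=
  qf (@L2dot R m) (F \*m (fun z => c z *: restr z)).
Proof.
move=> Lc; rewrite !qfL2 -rintZ; last exact: L2_rI.
apply: rint_le; [by apply: rIZ; exact: L2_rI|by apply: L2_rI; exact: L2_mulmx|].
apply: aeW => z; rewrite /restr -!scalemxAr !vn2Z.
rewrite mulrCA ler_wpM2l ?cn2_ge0 // mulrCA /exceed.
by case: ltP => [/ltW h|_]; rewrite ?cn2_1 ?mul1r // cn2_0 !mul0r.
Qed.
End restriction.

Lemma vn2_0col (R : realType) k1 k2 (y : 'cV[R[i]]_k2) : vn2 (col_mx 0 y : 'cV_(k1 + k2)) = vn2 y.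
Proof. by rewrite vn2_col col_mxKu col_mxKd vn2_0 add0r. Qed.

(** * Bounds for the last block column and the last block row of Phi *)

Section lower_blocks.
Variable R : realType.
Local Notation C := R[i].
Local Notation T := (circle R).
Local Notation mu := (@arc_measure R).
Local Notation Re := (@complex.Re R).
Variables (m1 m2 n1 n2 : nat).
Variable Phi : T -> 'M[C]_(m1 + m2, n1 + n2).
Hypothesis hPhi : Linf Phi.
Local Notation dom := (@Gamma_dom R n1 n2).
Local Notation cod := (@Gamma_cod R m1 m2).
Let hD := L2_hform R (n1 + n2).
Let hC := L2_hform R (m1 + m2).
Local Notation dotD := (@L2dot R (n1 + n2)).
Local Notation dotC := (@L2dot R (m1 + m2)).
Local Notation fD := (T -> 'cV[C]_(n1 + n2)).
Local Notation G := (gam Phi).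
Variable b : R.
Hypothesis b_gt : (Gamma_ess_norm Phi < b%:E)%E.

Lemma qf_col (k1 k2 : nat) (f : T -> 'cV[C]_(k1 + k2)) : L2 f ->
  (\forall z \ae mu, bot f z = 0) -> qf (@L2dot R _) f = qf (@L2dot R _) (top f).
Proof.
move=> Lf h; have /L2_col[Lt Lb] := Lf.
rewrite /qf (L2dot_col Lf Lf) ReD; have := (qf_eq0_ae Lb).2 h.
by rewrite /qf => ->; rewrite addr0.
Qed.

Lemma ae_vn2_le p q (F : T -> 'M[C]_(p, q)) : (forall y, \forall z \ae mu, vn2 (F z *m y) <= b ^+ 2 * vn2 y) ->
  \forall z \ae mu, forall y, vn2 (F z *m y) <= b ^+ 2 * vn2 y.
Proof.
move=> h; have E z y : Re (hdot (((b ^+ 2)%:C%C *: 1%:M - adj (F z) *m F z) *m y) y) =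
    b ^+ 2 * vn2 y - vn2 (F z *m y).
  by rewrite mulmxBl hdotB ReB hdot_gram hdotxx -scalemxAl mul1mx hdotZ hdotxx !ReImE mul0r subr0.
have := @ae_psd R q (fun z => (b ^+ 2)%:C%C *: 1%:M - adj (F z) *m F z).
have h' y : \forall z \ae mu, 0 <= Re (hdot (((b ^+ 2)%:C%C *: 1%:M - adj (F z) *m F z) *m y) y).
  by apply: filterS (h y) => z; rewrite E subr_ge0.
by move=> /(_ h'); apply: filterS => z hz y; have := hz y; rewrite E subr_ge0.
Qed.

Lemma homo_ge (phi : nat -> nat) : {homo phi : p q / (p < q)%N} -> forall n, (n <= phi n)%N.
Proof. by move=> h; elim=> // n IH; exact: leq_ltn_trans IH (h _ _ (ltnSn n)). Qed.

Lemma L2_inr_shift k1 k2 v (h : T -> 'cV[C]_k2) : shift v (inr_fun h) = inr_fun (shift v h) :> (T -> 'cV[C]_(k1 + k2)).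
Proof. by apply/funext => z; rewrite /shift /inr_fun scale_col_mx scaler0. Qed.

(* A violation on a set of positive measure yields, through the test functions
   [z^-N (0, chi y)], a weakly null sequence on which Gamma is as large as Phi. *)
Lemma right_block_bound : \forall z \ae mu, forall y : 'cV[C]_n2,
  vn2 (Phi z *m col_mx 0 y) <= b ^+ 2 * vn2 y.
Proof.
suff main (y : 'cV[C]_n2) : \forall z \ae mu, vn2 (Phi z *m (col_mx 0 y : 'cV[C]_(n1 + n2))) <=
    b ^+ 2 * vn2 (col_mx 0 y : 'cV[C]_(n1 + n2)).
  have E z (y : 'cV[C]_n2) : rsubmx (Phi z) *m y = Phi z *m col_mx 0 y.
    by rewrite -[in RHS](hsubmxK (Phi z)) mul_row_col mulmx0 add0r.
  have h y : \forall z \ae mu, vn2 (rsubmx (Phi z) *m y) <= b ^+ 2 * vn2 y.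
    by apply: filterS (main y) => z; rewrite E vn2_0col.
  by apply: filterS (ae_vn2_le h) => z hz y; rewrite -E.
have [K [al hK al_b]] := ess_norm_approx hPhi b_gt; rewrite lte_fin in al_b.
pose Y : 'cV[C]_(n1 + n2) := col_mx 0 y.
pose f0 := restr Phi b Y; have Lf0 : L2 f0 by exact: L2_restr.
apply: le_of_restr0 => //; left; rewrite -/Y -/f0.
have f0E : f0 = inr_fun (fun z => exceed Phi b Y z *: y).
  by apply/funext => z; rewrite /f0 /restr /Y scale_col_mx scaler0.
have [u uE] : exists u : nat -> fD, forall N, u N = shift (- N%:Z) f0.
  by exists (fun N => shift (- N%:Z) f0).
have Du N : dom (u N).
  by rewrite uE f0E L2_inr_shift; apply: dom_inr; apply: L2_shift; apply: L2_exceed => //; exact: L2_cst.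
have Lu N := dom_L2 (Du N).
have [r rdef] : exists r : nat -> T -> 'cV[C]_(m1 + m2), forall N, r N = (Phi \*m u N) - G (u N).
  by exists (fun N => (Phi \*m u N) - G (u N)).
have Lr N : L2 (r N) by rewrite rdef; exact: (L2_PhiB hPhi (Lu N)).
have rE N : H2 (top (r N)) /\ \forall z \ae mu, bot (r N) z = 0.
  by rewrite rdef; exact: (Gamma_residual hPhi (Lu N)).
have LP : L2 (Phi \*m f0) by exact: L2_mulmx.
pose P (N : nat) (n : int) : Prop := N%:Z <= n.
have decP N n : P N.+1 n -> P N n by rewrite /P; lia.
have capP n : exists N, ~ P N n by exists `|n|.+1%N; rewrite /P; lia.
(* With [ortho], z^N r_N is the part of the upper half of Phi f0 with frequencies at least N. Hence
   r_N tends to 0, and Gamma u_N is asymptotically Phi u_N. *)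
have bandr N : band P N (shift N (top (r N))).
  have [Hr _] := rE N; apply/bandP; split; first by apply: L2_shift; exact: Hr.1.
  move=> n i; rewrite L2dot_shift_zvec /P => Nn; have /H2P[_ h] := Hr; apply: h; lia.
have ortho N t : band P N t -> L2dot (top (Phi \*m f0) - shift N (top (r N))) t = 0.
  move=> /bandP[Lt ht].
  have -> : top (Phi \*m f0) - shift N (top (r N)) = shift N (top (G (u N))).
    have e1 : Phi \*m f0 = shift N (Phi \*m u N) by rewrite uE mulmx_shift shiftNK.
    rewrite e1 -!top_shift rdef; apply/funext => z.
    rewrite -[LHS]/(usubmx (zpow N z *: (Phi z *m u N z)) - usubmx (zpow N z *: (Phi z *m u N z - G (u N) z))).
    by rewrite -linearB -scalerBr opprB addrC subrK.
  rewrite L2dot_shift; have [hG _] := Gamma_in_cod hPhi (Lu N); apply: hG.2.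
  apply/H2P; split; first exact: L2_shift.
  move=> n i n0; rewrite L2dot_shift_zvec; apply: ht; rewrite /P; lia.
have r0 e : 0 < e -> exists N, forall n, (N <= n)%N -> qf dotC (r n) < e.
  move=> e0; have LtP : L2 (top (Phi \*m f0)) by have /L2_col[] := LP.
  have [N hN] := band_projections_vanish decP capP LtP bandr ortho e0.
  exists N => n Nn; have [_ hb] := rE n; rewrite (qf_col (Lr n) hb).
  by have := hN n Nn; rewrite qf_shift.
have uB m n : u m - u n = fun z => (zpow (- m%:Z) z - zpow (- n%:Z) z) *: f0 z.
  by apply/funext => z; rewrite !uE scalerBl.
have [n|n|e e0|phi [phim hphi]] := gap hPhi hK al_b (u := u) (M := qf dotD f0).
- exact: Du.
- by rewrite uE qf_shift.
- have e4 : 0 < e / 4 by apply: divr_gt0.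
  have [N hN] := r0 _ e4; exists N => m n hm hn.
  have Ld : L2 (u m - u n) by exact: (subB (L2_sub R _)).
  have h1 : b ^+ 2 * qf dotD (u m - u n) <= qf dotC (Phi \*m (u m - u n)).
    by rewrite uB in Ld *; exact: restr_dominates.
  apply: le_trans h1 _; rewrite (qf_Gamma_split hPhi Ld) lerD2l.
  have ae := GammaB hPhi (Lu m) (Lu n).
  have ae' : \forall z \ae mu, ((Phi \*m (u m - u n)) - G (u m - u n)) z = (r m - r n) z.
    apply: filterS ae => z hz.
    rewrite -[LHS]/(Phi z *m (u m z - u n z) - G (u m - u n) z) hz.
    change (Phi z *m (u m z - u n z) - (G (u m) z - G (u n) z) = r m z - r n z).
    rewrite !rdef.
    change (Phi z *m (u m z - u n z) - (G (u m) z - G (u n) z) =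
      (Phi z *m u m z - G (u m) z) - (Phi z *m u n z - G (u n) z)).
    by rewrite mulmxBr !opprD addrACA.
  have Lrr : L2 (r m - r n) by exact: (subB (L2_sub R _)).
  have LX := L2_PhiB hPhi Ld.
  have -> : qf dotC ((Phi \*m (u m - u n)) - G (u m - u n)) = qf dotC (r m - r n).
    by rewrite /qf; congr Re; exact: (L2dot_ae LX Lrr LX Lrr ae' ae').
  apply: le_trans (qfB_le hC (Lr m) (Lr n)) _.
  have := hN m hm; have := hN n hn; lra.
have hphi' : qcauchy dotD (fun n => shift (- (phi n)%:Z) f0).
  by move: hphi; rewrite (_ : u \o phi = fun n => shift (- (phi n)%:Z) f0) //; apply/funext => n /=.
apply: (cauchy_shifts_eq0 decP capP _ Lf0 hphi').
move=> l N; exists (N + `|l|)%N => n hn; exists N => //.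
have := homo_ge phim n; rewrite /P; lia.
Qed.

Lemma orth_dom (f : fD) : L2 f -> (forall h, dom h -> dotD f h = 0) ->
  H2minus (top f) /\ \forall z \ae mu, bot f z = 0.
Proof.
move=> Lf hf; have /L2_col[Lt Lb] := Lf; split.
  split=> // g Hg; rewrite -dot_inl //; last exact: Hg.1.
  by apply: hf; exact: dom_inl.
by apply/(qf_eq0_ae Lb); rewrite /qf -dot_inr // hf //; exact: dom_inr.
Qed.

(** Division of the last hypothesis by d leaves the error g w / d, which is at most M w. *)
Lemma gap_quotient (B d g w M : R) : 0 <= B -> 0 <= d -> 0 <= w -> 0 <= M -> 0 <= g ->
  g <= M * d -> B * d ^+ 2 <= g * (d + w) -> B * d <= g + M * w.
Proof.
move=> B0 d0 w0 M0 g0 gM h; have [->|dn] := eqVneq d 0.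
  by rewrite mulr0 addr_ge0 // mulr_ge0.
have dp : 0 < d by rewrite lt_neqAle eq_sym dn.
by rewrite -(ler_pM2r dp); nra.
Qed.

(* The adjoint version: test functions are the projections of
   [z^N chi Phi^* (0, y)] onto the domain of Gamma. *)
Lemma left_block_bound : \forall z \ae mu, forall y : 'cV[C]_m2,
  vn2 (adj (Phi z) *m col_mx 0 y) <= b ^+ 2 * vn2 y.
Proof.
have LA : Linf (fun z => adj (Phi z)) by exact: Linf_adj.
suff main (y : 'cV[C]_m2) : \forall z \ae mu, vn2 (adj (Phi z) *m (col_mx 0 y : 'cV[C]_(m1 + m2))) <=
    b ^+ 2 * vn2 (col_mx 0 y : 'cV[C]_(m1 + m2)).
  have E z (y : 'cV[C]_m2) : rsubmx (adj (Phi z)) *m y = adj (Phi z) *m col_mx 0 y.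
    by rewrite -[in RHS](hsubmxK (adj (Phi z))) mul_row_col mulmx0 add0r.
  have h y : \forall z \ae mu, vn2 (rsubmx (adj (Phi z)) *m y) <= b ^+ 2 * vn2 y.
    by apply: filterS (main y) => z; rewrite E vn2_0col.
  by apply: filterS (ae_vn2_le h) => z hz y; rewrite -E.
have [K [al hK al_b]] := ess_norm_approx hPhi b_gt; rewrite lte_fin in al_b.
pose Y : 'cV[C]_(m1 + m2) := col_mx 0 y.
pose h0 := restr (fun z => adj (Phi z)) b Y.
have Lh0 : L2 h0 by exact: (L2_restr b Y LA).
apply: (le_of_restr0 LA); right; rewrite -/Y -/h0.
have h0E : h0 = inr_fun (fun z => exceed (fun z => adj (Phi z)) b Y z *: y).
  by apply/funext => z; rewrite /h0 /restr /Y scale_col_mx scaler0.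
have [w0 w0E] : exists w0 : fD, w0 = (fun z => adj (Phi z)) \*m h0 by eexists.
have Lw0 : L2 w0 by rewrite w0E; exact: L2_mulmx.
rewrite -w0E.
(* Projections are needed because the upper part of z^N w0 may keep negative frequencies; the defect
   p_N tends to 0. *)
have [u uE] : exists u : nat -> fD, forall N, u N = orthproj dom (shift N w0).
  by exists (fun N => orthproj dom (shift N w0)).
have Lw (N : nat) : L2 (shift N w0) by exact: L2_shift.
have spec N : dom (u N) /\ forall h, dom h -> dotD (shift N w0 - u N) h = 0.
  by rewrite uE; exact: (orthproj_spec (@dom_sub R n1 n2) (@dom_L2 R n1 n2) (@dom_closed R n1 n2) (Lw N)).
have Du N : dom (u N) by have [] := spec N.
have Lu N := dom_L2 (Du N).
have [p pE] : exists p : nat -> fD, forall N, p N = shift N w0 - u N.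
  by exists (fun N : nat => shift N w0 - u N).
have Lp N : L2 (p N) by rewrite pE; exact: (subB (L2_sub R _)).
have po N h : dom h -> dotD (p N) h = 0 by rewrite pE; exact: (spec N).2.
have rE N : H2minus (top (p N)) /\ \forall z \ae mu, bot (p N) z = 0.
  by apply: orth_dom => // h; exact: po.
pose P (N : nat) (n : int) : Prop := n < - N%:Z.
have decP N n : P N.+1 n -> P N n by rewrite /P; lia.
have capP n : exists N, ~ P N n by exists `|n|%N; rewrite /P; lia.
(* With [ortho], this is the part of the upper half of w0 with frequencies below -N. *)
have bandr N : band P N (shift (- N%:Z) (top (p N))).
  have [Hr _] := rE N; apply/bandP; split; first by apply: L2_shift; exact: Hr.1.
  move=> n i; rewrite L2dot_shift_zvec /P => Nn.
  have -> : n - - N%:Z = `|n - - N%:Z|%N :> int by lia.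
  by apply: Hr.2; exact: H2_zvec.
have ortho N t : band P N t -> L2dot (top w0 - shift (- N%:Z) (top (p N))) t = 0.
  move=> /bandP[Lt ht].
  have -> : top w0 - shift (- N%:Z) (top (p N)) = shift (- N%:Z) (top (u N)).
    have e1 : w0 = shift (- N%:Z) (shift N w0) by rewrite shiftK.
    rewrite [in LHS]e1 -!top_shift pE; apply/funext => z.
    move: (shift N w0) => f.
    change (usubmx (zpow (- N%:Z) z *: f z) - usubmx (zpow (- N%:Z) z *: (f z - u N z)) =
      usubmx (zpow (- N%:Z) z *: u N z)).
    by rewrite -linearB -scalerBr opprB addrC subrK.
  rewrite L2dot_shift opprK; have [hu _] := Du N; apply: H2_H2minus => //.
  apply: H2minus_of_fourier; first exact: L2_shift.
  move=> n i; rewrite L2dot_shift_zvec; apply: ht; rewrite /P; lia.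
have p0 e : 0 < e -> exists N, forall n, (N <= n)%N -> qf dotD (p n) < e.
  move=> e0; have LtP : L2 (top w0) by have /L2_col[] := Lw0.
  have [N hN] := band_projections_vanish decP capP LtP bandr ortho e0.
  exists N => n Nn; have [_ hb] := rE n; rewrite (qf_col (Lp n) hb).
  by have := hN n Nn; rewrite qf_shift.
have split_w (N : nat) : shift N w0 = u N + p N by rewrite pE addrC subrK.
have qw N : qf dotD (u N) <= qf dotD w0.
  rewrite -(qf_shift N%:Z w0) split_w (qfD hD (Lu N) (Lp N)).
  rewrite (hformJ hD (Lp N) (Lu N)) po // conjc0 Re0 mulr0 addr0 lerDl.
  exact: (qf_ge0 hD).
have Ld m n : L2 (u m - u n) by exact: (subB (L2_sub R _)).
have Dd m n : dom (u m - u n) by exact: (subB (@dom_sub R n1 n2)).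
have Lpd m n : L2 (p m - p n) by exact: (subB (L2_sub R _)).
have wd m n : shift m%:Z w0 - shift n%:Z w0 = (u m - u n) + (p m - p n).
  by rewrite !split_w opprD addrACA.
have pd0 m n : dotD (p m - p n) (u m - u n) = 0.
  by rewrite (hformB hD (Lp m) (Lp n) (Ld m n)) !po // subrr.
have qwd m n : qf dotD (shift m%:Z w0 - shift n%:Z w0) = qf dotD (u m - u n) + qf dotD (p m - p n).
  rewrite wd (qfD hD) // (hformJ hD (Lpd m n) (Ld m n)) pd0 conjc0 Re0 mulr0 addr0.
  by [].
have qpd e : 0 < e -> exists N, forall m n, (N <= m)%N -> (N <= n)%N -> qf dotD (p m - p n) < e.
  move=> e0; have e4 : 0 < e / 4 by apply: divr_gt0.
  have [N hN] := p0 _ e4; exists N => m n hm hn.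
  apply: le_lt_trans (qfB_le hD (Lp m) (Lp n)) _.
  have := hN m hm; have := hN n hn; lra.
have /LinfP[_ [M M0 hM]] := hPhi.
have qG f : dom f -> qf dotC (G f) <= M ^+ 2 * qf dotD f.
  move=> /dom_L2 Lf; apply: le_trans (qf_Gamma_le hPhi Lf) _.
  rewrite !qfL2 -rintZ; last exact: L2_rI.
  apply: rint_le; [by apply: L2_rI; exact: L2_mulmx|by apply: rIZ; exact: L2_rI|].
  by apply: filterS hM => z; apply.
(* Gamma is tested against Fc = (z^m - z^n) h0: the pairing with Gamma (u m - u n) is exactly ||u m
   - u n||^2, and Fc is bounded through b ||Fc|| <= ||Phi^* Fc||. Cauchy-Schwarz then gives the
   hypothesis of [gap_quotient]. *)
have key m n : b ^+ 2 * qf dotD (u m - u n) <= qf dotC (G (u m - u n)) + M ^+ 2 * qf dotD (p m - p n).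
  apply: gap_quotient; [exact: sqr_ge0|exact: (qf_ge0 hD)|exact: (qf_ge0 hD)|exact: sqr_ge0|by apply: (qf_ge0 hC); exact: L2_Gamma|exact: qG|].
  pose Fc := shift m%:Z h0 - shift n%:Z h0.
  have cFc : cod Fc.
    by apply: (subB (@cod_sub R m1 m2)); rewrite h0E L2_inr_shift; apply: cod_inr;
      apply: L2_shift; apply: (L2_exceed b Y LA); exact: L2_cst.
  have LFc := cod_L2 cFc.
  have FcE : Fc = fun z => (zpow m%:Z z - zpow n%:Z z) *: h0 z.
    by apply/funext => z; rewrite scalerBl.
  have AFc : (fun z => adj (Phi z)) \*m Fc = shift m%:Z w0 - shift n%:Z w0.
    by rewrite w0E -!mulmx_shift -mulmxfB.
  have hw : b ^+ 2 * qf dotC Fc <= qf dotD (u m - u n) + qf dotD (p m - p n).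
    by rewrite -qwd -AFc; rewrite FcE in LFc *; exact: (restr_dominates LA).
  have e1 : dotC (G (u m - u n)) Fc = (qf dotD (u m - u n))%:C%C.
    have [_ hs] := Gamma_spec hPhi (Ld m n).
    have LPd : L2 (Phi \*m (u m - u n)) by exact: L2_mulmx.
    have := hs _ cFc; rewrite (hformB hC LPd (L2_Gamma hPhi (Ld m n)) LFc) => /eqP.
    rewrite subr_eq0 => /eqP <-; rewrite L2dot_adj AFc wd (hformDr hD (Ld m n) (Lpd m n) (Ld m n)).
    by rewrite (hformJ hD (Lpd m n) (Ld m n)) pd0 conjc0 addr0 (hformxx hD).
  have cs := cauchy_schwarz hC (L2_Gamma hPhi (Ld m n)) LFc.
  rewrite e1 cn2R in cs.
  have g0 := qf_ge0 hC (L2_Gamma hPhi (Ld m n)).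
  apply: le_trans (ler_wpM2l (sqr_ge0 b) cs) _.
  by rewrite mulrCA ler_wpM2l.
have [n|n|e e0|phi [phim hphi]] := gap hPhi hK al_b (u := u) (M := qf dotD w0).
- exact: Du.
- exact: qw.
- have eM : 0 < e / (M ^+ 2 + 1) by apply: divr_gt0 => //; rewrite ltr_wpDl ?sqr_ge0.
  have [N hN] := qpd _ eM; exists N => m n hm hn.
  apply: le_trans (key m n) _; rewrite lerD2l.
  have := hN m n hm hn; rewrite ltr_pdivlMr; last by rewrite ltr_wpDl ?sqr_ge0.
  have := qf_ge0 hD (Lpd m n); move: (qf _ _) (sqr_ge0 M) => q; move: (M ^+ 2) => M2 M20 q0; nra.
have hphi' : qcauchy dotD (fun n => shift (phi n)%:Z w0).
  move=> e e0; have e2 : 0 < e / 2 by apply: divr_gt0.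
  have [N1 hN1] := hphi _ e2; have [N2 hN2] := qpd _ e2.
  exists (maxn N1 N2) => m n; rewrite !geq_max => /andP[m1' m2'] /andP[n1' n2'].
  rewrite qwd [e]splitr; apply: ltrD; first exact: hN1.
  exact: hN2 (leq_trans m2' (homo_ge phim m)) (leq_trans n2' (homo_ge phim n)).
apply: (cauchy_shifts_eq0 decP capP _ Lw0 hphi').
move=> l N; exists (N + `|l|).+1%N => n hn; exists N => //.
have := homo_ge phim n; rewrite /P; lia.
Qed.
End lower_blocks.

(** * Minimal weights *)

Section minimal_weight.
Variable R : realType.
Local Notation C := R[i].
Local Notation T := (circle R).
Local Notation mu := (@arc_measure R).
Local Notation Re := (@complex.Re R).
Variables (m1 m2 n1 n2 : nat).
Variable Phi : T -> 'M[C]_(m1 + m2, n1 + n2).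
Hypothesis hPhi : Linf Phi.
Local Notation dom := (@Gamma_dom R n1 n2).
Local Notation cod := (@Gamma_cod R m1 m2).
Let hD := L2_hform R (n1 + n2).
Let hC := L2_hform R (m1 + m2).
Local Notation dotD := (@L2dot R (n1 + n2)).
Local Notation dotC := (@L2dot R (m1 + m2)).
Local Notation fD := (T -> 'cV[C]_(n1 + n2)).
Local Notation G := (gam Phi).

Lemma rI_quad (W : T -> 'M[C]_(n1 + n2)) f : Linf W -> L2 f ->
  rI (fun z => Re (hdot (W z *m f z) (f z))).
Proof. by move=> LW Lf; have [] := cI_hdot (L2_mulmx LW Lf) Lf. Qed.

Lemma quad_le (W : T -> 'M[C]_(n1 + n2)) (K : R) f : Linf W -> L2 f ->
  (\forall z \ae mu, forall x, Re (hdot (W z *m x) x) <= K * vn2 x) ->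
  Re (dotD (W \*m f) f) <= K * qf dotD f.
Proof.
move=> LW Lf h; rewrite qfL2 -rintZ; last exact: L2_rI.
rewrite L2dotE cintE /=; apply: rint_le; [exact: rI_quad|by apply: rIZ; exact: L2_rI|].
by apply: filterS h => z; apply.
Qed.

Lemma quad_ge (W : T -> 'M[C]_(n1 + n2)) (K : R) f : Linf W -> L2 f ->
  (\forall z \ae mu, forall x, K * vn2 x <= Re (hdot (W z *m x) x)) ->
  K * qf dotD f <= Re (dotD (W \*m f) f).
Proof.
move=> LW Lf h; rewrite qfL2 -rintZ; last exact: L2_rI.
rewrite L2dotE cintE /=; apply: rint_le; [by apply: rIZ; exact: L2_rI|exact: rI_quad|].
by apply: filterS h => z; apply.
Qed.

Lemma qf_wformE (W : T -> 'M[C]_(n1 + n2)) f :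
  qf (wform Phi W) f = Re (dotD (W \*m f) f) - qf dotC (G f).
Proof. by rewrite /qf /wform ReB. Qed.

Variables (W : R -> T -> 'M[C]_(n1 + n2)) (D : T -> 'M[C]_(n1 + n2)) (a : R).
Hypothesis LW : forall a', Linf (W a').
Hypothesis LD : Linf D.
Hypothesis adjD : forall z, adj (D z) = D z.
Hypothesis WE : forall a1 a2 z, W a1 z = W a2 z + (a1 ^+ 2 - a2 ^+ 2)%:C%C *: D z.
Hypothesis D_ge0 : forall z x, 0 <= Re (hdot (D z *m x) x).
Hypothesis D_le : forall z x, Re (hdot (D z *m x) x) <= vn2 x.
Hypothesis W_ge : forall z x, a ^+ 2 * vn2 x <= Re (hdot (W a z *m x) x).
Hypothesis a_gt0 : 0 < a.
Hypothesis ess_a : (Gamma_ess_norm Phi < a%:E)%E.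
Hypothesis adm : admissible Phi (W a).
Hypothesis minimal : forall a', 0 <= a' -> a' < a ->
  exists2 f, dom f & qf (wform Phi (W a')) f < 0.

Let hB := wform_hform hPhi adm.
Local Notation q := (qf (wform Phi (W a))).

Lemma qf_wform_diff a' f : L2 f ->
  qf (wform Phi (W a')) f = q f - (a ^+ 2 - a' ^+ 2) * Re (dotD (D \*m f) f).
Proof.
move=> Lf; rewrite [LHS]qf_wformE [X in _ = X - _]qf_wformE.
have -> : dotD (W a \*m f) f = dotD (W a' \*m f) f + (a ^+ 2 - a' ^+ 2)%:C%C * dotD (D \*m f) f.
  have L1 := L2_mulmx LD Lf.
  have L2' := L2_mulmx (LW a') Lf.
  rewrite addrC -[RHS](hformL hD _ L1 L2' Lf).
  congr L2dot; apply/funext => z; rewrite (WE a a').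
  change ((W a' z + (a ^+ 2 - a' ^+ 2)%:C%C *: D z) *m f z =
    (a ^+ 2 - a' ^+ 2)%:C%C *: (D z *m f z) + W a' z *m f z).
  by rewrite mulmxDl addrC scalemxAl.
rewrite ReD ReM ReR ImR mul0r subr0.
by rewrite [RHS]addrAC addrK.
Qed.

Lemma dotD_ge0 f : L2 f -> 0 <= Re (dotD (D \*m f) f).
Proof.
move=> Lf; rewrite -(mul0r (qf dotD f)); apply: quad_ge => //.
by apply: aeW => z x; rewrite mul0r.
Qed.

Lemma dotD_le f : L2 f -> Re (dotD (D \*m f) f) <= qf dotD f.
Proof.
move=> Lf; rewrite -[leRHS]mul1r; apply: quad_le => //.
by apply: aeW => z x; rewrite mul1r.
Qed.

Definition ker : set fD := [set f | dom f /\ q f = 0].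

Lemma ker_sub : linsub ker.
Proof.
have sD := @dom_sub R n1 n2; split; first by split; [exact: sub0|exact: (qf0 hB)].
move=> c x y [Dx qx] [Dy qy]; split; first exact: subL.
have Dc : dom (c *: x) by exact: subZ.
by rewrite (qf_eq0D hB Dc Dy) // (qfZ hB) // qx mulr0.
Qed.

Lemma q_bound : exists2 M : R, 0 <= M & forall f, dom f -> q f <= M * qf dotD f.
Proof.
have [M M0 hM] := Re_hdot_Linf (LW a); exists M => // f Df; have Lf := dom_L2 Df.
rewrite qf_wformE; apply: le_trans (quad_le (LW a) Lf hM).
by rewrite gerBl (qf_ge0 hC) //; exact: L2_Gamma.
Qed.

Lemma q_limit (u : nat -> fD) x : (forall n, dom (u n)) -> dom x -> qlim dotD u x ->
  (forall e, 0 < e -> exists N, forall n, (N <= n)%N -> q (u n) < e) -> q x = 0.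
Proof.
move=> Du Dx ux hu; have [M M0 hM] := q_bound.
apply/eqP; rewrite eq_le (qf_ge0 hB) // andbT.
have M1 : 0 < M + 1 by lra.
apply/ler_addgt0Pr => e e0; rewrite add0r.
have e1 : 0 < e / (4 * (M + 1)) by apply: divr_gt0 => //; lra.
have e4 : 0 < e / 4 by apply: divr_gt0.
have [N1 hN1] := ux _ e1; have [N2 hN2] := hu _ e4.
pose n := maxn N1 N2; have Dn := Du n.
have Dd : dom (x - u n) by exact: (subB (@dom_sub R n1 n2)).
have h1 : q x <= 2 * q (x - u n) + 2 * q (u n).
  by rewrite -[in leLHS](subrK (u n) x); exact: (qfD_le hB).
have h2 := hM _ Dd; have h3 := hN1 n (leq_maxl _ _); have h4 := hN2 n (leq_maxr _ _).
rewrite (qfBC hD (dom_L2 Dn) (dom_L2 Dx)) in h3.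
have h0 := qf_ge0 hD (dom_L2 Dd).
have h5 : M * qf dotD (x - u n) <= e / 4.
  apply: (@le_trans _ _ ((M + 1) * (e / (4 * (M + 1))))).
    apply: ler_pM => //; [lra|exact: ltW].
  rewrite le_eqVlt; apply/orP; left; apply/eqP; field; lra.
move: h1 h2 h4 h5; move: (q _) (q _) (q _) (M * _) => b1 b2 b3 b4; lra.
Qed.

Lemma ker_closed : qclosed (@L2 R _) dotD ker.
Proof.
move=> u x hu Lx ux; have Du n : dom (u n) by have [] := hu n.
have Dx : dom x by exact: (dom_closed Du Lx ux).
split => //; apply: (q_limit Du Dx ux) => e e0; exists 0%N => n _.
by have [_ ->] := hu n.
Qed.

Lemma ker_L2 : ker `<=` @L2 R _. Proof. by move=> f [/dom_L2]. Qed.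

(** The assumption to be refuted. With D the projection off the frame, it says that the kernel
    contains no new direction. *)
Hypothesis ker_D : forall f, ker f -> \forall z \ae mu, D z *m f z = 0.

Lemma dot_ker_D f s : L2 f -> ker s -> dotD (D \*m f) s = 0.
Proof.
move=> Lf ks; rewrite L2dot_adj; have Ls := ker_L2 ks.
have LDs : L2 (D \*m s) by exact: L2_mulmx.
have -> : (fun z => adj (D z) *m s z) = D \*m s by apply/funext => z; rewrite adjD.
have q0 : qf dotD (D \*m s) = 0 by apply/(qf_eq0_ae LDs); exact: ker_D.
by rewrite (hformJ hD LDs Lf) (hform_radical hD LDs Lf q0) conjc0.
Qed.

(** Removing the component along the kernel changes neither form, because the kernel lies in the
    radical of both. What remains has nonzero norm, and (D g, g) <= ||g||^2 bounds q(g). *)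
Lemma normalized_violation a' : 0 <= a' -> a' < a -> exists g, [/\ dom g, qf dotD g = 1,
  forall s, ker s -> dotD g s = 0 & q g <= a ^+ 2 - a' ^+ 2].
Proof.
move=> a'0 a'a; have [f Df qf0] := minimal a'0 a'a; have Lf := dom_L2 Df.
have [s ks hs] := projection hD (@L2_complete R _) ker_sub ker_L2 ker_closed Lf.
have [Ds qs] := ks; have Ls := dom_L2 Ds.
pose f' := f - s; have Df' : dom f' by exact: (subB (@dom_sub R n1 n2)).
have Lf' := dom_L2 Df'.
have qf' : q f' = q f.
  have Dm : dom (- s) by exact: (subN (@dom_sub R n1 n2)).
  by rewrite /f' addrC (qf_eq0D hB Dm Df) // (qfN hB).
have Df'E : Re (dotD (D \*m f') f') = Re (dotD (D \*m f) f).
  have LDf : L2 (D \*m f) by exact: L2_mulmx.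
  have LDs : L2 (D \*m s) by exact: L2_mulmx.
  have q0 : qf dotD (D \*m s) = 0 by apply/(qf_eq0_ae LDs); exact: ker_D.
  rewrite /f' mulmxfB (hformB hD LDf LDs Lf') (hform_radical hD LDs Lf' q0) subr0.
  by rewrite (hformBr hD Lf Ls LDf) (dot_ker_D Lf ks) subr0.
have neg : q f' - (a ^+ 2 - a' ^+ 2) * Re (dotD (D \*m f') f') < 0.
  by rewrite qf' Df'E -qf_wform_diff.
have a2 : 0 <= a ^+ 2 - a' ^+ 2 by rewrite subr_ge0 lerXn2r // ?nnegrE // ltW.
have nf : 0 < qf dotD f'.
  rewrite lt_neqAle (qf_ge0 hD) // andbT; apply/eqP => f0.
  have := qf_ge0 hB Df'; have := dotD_le Lf'; rewrite -f0 => h1 h2.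
  have d0 : Re (dotD (D \*m f') f') = 0 by apply/eqP; rewrite eq_le h1 dotD_ge0.
  by move: neg; rewrite d0 mulr0 subr0 ltNge h2.
have c2 : (Num.sqrt (qf dotD f'))^-1 ^+ 2 = (qf dotD f')^-1.
  by rewrite exprVn sqr_sqrtr // ltW.
exists ((Num.sqrt (qf dotD f'))^-1%:C%C *: f'); split.
- exact: (subZ (@dom_sub R n1 n2)).
- by rewrite (qfZ hD) // cn2R c2 mulVf // gt_eqF.
- by move=> t kt; rewrite (hformZ hD _ Lf' (ker_L2 kt)) hs // mulr0.
- rewrite (qfZ hB) // cn2R c2 mulrC ler_pdivrMr //.
  apply: ltW; apply: (@lt_le_trans _ _ ((a ^+ 2 - a' ^+ 2) * Re (dotD (D \*m f') f'))).
    by rewrite -subr_lt0.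
  by rewrite ler_wpM2l //; exact: dotD_le.
Qed.

(** For levels a' increasing to a the normalized violations g_k satisfy q(g_k) -> 0. As W(a) >= a^2
    with a above the essential norm, a subsequence converges; its limit has norm 1, lies in the
    kernel and is orthogonal to it. *)
Lemma minimal_contradiction : False.
Proof.
have [K [al hK al_a]] := ess_norm_approx hPhi ess_a; rewrite lte_fin in al_a.
pose ak (k : nat) := a * (1 - k.+1%:R^-1).
have ki k : 0 < k.+1%:R^-1 :> R by rewrite invr_gt0.
have ki1 k : k.+1%:R^-1 <= 1 :> R by rewrite invf_le1 // ler1n.
have ak0 k : 0 <= ak k by rewrite mulr_ge0 ?subr_ge0 ?(ltW a_gt0).
have aka k : ak k < a by rewrite /ak -[ltRHS]mulr1 ltr_pM2l // ltrBlDr ltrDl.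
have aka2 k : a ^+ 2 - ak k ^+ 2 <= 2 * a ^+ 2 * k.+1%:R^-1.
  rewrite /ak exprMn; have := ki k; have := sqr_ge0 a.
  move: (a ^+ 2) (k.+1%:R^-1) => A t A0 t0; nra.
have /choice[g hg] := fun k => normalized_violation (ak0 k) (aka k).
have Dg k : dom (g k) by have [] := hg k.
have Lg k := dom_L2 (Dg k).
have g1 k : qf dotD (g k) = 1 by have [] := hg k.
have q0 e : 0 < e -> exists N, forall n, (N <= n)%N -> q (g n) < e.
  move=> e0; have A0 : 0 < 2 * a ^+ 2 by rewrite mulr_gt0 ?exprn_gt0.
  have [N hN] := natSinv_lt (divr_gt0 e0 A0); exists N => n /hN.
  rewrite ltr_pdivlMr // mulrC => h; have [_ _ _ h'] := hg n.
  by apply: le_lt_trans h' (le_lt_trans (aka2 n) h).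
have [n|n|e e0|phi [phim hphi]] := gap hPhi hK al_a (u := g) (M := 1).
- exact: Dg.
- by rewrite g1.
- have e4 : 0 < e / 4 by apply: divr_gt0.
  have [N hN] := q0 _ e4; exists N => m n hm hn.
  have Dd : dom (g m - g n) by exact: (subB (@dom_sub R n1 n2)).
  have h1 := quad_ge (LW a) (dom_L2 Dd) (aeW _ W_ge).
  apply: (le_trans h1); have h2 := qfB_le hB (Dg m) (Dg n).
  rewrite qf_wformE in h2; have := hN m hm; have := hN n hn; move: h2.
  move: (Re _) (qf _ _) (q _) (q _) => b1 b2 b3 b4; lra.
have [x Lx hx] := @L2_complete R _ _ (fun n => Lg (phi n)) hphi.
have Dx : dom x by exact: (dom_closed (fun n => Dg (phi n)) Lx hx).
have kx : ker x.
  split => //; apply: (q_limit (fun n => Dg (phi n)) Dx hx) => e e0.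
  have [N hN] := q0 e e0; exists N => n hn; apply: hN; exact: leq_trans hn (homo_ge phim n).
have x0 : dotD x x = 0.
  apply: (qlim_form hD (fun n => Lg (phi n)) Lx Lx hx) => e e0; exists 0%N => n _ /=.
  by have [_ _ h _] := hg (phi n); rewrite h // subrr cn2_0 ltW.
have [N /(_ N (leqnn N))] := qlim_qf hD (fun n => Lg (phi n)) Lx hx (ltr01 : 0 < 1 :> R).
by rewrite /= g1 /qf x0 /= subr0 normr1 ltxx.
Qed.
End minimal_weight.

(** * Measurability of the pointwise Gram-Schmidt process *)

Section orthonormalization.
Variable R : realType.
Local Notation C := R[i].
Local Notation T := (circle R).
Local Notation mu := (@arc_measure R).
Local Notation Re := (@complex.Re R).
Variable k : nat.
Implicit Types (h : nat -> T -> 'cV[C]_k).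

Lemma mm_vnormalize (x : T -> 'cV[C]_k) : mx_measurable x ->
  mx_measurable (fun z => vnormalize (x z)).
Proof.
move=> mx; apply: mmZ => //; apply: cmR.
rewrite (_ : (fun z => _) = (fun z => (Num.sqrt (vn2 (x z))) `^ (-1))); last first.
  by apply/funext => z; rewrite powR_inv1 // sqrtr_ge0.
apply: (measurableT_comp (measurable_powR (-1))).
by apply: (measurableT_comp (continuous_measurable_fun (@sqrt_continuous R))); exact: m_vn2.
Qed.

Lemma mm_gs h i : (forall j, (j <= i)%N -> mx_measurable (h j)) ->
  mx_measurable (fun z => gs (fun j => h j z) i).
Proof.
elim/ltn_ind: i => i IH mh.
rewrite (_ : (fun z => _) = fun z => vnormalize (h i z -
   \sum_(j < i) hdot (h i z) (gs (fun l => h l z) j) *: gs (fun l => h l z) j)); last first.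
  by apply/funext => z; rewrite gsE.
apply: mm_vnormalize; apply: mmB; first exact: mh.
apply: mm_sum => j _.
have mj : mx_measurable (fun z => gs (fun l => h l z) j).
  by apply: IH => // l lj; apply: mh; exact: leq_trans lj (ltnW (ltn_ord j)).
by apply: mmZ => //; apply: cm_hdot => //; exact: mh.
Qed.

Lemma vn2_gs_le1 (x : nat -> 'cV[C]_k) i : vn2 (gs x i) <= 1.
Proof. by rewrite (porth_vn2 (@gs_porth R k x i.+1) (ltnSn i)); case: (_ != _). Qed.

Lemma L2_proj h l f : (forall j, (j < l)%N -> mx_measurable (h j)) -> L2 f ->
  L2 (fun z => proj (gs (fun j => h j z)) l (f z)).
Proof.
move=> mh /L2P[mf hf]; apply/L2P.
have mp : mx_measurable (fun z => proj (gs (fun j => h j z)) l (f z)).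
  apply: mm_sum => j _; have mg : mx_measurable (fun z => gs (fun i => h i z) j).
    by apply: mm_gs => i ij; apply: mh; exact: leq_ltn_trans ij (ltn_ord j).
  by apply: mmZ => //; exact: cm_hdot.
split => //; apply: (rI_dom _ hf); first exact: m_vn2.
move=> z; rewrite ger0_norm ?vn2_ge0 // (vn2_split (@gs_porth R k (fun j => h j z) l) (f z)).
by rewrite lerDl vn2_ge0.
Qed.
End orthonormalization.

(** * Rank of analytic families *)

Section wandering.
Variable R : realType.
Local Notation C := R[i].
Local Notation T := (circle R).
Local Notation mu := (@arc_measure R).
Local Notation Re := (@complex.Re R).
Variable k : nat.
Local Notation dot := (@L2dot R k).
Local Notation F := (T -> 'cV[C]_k).
Let hL := L2_hform R k.
Implicit Types (h u : nat -> F).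

Definition analytic_orbit h l : set F := [set f | exists (n i : nat), (i < l)%N /\ f = shift n (h i)].

Definition orth_orbit h l := annih (@L2 R k) dot (analytic_orbit h l).

(** The closed shift-invariant subspace generated by h_0, ..., h_(l-1), as a double annihilator. *)
Definition orbit_space h l := annih (@L2 R k) dot (orth_orbit h l).

Section family.
Variables (h : nat -> F) (l : nat).
Hypothesis Lh : forall i, (i < l)%N -> L2 (h i).

Lemma orth_orbit_L2 : orth_orbit h l `<=` @L2 R k. Proof. by move=> f []. Qed.

Lemma orbit_space_sub : linsub (orbit_space h l).
Proof. exact: (annih_sub hL orth_orbit_L2). Qed.

Lemma orbit_space_closed : qclosed (@L2 R k) dot (orbit_space h l).
Proof. exact: (annih_closed hL orth_orbit_L2). Qed.

Lemma orbit_space_L2 : orbit_space h l `<=` @L2 R k. Proof. by move=> f []. Qed.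

Lemma orbit_spaceS (n : nat) i : (i < l)%N -> orbit_space h l (shift n (h i)).
Proof.
move=> il; have Ls : L2 (shift n (h i)) by apply: L2_shift; exact: Lh.
split => // a [La ha]; rewrite (hformJ hL La Ls) ha ?conjc0 //.
by exists n, i.
Qed.

Lemma orbit_space_shift f : orbit_space h l f -> orbit_space h l (shift 1 f).
Proof.
move=> [Lf hf]; split; first exact: L2_shift.
move=> a [La ha]; rewrite L2dot_shift; apply: hf; split; first exact: L2_shift.
move=> _ [n [i [il ->]]]; rewrite L2dot_shift opprK shiftD.
by apply: ha; exists (1 + n)%N, i.
Qed.

(* If w is the pointwise residual of f, then w is orthogonal to the orbit, hence
   to f, so that w = 0. *)
Lemma orbit_space_spanp f : orbit_space h l f ->
  \forall z \ae mu, spanp (fun i => h i z) l (f z).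
Proof.
move=> [Lf hf]; pose e z := gs (fun i => h i z).
have mh i : (i < l)%N -> mx_measurable (h i) by move=> il; exact: L2_meas (Lh il).
have Lp := L2_proj mh Lf.
pose w z := f z - proj (e z) l (f z).
have Lw : L2 w by exact: (subB (L2_sub R k) Lf Lp).
have porth_e z : porth (e z) l by exact: gs_porth.
have Aw : orth_orbit h l w.
  split => // _ [n [i [il ->]]]; rewrite L2dotE.
  rewrite (@cint_ext _ _ (fun=> 0)) ?cint0 // => z; rewrite /shift hdotZr.
  by rewrite (hdot_res_span (porth_e z)) ?mulr0 //; exact: spanp_gs.
have w0 : qf dot w = 0.
  have e1 : dot w w = dot f w.
    rewrite !L2dotE; apply: cint_ext => z.
    have fz : f z = w z + proj (e z) l (f z) by rewrite /w subrK.
    have o : hdot (proj (e z) l (f z)) (w z) = 0.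
      by rewrite hdotC (hdot_res_span (porth_e z)) ?conjc0 //; exact: proj_span.
    move: (w z) (proj (e z) l (f z)) fz o => x y -> o.
    by rewrite [RHS]hdotD o addr0.
  by rewrite /qf e1 hf.
move/(qf_eq0_ae Lw): w0; apply: filterS => z /eqP; rewrite subr_eq0 => /eqP ->.
apply: (spanp_trans (e := e z)); last exact: proj_span.
by move=> i il; apply: (spanp_widen (k := i.+1)) => //; exact: gs_spanp.
Qed.
End family.

Lemma exists_last (P : nat -> Prop) n : P 0%N -> ~ P n -> exists2 r, P r & ~ P r.+1.
Proof.
move=> P0; elim: n => // n IH nP; have [Pn|/IH//] := pselect (P n).
by exists n.
Qed.

(** Bessel's inequality summed over the standard basis. *)
Lemma orthonormal_le (u : nat -> 'cV[C]_k) r :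
  (forall i j, (i < r)%N -> (j < r)%N -> hdot (u i) (u j) = (i == j)%:R) -> (r <= k)%N.
Proof.
move=> hu; have u1 i : (i < r)%N -> vn2 (u i) = 1.
  by move=> ir; have := congr1 Re (hdotxx (u i)); rewrite hu // eqxx ReR => <-.
have pu : porth u r.
  move=> i j ir jr; rewrite hu //; case: eqP => //= ij.
  suff -> : u i != 0 by [].
  by apply/eqP => u0; have := u1 i ir; rewrite u0 vn2_0 => /eqP; rewrite eq_sym oner_eq0.
have : \sum_(i < r) vn2 (u i) <= k%:R.
  under eq_bigr => i _ do rewrite /vn2.
  rewrite exchange_big /= -[k in leRHS]card_ord -sum1_card natr_sum.
  apply: ler_sum => j _; have := bessel pu (delta_mx j ord0).
  have -> : vn2 (delta_mx j ord0 : 'cV[C]_k) = 1.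
    by have := congr1 Re (hdotxx (delta_mx j ord0 : 'cV[C]_k)); rewrite hdot_delta mxE !eqxx ReR => <-.
  have E i : cn2 (hdot (delta_mx j ord0) (u i)) = cn2 (u i j ord0).
    by rewrite hdotC hdot_delta cn2J.
  suff -> : \sum_(i < r) cn2 (u i j ord0) = \sum_(i < r) cn2 (hdot (delta_mx j ord0) (u i)) by [].
  by apply: eq_bigr => i _; rewrite E.
under eq_bigr => i _ do rewrite u1 //.
by rewrite sumr_const card_ord -[leLHS]mulr_natl mulr1 ler_nat.
Qed.

Section rank.
Variables (h : nat -> F) (l : nat).
Hypothesis Hh : forall i, (i < l)%N -> H2 (h i).
Let Lh i (il : (i < l)%N) : L2 (h i) := H2_L2 (Hh il).
Local Notation M := (orbit_space h l).

Lemma orbit_space_H2 : M `<=` @H2 R k.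
Proof.
move=> f [Lf hf]; apply/H2P; split => // n i n0; apply: hf; split; first exact: L2_zvec.
move=> _ [m [j [jl ->]]]; have /H2P[_ hm] := H2_shift m (Hh jl).
rewrite (hformJ hL _ (L2_zvec R n i)) ?hm ?conjc0 //; apply: L2_shift; exact: Lh.
Qed.

(** The orthogonal complement of z M in M. *)
Definition wandering : set F := [set u | M u /\ forall f, M f -> dot u (shift 1 f) = 0].

Lemma wandering_sub : linsub wandering.
Proof.
have sM := orbit_space_sub h l; split.
  split; first exact: sub0.
  by move=> f [Lf _]; rewrite (hform0 hL) //; exact: L2_shift.
move=> c u v [Mu hu] [Mv hv]; split; first exact: subL.
move=> f Mf; rewrite (hformL hL _ (proj1 Mu) (proj1 Mv)) ?hu ?hv ?mulr0 ?addr0 //.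
by apply: L2_shift; have [] := Mf.
Qed.

Lemma orbit_space_shiftn (n : nat) f : M f -> M (shift n f).
Proof.
move=> Mf; elim: n => [|n IH]; first by rewrite shift0.
have -> : shift n.+1 f = shift 1 (shift n f) by rewrite shiftD; congr shift; lia.
exact: orbit_space_shift.
Qed.

Lemma wandering_shift (u v : F) (n : nat) : wandering u -> wandering v -> (0 < n)%N ->
  dot u (shift n v) = 0.
Proof.
move=> [Mu hu] [Mv _]; case: n => // n _.
have -> : shift n.+1 v = shift 1 (shift n v) by rewrite shiftD; congr shift; lia.
by apply: hu; exact: orbit_space_shiftn.
Qed.

(** All Fourier coefficients of <u(z), v(z)> except the one of index 0 vanish: those of one sign
    because u is wandering, the others because v is. *)
Lemma wandering_const (u v : F) : wandering u -> wandering v ->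
  \forall z \ae mu, hdot (u z) (v z) = dot u v.
Proof.
move=> wu wv; have [[Lu _] _] := wu; have [[Lv _] _] := wv.
have cIuv := cI_hdot Lu Lv; pose c := dot u v.
have cIc : cI (fun _ : T => - c) by split; exact: rI_cst.
suff : \forall z \ae mu, hdot (u z) (v z) + (- c) = 0.
  by apply: filterS => z /eqP; rewrite subr_eq0 => /eqP.
apply: fourier_null_eq0; first exact: cID.
move=> n; rewrite (@cint_ext _ _ (fun z => hdot (shift n u z) (v z) + (- c) * zpow n z)); last first.
  by move=> z; rewrite /shift hdotZ mulrDl; congr (_ + _); rewrite mulrC.
have LsU : L2 (shift n u) by exact: L2_shift.
rewrite cintD; [|exact: cI_hdot|by apply: cIZ; exact: cI_zpow1].
rewrite cintZ ?cint_zpow; last exact: cI_zpow1.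
rewrite -L2dotE; have [n0|n0|->] := ltgtP n 0.
- rewrite mulr0 addr0 L2dot_shift.
  have -> : - n = `|n|%N :> int by lia.
  by apply: wandering_shift => //; lia.
- rewrite mulr0 addr0 (hformJ hL Lv LsU).
  have -> : n = `|n|%N :> int by lia.
  by rewrite wandering_shift ?conjc0 //; lia.
- by rewrite mulr1 shift0 addrN.
Qed.

Definition orthonormal_family u r := (forall i, (i < r)%N -> wandering (u i)) /\
  forall i j, (i < r)%N -> (j < r)%N -> dot (u i) (u j) = (i == j)%:R.

Lemma orthonormal_pointwise u r : orthonormal_family u r ->
  \forall z \ae mu, forall i j, (i < r)%N -> (j < r)%N -> hdot (u i z) (u j z) = (i == j)%:R.
Proof.
move=> [wu ou].
have : \forall z \ae mu, forall i : 'I_r, forall j : 'I_r, hdot (u i z) (u j z) = (i == j :> nat)%:R.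
  apply: ae_all_fin => i; apply: ae_all_fin => j.
  by have := wandering_const (wu i (ltn_ord i)) (wu j (ltn_ord j)); rewrite ou.
by apply: filterS => z hz i j ir jr; exact: (hz (Ordinal ir) (Ordinal jr)).
Qed.

(** An orthonormal family of wandering functions is orthonormal at almost every point, so it has at
    most k members and a largest one exists. *)
Lemma maximal_family : exists u r, orthonormal_family u r /\
  forall w, wandering w -> (forall i, (i < r)%N -> dot w (u i) = 0) -> qf dot w = 0.
Proof.
have [|[u hu]|r [u hu] max] := @exists_last (fun r => exists u, orthonormal_family u r) k.+1.
- by exists (fun _ => 0); split=> [i|i j]; rewrite ltn0.
- have [z hz] := ae_ex (orthonormal_pointwise hu).
  by have := orthonormal_le hz; rewrite ltnn.
exists u, r; split => // w ww wo; apply: contrapT => w0; apply: max.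
have [[Lw _] _] := ww; have wp : 0 < qf dot w.
  by rewrite lt_neqAle (qf_ge0 hL) // andbT eq_sym; apply/eqP.
pose c := ((Num.sqrt (qf dot w))^-1)%:C%C.
have [wu ou] := hu; have Lu i : (i < r)%N -> L2 (u i) by move=> /wu[[]].
exists (fun i => if i == r then c *: w else u i); split.
  move=> i; rewrite ltnS leq_eqVlt; case: eqP => [_ _|_ /= ir]; last exact: wu.
  exact: (subZ wandering_sub).
have Lc : L2 (c *: w) by exact: (subZ (L2_sub R k)).
move=> i j; rewrite [(i < _)%N]ltnS [(j < _)%N]ltnS => hi hj.
have [ir|ir] := eqVneq i r; have [jr|jr] := eqVneq j r.
- rewrite ir jr eqxx (hformxx hL Lc) (qfZ hL _ Lw) /c cn2R exprVn sqr_sqrtr ?(ltW wp) //.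
  by rewrite mulVf // gt_eqF.
- have jr' : (j < r)%N by rewrite ltn_neqAle jr.
  by rewrite ir (hformZ hL _ Lw (Lu _ jr')) wo // mulr0 gtn_eqF.
- have ir' : (i < r)%N by rewrite ltn_neqAle ir.
  by rewrite jr (hformZr hL _ Lw (Lu _ ir')) (hformJ hL Lw (Lu _ ir')) wo // conjc0 mulr0 ltn_eqF.
- by apply: ou; rewrite ltn_neqAle ?ir ?jr.
Qed.

Lemma shift1_sub : linsub [set shift 1 f | f in M].
Proof.
have sM := orbit_space_sub h l; split.
  by exists 0; [exact: sub0|apply/funext => z; rewrite /shift scaler0].
move=> c _ _ [f Mf <-] [g Mg <-]; exists (c *: f + g); first exact: subL.
exact: shift_lin.
Qed.

Lemma shift1_closed : qclosed (@L2 R k) dot [set shift 1 f | f in M].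
Proof.
move=> v x hv Lx vx; exists (shift (- 1) x); last by rewrite shiftNK.
have /choice[f hf] : forall n, exists f, M f /\ shift 1 f = v n.
  by move=> n; have [f Mf e] := hv n; exists f.
apply: (orbit_space_closed (u := f)) => [n||e e0]; first by have [] := hf n.
  exact: L2_shift.
have [N hN] := vx e e0; exists N => n /hN; have [_ <-] := hf n.
by rewrite -(qf_shift 1 (f n - _)) shiftB shiftNK.
Qed.

(* Wold decomposition: an element of M orthogonal to the shifts of a maximal
   family lies in all [z^n M], hence vanishes. *)
Lemma wold u r f : orthonormal_family u r ->
  (forall w, wandering w -> (forall i, (i < r)%N -> dot w (u i) = 0) -> qf dot w = 0) ->
  M f -> (forall (n i : nat), (i < r)%N -> dot f (shift n (u i)) = 0) -> qf dot f = 0.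
Proof.
move=> [wu ou] hmax.
have Lu i : (i < r)%N -> L2 (u i) by move=> /wu[[]].
have step g : M g -> (forall (n i : nat), (i < r)%N -> dot g (shift n (u i)) = 0) ->
  exists g', [/\ M g', forall (n i : nat), (i < r)%N -> dot g' (shift n (u i)) = 0 &
    \forall z \ae mu, g z = shift 1 g' z].
  move=> Mg og; have [Lg _] := Mg.
  have sL : [set shift 1 f | f in M] `<=` @L2 R k by move=> _ [x [Lx _] <-]; exact: L2_shift.
  have [s [g' Mg' sE] hs] := projection hL (@L2_complete R k) shift1_sub sL shift1_closed Lg.
  have Ls : L2 s by rewrite -sE; apply: sL; exists g'.
  have Ms : M s by rewrite -sE; exact: orbit_space_shift.
  have ww : wandering (g - s).
    split; first exact: (subB (orbit_space_sub h l)).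
    by move=> x Mx; apply: hs; exists x.
  have w0 : qf dot (g - s) = 0.
    apply: hmax => // i ir; rewrite (hformB hL Lg Ls (Lu i ir)).
    rewrite -[u i]shift0 og // -sE (hformJ hL _ (L2_shift 1 Mg'.1)); last first.
      by apply: L2_shift; exact: Lu.
    by rewrite shift0 (wu i ir).2 // conjc0 subr0.
  have ae := L2_ae_of_qf Lg Ls w0.
  exists g'; split => //; last by apply: filterS ae => z ->; rewrite -sE.
  move=> n i ir; have Lsu : L2 (shift (1 + n) (u i)) by apply: L2_shift; exact: Lu.
  rewrite -(L2dot_shift2 1) shiftD sE -(og n.+1 i ir).
  apply: (L2dot_ae Ls Lg Lsu Lsu); last exact: aeW.
  by apply: filterS ae => z ->.
move=> Mf of_.
have red (n : int) i g g' : M g -> M g' -> (\forall z \ae mu, g z = shift 1 g' z) ->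
    dot g (zvec n i) = dot g' (zvec (n - 1) i).
  move=> [Lg _] [Lg' _] ae; rewrite -L2dot_shift_zvec.
  by apply: (L2dot_ae Lg (L2_shift 1 Lg') (L2_zvec R n i) (L2_zvec R n i) ae); exact: aeW.
(* Each step removes a factor z; after N + 1 steps the coefficient of index N has become one of
   index -1 of an element of H^2. *)
have coef N g : M g -> (forall (n i : nat), (i < r)%N -> dot g (shift n (u i)) = 0) ->
    forall i, dot g (zvec N%:Z i) = 0.
  elim: N g => [|N IH] g Mg og i; have [g' [Mg' og' ae]] := step g Mg og;
    rewrite (red _ i g g' Mg Mg' ae).
  - by have /H2P[_] := orbit_space_H2 Mg'; apply.
  - have -> : N.+1%:Z - 1 = N by lia.
    exact: (IH g' Mg' og').
apply: L2_fourier_eq0; first by have [] := Mf.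
move=> n i; have [n0|n0] := ltP n 0; first by have /H2P[_] := orbit_space_H2 Mf; apply.
by have := coef `|n|%N f Mf of_ i; rewrite gez0_abs.
Qed.

(* The spans of the values of the h_i have a.e. constant dimension; the sum
   below is that dimension. *)
Lemma rank_constant : exists c : R,
  \forall z \ae mu, \sum_(i < l) vn2 (gs (fun j => h j z) i) = c.
Proof.
have [u [r [hu hmax]]] := maximal_family; have [wu ou] := hu.
have Lu i : (i < r)%N -> L2 (u i) by move=> /wu[[]].
have Mu i : (i < r)%N -> M (u i) by move=> /wu[].
(* The families h and u generate each other, hence span the same space at almost every point; u is
   orthonormal there, so the dimension is r. *)
have hU i : (i < l)%N -> orbit_space u r (h i).
  move=> il; have sN := orbit_space_sub u r; have LN := @orbit_space_L2 u r.
  have [s Ns hs] := projection hL (@L2_complete R k) sN LN (@orbit_space_closed u r) (Lh il).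
  have Ls := LN _ Ns; have Lhi := Lh il.
  have Mhi : M (h i) by have := orbit_spaceS Lh 0%N il; rewrite shift0.
  have NM : orbit_space u r `<=` M.
    move=> x [Lx hx]; split => // a Aa; apply: hx; have [La ha] := Aa; split => //.
    move=> _ [n [j [jr ->]]]; have [Ls' hs'] := orbit_space_shiftn n (Mu _ jr).
    by rewrite (hformJ hL Ls' La) hs' // conjc0.
  have d0 : qf dot (h i - s) = 0.
    apply: (wold hu hmax); first by apply: (subB (orbit_space_sub h l)) => //; exact: NM.
    by move=> n j jr; apply: hs; exact: orbit_spaceS.
  have ae := L2_ae_of_qf Lhi Ls d0.
  have [_ hN] := Ns; split => // a Aa; rewrite -(hN a Aa).
  have [La _] := Aa; apply: (L2dot_ae Lhi Ls La La ae); exact: aeW.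
have ae1 : \forall z \ae mu, forall i : 'I_l, spanp (fun j => u j z) r (h i z).
  by apply: ae_all_fin => i; apply: orbit_space_spanp => //; exact: hU.
have ae2 : \forall z \ae mu, forall i : 'I_r, spanp (fun j => h j z) l (u i z).
  by apply: ae_all_fin => i; apply: orbit_space_spanp => //; exact: Mu.
exists r%:R; apply: filterS3 ae1 ae2 (orthonormal_pointwise hu) => z h1 h2 h3.
have u1 i : (i < r)%N -> vn2 (u i z) = 1.
  by move=> ir; have := congr1 Re (hdotxx (u i z)); rewrite h3 // eqxx ReR => <-.
have pu : porth (fun j => u j z) r.
  move=> i j ir jr; rewrite h3 //; case: eqP => //= ij.
  suff -> : u i z != 0 by [].
  by apply/eqP => u0; have := u1 i ir; rewrite u0 vn2_0 => /eqP; rewrite eq_sym oner_eq0.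
rewrite (porth_trace (@gs_porth R k (fun j => h j z) l) pu).
- under eq_bigr => i _ do rewrite u1 //.
  by rewrite sumr_const card_ord.
- move=> i il; apply: (spanp_trans (e := fun j => h j z) (k := l)).
    by move=> j jl; exact: (h1 (Ordinal jl)).
  by apply: (spanp_widen (k := i.+1)) => //; exact: gs_spanp.
- move=> i ir; apply: (spanp_trans (e := fun j => h j z) (k := l)); last exact: (h2 (Ordinal ir)).
  by move=> j jl; exact: spanp_gs.
Qed.
End rank.
End wandering.

(** * Hermitian matrices and bounded matrix functions *)

Section hermitian_matrices.
Variable R : realType.
Local Notation C := R[i].
Local Notation T := (circle R).
Local Notation mu := (@arc_measure R).
Local Notation Re := (@complex.Re R).

Lemma adjD m n (A B : 'M[C]_(m, n)) : adj (A + B) = adj A + adj B.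
Proof. by apply/matrixP => i j; rewrite !mxE conjcD. Qed.

Lemma adjZR m n (a : R) (A : 'M[C]_(m, n)) : adj (a%:C%C *: A) = a%:C%C *: adj A.
Proof. by apply/matrixP => i j; rewrite !mxE conjcM conjcR. Qed.

Lemma adjN m n (A : 'M[C]_(m, n)) : adj (- A) = - adj A.
Proof. by apply/matrixP => i j; rewrite !mxE rmorphN. Qed.

Lemma adj_sum m n I (r : seq I) (P : pred I) (F : I -> 'M[C]_(m, n)) :
  adj (\sum_(i <- r | P i) F i) = \sum_(i <- r | P i) adj (F i).
Proof.
apply: (big_morph (@adj R m n)); first exact: adjD.
by apply/matrixP => i j; rewrite !mxE conjc0.
Qed.

Lemma adj1 n : adj (1%:M : 'M[C]_n) = 1%:M.
Proof. by apply/matrixP => i j; rewrite !mxE eq_sym; case: eqP; rewrite ?conjc1 ?conjc0. Qed.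

Definition rk1 n (v : 'cV[C]_n) : 'M[C]_n := v *m adj v.

Lemma rk1_mul n (v x : 'cV[C]_n) : rk1 v *m x = hdot x v *: v.
Proof.
apply/matrixP => i j; rewrite (ord1 j) /rk1 -mulmxA mxE big_ord1 !mxE mulrC; congr (_ * _).
by rewrite /hdot; apply: eq_bigr => l _; rewrite mxE mulrC.
Qed.

Lemma adj_rk1 n (v : 'cV[C]_n) : adj (rk1 v) = rk1 v.
Proof.
apply/matrixP => i j; rewrite !mxE conjc_sum; apply: eq_bigr => l _.
by rewrite !mxE conjcM conjcK mulrC.
Qed.

(** Cauchy-Schwarz for the semi-inner product <K x, y>, tested with y = K x. *)
Lemma psd_kernel n (K : 'M[C]_n) x : adj K = K -> (forall y, 0 <= Re (hdot (K *m y) y)) ->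
  Re (hdot (K *m x) x) = 0 -> K *m x = 0.
Proof.
move=> aK pK x0.
have hK : hform [set: 'cV[C]_n] (fun x y => hdot (K *m x) y).
  split => //.
  - by move=> a u v w _ _ _; rewrite mulmxDr -scalemxAr hdotD hdotZ.
  - by move=> u v _ _; rewrite hdot_adj aK hdotC.
apply: vn2_eq0; have := hform_radical hK I I x0 (y := K *m x).
by move=> h; have := congr1 Re (hdotxx (K *m x)); rewrite h ReR.
Qed.

Lemma LinfD m n (F H : T -> 'M[C]_(m, n)) : Linf F -> Linf H -> Linf (fun z => F z + H z).
Proof.
move=> /LinfP[mF [M M0 hM]] /LinfP[mH [N N0 hN]].
apply: (@Linf_of_bound _ _ _ _ (2 * M ^+ 2 + 2 * N ^+ 2)).
- exact: mmD.
- by rewrite addr_ge0 ?mulr_ge0 ?sqr_ge0.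
- apply: filterS2 hM hN => z h1 h2 x; rewrite mulmxDl; apply: le_trans (vn2D_le _ _) _.
  by rewrite [leRHS]mulrDl -(mulrA 2 (M ^+ 2)) -(mulrA 2 (N ^+ 2)) lerD ?ler_pM2l.
Qed.

Lemma LinfZ m n (c : C) (F : T -> 'M[C]_(m, n)) : Linf F -> Linf (fun z => c *: F z).
Proof.
move=> /LinfP[mF [M M0 hM]]; apply: (@Linf_of_bound _ _ _ _ (cn2 c * M ^+ 2)).
- by apply: mmZ => //; exact: cm_cst.
- by rewrite mulr_ge0 ?cn2_ge0 ?sqr_ge0.
- by apply: filterS hM => z h x; rewrite -scalemxAl vn2Z -mulrA ler_wpM2l ?cn2_ge0.
Qed.

Lemma Linf_cst m n (A : 'M[C]_(m, n)) : Linf (fun _ : T => A).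
Proof.
apply: (Linf_of_bound (mm_cst A) _ (aeW _ (fun=> vn2_mulmx_le A))).
by apply: sumr_ge0 => i _; apply: sumr_ge0 => j _; exact: cn2_ge0.
Qed.

Lemma Linf_sum m n I (r : seq I) (F : I -> T -> 'M[C]_(m, n)) :
  (forall i, Linf (F i)) -> Linf (fun z => \sum_(i <- r) F i z).
Proof.
move=> hF; elim: r => [|i r IH].
  by under eq_fun do rewrite big_nil; exact: Linf_cst.
rewrite (_ : (fun z => _) = fun z => F i z + \sum_(j <- r) F j z); first exact (LinfD (hF i) IH).
by apply/funext => z; rewrite big_cons.
Qed.

Lemma Linf_rk1 n (v : T -> 'cV[C]_n) : mx_measurable v -> (forall z, vn2 (v z) <= 1) ->
  Linf (fun z => rk1 (v z)).
Proof.
move=> mv v1; apply: (@Linf_of_bound _ _ _ _ 1) => //.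
  by apply: mm_mulmx => //; exact: mm_adj.
apply: aeW => z x; rewrite rk1_mul vn2Z.
apply: le_trans (ler_wpM2r (vn2_ge0 (v z)) (hdot_cs x (v z))) _.
have := v1 z; have := vn2_ge0 (v z); have := vn2_ge0 x.
move: (vn2 x) (vn2 (v z)) => X a X0 a0 a1; rewrite mul1r.
by apply: (@le_trans _ _ (X * a)); rewrite ler_piMr // mulr_ge0.
Qed.
End hermitian_matrices.

(** * Superoptimal weights *)

Section weights.
Variable R : realType.
Local Notation C := R[i].
Local Notation T := (circle R).
Local Notation mu := (@arc_measure R).
Local Notation Re := (@complex.Re R).
Variable n : nat.
Implicit Types (f : nat -> T -> 'cV[C]_n) (t : nat -> R).

Definition frame f (z : T) (i : nat) : 'cV[C]_n := gs (fun l => f l z) i.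

Lemma frame_porth f z j : porth (frame f z) j.
Proof. exact: gs_porth. Qed.

Definition residual f j (z : T) : 'M[C]_n := 1%:M - \sum_(i < j) rk1 (frame f z i).

(* [sum t_i^2 v_i v_i^* + a^2 (1 - sum v_i v_i^* )], v the frame of f. *)
Definition weight f t j (a : R) (z : T) : 'M[C]_n :=
  \sum_(i < j) (t i ^+ 2)%:C%C *: rk1 (frame f z i) + (a ^+ 2)%:C%C *: residual f j z.

Section fixed.
Variables (f : nat -> T -> 'cV[C]_n) (t : nat -> R) (j : nat).
Local Notation v := (frame f).

Lemma residual_mul z x : residual f j z *m x = x - proj (v z) j x.
Proof.
rewrite mulmxBl mul1mx mulmx_suml; congr (_ - _).
by apply: eq_bigr => i _; rewrite rk1_mul.
Qed.

Lemma weight_mul a z x : weight f t j a z *m x =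
  \sum_(i < j) ((t i ^+ 2)%:C%C * hdot x (v z i)) *: v z i
    + (a ^+ 2)%:C%C *: (x - proj (v z) j x).
Proof.
rewrite mulmxDl mulmx_suml -[in RHS]residual_mul -scalemxAl; congr (_ + _).
by apply: eq_bigr => i _; rewrite -scalemxAl rk1_mul scalerA.
Qed.

Lemma hdot_res_self z x : hdot (x - proj (v z) j x) x = (vn2 (x - proj (v z) j x))%:C%C.
Proof.
have e : x = (x - proj (v z) j x) + proj (v z) j x by rewrite subrK.
have o := hdot_res_span (@frame_porth f z j) x (proj_span _ _ x).
by rewrite [X in hdot _ X]e hdotDr o addr0 hdotxx.
Qed.

Lemma weight_quad a z x : Re (hdot (weight f t j a z *m x) x) =
  \sum_(i < j) t i ^+ 2 * cn2 (hdot x (v z i)) + a ^+ 2 * vn2 (x - proj (v z) j x).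
Proof.
rewrite weight_mul hdotD ReD hdot_suml Re_sum hdotZ hdot_res_self; congr (_ + _).
  apply: eq_bigr => i _; rewrite hdotZ [hdot (v z i) x]hdotC -mulrA mulcJ.
  by rewrite !ReImE mul0r subr0.
by rewrite !ReImE mul0r subr0.
Qed.

Lemma weight_perp a z x : (forall i, (i < j)%N -> hdot x (v z i) = 0) ->
  Re (hdot (weight f t j a z *m x) x) = a ^+ 2 * vn2 x.
Proof.
move=> hx; rewrite weight_quad big1 ?add0r => [|i _]; last by rewrite hx // cn2_0 mulr0.
by rewrite /proj big1 ?subr0 // => i _; rewrite hx // scale0r.
Qed.

Lemma residual_quad z x : Re (hdot (residual f j z *m x) x) = vn2 (x - proj (v z) j x).
Proof. by rewrite residual_mul hdot_res_self ReR. Qed.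

Lemma residual_ge0 z x : 0 <= Re (hdot (residual f j z *m x) x).
Proof. by rewrite residual_quad vn2_ge0. Qed.

Lemma residual_le z x : Re (hdot (residual f j z *m x) x) <= vn2 x.
Proof. by rewrite residual_quad (vn2_split (@frame_porth f z j) x) lerDr vn2_ge0. Qed.

Lemma adj_residual z : adj (residual f j z) = residual f j z.
Proof.
rewrite /residual adjD adjN adj1 adj_sum; congr (_ - _).
by apply: eq_bigr => i _; exact: adj_rk1.
Qed.

Lemma adj_weight a z : adj (weight f t j a z) = weight f t j a z.
Proof.
rewrite /weight adjD adjZR adj_residual adj_sum; congr (_ + _).
by apply: eq_bigr => i _; rewrite adjZR adj_rk1.
Qed.

Lemma weightE a1 a2 z :
  weight f t j a1 z = weight f t j a2 z + (a1 ^+ 2 - a2 ^+ 2)%:C%C *: residual f j z.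
Proof.
rewrite /weight -addrA -scalerDl; congr (_ + _ *: _).
by apply: complex_ext; rewrite !ReImE; ring.
Qed.

Lemma weight_le a1 a2 z x : 0 <= a1 -> a1 <= a2 ->
  Re (hdot (weight f t j a1 z *m x) x) <= Re (hdot (weight f t j a2 z *m x) x).
Proof.
move=> a0 a12; rewrite [leLHS]weight_quad [leRHS]weight_quad lerD2l ler_wpM2r ?vn2_ge0 //.
by rewrite lerXn2r // nnegrE // (le_trans a0).
Qed.

Lemma weight_ge a z x : 0 <= a -> (forall i, (i < j)%N -> a <= t i) ->
  a ^+ 2 * vn2 x <= Re (hdot (weight f t j a z *m x) x).
Proof.
move=> a0 ha; rewrite weight_quad (vn2_split (@frame_porth f z j) x) mulrDr lerD2r.
rewrite (vn2_proj (@frame_porth f z j)) mulr_sumr; apply: ler_sum => i _.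
by rewrite ler_wpM2r ?cn2_ge0 // lerXn2r ?nnegrE ?(le_trans a0 (ha i _)) ?ha.
Qed.

Lemma residual_frame z i : (i < j)%N -> residual f j z *m v z i = 0.
Proof.
move=> ij; rewrite residual_mul span_proj ?subrr //; first exact: frame_porth.
exact: spanp_mem.
Qed.

Lemma residual_fun z i : (i < j)%N -> residual f j z *m f i z = 0.
Proof.
move=> ij; rewrite residual_mul span_proj ?subrr //; first exact: frame_porth.
exact: (@spanp_gs R n (fun l => f l z) j i ij).
Qed.

Lemma weight_frame a z i : (i < j)%N -> weight f t j a z *m v z i = (t i ^+ 2)%:C%C *: v z i.
Proof.
move=> ij; rewrite weight_mul -residual_mul residual_frame // scaler0 addr0.
rewrite (bigD1 (Ordinal ij)) //= big1 ?addr0 => [|l li].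
  have := frame_porth f z ij ij; rewrite eqxx /= => ->.
  by case: eqVneq => [->|_] /=; rewrite ?scaler0 // mulr1.
have := frame_porth f z ij (ltn_ord l); rewrite eq_sym -val_eqE /= in li *.
by rewrite (negbTE li) => ->; rewrite mulr0 scale0r.
Qed.

Hypothesis mf : forall i, (i < j)%N -> mx_measurable (f i).

Lemma Linf_frame i : (i < j)%N -> Linf (fun z => rk1 (v z i)).
Proof.
move=> ij; apply: Linf_rk1; last by move=> z; exact: vn2_gs_le1.
by apply: mm_gs => l li; apply: mf; exact: leq_ltn_trans li ij.
Qed.

Lemma Linf_residual : Linf (residual f j).
Proof.
have h : Linf (fun z => \sum_(i < j) rk1 (v z i)).
  by apply: Linf_sum => i; exact: Linf_frame.
have := LinfD (Linf_cst 1%:M) (LinfZ (-1) h).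
by rewrite (_ : (fun z => _) = residual f j) //; apply/funext => z; rewrite scaleN1r.
Qed.

Lemma Linf_weight a : Linf (weight f t j a).
Proof.
apply: LinfD; last by apply: LinfZ; exact: Linf_residual.
by apply: Linf_sum => i; apply: LinfZ; exact: Linf_frame.
Qed.
End fixed.

Lemma eq_frame f g k z : (forall i, (i <= k)%N -> f i = g i) -> frame f z k = frame g z k.
Proof. by move=> h; apply: eq_gs => i ik; rewrite h. Qed.

Lemma eq_weight f g t s j a z : (forall i, (i < j)%N -> f i = g i) ->
  (forall i, (i < j)%N -> t i = s i) -> weight f t j a z = weight g s j a z.
Proof.
move=> fg ts; have e (i : 'I_j) : frame f z i = frame g z i.
  by apply: eq_frame => l li; apply: fg; exact: leq_ltn_trans li (ltn_ord i).
have s1 : \sum_(i < j) (t i ^+ 2)%:C%C *: rk1 (frame f z i) =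
    \sum_(i < j) (s i ^+ 2)%:C%C *: rk1 (frame g z i).
  by apply: eq_bigr => i _; rewrite (e i) (ts _ (ltn_ord i)).
have s2 : \sum_(i < j) rk1 (frame f z i) = \sum_(i < j) rk1 (frame g z i).
  by apply: eq_bigr => i _; rewrite (e i).
exact (f_equal2 (fun A B : 'M[C]_n => A + (a ^+ 2)%:C%C *: (1%:M - B)) s1 s2).
Qed.

(** At level t_j the new rank-one term only moves from the residual to the sum, so passing to the
    next stage does not change the weight. *)
Lemma weightS f t j z : weight f t j.+1 (t j) z = weight f t j (t j) z.
Proof.
rewrite /weight big_ord_recr /= /residual big_ord_recr /= -addrA; congr (_ + _).
by rewrite -scalerDr; congr (_ *: _); rewrite [LHS]addrC opprD addrA subrK.
Qed.
End weights.

(** * Symbols dominated by a weight *)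

Section bounded_symbols.
Variable R : realType.
Local Notation C := R[i].
Local Notation T := (circle R).
Local Notation mu := (@arc_measure R).
Local Notation Re := (@complex.Re R).
Variables (m1 m2 n1 n2 : nat).
Variable Phi : T -> 'M[C]_(m1 + m2, n1 + n2).
Hypothesis hPhi : Linf Phi.
Local Notation dom := (@Gamma_dom R n1 n2).
Local Notation cod := (@Gamma_cod R m1 m2).
Let hD := L2_hform R (n1 + n2).
Let hC := L2_hform R (m1 + m2).
Local Notation dotD := (@L2dot R (n1 + n2)).
Local Notation dotC := (@L2dot R (m1 + m2)).
Local Notation fD := (T -> 'cV[C]_(n1 + n2)).
Local Notation G := (gam Phi).
Implicit Types (f : nat -> fD) (t : nat -> R) (Q : T -> 'M[C]_(m1, n1)).

Lemma L2_PhiQ Q (g : fD) : Hinf Q -> L2 g -> L2 (PhiQ Phi Q \*m g).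
Proof. by move=> [LQ _] Lg; exact (L2_mulmx (PhiQ_Linf hPhi LQ) Lg). Qed.

(** Replacing Phi by Phi_Q changes Phi g by an analytic upper part, to which Gamma g is
    orthogonal. *)
Lemma qf_PhiQ_split Q (g : fD) : Hinf Q -> dom g ->
  qf dotC (PhiQ Phi Q \*m g) = qf dotC (G g) + qf dotC ((PhiQ Phi Q \*m g) - G g).
Proof.
move=> HQ Dg; have Lg := dom_L2 Dg; have [cG hG] := Gamma_spec hPhi Lg.
have LG := cod_L2 cG; have LP := L2_PhiQ HQ Lg.
have LX : L2 (Phi \*m g) by exact: L2_mulmx.
have Lr : L2 ((PhiQ Phi Q \*m g) - G g) by exact: (subB (L2_sub R _)).
have HQt : H2 (Q \*m top g) by have [Ht _] := Dg; exact: H2_mulmx.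
have Li : L2 (inl_fun (Q \*m top g) : T -> 'cV[C]_(m1 + m2)) by apply: L2_inl; exact: HQt.1.
have o : dotC ((PhiQ Phi Q \*m g) - G g) (G g) = 0.
  rewrite PhiQ_mul addrAC.
  have := hG _ cG; move=> h; rewrite (hformB hC (L2_PhiB hPhi Lg) Li LG) h sub0r.
  have e : dotC (G g) (inl_fun (Q \*m top g)) = 0.
    by rewrite (dot_inl LG HQt.1); have [[_ h'] _] := cG; exact: h'.
  by rewrite (hformJ hC LG Li) e conjc0 oppr0.
have e : PhiQ Phi Q \*m g = ((PhiQ Phi Q \*m g) - G g) + G g by rewrite subrK.
rewrite [in LHS]e; move: ((PhiQ Phi Q \*m g) - G g) Lr o => r Lr o.
by rewrite (qfD hC Lr LG) o Re0 mulr0 addr0 addrC.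
Qed.

Section weight.
Variables (f : nat -> fD) (t : nat -> R) (j : nat).
Hypothesis Df : forall i, (i < j)%N -> dom (f i).

Definition bounded (a : R) Q := \forall z \ae mu, forall x,
  vn2 (PhiQ Phi Q z *m x) <= Re (hdot (weight f t j a z *m x) x).

Lemma family_meas i : (i < j)%N -> mx_measurable (f i).
Proof. by move=> /Df /dom_L2 /L2_meas. Qed.

Lemma Linf_W a : Linf (weight f t j a).
Proof. exact: Linf_weight family_meas a. Qed.

Lemma Linf_D : Linf (residual f j).
Proof. exact: Linf_residual family_meas. Qed.

Lemma qf_PhiQ_le a Q g : Hinf Q -> bounded a Q -> dom g ->
  qf dotC (PhiQ Phi Q \*m g) <= Re (dotD (weight f t j a \*m g) g).
Proof.
move=> HQ hQ Dg; have Lg := dom_L2 Dg; rewrite qfL2 L2dotE cintE /=.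
apply: rint_le; [by apply: L2_rI; exact: L2_PhiQ|exact: (rI_quad (Linf_W a) Lg)|].
by apply: filterS hQ => z; apply.
Qed.

(** The easy direction of the weighted Nehari theorem. *)
Lemma bounded_admissible a Q : Hinf Q -> bounded a Q -> admissible Phi (weight f t j a).
Proof.
move=> HQ hQ; split; [exact: Linf_W|by move=> z; exact: adj_weight|].
move=> g Dg; rewrite qf_wformE subr_ge0; apply: le_trans (qf_PhiQ_le HQ hQ Dg).
have Lg := dom_L2 Dg; rewrite (qf_PhiQ_split HQ Dg) lerDl.
exact (qf_ge0 hC (subB (L2_sub R _) (L2_PhiQ HQ Lg) (L2_Gamma hPhi Lg))).
Qed.

(* On the kernel of the form all the inequalities in
   [||Gamma g|| <= ||Phi_Q g|| <= (W g, g)] are equalities. *)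
Lemma kernel_structure a Q g : Hinf Q -> bounded a Q -> dom g ->
  qf (wform Phi (weight f t j a)) g = 0 ->
  (\forall z \ae mu, PhiQ Phi Q z *m g z = G g z) /\
  \forall z \ae mu, adj (PhiQ Phi Q z) *m (PhiQ Phi Q z *m g z) = weight f t j a z *m g z.
Proof.
move=> HQ hQ Dg; rewrite qf_wformE => q0; have Lg := dom_L2 Dg.
have LP := L2_PhiQ HQ Lg; have LG := L2_Gamma hPhi Lg.
have Lr : L2 ((PhiQ Phi Q \*m g) - G g) by exact: (subB (L2_sub R _)).
have h1 := qf_PhiQ_le HQ hQ Dg; have h2 := qf_PhiQ_split HQ Dg.
have h3 := qf_ge0 hC Lr.
have r0 : qf dotC ((PhiQ Phi Q \*m g) - G g) = 0.
  move: h1 h2 h3 q0; move: (qf _ _) (Re _) (qf _ _) (qf _ _) => b1 b2 b3 b4; lra.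
have e0 : qf dotC (PhiQ Phi Q \*m g) = Re (dotD (weight f t j a \*m g) g).
  move: h1 h2 h3 q0; move: (qf _ _) (Re _) (qf _ _) (qf _ _) => b1 b2 b3 b4; lra.
split.
  have := L2_ae_of_qf LP LG r0; exact.
have rW := rI_quad (Linf_W a) Lg.
have rP : rI (fun z => vn2 (PhiQ Phi Q z *m g z)) by exact: L2_rI.
have E (z : T) x : Re (hdot ((weight f t j a z - adj (PhiQ Phi Q z) *m PhiQ Phi Q z) *m x) x) =
    Re (hdot (weight f t j a z *m x) x) - vn2 (PhiQ Phi Q z *m x).
  by rewrite mulmxBl hdotB ReB hdot_gram hdotxx.
have ge0 : \forall z \ae mu, 0 <= Re (hdot (weight f t j a z *m g z) (g z)) - vn2 (PhiQ Phi Q z *m g z).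
  by apply: filterS hQ => z hz; rewrite subr_ge0.
have i0 : rint (fun z => Re (hdot (weight f t j a z *m g z) (g z)) - vn2 (PhiQ Phi Q z *m g z)) = 0.
  by rewrite rintB //; move: e0; rewrite qfL2 L2dotE cintE /= => ->; rewrite subrr.
have ae0 := rint_eq0 (rIB rW rP) ge0 i0.
apply: filterS2 hQ ae0 => z hz z0.
have : (weight f t j a z - adj (PhiQ Phi Q z) *m PhiQ Phi Q z) *m g z = 0.
  apply: psd_kernel.
  - rewrite adjD adjN adj_weight; congr (_ - _).
    apply/matrixP => i l; rewrite !mxE conjc_sum; apply: eq_bigr => s _.
    by rewrite !mxE conjcM conjcK mulrC.
  - by move=> y; rewrite E subr_ge0.
  - by rewrite E.
by rewrite mulmxBl -mulmxA => /eqP; rewrite subr_eq0 => /eqP ->.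
Qed.

(** The level acts only on the complement of the span of the f_i. *)
Lemma wform_weight_fun a1 a2 i : (i < j)%N ->
  qf (wform Phi (weight f t j a1)) (f i) = qf (wform Phi (weight f t j a2)) (f i).
Proof.
move=> ij; rewrite [LHS]qf_wformE [RHS]qf_wformE.
have e : weight f t j a1 \*m f i = weight f t j a2 \*m f i.
  apply/funext => z; rewrite (weightE f t j a1 a2 z) mulmxDl -scalemxAl.
  by rewrite residual_fun // scaler0 addr0.
exact (congr1 (fun X => Re (dotD X (f i)) - qf dotC (G (f i))) e).
Qed.

Lemma frame_structure a Q : Hinf Q -> bounded a Q ->
  (forall i, (i < j)%N -> qf (wform Phi (weight f t j a)) (f i) = 0) ->
  \forall z \ae mu, forall i, (i < j)%N -> PhiQ Phi Q z *m f i z = G (f i) z /\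
    adj (PhiQ Phi Q z) *m (PhiQ Phi Q z *m frame f z i) = (t i ^+ 2)%:C%C *: frame f z i.
Proof.
move=> HQ hQ h0.
have : \forall z \ae mu, forall i : 'I_j, PhiQ Phi Q z *m f i z = G (f i) z /\
    adj (PhiQ Phi Q z) *m (PhiQ Phi Q z *m f i z) = weight f t j a z *m f i z.
  apply: ae_all_fin => i; have [h1 h2] := kernel_structure HQ hQ (Df (ltn_ord i)) (h0 _ (ltn_ord i)).
  exact: filterS2 h1 h2.
apply: filterS => z hz i ij; split; first exact: (hz (Ordinal ij)).1.
rewrite -(weight_frame f t a z ij).
(* At a fixed z the frame vector is a combination of values f_l(z), l <= i, so the matrix identity
   passes from the f_l to it. *)
have [c e] := gs_spanp (fun l => f l z) (ltnSn i).
rewrite /frame e !mulmx_sumr; apply: eq_bigr => l _; rewrite -!scalemxAr; congr (_ *: _).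
exact: (hz (Ordinal (leq_trans (ltn_ord l) ij))).2.
Qed.

(** On the span of the frame both sides of the matrix inequality agree, which leaves the complement
    and [sval_leP]. The level c provides the a priori bound required there. *)
Lemma weight_sval a c Q z : 0 <= a -> 0 <= c -> (forall i, (i < j)%N -> c <= t i) ->
  (forall i, (i < j)%N -> frame f z i != 0) ->
  (forall i, (i < j)%N ->
    adj (PhiQ Phi Q z) *m (PhiQ Phi Q z *m frame f z i) = (t i ^+ 2)%:C%C *: frame f z i) ->
  (forall x, vn2 (PhiQ Phi Q z *m x) <= Re (hdot (weight f t j c z *m x) x)) ->
  sval_mx j (PhiQ Phi Q z) <= a <->
  forall x, vn2 (PhiQ Phi Q z *m x) <= Re (hdot (weight f t j a z *m x) x).
Proof.
move=> a0 c0 ct v0 hv hc; have pv := @frame_porth R _ f z j.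
rewrite (sval_leP pv v0 (fun i ij => le_trans c0 (ct i ij)) hv a0 ct c0); last first.
  by move=> x hx; rewrite -(weight_perp t c hx).
split=> h x; last by move=> hx; rewrite -(weight_perp t a hx); exact: h.
rewrite (vn2_mul_split pv hv x) weight_quad lerD2l; apply: h => i ij.
exact: hdot_res.
Qed.
End weight.
End bounded_symbols.

(** * The successive minimization problems *)

Section stages.
Variable R : realType.
Local Notation C := R[i].
Local Notation T := (circle R).
Local Notation mu := (@arc_measure R).
Local Notation Re := (@complex.Re R).
Variables (m1 m2 n1 n2 : nat).
Hypothesis m1_gt0 : (0 < m1)%N.
Variable Phi : T -> 'M[C]_(m1 + m2, n1 + n2).
Hypothesis hPhi : Linf Phi.
Local Notation dom := (@Gamma_dom R n1 n2).
Local Notation cod := (@Gamma_cod R m1 m2).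
Let hD := L2_hform R (n1 + n2).
Let hC := L2_hform R (m1 + m2).
Local Notation dotD := (@L2dot R (n1 + n2)).
Local Notation dotC := (@L2dot R (m1 + m2)).
Local Notation fD := (T -> 'cV[C]_(n1 + n2)).
Local Notation G := (gam Phi).
Local Notation ess := (Gamma_ess_norm Phi).
Local Notation bounded f t j a Q := (@bounded R m1 m2 n1 n2 Phi f t j a Q).
Implicit Types (f : nat -> fD) (t : nat -> R) (Q : T -> 'M[C]_(m1, n1)).

(** The competitors in the j-th minimization; the shift of index treats j = 0 like the other
    stages. *)
Definition pre_Omega j : set (T -> 'M[C]_(m1, n1)) :=
  if j is i.+1 then Omega Phi i else @Hinf R m1 n1.

Lemma Linfnorm_sval Q : Linfnorm (PhiQ Phi Q) = ess_sval Phi 0 Q.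
Proof.
rewrite /Linfnorm /ess_sval; congr (ess_sup _ _); apply/funext => z.
by rewrite sval_mx0.
Qed.

Lemma OmegaE j Q : Omega Phi j Q <-> pre_Omega j Q /\
  forall Q', pre_Omega j Q' -> (ess_sval Phi j Q <= ess_sval Phi j Q')%E.
Proof.
case: j => [|j]; last exact: iff_refl.
split=> -[HQ h]; (split; [exact HQ|move=> Q' HQ'; have := h Q' HQ']); by rewrite !Linfnorm_sval.
Qed.

Lemma ess_sval_ge0 j Q : (0 <= ess_sval Phi j Q)%E.
Proof.
rewrite leNgt; apply/negP => h.
have := ess_sup_ge mu (fun z => (sval_mx j (PhiQ Phi Q z))%:E).
move=> /ae_ex[z hz]; have := le_lt_trans hz h; rewrite lte_fin ltNge.
by rewrite sval_ge0.
Qed.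

(** For j > 0 the number b is the last level found, t_(j-1); for j = 0 it is a level at which some
    symbol is bounded. [st_out] allows a level c depending on Q because the elements of H^infinity
    have no common bound at stage 0. *)
Record stage j f t (b : R) : Prop := Stage {
  st_dom : forall i, (i < j)%N -> dom (f i) ;
  st_ess : forall i, (i < j)%N -> (ess < (t i)%:E)%E ;
  st_ge0 : 0 <= b ;
  st_le : forall i, (i < j)%N -> b <= t i ;
  st_pos : forall i, (i < j)%N -> 0 < t i ;
  st_anti : forall i k, (i <= k)%N -> (k < j)%N -> t k <= t i ;
  st_frame : forall i, (i < j)%N -> \forall z \ae mu, frame f z i != 0 ;
  st_adm : admissible Phi (weight f t j b) ;
  st_ker : forall i, (i < j)%N -> qf (wform Phi (weight f t j b)) (f i) = 0 ;
  st_in : forall Q, Hinf Q -> bounded f t j b Q -> pre_Omega j Q ;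
  st_out : forall Q, pre_Omega j Q -> Hinf Q /\
    exists c, [/\ 0 <= c, forall i, (i < j)%N -> c <= t i & bounded f t j c Q] }.

Lemma Hinf_bounded f t Q : Hinf Q -> exists2 c, 0 <= c & bounded f t 0 c Q.
Proof.
move=> [LQ _]; have /LinfP[_ [c c0 hc]] := PhiQ_Linf hPhi LQ.
exists c => //; apply: filterS hc => z hz x; rewrite weight_quad big_ord0 add0r.
by rewrite /proj big_ord0 subr0.
Qed.

Lemma Hinf0 : Hinf (fun _ : T => 0 : 'M[C]_(m1, n1)).
Proof.
split; first exact: Linf_cst.
move=> i j n _; rewrite /fourier (@cint_ext _ _ (fun=> 0)) ?cint0 // => z.
by rewrite mxE mul0r.
Qed.

Lemma stage0 f t : exists b, stage 0 f t b.
Proof.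
have [b b0 hb] := Hinf_bounded f t Hinf0; exists b; split; [by []|by []|exact b0|by []|by []|by []|by []| |by []| |].
- by apply: (bounded_admissible hPhi _ Hinf0 hb) => i.
- by move=> Q HQ _; exact HQ.
- by move=> Q HQ; split; [exact HQ|have [c c0 hc] := Hinf_bounded f t HQ; exists c].
Qed.

Section one_stage.
Variables (j : nat) (f : nat -> fD) (t : nat -> R) (b : R).
Hypothesis st : stage j f t b.
Local Notation W := (weight f t j).

Lemma stage_structure Q : pre_Omega j Q ->
  \forall z \ae mu, forall i, (i < j)%N -> PhiQ Phi Q z *m f i z = G (f i) z /\
    adj (PhiQ Phi Q z) *m (PhiQ Phi Q z *m frame f z i) = (t i ^+ 2)%:C%C *: frame f z i.
Proof.
move=> /(st_out st)[HQ [c [c0 ct hc]]].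
apply: (frame_structure hPhi (st_dom st) HQ hc) => i ij.
by rewrite (wform_weight_fun Phi f t c b ij); exact: (st_ker st ij).
Qed.

Lemma ess_sval_leP Q a : pre_Omega j Q -> 0 <= a ->
  (ess_sval Phi j Q <= a%:E)%E <-> bounded f t j a Q.
Proof.
move=> PQ a0; have [HQ [c [c0 ct hc]]] := st_out st PQ.
have hs := stage_structure PQ.
have hf : \forall z \ae mu, forall i : 'I_j, frame f z i != 0.
  by apply: ae_all_fin => i; exact: (st_frame st).
have key : \forall z \ae mu, sval_mx j (PhiQ Phi Q z) <= a <->
    forall x, vn2 (PhiQ Phi Q z *m x) <= Re (hdot (W a z *m x) x).
  apply: filterS3 hs hf hc => z h1 h2 h3.
  apply: (weight_sval a0 c0 ct) => //.
    by move=> i ij; exact: (h2 (Ordinal ij)).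
  by move=> i ij; exact: (h1 i ij).2.
split=> [/ess_supP h|h].
  by apply: filterS2 key h => z hz; rewrite lee_fin => /hz.
by apply/ess_supP; apply: filterS2 key h => z hz h'; rewrite lee_fin; exact/hz.
Qed.

Lemma bounded_le a1 a2 Q : 0 <= a1 -> a1 <= a2 -> bounded f t j a1 Q -> bounded f t j a2 Q.
Proof.
move=> a0 a12; apply: filterS => z hz x; apply: le_trans (hz x) _; exact: weight_le.
Qed.

(** The infimum of the admissible levels is itself admissible, because the form of a fixed function
    depends continuously on the level. *)
Lemma optimal_level : exists tau, [/\ 0 <= tau, tau <= b, admissible Phi (W tau) &
  forall a, 0 <= a -> a < tau -> exists2 g, dom g & qf (wform Phi (W a)) g < 0].
Proof.
pose S := [set a | 0 <= a /\ admissible Phi (W a)].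
have Sb : S b by split; [exact: (st_ge0 st)|exact: (st_adm st)].
have lbS : lbound S 0 by move=> a [].
have hS : has_inf S by split; [exists b|exists 0].
have LW a := Linf_W t (st_dom st) a.
have LD := Linf_D (st_dom st).
have tau0 : 0 <= inf S by apply: lb_le_inf => //; exists b.
exists (inf S); split; [exact tau0|by apply: ge_inf => //; exact: hS.2| |].
- split; [exact: LW|by move=> z; exact: adj_weight|].
  move=> g Dg; have Lg := dom_L2 Dg.
  have q0 := qf_ge0 hD Lg.
  have t1 : 0 <= 2 * inf S + 1 by lra.
  (* If a < inf S + e with e <= 1, then a^2 exceeds the square of inf S by at most (2 inf S + 1)
     e. *)
  apply: (@le_eps _ _ _ ((2 * inf S + 1) * qf dotD g)); first exact: mulr_ge0.
  move=> e e0 e1; have [a [a0 adm_a] ha] := inf_adherent e0 hS.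
  have sa : inf S <= a := ge_inf hS.2 (conj a0 adm_a).
  have [_ _ pos] := adm_a.
  have := eq_ind _ (fun x : R => 0 <= x) (pos g Dg) _
    (qf_wform_diff Phi (inf S) LW LD (weightE f t j) a Lg).
  have d0 : 0 <= Re (dotD (residual f j \*m g) g).
    rewrite -(mul0r (qf dotD g)); apply: quad_ge => //.
    by apply: aeW => z x; rewrite mul0r residual_ge0.
  have d1 : Re (dotD (residual f j \*m g) g) <= qf dotD g.
    rewrite -[leRHS]mul1r; apply: quad_le => //.
    by apply: aeW => z x; rewrite mul1r residual_le.
  have a2 : 0 <= a ^+ 2 - inf S ^+ 2 <= (2 * inf S + 1) * e by nra.
  move: d0 d1 a2 q0; move: (Re _) (qf dotD g) (qf (wform _ _) g) => d q s d0 d1 /andP[a2 a2'] q0 h.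
  have : (a ^+ 2 - inf S ^+ 2) * d <= (2 * inf S + 1) * e * q by apply: ler_pM.
  by move: h; rewrite -[inf S ^+ 2 - _]opprB mulNr opprK; lra.
- move=> a a0 at_; apply: contrapT => h; have adm_a : admissible Phi (W a).
    split; [exact: LW|by move=> z; exact: adj_weight|].
    by move=> g Dg; rewrite leNgt; apply/negP => hg; apply: h; exists g.
  by have := ge_inf hS.2 (conj a0 adm_a); rewrite leNgt at_.
Qed.

Variable tau : R.
Hypothesis tau_ge0 : 0 <= tau.
Hypothesis tau_le : tau <= b.
Hypothesis tau_adm : admissible Phi (W tau).
Hypothesis tau_min : forall a, 0 <= a -> a < tau -> exists2 g, dom g & qf (wform Phi (W a)) g < 0.

Lemma bounded_pre Q : Hinf Q -> bounded f t j tau Q -> pre_Omega j Q.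
Proof. by move=> HQ hQ; exact (st_in st HQ (bounded_le tau_ge0 tau_le hQ)). Qed.

Lemma optimal_exists : exists2 Q, Hinf Q & bounded f t j tau Q.
Proof. exact: (weighted_nehari hPhi m1_gt0 tau_adm). Qed.

Lemma tau_le_sval Q : pre_Omega j Q -> (tau%:E <= ess_sval Phi j Q)%E.
Proof.
move=> PQ; rewrite leNgt; apply/negP => h.
have [HQ _] := st_out st PQ.
have [r r0 er] : exists2 r, 0 <= r & ess_sval Phi j Q = r%:E.
  move: h (ess_sval_ge0 j Q); case: (ess_sval Phi j Q) => [r| |] // _; rewrite lee_fin => r0.
  by exists r.
have rt : r < tau by rewrite -lte_fin -er.
have /(ess_sval_leP PQ r0) hr : (ess_sval Phi j Q <= r%:E)%E by rewrite er.
have [_ _ pos] := bounded_admissible hPhi (st_dom st) HQ hr.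
by have [g Dg] := tau_min r0 rt; rewrite ltNge pos.
Qed.

(** No competitor goes below tau, and the weighted Nehari theorem at level tau yields one that
    attains it. *)
Lemma Omega_bounded Q : Omega Phi j Q <-> Hinf Q /\ bounded f t j tau Q.
Proof.
have [Q0 HQ0 hQ0] := optimal_exists; have P0 := bounded_pre HQ0 hQ0.
have s0 := (ess_sval_leP P0 tau_ge0).2 hQ0.
rewrite OmegaE; split=> [[PQ hQ]|[HQ hQ]].
  split; first by have [] := st_out st PQ.
  by apply/(ess_sval_leP PQ tau_ge0); exact: le_trans (hQ _ P0) s0.
have PQ := bounded_pre HQ hQ; split; [exact PQ|move=> Q' PQ'].
by apply: le_trans (tau_le_sval PQ'); exact: (ess_sval_leP PQ tau_ge0).2.
Qed.

Lemma Omega_sval Q : Omega Phi j Q -> ess_sval Phi j Q = tau%:E.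
Proof.
move=> OQ; have [PQ _] := (OmegaE j Q).1 OQ; have [_ hQ] := (Omega_bounded Q).1 OQ.
by apply/eqP; rewrite eq_le tau_le_sval // andbT; exact: (ess_sval_leP PQ tau_ge0).2.
Qed.

Lemma Omega_nonempty : exists Q, Omega Phi j Q.
Proof. by have [Q HQ hQ] := optimal_exists; exists Q; apply/Omega_bounded. Qed.
End one_stage.
End stages.

(** * Pointwise independence of upper parts *)

Section pointwise_injectivity.
Variable R : realType.
Local Notation C := R[i].

(** On the span of singular vectors with values t_i > b one has |A x| > b |x| for x nonzero, whereas
    |A x| <= b |x| if the upper part of x is 0. *)
Lemma spanp_top_inj (p k1 k2 : nat) (A : 'M[C]_(p, k1 + k2)) (e : nat -> 'cV[C]_(k1 + k2))
    (t : nat -> R) l (b : R) : porth e l ->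
  (forall i, (i < l)%N -> adj A *m (A *m e i) = (t i ^+ 2)%:C%C *: e i) ->
  0 <= b -> (forall i, (i < l)%N -> b < t i) ->
  (forall y : 'cV[C]_k2, vn2 (A *m col_mx 0 y) <= b ^+ 2 * vn2 y) ->
  forall x, spanp e l x -> usubmx x = 0 -> x = 0.
Proof.
move=> pe he b0 bt hA x sx x0.
have hx : x = col_mx 0 (dsubmx x) by rewrite -x0 vsubmxK.
have s0 : \sum_(i < l) (t i ^+ 2 - b ^+ 2) * cn2 (hdot x (e i)) <= 0.
  under eq_bigr do rewrite mulrBl.
  rewrite big_split /= sumrN -mulr_sumr -(vn2_mul_span pe he sx) -(vn2_span pe sx) subr_le0.
  by rewrite [in X in _ <= _ * X]hx vn2_0col [in X in X <= _]hx hA.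
have tb (i : 'I_l) : 0 < t i ^+ 2 - b ^+ 2.
  by have := bt _ (ltn_ord i); rewrite subr_gt0; nra.
apply: vn2_eq0; rewrite (vn2_span pe sx) big1 // => i _.
have hge (k : 'I_l) : true -> 0 <= (t k ^+ 2 - b ^+ 2) * cn2 (hdot x (e k)).
  by move=> _; rewrite mulr_ge0 ?cn2_ge0 // ltW.
have /eqP : \sum_(i < l) (t i ^+ 2 - b ^+ 2) * cn2 (hdot x (e i)) == 0.
  by rewrite eq_le s0 sumr_ge0.
move=> /psumr_eq0P -/(_ hge i isT)/eqP; rewrite mulf_eq0 (gt_eqF (tb i)) /=.
by move/eqP.
Qed.

(** By injectivity g_i and its upper part depend on their predecessors at the same indices i. A
    Gram-Schmidt vector is 0 exactly at such a dependence and a unit vector otherwise. *)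
Lemma gs_top_eq0 (k1 k2 : nat) (g : nat -> 'cV[C]_(k1 + k2)) l :
  (forall x, spanp (gs g) l x -> usubmx x = 0 -> x = 0) ->
  forall i, (i < l)%N -> vn2 (gs (fun k => usubmx (g k)) i) = vn2 (gs g i).
Proof.
move=> inj i il.
have e : gs (fun k => usubmx (g k)) i = 0 <-> gs g i = 0.
  rewrite !gs_eq0; split=> -[c hc]; exists c; last first.
    by rewrite {1}hc linear_sum; apply: eq_bigr => k _; rewrite linearZ.
  apply/eqP; rewrite -subr_eq0; apply/eqP; apply: inj.
    apply: (subB (spanp_sub _ _)); first exact: spanp_gs.
    apply: (sub_sum (spanp_sub _ _)) => k _; apply: (subZ (spanp_sub _ _)).
    by apply: spanp_gs; exact: ltn_trans (ltn_ord k) il.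
  rewrite linearB /= hc linear_sum /=; apply/eqP; rewrite subr_eq0; apply/eqP.
  by apply: eq_bigr => k _; rewrite linearZ.
rewrite (porth_vn2 (@gs_porth R _ (fun k => usubmx (g k)) l) il) (porth_vn2 (@gs_porth R _ g l) il).
congr (~~ _)%:R; apply/idP/idP => /eqP /e ->; exact: eqxx.
Qed.

Lemma eq_mulmx_indep (p k : nat) (A B : 'M[C]_(p, k)) (w : nat -> 'cV[C]_k) :
  (forall c : nat -> C, \sum_(i < k) c i *: w i = 0 -> forall i, (i < k)%N -> c i = 0) ->
  (forall i, (i < k)%N -> A *m w i = B *m w i) -> A = B.
Proof.
move=> hw hAB; pose M : 'M[C]_k := \matrix_(i, j) w j i ord0.
have uM : M \in unitmx.
  rewrite -unitmx_tr -row_free_unit; apply: inj_row_free => v hv.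
  apply/rowP => i; rewrite mxE.
  have := hw (fun l => if insub l is Some o then v 0 o else 0).
  move=> /(_ _ i (ltn_ord i)); rewrite valK; apply.
  apply/matrixP => l o; rewrite (ord1 o) summxE !mxE.
  have := congr1 (fun X : 'rV[C]_k => X 0 l) hv; rewrite !mxE => e; rewrite -[RHS]e.
  by apply: eq_bigr => q _; rewrite valK !mxE.
apply: (can_inj (mulmxK uM)); apply/matrixP => i j.
have e (X : 'M[C]_(p, k)) : (X *m M) i j = (X *m w j) i ord0.
  by rewrite !mxE; apply: eq_bigr => q _; rewrite mxE.
by rewrite !e hAB.
Qed.

Lemma sval_anti (p k i j : nat) (A : 'M[C]_(p, k)) : (i <= j)%N -> sval_mx j A <= sval_mx i A.
Proof.
move=> ij; apply: lb_le_inf; first exact: (sval_has_inf i A).1.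
move=> _ [B hB <-]; apply: ge_inf; first exact: (sval_has_inf j A).2.
by exists B => //; exact: leq_trans hB ij.
Qed.
End pointwise_injectivity.

(** * Passage to the next stage, and uniqueness *)

Section next_stages.
Variable R : realType.
Local Notation C := R[i].
Local Notation T := (circle R).
Local Notation mu := (@arc_measure R).
Local Notation Re := (@complex.Re R).
Variables (m1 m2 n1 n2 : nat).
Hypothesis m1_gt0 : (0 < m1)%N.
Variable Phi : T -> 'M[C]_(m1 + m2, n1 + n2).
Hypothesis hPhi : Linf Phi.
Local Notation dom := (@Gamma_dom R n1 n2).
Local Notation fD := (T -> 'cV[C]_(n1 + n2)).
Local Notation G := (gam Phi).
Local Notation ess := (Gamma_ess_norm Phi).
Local Notation stage := (@stage R m1 m2 n1 n2 Phi).
Local Notation pre_Omega := (@pre_Omega R m1 m2 n1 n2 Phi).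
Implicit Types (f : nat -> fD) (t : nat -> R) (Q : T -> 'M[C]_(m1, n1)).

Lemma ess_gap (e : \bar R) (a : R) : (e < a%:E)%E -> 0 < a ->
  exists b, [/\ 0 <= b, b < a & (e < b%:E)%E].
Proof.
case: e => [r| |] // ra a0; last by exists (a / 2); split; rewrite ?ltNyr //; lra.
rewrite lte_fin in ra; exists (Num.max ((r + a) / 2) (a / 2)).
split; rewrite ?lte_fin ?le_max ?gt_max ?lt_max.
- by apply/orP; right; lra.
- by apply/andP; split; lra.
- by apply/orP; left; lra.
Qed.

Lemma PhiQ_0col Q z (y : 'cV[C]_n2) : PhiQ Phi Q z *m col_mx 0 y = Phi z *m col_mx 0 y.
Proof. by rewrite PhiQ_mulE col_mxKu mulmx0 col_mx0 subr0. Qed.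

Lemma PhiQ_eq_top Q Q' z (x : 'cV[C]_(n1 + n2)) :
  PhiQ Phi Q z *m x = PhiQ Phi Q' z *m x -> Q z *m usubmx x = Q' z *m usubmx x.
Proof.
rewrite !PhiQ_mulE => /addrI/oppr_inj/(congr1 usubmx).
by rewrite !col_mxKu.
Qed.

Lemma adj_PhiQ_mulE Q z (y : 'cV[C]_(m1 + m2)) :
  adj (PhiQ Phi Q z) *m y = adj (Phi z) *m y - col_mx (adj (Q z) *m usubmx y) 0.
Proof.
have e2 : adj (block_mx (Q z) 0 0 0 : 'M[C]_(m1 + m2, n1 + n2)) = block_mx (adj (Q z)) 0 0 0.
  have aE p q (A : 'M[C]_(p, q)) : adj A = map_mx conjc A^T.
    by apply/matrixP => i j; rewrite !mxE.
  rewrite !aE tr_block_mx map_block_mx !trmx0.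
  by congr block_mx; apply/matrixP => i j; rewrite !mxE conjc0.
rewrite PhiQE adjD adjN e2 mulmxBl; congr (_ - _).
by rewrite -{1}[y]vsubmxK mul_block_col !mul0mx !addr0.
Qed.

Lemma adj_PhiQ_eq_top Q Q' z (y : 'cV[C]_(m1 + m2)) :
  adj (PhiQ Phi Q z) *m y = adj (PhiQ Phi Q' z) *m y ->
  adj (Q z) *m usubmx y = adj (Q' z) *m usubmx y.
Proof.
rewrite !adj_PhiQ_mulE => /addrI/oppr_inj/(congr1 usubmx).
by rewrite !col_mxKu.
Qed.

Lemma adj_PhiQ_0col Q z (y : 'cV[C]_m2) :
  adj (PhiQ Phi Q z) *m col_mx 0 y = adj (Phi z) *m col_mx 0 y.
Proof. by rewrite adj_PhiQ_mulE col_mxKu mulmx0 col_mx0 subr0. Qed.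

Lemma stage_nonempty j f t b : stage j f t b -> exists Q, pre_Omega j Q.
Proof.
move=> st; have [Q HQ hQ] := weighted_nehari hPhi m1_gt0 (st_adm st).
by exists Q; exact (st_in st HQ hQ).
Qed.

Lemma stage_frame0 j f t b : stage j f t b ->
  \forall z \ae mu, forall i, (i < j)%N -> frame f z i != 0.
Proof.
move=> st; have : \forall z \ae mu, forall i : 'I_j, frame f z i != 0.
  by apply: ae_all_fin => i; exact: (st_frame st).
by apply: filterS => z hz i ij; exact: (hz (Ordinal ij)).
Qed.

Lemma stage_sval j f t b Q : stage j f t b -> pre_Omega j Q ->
  \forall z \ae mu, forall i, (i < j)%N -> sval_mx i (PhiQ Phi Q z) = t i.
Proof.
move=> st PQ; have [HQ [c [c0 ct hc]]] := st_out st PQ.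
apply: filterS3 (stage_structure hPhi st PQ) (stage_frame0 st) hc => z h1 h2 h3 i ij.
apply: (sval_eq (@frame_porth R _ f z j) h2 _ _ ij (st_anti st) (ct i ij) c0).
- by move=> k kj; exact: ltW (st_pos st kj).
- by move=> k kj; exact (h1 k kj).2.
- by move=> x hx; rewrite -(weight_perp t c hx); exact: h3.
Qed.

Section step.
Variables (j : nat) (f : nat -> fD) (t : nat -> R) (b : R).
Hypothesis st : stage j f t b.
Variable tau : R.
Hypothesis tau_ge0 : 0 <= tau.
Hypothesis tau_le : tau <= b.
Hypothesis tau_adm : admissible Phi (weight f t j tau).
Hypothesis tau_min : forall a, 0 <= a -> a < tau ->
  exists2 g, dom g & qf (wform Phi (weight f t j a)) g < 0.

Definition upd (X : Type) (g : nat -> X) (y : X) i := if i == j then y else g i.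

Lemma upd_old (X : Type) (g : nat -> X) y i : (i < j)%N -> upd g y i = g i.
Proof. by move=> ij; rewrite /upd ltn_eqF. Qed.

Lemma upd_new (X : Type) (g : nat -> X) y : upd g y j = y.
Proof. by rewrite /upd eqxx. Qed.

Lemma upd_ind (X : Type) (P : nat -> X -> Prop) (g : nat -> X) y : P j y ->
  (forall i, (i < j)%N -> P i (g i)) -> forall i, (i < j.+1)%N -> P i (upd g y i).
Proof.
move=> Py Pg i; rewrite ltnS leq_eqVlt => /orP[/eqP ->|ij]; first by rewrite upd_new.
by rewrite upd_old //; exact: Pg.
Qed.

Section positive.
Hypothesis tau_gt0 : 0 < tau.
Hypothesis ess_tau : (ess < tau%:E)%E.

(** Otherwise all hypotheses of [minimal_contradiction] hold; the lower bound W >= tau^2 comes from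
    tau <= b <= t_i. *)
Lemma new_function : exists2 g, dom g /\ qf (wform Phi (weight f t j tau)) g = 0 &
  ~ \forall z \ae mu, residual f j z *m g z = 0.
Proof.
apply: contrapT => H.
have wge z x : tau ^+ 2 * vn2 x <= Re (hdot (weight f t j tau z *m x) x).
  by apply: weight_ge => // i ij; exact: le_trans tau_le (st_le st ij).
apply: (minimal_contradiction hPhi (Linf_W t (st_dom st)) (Linf_D (st_dom st))
  (adj_residual f j) (weightE f t j) (@residual_ge0 R _ f j) (@residual_le R _ f j) wge
  tau_gt0 ess_tau tau_adm tau_min) => g kg.
by apply: contrapT => hg; apply: H; exists g.
Qed.

Lemma next_stage : exists f' t', stage j.+1 f' t' tau.
Proof.
have [g [Dg g0] gr] := new_function.
pose f' := upd f g; pose t' := upd t tau; exists f', t'.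
have WE : weight f' t' j.+1 tau = weight f t j tau.
  apply/funext => z; have := weightS f' t' j z; rewrite /t' upd_new => ->.
  by apply: eq_weight => i ij; exact: upd_old.
have Df := upd_ind (P := fun=> dom) Dg (st_dom st).
have tle := upd_ind (P := fun _ x => tau <= x) (lexx tau)
  (fun i ij => le_trans tau_le (st_le st ij)).
have ker0 i : (i < j.+1)%N -> qf (wform Phi (weight f' t' j.+1 tau)) (f' i) = 0.
  rewrite WE; move: i; apply: (upd_ind (P := fun _ x => qf (wform Phi _) x = 0)); first exact g0.
  by move=> i ij; rewrite (wform_weight_fun Phi f t tau b ij); exact (st_ker st ij).
have adm : admissible Phi (weight f' t' j.+1 tau) by rewrite WE; exact tau_adm.
have bE Q : bounded Phi f' t' j.+1 tau Q = bounded Phi f t j tau Q by rewrite /bounded WE.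
have fr i z : (i < j)%N -> frame f' z i = frame f z i.
  by move=> ij; apply: eq_frame => k ki; rewrite /f' upd_old // (leq_ltn_trans ki ij).
(* The squared norms of the frame vectors add up to the rank of the upper parts, a constant c; the
   first j are 1, so the last is c - j almost everywhere. If it were 0, g would lie pointwise in the
   span of the f_i, against the choice of g. *)
have new : \forall z \ae mu, frame f' z j != 0.
  have [Q OQ] := Omega_nonempty m1_gt0 hPhi st tau_ge0 tau_le tau_adm tau_min.
  have [HQ hQ] := (Omega_bounded m1_gt0 hPhi st tau_ge0 tau_le tau_adm tau_min Q).1 OQ.
  have hQ' : bounded Phi f' t' j.+1 tau Q by rewrite bE.
  have str := frame_structure hPhi Df HQ hQ' ker0.
  (* Both comparisons have to be strict: the block bound needs a level above the essential norm, and
     injectivity one below all t_i. *)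
  have [b' [b'0 b't eb']] := ess_gap ess_tau tau_gt0.
  have hb := right_block_bound hPhi eb'.
  have inj : \forall z \ae mu, forall x, spanp (frame f' z) j.+1 x -> usubmx x = 0 -> x = 0.
    apply: filterS2 str hb => z h1 h2.
    apply: (spanp_top_inj (@frame_porth R _ f' z j.+1) (fun i ij => (h1 i ij).2) b'0).
      by move=> i ij; exact: lt_le_trans b't (tle i ij).
    by move=> y; rewrite PhiQ_0col; exact: h2.
  have [c hc] := rank_constant (fun i ij => (Df i ij).1).
  have hj : \forall z \ae mu, vn2 (frame f' z j) = c - j%:R.
    apply: filterS3 inj hc (stage_frame0 st) => z h1 h2 h3.
    rewrite -h2 big_ord_recr /= (gs_top_eq0 h1 (ltnSn j)) addrC.
    rewrite (eq_bigr (fun=> 1)) => [|i _]; last first.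
      rewrite (gs_top_eq0 h1 (ltnW (ltn_ord i))).
      have ij := ltn_ord i.
      by rewrite -/(frame f' z i) fr // (porth_vn2 (@frame_porth R _ f z j) ij) h3.
    by rewrite sumr_const card_ord addrK.
  have [cj|cj] := eqVneq (c - j%:R) 0; last first.
    apply: filterS hj => z hz; apply/eqP => h0; move: hz; rewrite h0 vn2_0 => /esym/eqP.
    by rewrite (negbTE cj).
  exfalso; apply: gr; apply: filterS hj => z; rewrite cj => /vn2_eq0/gs_eq0.
  rewrite -/(f' j) /f' upd_new => sg.
  rewrite residual_mul span_proj ?subrr //; first exact: frame_porth.
  apply: spanp_trans sg => i ij; rewrite upd_old //.
  exact: (@spanp_gs R _ (fun l => f l z) j i ij).
split.
- exact Df.
- exact (upd_ind (P := fun _ x => (ess < x%:E)%E) ess_tau (st_ess st)).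
- exact tau_ge0.
- exact tle.
- by move=> i ij; exact: lt_le_trans tau_gt0 (tle i ij).
- move=> i k ik; rewrite ltnS leq_eqVlt => /orP[/eqP kj|kj].
    by rewrite kj /t' upd_new; apply: tle; rewrite ltnS -kj.
  by rewrite /t' (upd_old _ _ kj) (upd_old _ _ (leq_ltn_trans ik kj)); exact (st_anti st ik kj).
- move=> i; rewrite ltnS leq_eqVlt => /orP[/eqP ->|ij]; first exact new.
  by apply: filterS (st_frame st ij) => z; rewrite fr.
- exact adm.
- exact ker0.
- move=> Q HQ; rewrite bE => hQ.
  exact ((Omega_bounded m1_gt0 hPhi st tau_ge0 tau_le tau_adm tau_min Q).2 (conj HQ hQ)).
- move=> Q OQ.
  have [HQ hQ] := (Omega_bounded m1_gt0 hPhi st tau_ge0 tau_le tau_adm tau_min Q).1 OQ.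
  split; first exact HQ.
  by exists tau; split; [exact tau_ge0|exact tle|rewrite bE; exact hQ].
Qed.
End positive.

Section zero.
Hypothesis tau0 : tau = 0.

Lemma bounded0 Q : Omega Phi j Q -> pre_Omega j Q /\ \forall z \ae mu, forall x,
  (forall i, (i < j)%N -> hdot x (frame f z i) = 0) -> PhiQ Phi Q z *m x = 0.
Proof.
move=> OQ; split; first exact: ((OmegaE Phi j Q).1 OQ).1.
have [HQ hQ] := (Omega_bounded m1_gt0 hPhi st tau_ge0 tau_le tau_adm tau_min Q).1 OQ.
apply: filterS hQ => z hz x hx; apply: vn2_eq0; apply/eqP; rewrite eq_le vn2_ge0 andbT.
by apply: le_trans (hz x) _; rewrite (weight_perp t tau hx) tau0 expr0n /= mul0r.
Qed.

(** Every vector splits into a part orthogonal to the frame, which Phi_Q kills, and a combination of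
    the f_i, on which Phi_Q f_i = Gamma f_i does not depend on Q. *)
Lemma Omega_unique0 Q Q' : Omega Phi j Q -> Omega Phi j Q' -> ae_eq mu [set: T] Q' Q.
Proof.
move=> /bounded0[PQ hQ] /bounded0[PQ' hQ'].
have s1 := stage_structure hPhi st PQ; have s2 := stage_structure hPhi st PQ'.
apply: filterS2 (filterI s1 s2) (filterI hQ hQ') => z [h1 h2] [h3 h4] _.
have e (x : 'cV[C]_(n1 + n2)) : PhiQ Phi Q' z *m x = PhiQ Phi Q z *m x.
  have [c hc] : spanp (fun l => f l z) j (proj (frame f z) j x).
    apply: spanp_trans (proj_span _ _ x) => i ij.
    by apply: spanp_widen ij _; exact: gs_spanp.
  have hx i : (i < j)%N -> hdot (x - proj (frame f z) j x) (frame f z i) = 0.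
    by move=> ij; apply: hdot_res => //; exact: frame_porth.
  have split A : A *m x = A *m (x - proj (frame f z) j x) + A *m proj (frame f z) j x :> 'cV[C]_(m1 + m2).
    by rewrite -mulmxDr subrK.
  rewrite [LHS]split [RHS]split (h3 _ hx) (h4 _ hx) !add0r hc !mulmx_sumr.
  by apply: eq_bigr => i _; rewrite -!scalemxAr (h1 i (ltn_ord i)).1 (h2 i (ltn_ord i)).1.
apply/matrixP => i k.
have := PhiQ_eq_top (e (col_mx (delta_mx k 0) 0)); rewrite col_mxKu.
by move=> /(congr1 (fun X : 'cV[C]_m1 => X i 0)); rewrite -!colE !mxE.
Qed.

(** The elements of Omega_j agree almost everywhere, so further essential suprema cannot tell them
    apart. *)
Lemma Omega_stable0 r Q : (j <= r)%N -> Omega Phi r Q <-> Omega Phi j Q.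
Proof.
move=> /subnKC <-; elim: (r - j)%N Q => [|k IH] Q; first by rewrite addn0.
rewrite addnS OmegaE /=; split=> [[/IH //]|OQ].
split; first exact/IH.
move=> Q' /IH OQ'; rewrite le_eqVlt; apply/orP; left; apply/eqP; apply: eq_ess_sup.
by apply: filterS (Omega_unique0 OQ' OQ) => z /(_ I); rewrite /PhiQ => ->.
Qed.

Lemma Omega_sval0 Q i : Omega Phi j Q ->
  exists c, \forall z \ae mu, sval_mx i (PhiQ Phi Q z) = c.
Proof.
move=> /bounded0[PQ hQ]; have [ij|ji] := ltnP i j.
  by exists (t i); apply: filterS (stage_sval st PQ) => z; apply.
exists 0; apply: filterS hQ => z hz; apply/eqP; rewrite eq_le sval_ge0 andbT.
apply: le_trans (sval_anti _ ji) _.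
apply: (sval_le (lexx 0) (@frame_porth R _ f z j)) => x hx.
by rewrite hz // vn2_0 expr0n /= mul0r.
Qed.
End zero.
End step.

Section last.
Variables (f : nat -> fD) (t : nat -> R) (b : R).
Let d := minn m1 n1.
Hypothesis n1_gt0 : (0 < n1)%N.
Hypothesis st : stage d f t b.

Lemma last_gap : exists b', [/\ 0 <= b', forall i, (i < d)%N -> b' < t i & (ess < b'%:E)%E].
Proof.
have dd : (d.-1 < d)%N by rewrite /d; lia.
have [b' [b0 bt eb]] := ess_gap (st_ess st dd) (st_pos st dd).
exists b'; split => // i id; apply: lt_le_trans bt _; apply: (st_anti st) => //.
by rewrite -ltnS prednK //; lia.
Qed.

Lemma top_indep (k1 k2 : nat) (e : nat -> 'cV[C]_(k1 + k2)) : porth e d ->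
  (forall i, (i < d)%N -> e i != 0) ->
  (forall x, spanp e d x -> usubmx x = 0 -> x = 0) ->
  forall c : nat -> C, \sum_(i < d) c i *: usubmx (e i) = 0 -> forall i, (i < d)%N -> c i = 0.
Proof.
move=> pe e0 inj c hc i id.
have x0 : \sum_(i < d) c i *: e i = 0.
  apply: inj; first by exists c.
  by rewrite linear_sum -[RHS]hc; apply: eq_bigr => k _; rewrite linearZ.
by have := hdot_sum_porth pe c id; rewrite x0 hdot0 e0 // mulr1.
Qed.

Lemma last_unique Q Q' : pre_Omega d Q -> pre_Omega d Q' -> ae_eq mu [set: T] Q' Q.
Proof.
move=> PQ PQ'; have [b' [b0 bt eb]] := last_gap.
have s1 := stage_structure hPhi st PQ; have s2 := stage_structure hPhi st PQ'.
have rb := right_block_bound hPhi eb; have lb := left_block_bound hPhi eb.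
apply: filterS3 (filterI s1 s2) (stage_frame0 st) (filterI rb lb) => z [h1 h2] v0 [hr hl] _.
have pv := @frame_porth R _ f z d.
have hv i (id : (i < d)%N) := (h1 i id).2.
have hv' i (id : (i < d)%N) := (h2 i id).2.
have ev i : (i < d)%N -> PhiQ Phi Q' z *m frame f z i = PhiQ Phi Q z *m frame f z i.
  move=> id; have [c e] := gs_spanp (fun l => f l z) (ltnSn i).
  rewrite /frame e !mulmx_sumr; apply: eq_bigr => l _; rewrite -!scalemxAr.
  have ld := leq_trans (ltn_ord l) id.
  by rewrite (h1 l ld).1 (h2 l ld).1.
(* With d = n1 the upper parts of the frame form a basis of the space on which Q acts; with d = m1
   the same is done for Q^*. *)
have [mn|nm] := leqP n1 m1.
  have dn : d = n1 by exact/minn_idPr.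
  have inj := spanp_top_inj pv hv b0 bt (fun y => eq_ind_r (fun X => vn2 X <= _) (hr y) (PhiQ_0col Q z y)).
  have ind := top_indep pv v0 inj; have ev' := ev; rewrite dn in ind ev'.
  by apply: (eq_mulmx_indep ind) => i id; exact: (PhiQ_eq_top (ev' i id)).
have dm : d = m1 by apply/minn_idPl; exact: ltnW.
(* The left singular vectors, which by [ev] are common to Q and Q'. For them the bound on the last
   block row replaces that on the last block column. *)
pose e i := ((t i)^-1)%:C%C *: (PhiQ Phi Q z *m frame f z i).
have t0 i (id : (i < d)%N) := st_pos st id.
have ae i : (i < d)%N -> adj (PhiQ Phi Q z) *m e i = (t i)%:C%C *: frame f z i.
  move=> id; rewrite /e -scalemxAr hv // scalerA; congr (_ *: _).
  have := t0 i id => ti; apply: complex_ext; rewrite !ReImE; last by ring.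
  by field; rewrite gt_eqF.
have ae' i : (i < d)%N -> adj (PhiQ Phi Q' z) *m e i = (t i)%:C%C *: frame f z i.
  move=> id; rewrite /e -ev // -scalemxAr hv' // scalerA; congr (_ *: _).
  have := t0 i id => ti; apply: complex_ext; rewrite !ReImE; last by ring.
  by field; rewrite gt_eqF.
have he i : (i < d)%N -> adj (adj (PhiQ Phi Q z)) *m (adj (PhiQ Phi Q z) *m e i) =
    (t i ^+ 2)%:C%C *: e i.
  move=> id; rewrite ae // adjK -scalemxAr /e scalerA; congr (_ *: _).
  have := t0 i id => ti; apply: complex_ext; rewrite !ReImE; last by ring.
  by field; rewrite gt_eqF.
have ee i k : (i < d)%N -> (k < d)%N -> hdot (e i) (e k) = hdot (frame f z i) (frame f z k) * (t k / t i)%:C%C.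
  move=> id kd; rewrite {1}/e hdotZ hdot_adj ae // hdotZr conjcR mulrA mulrC; congr (_ * _).
  by have := t0 i id => ti; apply: complex_ext; rewrite !ReImE; ring.
have e0 i : (i < d)%N -> e i != 0.
  move=> id; apply/eqP => ei; have := ee i i id id; rewrite ei hdot0 hdotxx.
  rewrite divff ?gt_eqF ?t0 // mulr1 => /(congr1 Re) /esym /vn2_eq0 /eqP.
  by rewrite (negbTE (v0 i id)).
have pe : porth e d.
  move=> i k id kd; rewrite ee // pv // v0 // e0 // !andbT.
  case: eqVneq => [->|_]; last by rewrite mul0r.
  by rewrite divff ?gt_eqF ?t0 // mul1r.
have inj := spanp_top_inj pe he b0 bt (fun y => eq_ind_r (fun X => vn2 X <= _) (hl y) (adj_PhiQ_0col Q z y)).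
have ind := top_indep pe e0 inj; have ae2 := ae; have ae3 := ae'; rewrite dm in ind ae2 ae3.
rewrite -[Q z]adjK -[Q' z]adjK; congr adj; apply: (eq_mulmx_indep ind) => i id.
by apply: (adj_PhiQ_eq_top (y := e i)); rewrite ae2 // ae3.
Qed.
End last.
End next_stages.

Theorem theorem2p1 (R : realType) (m1 m2 n1 n2 : nat)
    (hm1 : (0 < m1)%N) (hn1 : (0 < n1)%N)
    (Phi : circle R -> 'M[R[i]]_(m1 + m2, n1 + n2))
    (hPhi : Linf Phi)
    (hess : forall (j : nat) (t : \bar R), superoptimal_sval Phi j t ->
      t <> 0%E -> (Gamma_ess_norm Phi < t)%E) :
  exists Q : circle R -> 'M[R[i]]_(m1, n1),
    [/\ superoptimal Phi Q,
        forall Q' : circle R -> 'M[R[i]]_(m1, n1), superoptimal Phi Q' ->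
          ae_eq arc_measure [set: circle R] Q' Q &
        forall j : nat, (1 <= j <= (minn m1 n1).-1)%N ->
          exists c : R,
            {ae arc_measure, forall z, sval_mx j (PhiQ Phi Q z) = c}].
Proof.
have d0 : (0 < minn m1 n1)%N by rewrite leq_min hm1 hn1.
(* Arguing by contradiction lets the induction on stages stop early: at a level 0 the conclusion is
   already available and contradicts [none]. *)
apply: contrapT => none.
have step j : (j <= minn m1 n1)%N -> exists f t b, stage (m2 := m2) (n2 := n2) Phi j f t b.
  elim: j => [_|j IH jd].
    by have [b sb] := stage0 hPhi (fun _ _ => 0) (fun=> 0); exists (fun _ _ => 0), (fun=> 0), b.
  have [f [t [b st]]] := IH (ltnW jd).
  have [tau [tau0 taub adm tmin]] := optimal_level st.
  have [Q OQ] := Omega_nonempty hm1 hPhi st tau0 taub adm tmin.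
  have [tz|tnz] := eqVneq tau 0.
    have jd' : (j <= (minn m1 n1).-1)%N by rewrite -ltnS prednK.
    have stab := Omega_stable0 hm1 hPhi st tau0 taub adm tmin tz.
    (* All later sets equal Omega_j, so its almost everywhere unique element is the superoptimal
       solution. *)
    case: none; exists Q; split.
    - exact ((stab _ Q jd').2 OQ).
    - move=> Q' /(stab _ Q' jd') OQ'.
      exact (Omega_unique0 hm1 hPhi st tau0 taub adm tmin tz OQ OQ').
    - by move=> i _; exact (Omega_sval0 hm1 hPhi st tau0 taub adm tmin tz i OQ).
  have tgt : 0 < tau by rewrite lt_def tnz.
  have ess : (Gamma_ess_norm Phi < tau%:E)%E.
    apply: hess; last by move=> [] /eqP; rewrite (negbTE tnz).
    split; first exact jd.
    by exists Q => //; rewrite (Omega_sval hm1 hPhi st tau0 taub adm tmin OQ).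
  have [f' [t' st']] := next_stage hm1 hPhi st tau0 taub adm tmin tgt ess.
  by exists f', t', tau.
have [f [t [b st]]] := step _ (leqnn _).
have [Q PQ] := stage_nonempty hm1 hPhi st.
have supE Q' : superoptimal Phi Q' <-> pre_Omega Phi (minn m1 n1) Q'.
  by rewrite /superoptimal; case: (minn m1 n1) d0 => // k _.
case: none; exists Q; split; first exact/supE.
- by move=> Q' /supE PQ'; exact (last_unique hm1 hPhi hn1 st PQ PQ').
- move=> j /andP[_ jd]; exists (t j); apply: filterS (stage_sval hPhi st PQ) => z; apply.
  by rewrite -ltnS prednK // in jd.
Qed.
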